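(* The only hyper-Kähler metric with a non-constant Killing–Yano tensor is the half-flat Taub–NUT instanton.
   Context: Metrics are Riemannian metrics $g_{ab}$ on orientable 4-manifolds $M$, with Levi-Civita connection $\nabla_a$. $(M,g_{ab})$ is hyper-Kähler if it is Kähler for a 2-sphere of complex structures; in four dimensions this is equivalent to (anti-)self-duality of the Riemann tensor, and the orientation is chosen so that the Riemann tensor is anti-self-dual, i.e. the Ricci tensor and the self-dual Weyl curvature vanish. A Killing–Yano tensor is a 2-form $Y_{ab}=Y_{[ab]}$ satisfying $\nabla_{(a}Y_{b)c}=0$, equivalently $\nabla_aY_{bc}=\nabla_{[a}Y_{bc]}$; it is non-constant if it is not parallel, i.e. $\nabla_aY_{bc}\neq0$. The half-flat (here anti-self-dual) Taub–NUT instanton with NUT charge $n$ is the metric $$g=4n^2\left(\frac{\rho-n}{\rho+n}\right)(\mathrm{d}\tau+\cos\theta\,\mathrm{d}\varphi)^2+\left(\frac{\rho+n}{\rho-n}\right)\mathrm{d}\rho^2+(\rho^2-n^2)(\mathrm{d}\theta^2+\sin^2\theta\,\mathrm{d}\varphi^2).$$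
   Formalization: Flat metrics, which also carry non-constant Killing–Yano tensors, are excluded; complete metrics must be Taub–NUT with n>0, while incomplete ones may also be minus the Taub–NUT formula on |ρ|<|n| or the linear-potential Gibbons–Hawking limit. *)

(* Defs.v *)
From HB Require Import structures.
From mathcomp Require Import all_boot all_order all_algebra.
From mathcomp Require Import all_classical all_reals all_analysis.

Set Implicit Arguments.
Unset Strict Implicit.
Unset Printing Implicit Defensive.

Import Order.TTheory GRing.Theory Num.Theory.
Import numFieldNormedType.Exports.
Local Open Scope classical_set_scope.
Local Open Scope ring_scope.

Section Coordinates.
Variable R : realType.

Definition partial (a : 'I_4) (f : 'rV[R]_4 -> R) : 'rV[R]_4 -> R :=
  fun x => 'D_(delta_mx 0 a) f x.

Fixpoint class_C (k : nat) (U : set 'rV[R]_4) (f : 'rV[R]_4 -> R) : Prop :=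
  (forall x, U x -> {for x, continuous f}) /\
  match k with
  | 0%N => True
  | k'.+1 => forall a : 'I_4,
      (forall x, U x -> derivable f x (delta_mx 0 a)) /\
      class_C k' U (partial a f)
  end.

Definition smooth_on (U : set 'rV[R]_4) (f : 'rV[R]_4 -> R) : Prop :=
  forall k, class_C k U f.

Definition smooth_map_on (U : set 'rV[R]_4) (F : 'rV[R]_4 -> 'rV[R]_4) : Prop :=
  forall b, smooth_on U (fun x => F x 0 b).

Definition smooth_mx_on (U : set 'rV[R]_4) (T : 'rV[R]_4 -> 'M[R]_4) : Prop :=
  forall a b, smooth_on U (fun x => T x a b).

(* Tangent vectors are row vectors: the differential of F at x is
   v |-> v *m dmap F x. *)
Definition dmap (F : 'rV[R]_4 -> 'rV[R]_4) (x : 'rV[R]_4) : 'M[R]_4 :=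
  \matrix_(a, b) partial a (fun y => F y 0 b) x.

Definition pullback (F : 'rV[R]_4 -> 'rV[R]_4) (h : 'rV[R]_4 -> 'M[R]_4)
    (x : 'rV[R]_4) : 'M[R]_4 :=
  dmap F x *m h (F x) *m (dmap F x)^T.

(* christoffel g x k i j is Gamma^k_(ij). *)
Definition christoffel (g : 'rV[R]_4 -> 'M[R]_4) (x : 'rV[R]_4)
    (k i j : 'I_4) : R :=
  2^-1 * \sum_l invmx (g x) k l *
    (partial i (fun y => g y l j) x + partial j (fun y => g y l i) x
     - partial l (fun y => g y i j) x).

(* riemann g x d c a b is R^d_(cab), the d-component of
   (nabla_a nabla_b - nabla_b nabla_a) partial_c. *)
Definition riemann (g : 'rV[R]_4 -> 'M[R]_4) (x : 'rV[R]_4)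
    (d c a b : 'I_4) : R :=
  partial a (fun y => christoffel g y d b c) x
  - partial b (fun y => christoffel g y d a c) x
  + \sum_e (christoffel g x d a e * christoffel g x e b c
            - christoffel g x d b e * christoffel g x e a c).

(* nabla g Y x a b c is nabla_a Y_(bc). *)
Definition nabla (g Y : 'rV[R]_4 -> 'M[R]_4) (x : 'rV[R]_4)
    (a b c : 'I_4) : R :=
  partial a (fun y => Y y b c) x
  - \sum_d (christoffel g x d a b * Y x d c + christoffel g x d a c * Y x b d).

Definition ext_deriv (w : 'rV[R]_4 -> 'M[R]_4) (x : 'rV[R]_4)
    (a b c : 'I_4) : R :=
  partial a (fun y => w y b c) x + partial b (fun y => w y c a) x
  + partial c (fun y => w y a b) x.

(* An endomorphism J of the tangent bundle acts by v |-> v *m J, so that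
   J(partial_a) = \sum_b J a b partial_b; nijenhuis J x a b d is the
   d-component of
   [J pa, J pb] - J [J pa, pb] - J [pa, J pb] + J^2 [pa, pb]
   for the coordinate fields pa, pb. *)
Definition nijenhuis (J : 'rV[R]_4 -> 'M[R]_4) (x : 'rV[R]_4)
    (a b d : 'I_4) : R :=
  \sum_c (J x a c * partial c (fun y => J y b d) x
          - J x b c * partial c (fun y => J y a d) x
          + J x c d * (partial b (fun y => J y a c) x
                       - partial a (fun y => J y b c) x)).

End Coordinates.

(* Connected smooth 4-manifolds without boundary, given by an atlas of charts
   coord i : dom i -> R^4 with inverses param i. *)
Record manifold4 (R : realType) := Manifold4 {
  carrier :> topologicalType;
  chart : Type;
  dom : chart -> set carrier;
  coord : chart -> carrier -> 'rV[R]_4;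
  param : chart -> 'rV[R]_4 -> carrier;
  hausdorffM : hausdorff_space carrier;
  second_countableM : @second_countable carrier;
  connectedM : connected [set: carrier];
  dom_cover : forall p, exists i, dom i p;
  dom_open : forall i, open (dom i);
  cimg_open : forall i, open (coord i @` dom i);
  coordK : forall i p, dom i p -> param i (coord i p) = p;
  coord_continuous : forall i p, dom i p -> {for p, continuous (coord i)};
  param_continuous : forall i x, (coord i @` dom i) x -> {for x, continuous (param i)};
  trans_smooth : forall i j, smooth_map_on (coord i @` (dom i `&` dom j))
                                (coord j \o param i)
}.

Section Manifolds.
Variables (R : realType) (M : manifold4 R).

Definition cimg (i : chart M) : set 'rV[R]_4 := coord i @` dom i.

Definition overlap (i j : chart M) : set 'rV[R]_4 :=
  coord i @` (dom i `&` dom j).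

Definition trans (i j : chart M) : 'rV[R]_4 -> 'rV[R]_4 :=
  coord j \o param i.

(* Components of a 2-tensor in every chart. *)
Definition mxfield := chart M -> 'rV[R]_4 -> 'M[R]_4.

Definition covariant2 (T : mxfield) : Prop :=
  (forall i, smooth_mx_on (cimg i) (T i)) /\
  (forall i j x, overlap i j x -> T i x = pullback (trans i j) (T j) x).

Definition endomorphism (J : mxfield) : Prop :=
  (forall i, smooth_mx_on (cimg i) (J i)) /\
  (forall i j x, overlap i j x ->
     J i x *m dmap (trans i j) x = dmap (trans i j) x *m J j (trans i j x)).

(* Existence of a nowhere vanishing 4-form. *)
Definition orientable : Prop :=
  exists e : chart M -> 'rV[R]_4 -> R,
    (forall i, smooth_on (cimg i) (e i)) /\
    (forall i x, cimg i x -> e i x != 0) /\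
    (forall i j x, overlap i j x ->
       e i x = \det (dmap (trans i j) x) * e j (trans i j x)).

Definition riemannian (g : mxfield) : Prop :=
  covariant2 g /\
  forall i x, cimg i x ->
    (g i x)^T = g i x /\
    forall v : 'rV[R]_4, v != 0 -> 0 < (v *m g i x *m v^T) 0 0.

Definition flat (g : mxfield) : Prop :=
  forall i x, cimg i x -> forall d c a b, riemann (g i) x d c a b = 0.

(* J is an integrable complex structure, g is Hermitian, and the fundamental
   form g(J v, w), with components J *m g, is closed. *)
Definition kahler (g J : mxfield) : Prop :=
  endomorphism J /\
  forall i x, cimg i x ->
    [/\ J i x *m J i x = - 1%:M,
        J i x *m g i x *m (J i x)^T = g i x,
        forall a b d, nijenhuis (J i) x a b d = 0 &
        forall a b c, ext_deriv (fun y => J i y *m g i y) x a b c = 0].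

Definition hyperkahler (g : mxfield) : Prop :=
  exists I1 I2 I3 : mxfield,
    [/\ endomorphism I1, endomorphism I2 & endomorphism I3] /\
    (forall i x, cimg i x ->
       I1 i x *m I2 i x = I3 i x /\ I2 i x *m I1 i x = - I3 i x) /\
    (forall a b c : R, a ^+ 2 + b ^+ 2 + c ^+ 2 = 1 ->
       kahler g (fun i x => a *: I1 i x + b *: I2 i x + c *: I3 i x)).

Definition killing_yano (g Y : mxfield) : Prop :=
  covariant2 Y /\
  forall i x, cimg i x ->
    (Y i x)^T = - Y i x /\
    forall a b c, nabla (g i) (Y i) x a b c + nabla (g i) (Y i) x b a c = 0.

Definition parallel (g Y : mxfield) : Prop :=
  forall i x, cimg i x -> forall a b c, nabla (g i) (Y i) x a b c = 0.

Definition has_nonconstant_KY (g : mxfield) : Prop :=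
  exists Y, killing_yano g Y /\ ~ parallel g Y.

(* A C^1 curve, of speed at most 1 on [0, L], from p to q. *)
Definition joined (g : mxfield) (p q : M) (L : R) : Prop :=
  0 <= L /\
  exists gam : R -> M,
    [/\ gam 0 = p, gam L = q &
    forall t : R, 0 <= t <= L ->
      {for t, continuous gam} /\
      forall i, dom i (gam t) ->
        let c := coord i \o gam in
        [/\ \forall s \near t, derivable c s 1,
            {for t, continuous (derive1 c)} &
            (derive1 c t *m g i (c t) *m (derive1 c t)^T) 0 0 <= 1]].

(* The infimum of the lengths of the curves from p to q: a curve of length
   smaller than L can be reparametrized to satisfy joined g p q L. *)
Definition riemannian_dist (g : mxfield) (p q : M) : R :=
  inf [set L | joined g p q L].

Definition complete_metric (g : mxfield) : Prop :=
  forall u : nat -> M,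
    (forall eps : R, 0 < eps -> exists N : nat, forall k l : nat,
       (N <= k)%N -> (N <= l)%N -> riemannian_dist g (u k) (u l) < eps) ->
    exists p : M, u @ \oo --> p.

(* There are coordinates F, with values in W, near p in which g is h.  Such an
   F is automatically a local diffeomorphism when h is nondegenerate on W. *)
Definition has_form_near (g : mxfield) (W : set 'rV[R]_4)
    (h : 'rV[R]_4 -> 'M[R]_4) (p : M) : Prop :=
  exists i : chart M, dom i p /\
  exists (U : set 'rV[R]_4) (F : 'rV[R]_4 -> 'rV[R]_4),
    [/\ open U, U (coord i p), U `<=` cimg i, smooth_map_on U F &
        forall x, U x -> W (F x) /\ g i x = pullback F h x].

(* Every point has a punctured neighbourhood of points near which g has the
   form h: the exceptional points form a closed discrete set.  This allows for
   a nut, where the coordinates of h break down. *)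
Definition has_form (g : mxfield) (W : set 'rV[R]_4)
    (h : 'rV[R]_4 -> 'M[R]_4) : Prop :=
  forall p : M, \forall q \near p^', has_form_near g W h q.

End Manifolds.

Section Models.
Variable R : realType.

(* The covector d(x_k) and the square of a covector. *)
Definition dco (k : nat) : 'rV[R]_4 := delta_mx 0 (inord k).
Definition sq (w : 'rV[R]_4) : 'M[R]_4 := w^T *m w.
Definition co (k : nat) (x : 'rV[R]_4) : R := x 0 (inord k).

(* The coordinates (x_0, x_1, x_2, x_3) are (tau, rho, theta, phi). *)
Definition taub_nut (n : R) (x : 'rV[R]_4) : 'M[R]_4 :=
  let rho := co 1 x in
  let theta := co 2 x in
  (4 * n ^+ 2 * ((rho - n) / (rho + n))) *: sq (dco 0 + cos theta *: dco 3)
  + ((rho + n) / (rho - n)) *: sq (dco 1)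
  + (rho ^+ 2 - n ^+ 2) *: (sq (dco 2) + (sin theta ^+ 2) *: sq (dco 3)).

Definition taub_nut_dom (n : R) : set 'rV[R]_4 :=
  [set x | `|n| < co 1 x /\ 0 < co 2 x < pi].

(* taub_nut n is negative definite here when n != 0. *)
Definition taub_nut_inner_dom (n : R) : set 'rV[R]_4 :=
  [set x | `|co 1 x| < `|n| /\ 0 < co 2 x < pi].

(* The Gibbons-Hawking metric of the linear potential x_1, a limit of
   Taub-NUT metrics in shifted and rescaled coordinates as n tends to
   -infinity:
   x_1^-1 (d x_0 + x_2 d x_3)^2 + x_1 (d x_1^2 + d x_2^2 + d x_3^2). *)
Definition linear_gh (x : 'rV[R]_4) : 'M[R]_4 :=
  (co 1 x)^-1 *: sq (dco 0 + co 2 x *: dco 3)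
  + co 1 x *: (sq (dco 1) + sq (dco 2) + sq (dco 3)).

Definition linear_gh_dom : set 'rV[R]_4 := [set x | 0 < co 1 x].

End Models.

Definition is_taub_nut (R : realType) (M : manifold4 R) (g : mxfield M) (n : R) :=
  has_form g (taub_nut_dom n) (taub_nut n).

(* Main.v *)
(* Write a Killing-Yano form on a hyper-Kaehler chart as Y = sum_i f_i w_i + K
   with w_i the fundamental forms and K anti-self-dual.  Since nabla Y is a
   3-form, it is dual to a vector xi, and df_i = w_i(xi, .); differentiating
   once more, xi is Killing and triholomorphic, so g is the Gibbons-Hawking
   metric of the moment maps f_i, with potential 1/N for N = |xi|^2.  The form K
   determines the potential: with S = -tr(K^2)/4 and m = -tr(nabla xi . K)/4,
   one finds dS = -2 (K xi)^flat and S nabla xi = m K, whence N + 2 m = N0 and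
   m sqrt(S) = m0 are constant, and h_i = g(I_i xi, K xi) satisfies
   dh_i = -N0 df_i and |h| = N sqrt(S).  Thus N = N0 - 2 m0 / sqrt(S) is a
   function of |h|, and the spherical coordinates of (h_1, h_2, h_3) put g in
   Taub-NUT form with charge m0 / N0^(3/2); N0 < 0 gives the inner metric and
   N0 = 0 the Gibbons-Hawking metric of a linear potential.  If m0 < 0, the
   gradient flow of sqrt(S) would decrease the positive function sqrt(S) at a
   uniform rate along unit speed curves, so that g is incomplete; if m0 > 0, then
   N0 > 0.  Conversely, pulling Taub-NUT back by the Hopf map R^4 -> R^3 extends
   it and its Killing-Yano form over the nut by rational expressions. *)
Require Import Defs.
From mathcomp Require Import all_boot all_order all_algebra.
From mathcomp Require Import all_classical all_reals all_analysis.
From mathcomp Require Import ring lra.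
Set Implicit Arguments.
Unset Strict Implicit.
Unset Printing Implicit Defensive.
Import Order.TTheory GRing.Theory Num.Theory.
Import numFieldNormedType.Exports.
Local Open Scope classical_set_scope.
Local Open Scope ring_scope.

(** * Calculus on open subsets of R^4 *)

Section DirectionalCalculus.
Variable R : realType.
Implicit Types (f g : 'rV[R]_4 -> R) (x y z v : 'rV[R]_4).

Lemma is_derive_line f x v (t : R) :
  derivable f (x + t *: v) v ->
  is_derive t 1 (fun s => f (x + s *: v)) ('D_v f (x + t *: v)).
Proof.
move=> df.
have E : (fun h : R => h^-1 *: (((fun s => f (x + s *: v)) \o shift t) (h *: 1) - f (x + t *: v)))
       = (fun h : R => h^-1 *: ((f \o shift (x + t *: v)) (h *: v) - f (x + t *: v))).
  apply/funext => h /=; congr (_ *: (f _ - _)).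
  by rewrite [h *: 1]mulr1 scalerDl addrCA.
by split; rewrite /derivable /derive E.
Qed.

Lemma is_derive_dirZ f x v (h : R) :
  derivable f x v -> is_derive x (h *: v) f (h * 'D_v f x).
Proof.
move=> df.
have /(is_derive_line (x := x) (v := v)) d0 : derivable f (x + (h * 0) *: v) v.
  by rewrite mulr0 scale0r addr0.
have d1 : is_derive (0 : R) 1 (fun s : R => h * s) h.
  by apply: is_derive_eq; rewrite scaler1.
have d2 := @is_derive1_comp R (fun s => f (x + s *: v)) (fun s => h * s) 0 _ _ d0 d1.
have E : (fun s => f (x + s *: v)) \o (fun s => h * s) = (fun s => f (x + s *: (h *: v))).
  by apply/funext => s /=; rewrite scalerA mulrC.
rewrite E mulr0 scale0r addr0 mulrC in d2.
have dx : derivable f x (h *: v).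
  apply: (proj2 (derivable1P f x (h *: v))).
  have -> : (fun s : R => f (s *: (h *: v) + x)) = fun s => f (x + s *: (h *: v)).
    by apply/funext => s; rewrite addrC.
  exact: (@ex_derive _ _ _ _ _ _ _ d2).
split=> //.
have := @is_derive_line f x (h *: v) 0; rewrite scale0r addr0 => /(_ dx) d3.
by rewrite -(@derive_val _ _ _ _ _ _ _ d3) (@derive_val _ _ _ _ _ _ _ d2).
Qed.

Lemma line_mvt f x v (c : R) :
  (forall t : R, 0 <= t <= 1 ->
     derivable f (x + t *: v) v /\ `|'D_v f (x + t *: v)| <= c) ->
  `|f (x + v) - f x| <= c.
Proof.
move=> H.
have D (t : R) : t \in `[0, 1]%R -> is_derive t 1 (fun s => f (x + s *: v)) ('D_v f (x + t *: v)).
  by rewrite in_itv /= => /H[/is_derive_line].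
have C : {within `[0, 1]%classic, continuous (fun s => f (x + s *: v))}.
  by apply: derivable_within_continuous => s /D[].
have Do (t : R) : t \in `]0, 1[%R -> is_derive t 1 (fun s => f (x + s *: v)) ('D_v f (x + t *: v)).
  by move=> /subset_itv_oo_cc /D.
have [z z01] := @MVT_segment R (fun s => f (x + s *: v))
   (fun t => 'D_v f (x + t *: v)) 0 1 ler01 Do C.
rewrite scale1r scale0r addr0 subr0 mulr1 => ->.
by apply: (H z _).2; move: z01; rewrite in_itv.
Qed.

Lemma normrV_coord x a : `|x 0 a| <= `|x|.
Proof.
rewrite [`|x|]mx_normrE (le_trans _ (le_bigmax _ _ (0, a))) //=.
Qed.

Lemma normrB_coord x y a : `|x 0 a - y 0 a| <= `|x - y|.
Proof. by have := normrV_coord (x - y) a; rewrite !mxE. Qed.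

Lemma normrV_le x (c : R) : 0 <= c -> (forall a, `|x 0 a| <= c) -> `|x| <= c.
Proof.
move=> c0 H; rewrite [`|x|]mx_normrE; apply/bigmax_leP; split=> // -[i j] _ /=.
by rewrite ord1.
Qed.

Lemma differentiable0 f x :
  (forall e : R, 0 < e -> \forall y \near x, `|f y - f x| <= e * `|y - x|) ->
  differentiable f x.
Proof.
move=> H.
have E : f \o shift x = cst (f x) + \0 +o_ (0 : 'rV[R]_4) id.
  apply/eqaddoP => e e0.
  have := H _ e0; rewrite (near_shift 0) /= => {}H.
  by apply: filterS H => h /=; rewrite !fctE /= !(subr0, addr0, addrK).
have dE : 'd f x = \0 :> ('rV[R]_4 -> R).
  by apply: (diff_unique _ E) => // y; apply: cst_continuous.
apply/diff_locallyP; split; first by rewrite dE; apply: cst_continuous.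
by rewrite dE.
Unshelve. all: by end_near. Qed.

Definition rvmix (k : nat) x y : 'rV[R]_4 := \row_j (if (j < k)%N then y 0 j else x 0 j).

Lemma rvmixS (k : 'I_4) x y :
  rvmix k.+1 x y = rvmix k x y + (y 0 k - x 0 k) *: delta_mx 0 k.
Proof.
apply/rowP => j; rewrite !mxE eqxx /= ltnS.
case: (ltngtP j k) => [jk|jk|/val_inj ->].
- by rewrite (_ : (j == k) = false) ?mulr0 ?addr0 //; apply/negbTE; rewrite -val_eqE neq_ltn jk.
- by rewrite (_ : (j == k) = false) ?mulr0 ?addr0 //; apply/negbTE; rewrite -val_eqE neq_ltn jk orbT.
- by rewrite eqxx mulr1 addrC subrK.
Qed.

Lemma coord_mvt f x (k : 'I_4) (h c : R) :
  (forall t : R, 0 <= t <= 1 -> derivable f (x + (t * h) *: delta_mx 0 k) (delta_mx 0 k) /\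
     `|partial k f (x + (t * h) *: delta_mx 0 k)| <= c) ->
  `|f (x + h *: delta_mx 0 k) - f x| <= c * `|h|.
Proof.
move=> H; apply: line_mvt => t /H[d le].
rewrite scalerA; have D := is_derive_dirZ h d; split; first by case: D.
by rewrite (@derive_val _ _ _ _ _ _ _ D) normrM mulrC ler_wpM2r.
Qed.

Lemma near_all4 (P : 'I_4 -> 'rV[R]_4 -> Prop) x :
  (forall a, \forall y \near x, P a y) -> \forall y \near x, forall a, P a y.
Proof. by move=> H; exact: (@filter_forall _ _ P (nbhs x) _ H). Qed.

Lemma differentiable_partial0 f x :
  (forall a, \forall y \near x, derivable f y (delta_mx 0 a)) ->
  (forall a, {for x, continuous (partial a f)}) ->
  (forall a, partial a f x = 0) -> differentiable f x.
Proof.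
move=> df cf f0; apply: differentiable0 => e e0.
have e40 : 0 < e / 4 by rewrite divr_gt0.
have H : \forall y \near x, forall a : 'I_4, derivable f y (delta_mx 0 a) /\ `|partial a f y| <= e / 4.
  apply: near_all4 => a; apply: filterI; first exact: df.
  by have /cvgrPdist_le/(_ _ e40) := cf a; rewrite f0; apply: filterS => y /=; rewrite sub0r normrN.
have [r /= r0 rH] := (nbhs_ballP _ _).1 H.
apply/nbhs_ballP; exists r => // y; rewrite -ball_normE /= => xy.
have mixB (k : 'I_4) (t : R) : 0 <= t <= 1 -> ball x r (rvmix k x y + (t * (y 0 k - x 0 k)) *: delta_mx 0 k).
  move=> /andP[t0 t1]; rewrite -ball_normE /=; apply: le_lt_trans xy.
  apply: normrV_le => // j; rewrite !mxE eqxx /=.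
  have xyj := normrB_coord x y j.
  have [->|jk] := eqVneq j k.
    rewrite ltnn mulr1 opprD addrA subrr sub0r normrN normrM ger0_norm // distrC.
    have xyk := normrB_coord x y k.
    by rewrite (le_trans _ xyk) // ler_piMl.
  by rewrite mulr0 addr0; case: ifP => // _; rewrite subrr normr0.
have step (k : 'I_4) : `|f (rvmix k.+1 x y) - f (rvmix k x y)| <= e / 4 * `|y - x|.
  rewrite rvmixS; apply: (@le_trans _ _ (e / 4 * `|y 0 k - x 0 k|)).
    by apply: coord_mvt => t t01; exact/rH/mixB.
  by rewrite ler_wpM2l ?normrB_coord // ltW.
have E : f y - f x = \sum_(k < 4) (f (rvmix k.+1 x y) - f (rvmix k x y)).
  rewrite -(big_mkord xpredT (fun k => f (rvmix k.+1 x y) - f (rvmix k x y))) telescope_sumr //.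
  by congr (f _ - f _); apply/rowP => j; rewrite mxE ?ltn_ord.
rewrite E; apply: le_trans (ler_norm_sum _ _ _) _.
apply: le_trans (ler_sum _ (fun k _ => step k)) _.
rewrite sumr_const card_ord -mulr_natr le_eqVlt; apply/orP; left; apply/eqP; by field.
Qed.

Lemma differentiable_partial f x :
  (forall a, \forall y \near x, derivable f y (delta_mx 0 a)) ->
  (forall a, {for x, continuous (partial a f)}) -> differentiable f x.
Proof.
move=> df cf.
pose l (y : 'rV[R]_4) : R := \sum_(b < 4) partial b f x * y 0 b.
have ld y : differentiable l y.
  have -> : l = \sum_(b < 4) (partial b f x *: (fun y : 'rV[R]_4 => y 0 b : R)).
    by apply/funext => z; rewrite fct_sumE.
  by apply: differentiable_sum => b; apply: differentiableZ; apply: differentiable_coord.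
have lp y a : partial a l y = partial a f x.
  rewrite /partial; have L (h : R) : h^-1 *: (l (h *: delta_mx 0 a + y) - l y) = (h^-1 * h) * partial a f x.
    rewrite /l -sumrB (bigD1 a) //= big1 ?addr0.
      by rewrite !mxE !eqxx /= /GRing.scale /=; ring.
    by move=> b /negbTE ba; rewrite !mxE eqxx ba /= mulr0 add0r subrr.
  apply: lim_near_cst => //; near=> h => /=; rewrite L mulVf ?mul1r //.
  by near: h; apply: nbhs_dnbhs_neq.
have {1}-> : f = (f - l) + l by rewrite subrK.
apply: differentiableD; last exact: ld.
apply: differentiable_partial0.
- move=> a; have := df a; apply: filterS => y dy; apply: derivableB; [exact: dy|exact/diff_derivable/ld].
- move=> a.
  have E : \forall y \near x, partial a f y - partial a f x = partial a (f - l) y.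
    have := df a; apply: filterS => y dy.
    by rewrite -(lp y a) /partial deriveB; [|exact: dy|exact/diff_derivable/ld].
  have E0 := nbhs_singleton E.
  suff : partial a (f - l) y @[y --> x] --> partial a (f - l) x by [].
  rewrite -E0; apply: cvg_trans (near_eq_cvg E) _.
  by apply: cvgB; [exact: cf|exact: cvg_cst].
- move=> a; rewrite /partial deriveB; [|exact: nbhs_singleton (df a)|exact/diff_derivable/ld].
  by rewrite [X in _ - X]lp subrr.
Unshelve. all: by end_near. Qed.

Lemma is_derive_comp1 (phi : R -> R) f x v (d : R) :
  is_derive (f x) 1 phi d -> derivable f x v ->
  is_derive x v (fun y => phi (f y)) (d * 'D_v f x).
Proof.
move=> dphi df.
have := @is_derive_line f x v 0; rewrite scale0r addr0 => /(_ df) d1.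
have dphi' : is_derive ((fun s : R => f (x + s *: v)) 0) 1 phi d by rewrite scale0r addr0.
have d2 := is_derive1_comp dphi' d1.
have dx : derivable (fun y => phi (f y)) x v.
  apply: (proj2 (derivable1P (fun y => phi (f y)) x v)).
  have -> : (fun s : R => phi (f (s *: v + x))) = phi \o (fun s => f (x + s *: v)).
    by apply/funext => s /=; rewrite addrC.
  exact: (@ex_derive _ _ _ _ _ _ _ d2).
split; first exact: dx.
have := @is_derive_line (fun y => phi (f y)) x v 0; rewrite scale0r addr0 => /(_ dx) d3.
by rewrite -(@derive_val _ _ _ _ _ _ _ d3) (@derive_val _ _ _ _ _ _ _ d2).
Qed.

Lemma partialD a f g x : derivable f x (delta_mx 0 a) -> derivable g x (delta_mx 0 a) ->
  partial a (fun y => f y + g y) x = partial a f x + partial a g x.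
Proof. exact: deriveD. Qed.

Lemma partialN a f x : derivable f x (delta_mx 0 a) ->
  partial a (fun y => - f y) x = - partial a f x.
Proof. exact: deriveN. Qed.

Lemma partialM a f g x : derivable f x (delta_mx 0 a) -> derivable g x (delta_mx 0 a) ->
  partial a (fun y => f y * g y) x = partial a f x * g x + f x * partial a g x.
Proof. by move=> df dg; rewrite /partial deriveM; [rewrite addrC mulrC|exact: df|exact: dg]. Qed.

Lemma partialC a (c : R) x : partial a (fun=> c) x = 0.
Proof. exact: derive_cst. Qed.

Lemma is_derive_coord b x v : is_derive x v (fun y : 'rV[R]_4 => y 0 b : R) (v 0 b).
Proof.
have D : differentiable (fun y : 'rV[R]_4 => y 0 b : R) x by exact: differentiable_coord.
split; first exact: diff_derivable.
apply: lim_near_cst => //; near=> h => /=.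
rewrite !mxE addrK /GRing.scale /= mulrA mulVf ?mul1r //.
by near: h; apply: nbhs_dnbhs_neq.
Unshelve. all: by end_near. Qed.

Lemma partial_coord a b x : partial a (fun y => y 0 b) x = (a == b)%:R.
Proof. by rewrite /partial (@derive_val _ _ _ _ _ _ _ (is_derive_coord b x _)) mxE eqxx /= eq_sym. Qed.

Lemma near_partial a f g x : (\forall y \near x, f y = g y) -> partial a f x = partial a g x.
Proof. exact: near_eq_derive. Qed.

Lemma open_near (U : set 'rV[R]_4) x (P : 'rV[R]_4 -> Prop) : open U -> U x ->
  (forall y, U y -> P y) -> \forall y \near x, P y.
Proof. by move=> oU Ux H; apply: filterS (open_nbhs_nbhs (conj oU Ux)). Qed.

Lemma partial_ext (U : set 'rV[R]_4) a f g x : open U -> U x ->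
  (forall y, U y -> f y = g y) -> partial a f x = partial a g x.
Proof. by move=> oU Ux H; apply/near_partial/(open_near oU Ux). Qed.

Lemma derivable_ext (U : set 'rV[R]_4) f g x v : open U -> U x ->
  (forall y, U y -> f y = g y) -> derivable f x v -> derivable g x v.
Proof. by move=> oU Ux H; apply: near_eq_derivable; apply: (open_near oU Ux). Qed.

End DirectionalCalculus.

Section SmoothFunctions.
Variables (R : realType) (U : set 'rV[R]_4).
Hypothesis oU : open U.
Implicit Types (f g : 'rV[R]_4 -> R) (x : 'rV[R]_4).

Lemma class_CW k f : class_C k.+1 U f -> class_C k U f.
Proof.
elim: k f => [|k IH] f; first by case.
by move=> [cf H]; split=> // a; have [d C] := H a; split=> //; exact: IH.
Qed.

Lemma class_C_ext k f g : (forall x, U x -> f x = g x) -> class_C k U f -> class_C k U g.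
Proof.
elim: k f g => [|k IH] f g fg [cf H]; (split; last first).
- by [].
- move=> x Ux; have E := open_near oU Ux fg.
  suff : g y @[y --> x] --> g x by [].
  by rewrite -fg //; apply: cvg_trans (near_eq_cvg E) _; exact: cf.
- move=> a; have [d C] := H a; split.
    by move=> x Ux; apply: (derivable_ext oU Ux fg); exact: d.
  by apply: IH C => x Ux; exact: partial_ext fg.
- move=> x Ux; have E := open_near oU Ux fg.
  suff : g y @[y --> x] --> g x by [].
  by rewrite -fg //; apply: cvg_trans (near_eq_cvg E) _; exact: cf.
Qed.

Lemma class_CD k f g : class_C k U f -> class_C k U g -> class_C k U (fun y => f y + g y).
Proof.
elim: k f g => [|k IH] f g [cf Hf] [cg Hg]; (split; first by
  move=> x Ux; exact: cvgD (cf x Ux) (cg x Ux)) => //.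
move=> a; have [df Cf] := Hf a; have [dg Cg] := Hg a; split.
  by move=> x Ux; apply: derivableD; [exact: df|exact: dg].
by apply: class_C_ext (IH _ _ Cf Cg) => x Ux; rewrite partialD //; [exact: df|exact: dg].
Qed.

Lemma class_CM k f g : class_C k U f -> class_C k U g -> class_C k U (fun y => f y * g y).
Proof.
elim: k f g => [|k IH] f g Cf Cg; have [cf Hf] := Cf; have [cg Hg] := Cg; (split; first by
  move=> x Ux; exact: cvgM (cf x Ux) (cg x Ux)) => //.
move=> a; have [df Cfa] := Hf a; have [dg Cga] := Hg a; split.
  by move=> x Ux; apply: derivableM; [exact: df|exact: dg].
apply: class_C_ext (class_CD (IH _ _ Cfa (class_CW Cg)) (IH _ _ (class_CW Cf) Cga)) => x Ux.
by rewrite partialM //; [exact: df|exact: dg].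
Qed.

Lemma class_C_cst k (c : R) : class_C k U (fun=> c).
Proof.
elim: k c => [|k IH] c; (split; first by move=> x Ux; exact: cst_continuous) => //.
move=> a; split; first by move=> x Ux; exact: derivable_cst.
by apply: class_C_ext (IH 0) => x Ux; rewrite partialC.
Qed.

Lemma smooth_ext f g : (forall x, U x -> f x = g x) -> smooth_on U f -> smooth_on U g.
Proof. by move=> fg sf k; exact: class_C_ext (sf k). Qed.

Lemma smoothD f g : smooth_on U f -> smooth_on U g -> smooth_on U (fun y => f y + g y).
Proof. by move=> sf sg k; exact: class_CD. Qed.

Lemma smoothM f g : smooth_on U f -> smooth_on U g -> smooth_on U (fun y => f y * g y).
Proof. by move=> sf sg k; exact: class_CM. Qed.

Lemma smooth_cst (c : R) : smooth_on U (fun=> c).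
Proof. by move=> k; exact: class_C_cst. Qed.

Lemma smoothN f : smooth_on U f -> smooth_on U (fun y => - f y).
Proof. by move=> /(smoothM (smooth_cst (-1))); apply: smooth_ext => x _; rewrite mulN1r. Qed.

Lemma smoothB f g : smooth_on U f -> smooth_on U g -> smooth_on U (fun y => f y - g y).
Proof. by move=> sf /smoothN; exact: smoothD. Qed.

Lemma smoothX f n : smooth_on U f -> smooth_on U (fun y => f y ^+ n).
Proof.
move=> sf; elim: n => [|n IH]; first exact: smooth_cst.
by apply: smooth_ext (smoothM sf IH) => x _; rewrite exprS.
Qed.

Lemma smooth_sum (I : Type) (r : seq I) (P : pred I) (F : I -> 'rV[R]_4 -> R) :
  (forall i, smooth_on U (F i)) -> smooth_on U (fun y => \sum_(i <- r | P i) F i y).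
Proof.
move=> sF; elim: r => [|i r IH].
  by apply: smooth_ext (smooth_cst 0) => x _; rewrite big_nil.
have [Pi|Pi] := boolP (P i).
  by apply: smooth_ext (smoothD (sF i) IH) => x _; rewrite big_cons Pi.
by apply: smooth_ext IH => x _; rewrite big_cons (negbTE Pi).
Qed.

Lemma smooth_prod (I : Type) (r : seq I) (P : pred I) (F : I -> 'rV[R]_4 -> R) :
  (forall i, smooth_on U (F i)) -> smooth_on U (fun y => \prod_(i <- r | P i) F i y).
Proof.
move=> sF; elim: r => [|i r IH].
  by apply: smooth_ext (smooth_cst 1) => x _; rewrite big_nil.
have [Pi|Pi] := boolP (P i).
  by apply: smooth_ext (smoothM (sF i) IH) => x _; rewrite big_cons Pi.
by apply: smooth_ext IH => x _; rewrite big_cons (negbTE Pi).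
Qed.

Lemma smooth_coord b : smooth_on U (fun y => y 0 b).
Proof.
move=> [|k]; (split; first by move=> x _; exact: coord_continuous) => //.
move=> a; split; first by move=> x _; exact: (@ex_derive _ _ _ _ _ _ _ (is_derive_coord b x _)).
by apply: class_C_ext (class_C_cst k _) => x _; rewrite partial_coord.
Qed.

Lemma smooth_continuous f x : smooth_on U f -> U x -> {for x, continuous f}.
Proof. by move=> /(_ 0%N)[cf _]; exact: cf. Qed.

Lemma smooth_derivable f x a : smooth_on U f -> U x -> derivable f x (delta_mx 0 a).
Proof. by move=> /(_ 1%N)[_ /(_ a)[df _]]; exact: df. Qed.

Lemma smooth_partial f a : smooth_on U f -> smooth_on U (partial a f).
Proof. by move=> sf k; have [_ /(_ a)[]] := sf k.+1. Qed.

Lemma smooth_differentiable f x : smooth_on U f -> U x -> differentiable f x.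
Proof.
move=> sf Ux; apply: differentiable_partial => a.
  by apply: (open_near oU Ux) => y Uy; exact: smooth_derivable.
exact: smooth_continuous (smooth_partial a sf) Ux.
Qed.

Lemma smooth_ode f (F : 'I_4 -> 'rV[R]_4 -> R) :
  (forall x, U x -> {for x, continuous f}) ->
  (forall x a, U x -> is_derive x (delta_mx 0 a) f (F a x)) ->
  (forall k a, class_C k U f -> class_C k U (F a)) -> smooth_on U f.
Proof.
move=> cf df CF; elim=> [|k IH]; split=> // a; split.
  by move=> x Ux; have [] := df x a Ux.
by apply: class_C_ext (CF _ a IH) => x Ux; have [_ <-] := df x a Ux.
Qed.

Lemma smooth_comp1 (phi dphi : R -> R) f : smooth_on U f ->
  (forall x, U x -> is_derive (f x) 1 phi (dphi (f x))) ->
  (forall k, class_C k U (fun y => phi (f y)) -> class_C k U (fun y => dphi (f y))) ->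
  smooth_on U (fun y => phi (f y)).
Proof.
move=> sf dp CP; apply: (smooth_ode (F := fun a y => dphi (f y) * partial a f y)).
- move=> x Ux; apply: continuous_comp; first exact: smooth_continuous Ux.
  by apply: differentiable_continuous; apply/derivable1_diffP; have [] := dp x Ux.
- by move=> x a Ux; apply: is_derive_comp1; [exact: dp|exact: smooth_derivable].
- by move=> k a C; apply: class_CM; [exact: CP|exact: smooth_partial].
Qed.

Lemma smoothV f : smooth_on U f -> (forall x, U x -> f x != 0) -> smooth_on U (fun y => (f y)^-1).
Proof.
move=> sf f0; apply: (@smooth_comp1 GRing.inv (fun t => - (t^-1 * t^-1))) => //.
  move=> x Ux; have D : derivable (@id R) (f x) 1 by exact: derivable_id.
  split; first by apply: (@derivableV _ _ id); [exact: f0|].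
  rewrite (@deriveV _ _ id) //; last exact: f0.
  by rewrite derive_id [_ *: _]mulr1 expr2 invfM.
move=> k C; apply: class_C_ext (class_CM (class_C_cst k (-1)) (class_CM C C)) => x Ux.
by rewrite mulN1r.
Qed.

Lemma smooth_sqrt f : smooth_on U f -> (forall x, U x -> 0 < f x) ->
  smooth_on U (fun y => Num.sqrt (f y)).
Proof.
move=> sf f0.
have sV := smoothV sf (fun x Ux => lt0r_neq0 (f0 x Ux)).
apply: (@smooth_comp1 Num.sqrt (fun t => (2 * Num.sqrt t)^-1)) => //.
  by move=> x Ux; apply: is_derive1_sqrt; exact: f0.
move=> k C; apply: class_C_ext (class_CM (class_C_cst k 2^-1) (class_CM C (sV k))) => x Ux.
rewrite -{2}(sqr_sqrtr (ltW (f0 x Ux))).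
have s0 : Num.sqrt (f x) != 0 by rewrite gt_eqF // sqrtr_gt0 f0.
by field.
Qed.

Lemma smooth_atan f : smooth_on U f -> smooth_on U (fun y => atan (f y)).
Proof.
move=> sf.
have s1 : smooth_on U (fun y => (1 + f y ^+ 2)^-1).
  apply: smoothV; first exact: smoothD (smooth_cst 1) (smoothX 2 sf).
  by move=> x _; rewrite gt_eqF // ltr_pwDl // sqr_ge0.
by apply: (@smooth_comp1 atan (fun t => (1 + t ^+ 2)^-1)).
Qed.

Lemma partialV a f x : derivable f x (delta_mx 0 a) -> f x != 0 ->
  partial a (fun y => (f y)^-1) x = - partial a f x / f x ^+ 2.
Proof. by move=> df f0; rewrite /partial deriveV // /GRing.scale /= mulNr mulNr mulrC. Qed.

End SmoothFunctions.

Lemma smooth_sub (R : realType) (U V : set 'rV[R]_4) f : V `<=` U -> smooth_on U f -> smooth_on V f.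
Proof.
move=> VU sf k; elim: k f sf => [|k IH] f sf; (split; first by
  move=> x /VU; exact: smooth_continuous) => // a.
split; first by move=> x /VU; exact: smooth_derivable.
by apply: IH; exact: smooth_partial.
Qed.

Section ChainRule.
Variable R : realType.
Implicit Types (f g : 'rV[R]_4 -> R) (x y z v : 'rV[R]_4).

Lemma is_derive_dir f x v : differentiable f x ->
  is_derive x v f (\sum_b v 0 b * partial b f x).
Proof.
move=> df; split; first exact: diff_derivable.
rewrite deriveE // [in LHS](row_sum_delta v) linear_sum /=; apply: eq_bigr => b _.
by rewrite linearZ /= -deriveE.
Qed.

Lemma is_derive_curve f (c : R -> 'rV[R]_4) (t : R) :
  differentiable f (c t) -> derivable c t 1 ->
  is_derive t 1 (fun s => f (c s)) (\sum_b ('D_1 c t) 0 b * partial b f (c t)).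
Proof.
move=> df dc; have dcd : differentiable c t by apply/derivable1_diffP.
have dfc : differentiable (f \o c) t by exact: differentiable_comp.
split; first exact: diff_derivable.
rewrite -[fun s => _]/(f \o c) deriveE // diff_comp //= -deriveE //.
by rewrite -deriveE // (@derive_val _ _ _ _ _ _ _ (is_derive_dir _ df)).
Qed.

Lemma is_derive_comp f (F : 'rV[R]_4 -> 'rV[R]_4) x v :
  differentiable f (F x) -> (forall b, derivable (fun y => F y 0 b) x v) ->
  is_derive x v (fun y => f (F y)) (\sum_b 'D_v (fun y => F y 0 b) x * partial b f (F x)).
Proof.
move=> df dF.
have L b := @is_derive_line _ (fun y => F y 0 b) x v 0.
rewrite scale0r addr0 in L.
pose c (s : R) := F (x + s *: v).
have dcb b : derivable (fun s => c s 0 b) 0 1 by have [] := L b (dF b).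
have dc : derivable c 0 1 by apply/derivable_mxP => i j; rewrite ord1; exact: dcb.
have dfc0 : differentiable f (c 0) by rewrite /c scale0r addr0.
have D := is_derive_curve dfc0 dc.
have dx : derivable (fun y => f (F y)) x v.
  apply: (proj2 (derivable1P (fun y => f (F y)) x v)).
  have -> : (fun s : R => f (F (s *: v + x))) = (fun s => f (c s)).
    by apply/funext => s; rewrite addrC.
  by case: D.
split=> //.
have := @is_derive_line _ (fun y => f (F y)) x v 0; rewrite scale0r addr0 => /(_ dx) d3.
rewrite -(@derive_val _ _ _ _ _ _ _ d3) (@derive_val _ _ _ _ _ _ _ D).
apply: eq_bigr => b _; rewrite /c scale0r addr0; congr (_ * _).
by rewrite derive_mx // mxE -(@derive_val _ _ _ _ _ _ _ (L b (dF b))).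
Qed.

Lemma partial_comp f (F : 'rV[R]_4 -> 'rV[R]_4) x a :
  differentiable f (F x) -> (forall b, derivable (fun y => F y 0 b) x (delta_mx 0 a)) ->
  partial a (fun y => f (F y)) x = \sum_b dmap F x a b * partial b f (F x).
Proof.
move=> df dF; rewrite /partial (@derive_val _ _ _ _ _ _ _ (is_derive_comp df dF)).
by apply: eq_bigr => b _; rewrite mxE.
Qed.

Lemma is_derive_affine g y x0 v (t : R) : derivable g (x0 + t *: (y - x0)) v ->
  is_derive y v (fun z => g (x0 + t *: (z - x0))) (t * 'D_v g (x0 + t *: (y - x0))).
Proof.
move=> dg; have D := is_derive_dirZ t dg.
have E : (fun h : R => h^-1 *: (((fun z => g (x0 + t *: (z - x0))) \o shift y) (h *: v) - g (x0 + t *: (y - x0))))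
  = (fun h : R => h^-1 *: ((g \o shift (x0 + t *: (y - x0))) (h *: (t *: v)) - g (x0 + t *: (y - x0)))).
  apply/funext => h /=; congr (_ *: (g _ - _)).
  by rewrite -addrA scalerDr addrCA scalerA mulrC -scalerA.
case: D => D1 D2; split; first by rewrite /derivable E.
by rewrite -D2 /derive E.
Qed.

Lemma partial_shift f a w y : partial a (fun z => f (z + w)) y = partial a f (y + w).
Proof.
rewrite /partial /derive.
set g1 := fun h => _; set g2 := fun h => _.
by have -> : g1 = g2 by apply/funext => h; rewrite /g1 /g2 /= addrA.
Qed.

Lemma derivable_shift f v w y : derivable f (y + w) v -> derivable (fun z => f (z + w)) y v.
Proof.
rewrite /derivable; set g1 := fun h => _; set g2 := fun h => _.
by have -> : g1 = g2 by apply/funext => h; rewrite /g1 /g2 /= addrA.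
Qed.

Lemma coord_mvt_eq f x (k : 'I_4) (h : R) :
  (forall t : R, 0 <= t <= 1 -> derivable f (x + (t * h) *: delta_mx 0 k) (delta_mx 0 k)) ->
  exists2 t : R, 0 <= t <= 1 &
    f (x + h *: delta_mx 0 k) - f x = h * partial k f (x + (t * h) *: delta_mx 0 k).
Proof.
move=> H; set v := h *: delta_mx 0 k.
have D (t : R) : t \in `[0, 1]%R -> is_derive t 1 (fun s => f (x + s *: v)) (h * partial k f (x + (t * h) *: delta_mx 0 k)).
  rewrite in_itv /= => /H d; have D1 := is_derive_dirZ h d.
  have d1 : derivable f (x + t *: v) v by rewrite /v scalerA; case: D1.
  by have := is_derive_line d1; rewrite {2}/v scalerA (@derive_val _ _ _ _ _ _ _ D1).
have C : {within `[0, 1]%classic, continuous (fun s => f (x + s *: v))}.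
  by apply: derivable_within_continuous => s /D[].
have Do (t : R) : t \in `]0, 1[%R -> is_derive t 1 (fun s => f (x + s *: v)) (h * partial k f (x + (t * h) *: delta_mx 0 k)).
  by move=> /subset_itv_oo_cc /D.
have [z z01] := @MVT_segment R (fun s => f (x + s *: v)) _ 0 1 ler01 Do C.
rewrite scale1r scale0r addr0 subr0 mulr1 => ->; exists z; first by move: z01; rewrite in_itv.
by [].
Qed.

Lemma normr_delta (k : 'I_4) : `|delta_mx 0 k : 'rV[R]_4| <= 1.
Proof.
by apply: normrV_le => // a; rewrite mxE eqxx /=; case: eqP => _; rewrite ?normr1 ?normr0.
Qed.

Lemma ball_square x (r e : R) (a b : 'I_4) (s t : R) : 0 < e -> e + e <= r ->
  `|s| <= e -> `|t| < e -> ball x r (x + s *: delta_mx 0 a + t *: delta_mx 0 b).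
Proof.
move=> e0 er se te; rewrite -ball_normE /= -addrA opprD addrA subrr sub0r normrN.
apply: le_lt_trans (ler_normD _ _) _; rewrite !normrZ.
have sa : `|s| * `|delta_mx 0 a : 'rV[R]_4| <= `|s| by rewrite ler_piMr ?normr_delta.
have tb : `|t| * `|delta_mx 0 b : 'rV[R]_4| <= `|t| by rewrite ler_piMr ?normr_delta.
lra.
Qed.

Lemma second_difference f x (r h : R) a b : smooth_on (ball x r) f -> 0 < h -> 4 * h <= r ->
  exists2 z, ball x (4 * h) z &
  (f (x + h *: delta_mx 0 a + h *: delta_mx 0 b) - f (x + h *: delta_mx 0 a))
   - (f (x + h *: delta_mx 0 b) - f x) = h ^+ 2 * partial b (partial a f) z.
Proof.
move=> sf h0 hr.
have B (s t : R) : 0 <= s <= 1 -> 0 <= t <= 1 -> ball x (4 * h) (x + (s * h) *: delta_mx 0 a + (t * h) *: delta_mx 0 b).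
  move=> /andP[s0 s1] /andP[t0 t1]; apply: (@ball_square _ _ (2 * h)); [lra|lra| |].
  - rewrite ger0_norm ?mulr_ge0 ?(ltW h0) //; have := ler_piMl (ltW h0) s1; lra.
  - rewrite ger0_norm ?mulr_ge0 ?(ltW h0) //; have := ler_piMl (ltW h0) t1; lra.
have Br z : ball x (4 * h) z -> ball x r z by exact: le_ball.
pose phi y := f (y + h *: delta_mx 0 b) - f y.
have I01 : 0 <= (1 : R) <= 1 by rewrite ler01 lexx.
have I00 : 0 <= (0 : R) <= 1 by rewrite ler01 lexx.
have d1 s : 0 <= s <= 1 -> derivable f (x + (s * h) *: delta_mx 0 a + h *: delta_mx 0 b) (delta_mx 0 a).
  by move=> s01; have := B s 1 s01 I01; rewrite mul1r => /Br; exact: smooth_derivable.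
have d0 s : 0 <= s <= 1 -> derivable f (x + (s * h) *: delta_mx 0 a) (delta_mx 0 a).
  by move=> s01; have := B s 0 s01 I00; rewrite mul0r scale0r addr0 => /Br; exact: smooth_derivable.
have [|s s01 Es] := @coord_mvt_eq phi x a h.
  by move=> t t01; apply: derivableB; [apply: derivable_shift; exact: d1|exact: d0].
have Ep : partial a phi (x + (s * h) *: delta_mx 0 a) =
    partial a f (x + (s * h) *: delta_mx 0 a + h *: delta_mx 0 b) - partial a f (x + (s * h) *: delta_mx 0 a).
  rewrite -(partial_shift f a (h *: delta_mx 0 b)) /partial.
  by rewrite -deriveB; [|apply: derivable_shift; exact: d1|exact: d0].
have [|t t01 Et] := @coord_mvt_eq (partial a f) (x + (s * h) *: delta_mx 0 a) b h.
  by move=> t t01; apply: smooth_derivable (smooth_partial a sf) _; exact/Br/B.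
exists (x + (s * h) *: delta_mx 0 a + (t * h) *: delta_mx 0 b); first exact: B.
by move: Es; rewrite Ep Et /phi => ->; rewrite expr2 mulrA.
Qed.

Lemma schwarz (U : set 'rV[R]_4) f x a b : open U -> smooth_on U f -> U x ->
  partial a (partial b f) x = partial b (partial a f) x.
Proof.
move=> oU sf Ux.
have [r0 /= r00 r0U] : nbhs_ball x U by apply/nbhs_ballP; exact: open_nbhs_nbhs.
have sfr := smooth_sub r0U sf.
apply/eqP; rewrite -subr_eq0 -normr_le0; apply/ler_addgt0Pr => e e0.
have e20 : 0 < e / 2 by rewrite divr_gt0.
have cab := smooth_continuous (smooth_partial a (smooth_partial b sf)) Ux.
have cba := smooth_continuous (smooth_partial b (smooth_partial a sf)) Ux.
move/cvgrPdist_le/(_ _ e20)/nbhs_ballP : cab => [r1 /= r10 H1].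
move/cvgrPdist_le/(_ _ e20)/nbhs_ballP : cba => [r2 /= r20 H2].
pose h : R := Num.min r0 (Num.min r1 r2) / 4.
have h0 : 0 < h by rewrite divr_gt0 // !lt_min r00 r10 r20.
have h4 : 4 * h = Num.min r0 (Num.min r1 r2) by rewrite /h; field.
have hr0 : 4 * h <= r0 by rewrite h4 ge_min lexx.
have hr1 : 4 * h <= r1 by rewrite h4 !ge_min lexx orbT.
have hr2 : 4 * h <= r2 by rewrite h4 !ge_min lexx !orbT.
have hh : h ^+ 2 != 0 by rewrite expf_neq0 // gt_eqF.
move: h h0 h4 hr0 hr1 hr2 hh => h h0 _ hr0 hr1 hr2 hh.
have [z1 Bz1 E1] := second_difference a b sfr h0 hr0.
have [z2 Bz2 E2] := second_difference b a sfr h0 hr0.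
have swap (P A B F : R) : P - A - (B - F) = P - B - (A - F) by ring.
have E : partial b (partial a f) z1 = partial a (partial b f) z2.
  apply: (mulfI hh); apply: etrans (esym E1) (etrans _ E2).
  by rewrite [x + h *: delta_mx 0 a + _]addrAC; exact: swap.
have K1 := H1 z2 (le_ball hr1 Bz2); have K2 := H2 z1 (le_ball hr2 Bz1).
rewrite E in K2; rewrite add0r [leRHS]splitr.
apply: le_trans (ler_distD (partial a (partial b f) z2) _ _) _.
by apply: lerD; [exact: K1|rewrite distrC; exact: K2].
Qed.

Lemma ball_segment x (r : R) y z (t : R) : ball x r y -> ball x r z -> 0 <= t <= 1 -> ball x r (y + t *: (z - y)).
Proof.
rewrite -ball_normE /= => xy xz /andP[t0 t1].
have -> : x - (y + t *: (z - y)) = (1 - t) *: (x - y) + t *: (x - z).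
  by apply/rowP => i; rewrite !mxE; ring.
apply: le_lt_trans (ler_normD _ _) _; rewrite !normrZ (ger0_norm t0) ger0_norm ?subr_ge0 //.
have [->|tn0] := eqVneq t 0; first by rewrite subr0 mul1r mul0r addr0.
have tp : 0 < t by rewrite lt_def tn0.
have A : t * `|x - z| < t * r by rewrite ltr_pM2l.
have B : (1 - t) * `|x - y| <= (1 - t) * r by rewrite ler_wpM2l ?subr_ge0 // ltW.
lra.
Qed.

Lemma constant_on_ball f x (r : R) : smooth_on (ball x r) f ->
  (forall y a, ball x r y -> partial a f y = 0) -> forall y, ball x r y -> f y = f x.
Proof.
move=> sf pf y xy; have [r0|r0] := ltP 0 r; last first.
  by move: xy; rewrite -ball_normE /= => /(le_lt_trans (normr_ge0 _)); rewrite ltNge r0.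
apply/eqP; rewrite -subr_eq0 -normr_le0.
have oB : open (ball x r) by exact: ball_open.
have -> : f y = f (x + (y - x)) by rewrite addrC subrK.
apply: line_mvt => t t01.
have Bt : ball x r (x + t *: (y - x)) by apply: ball_segment => //; exact: ballxx.
have D := is_derive_dir (y - x) (smooth_differentiable oB sf Bt).
split; first by case: D.
by rewrite (@derive_val _ _ _ _ _ _ _ D) big1 ?normr0 // => b _; rewrite pf ?mulr0.
Qed.

End ChainRule.

Lemma continuous_sum (R : realType) (T : topologicalType) (I : finType) (F : I -> T -> R) (t : T) :
  (forall a, {for t, continuous (F a)}) -> {for t, continuous (fun s => \sum_a F a s)}.
Proof.
move=> cF; elim: (index_enum I) => [|a r IH].
  have -> : (fun s => \sum_(i <- [::]) F i s) = (fun=> 0) by apply/funext => s; rewrite big_nil.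
  exact: cst_continuous.
have -> : (fun s => \sum_(i <- a :: r) F i s) = (fun s => F a s + \sum_(i <- r) F i s).
  by apply/funext => s; rewrite big_cons.
exact: continuousD (cF a) IH.
Qed.

Lemma partial_sum_derivable (R : realType) n a (F : 'I_n -> 'rV[R]_4 -> R) x :
  (forall i, derivable (F i) x (delta_mx 0 a)) ->
  partial a (fun y => \sum_i F i y) x = \sum_i partial a (F i) x.
Proof.
move=> dF; rewrite /partial -(derive_sum dF); congr ('D_ _ _ x).
by apply/funext => y; rewrite fct_sumE.
Qed.

Section Poincare.
Variables (R : realType) (U : set 'rV[R]_4) (x0 : 'rV[R]_4).
Variable al : 'I_4 -> 'rV[R]_4 -> R.
Hypothesis oU : open U.
Hypothesis Ux0 : U x0.
Hypothesis sal : forall a, smooth_on U (al a).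
Hypothesis clal : forall a b x, U x -> partial a (al b) x = partial b (al a) x.
Let mu := @lebesgue_measure R.

Let ray (x : 'rV[R]_4) (t : R) : 'rV[R]_4 := x0 + t *: (x - x0).
Let phi (x : 'rV[R]_4) (t : R) : R := \sum_a (x 0 a - x0 0 a) * al a (ray x t).
Let psi b (x : 'rV[R]_4) (t : R) : R :=
  al b (ray x t) + t * \sum_a (x 0 a - x0 0 a) * partial b (al a) (ray x t).

Lemma ray_continuous x : continuous (ray x).
Proof.
move=> t; apply: (@cvgD _ _ _ _ _ (fun=> x0) (fun t => t *: (x - x0))); first exact: cvg_cst.
exact: scalel_continuous.
Qed.

Lemma poincare_bounds : exists r M : R, [/\ 0 < r, 0 <= M, ball x0 r `<=` U &
  forall x, ball x0 r x -> forall a b, `|al a x| <= M /\ `|partial b (al a) x| <= M].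
Proof.
have bd (f : 'rV[R]_4 -> R) : smooth_on U f -> \forall y \near x0, `|f y| <= `|f x0| + 1.
  move=> sf; have /cvgrPdist_le/(_ _ ltr01) := smooth_continuous sf Ux0.
  apply: filterS => y /= H; rewrite -lerBlDl; apply: le_trans H.
  by rewrite distrC; apply: le_trans (lerB_dist _ _) _.
pose M := \sum_a (`|al a x0| + 1) + \sum_a \sum_b (`|partial b (al a) x0| + 1).
have p0 (u : R) : 0 <= `|u| + 1 by rewrite addr_ge0.
have s0 (I : finType) (F : I -> R) : (forall i, 0 <= F i) -> forall i, F i <= \sum_j F j.
  by move=> F0 i; rewrite (bigD1 i) //= lerDl sumr_ge0.
have sg (I : finType) (F : I -> R) : (forall i, 0 <= F i) -> 0 <= \sum_j F j.
  by move=> F0; apply: sumr_ge0.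
have M1 a : `|al a x0| + 1 <= M.
  apply: le_trans (s0 _ (fun a => `|al a x0| + 1) _ a) _ => //.
  by rewrite /M lerDl; apply: (sg) => b; apply: (sg).
have M2 a b : `|partial b (al a) x0| + 1 <= M.
  apply: le_trans (s0 _ (fun b => `|partial b (al a) x0| + 1) _ b) _ => //.
  apply: le_trans (s0 _ (fun a => \sum_b (`|partial b (al a) x0| + 1)) _ a) _.
    by move=> i; apply: (sg).
  by rewrite /M lerDr; apply: (sg).
have near_M : \forall y \near x0, U y /\ forall a b, `|al a y| <= M /\ `|partial b (al a) y| <= M.
  apply: filterI; first exact: open_nbhs_nbhs.
  apply: near_all4 => a; apply: near_all4 => b; apply: filterI.
    by apply: filterS (bd _ (sal a)) => y H; exact: le_trans H (M1 a).
  by apply: filterS (bd _ (smooth_partial b (sal a))) => y H; exact: le_trans H (M2 a b).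
have [r /= r0 H] := (nbhs_ballP _ _).1 near_M.
exists r, M; split=> //; first exact: le_trans (p0 _) (M1 0).
  by move=> y /H[].
by move=> y /H[].
Qed.

Lemma poincare : exists (r : R) (f : 'rV[R]_4 -> R),
  [/\ 0 < r, ball x0 r `<=` U, smooth_on (ball x0 r) f &
   forall x a, ball x0 r x -> partial a f x = al a x].
Proof.
have [r [M [r0 M0 rU bM]]] := poincare_bounds.
have oB : open (ball x0 r) by exact: ball_open.
have rayB (x : 'rV[R]_4) (t : R) : ball x0 r x -> 0 <= t <= 1 -> ball x0 r (ray x t).
  by move=> xB t01; apply: ball_segment => //; exact: ballxx.
pose f x := \int[mu]_(t in `[0, 1]) phi x t.
have dphi (x : 'rV[R]_4) (t : R) b : ball x0 r x -> 0 <= t <= 1 -> is_derive x (delta_mx 0 b) (phi^~ t) (psi b x t).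
  move=> xB t01.
  have da a : is_derive x (delta_mx 0 b) (fun y : 'rV[R]_4 => (y 0 a - x0 0 a) * al a (ray y t))
      ((a == b)%:R * al a (ray x t) + (x 0 a - x0 0 a) * (t * partial b (al a) (ray x t))).
    have D1 : is_derive x (delta_mx 0 b) (fun y : 'rV[R]_4 => y 0 a - x0 0 a) ((a == b)%:R).
      have D0 := is_derive_coord a x (delta_mx 0 b).
      have D1 := is_deriveB D0 (is_derive_cst (x0 0 a) x (delta_mx 0 b)).
      by apply: (is_derive_eq D1); rewrite mxE eqxx subr0 eq_sym.
    have D2 := @is_derive_affine R (al a) x x0 (delta_mx 0 b) t (smooth_derivable (sal a) (rU _ (rayB x t xB t01))).
    have D3 := is_deriveM D1 D2; apply: (is_derive_eq D3).
    by rewrite addrC /GRing.scale /= [X in X + _ = _]mulrC.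
  have -> : phi^~ t = \sum_a (fun y : 'rV[R]_4 => (y 0 a - x0 0 a) * al a (ray y t)).
    by apply/funext => y; rewrite fct_sumE.
  apply: is_derive_eq; rewrite big_split /= (bigD1 b) //= eqxx mul1r big1 ?addr0.
    by congr (_ + _); rewrite mulr_sumr; apply: eq_bigr => a _; rewrite mulrCA.
  by move=> a /negbTE ->; rewrite mul0r.
have cal (g : 'rV[R]_4 -> R) (x : 'rV[R]_4) : smooth_on U g -> ball x0 r x -> {within `[0, 1], continuous (fun t => g (ray x t))}.
  move=> sg xB; apply: continuous_in_subspaceT => t; rewrite inE /= in_itv /= => t01.
  apply: continuous_comp; first exact: ray_continuous.
  exact: smooth_continuous sg (rU _ (rayB x t xB t01)).
have cphi (x : 'rV[R]_4) : ball x0 r x -> {within `[0, 1], continuous (phi x)}.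
  move=> xB; apply: continuous_in_subspaceT => t; rewrite inE /= in_itv /= => t01.
  apply: continuous_sum => a; apply: continuousM; first exact: cst_continuous.
  apply: continuous_comp; first exact: ray_continuous.
  exact: smooth_continuous (sal a) (rU _ (rayB x t xB t01)).
have cpsi b (x : 'rV[R]_4) : ball x0 r x -> {within `[0, 1], continuous (psi b x)}.
  move=> xB; apply: continuous_in_subspaceT => t; rewrite inE /= in_itv /= => t01.
  apply: (@continuousD _ _ _ (fun t => al b (ray x t)) (fun t => t * \sum_a (x 0 a - x0 0 a) * partial b (al a) (ray x t))).
    apply: continuous_comp; first exact: ray_continuous.
    exact: smooth_continuous (sal b) (rU _ (rayB x t xB t01)).
  apply: (@continuousM _ _ id (fun t => \sum_a (x 0 a - x0 0 a) * partial b (al a) (ray x t))); first exact: cvg_id.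
  apply: continuous_sum => a; apply: continuousM; first exact: cst_continuous.
  apply: continuous_comp; first exact: ray_continuous.
  exact: smooth_continuous (smooth_partial b (sal a)) (rU _ (rayB x t xB t01)).
have dray b (x : 'rV[R]_4) (t : R) : ball x0 r x -> 0 <= t <= 1 ->
    is_derive t 1 (fun s => s * al b (ray x s)) (psi b x t).
  move=> xB t01; have Ur := rU _ (rayB x t xB t01).
  have D1 := is_derive_dir (x - x0) (smooth_differentiable oU (sal b) Ur).
  have D2 := @is_derive_line R (al b) x0 (x - x0) t (@ex_derive _ _ _ _ _ _ _ D1).
  have D3 := is_deriveM (is_derive_id t (1 : R)) D2; apply: (is_derive_eq D3).
  rewrite (@derive_val _ _ _ _ _ _ _ D1) /psi addrC; congr (_ + _); first by rewrite [_ *: _]mulr1.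
  rewrite /GRing.scale /=; congr (_ * _); apply: eq_bigr => a _.
  by rewrite !mxE clal.
have ftc b (x : 'rV[R]_4) : ball x0 r x -> \int[mu]_(t in `[0, 1]) psi b x t = al b x.
  move=> xB; rewrite /Rintegral.
  rewrite (@continuous_FTC2 _ (psi b x) (fun s => s * al b (ray x s)) 0 1) ?ltr01 //.
  - by rewrite mul1r mul0r sube0 /= /ray scale1r addrC subrK.
  - exact: cpsi.
  - have cd (t : R) : 0 <= t <= 1 -> {for t, continuous (fun s : R => s * al b (ray x s))}.
      by move=> t01; apply/differentiable_continuous/derivable1_diffP; have [] := dray b x t xB t01.
    split.
    + by move=> t; rewrite in_itv /= => /andP[t0 t1]; have [|] := dray b x t xB; rewrite ?(ltW t0) ?(ltW t1).
    + by apply: cvg_at_right_filter; apply: cd; rewrite lexx ler01.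
    + by apply: cvg_at_left_filter; apply: cd; rewrite lexx ler01.
  - by move=> t; rewrite in_itv /= => /andP[t0 t1]; rewrite derive1E (@derive_val _ _ _ _ _ _ _ (dray b x t xB _)) // !ltW.
have psiM b (x : 'rV[R]_4) (t : R) : ball x0 r x -> 0 <= t <= 1 -> `|psi b x t| <= M + \sum_(c < 4) r * M.
  move=> xB t01; have rB := rayB x t xB t01; apply: le_trans (ler_normD _ _) _; apply: lerD.
    by have [] := bM _ rB b b.
  case/andP: t01 => t0 t1; rewrite normrM (ger0_norm t0).
  apply: (@le_trans _ _ (1 * `|\sum_a (x 0 a - x0 0 a) * partial b (al a) (ray x t)|)).
    by rewrite ler_wpM2r.
  rewrite mul1r; apply: le_trans (ler_norm_sum _ _ _) _; apply: ler_sum => a _.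
  rewrite normrM; apply: ler_pM => //; last by have [] := bM _ rB a b.
  apply: le_trans (normrB_coord _ _ _) _; rewrite distrC; apply: ltW.
  by move: xB; rewrite -ball_normE.
have df (x : 'rV[R]_4) b : ball x0 r x -> is_derive x (delta_mx 0 b) f (al b x).
  move=> xB; pose v : 'rV[R]_4 := delta_mx 0 b; pose eta := r - `|x0 - x|.
  have eta0 : 0 < eta by rewrite subr_gt0; move: xB; rewrite -ball_normE.
  have xBs (s : R) : `](- eta), eta[%classic s -> ball x0 r (x + s *: v).
    rewrite /= in_itv /= -ltr_norml => sE; rewrite -ball_normE /= opprD addrA.
    apply: le_lt_trans (ler_normB _ _) _; rewrite normrZ.
    have : `|s| * `|v| <= `|s| by rewrite ler_piMr // normr_delta.
    move=> H; have H2 : `|s| < r - `|x0 - x| := sE.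
    by rewrite ltrBrDl in H2; apply: le_lt_trans H2; rewrite lerD2l.
  have I0 : `](- eta), eta[%classic 0 by rewrite /= in_itv /= oppr_lt0 eta0.
  have m01 : measurable (`[0, 1]%classic : set (measurableTypeR R)) by exact: measurable_itv.
  have int1 : forall s : R, `](- eta), eta[%classic s ->
      mu.-integrable `[0, 1] (EFin \o (fun t => phi (x + s *: v) t)).
    move=> s /xBs sB; apply: continuous_compact_integrable; first exact: segment_compact.
    exact: cphi.
  have D (s t : R) : `](- eta), eta[%classic s -> `[0, 1]%classic t ->
      is_derive s 1 (fun s => phi (x + s *: v) t) (psi b (x + s *: v) t).
    rewrite [X in _ -> X -> _]/= in_itv /= => /xBs sB t01.
    have D0 := dphi _ _ b sB t01.
    have := @is_derive_line _ (phi^~ t) x v s (@ex_derive _ _ _ _ _ _ _ D0).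
    by rewrite (@derive_val _ _ _ _ _ _ _ D0).
  have dF1 (s t : R) : `](- eta), eta[%classic s -> `[0, 1]%classic t ->
      derivable (fun s : R => phi (x + s *: v) t) s 1.
    by move=> sI tI; case: (D s t sI tI).
  pose G : measurableTypeR R -> R := fun=> M + \sum_(c < 4) r * M.
  have G0 t : 0 <= G t by rewrite addr_ge0 // sumr_ge0 // => c _; rewrite mulr_ge0 // ltW.
  have intG : mu.-integrable `[0, 1] (EFin \o G).
    apply: continuous_compact_integrable; first exact: segment_compact.
    by apply: continuous_subspaceT => t; exact: cvg_cst.
  have Gub (s t : R) : `](- eta), eta[%classic s -> `[0, 1]%classic t ->
      `|partial1of2 (fun (s : R) (t : measurableTypeR R) => phi (x + s *: v) t) s t| <= G t.
    move=> sI tI; rewrite partial1of2E (@derive_val _ _ _ _ _ _ _ (D s t sI tI)).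
    by apply: psiM; [exact: xBs|move: tI; rewrite /= in_itv].
  have E1 := differentiation_under_integral m01 I0 int1 dF1 G0 intG Gub.
  have E2 := derivable_under_integral m01 I0 int1 dF1 G0 intG Gub.
  have dx : derivable f x v.
    apply: (proj2 (derivable1P f x v)).
    have -> : (fun h : R => f (h *: v + x)) = (fun h => f (x + h *: v)).
      by apply/funext => h; rewrite addrC.
    exact: E2.
  split=> //.
  have := @is_derive_line _ f x v 0; rewrite scale0r addr0 => /(_ dx) d3.
  rewrite -(@derive_val _ _ _ _ _ _ _ d3) -derive1E E1 -(ftc b x xB).
  apply: eq_Rintegral => t; rewrite inE => tI.
  by rewrite partial1of2E (@derive_val _ _ _ _ _ _ _ (D 0 t I0 tI)) scale0r addr0.
exists r, f; split=> //; last by move=> x a /df D; rewrite /partial (@derive_val _ _ _ _ _ _ _ (D a)).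
have pf a (x : 'rV[R]_4) : ball x0 r x -> partial a f x = al a x.
  by move=> /df D; rewrite /partial (@derive_val _ _ _ _ _ _ _ (D a)).
apply: (smooth_ode oB (F := al)).
- move=> x xB; apply: differentiable_continuous; apply: differentiable_partial => a.
    by apply: (open_near oB xB) => y /df D; have [] := D a.
  suff : partial a f y @[y --> x] --> partial a f x by [].
  rewrite pf //.
  have E : \forall y \near x, al a y = partial a f y by apply: (open_near oB xB) => y yB; rewrite pf.
  apply: cvg_trans (near_eq_cvg E) _; exact: smooth_continuous (sal a) (rU _ xB).
- by move=> k a _; exact: smooth_sub rU (sal a) k.
Qed.

End Poincare.

(** * Spherical coordinates and Gibbons-Hawking metrics *)

Lemma partial_atan (R : realType) (f : 'rV[R]_4 -> R) a x : derivable f x (delta_mx 0 a) ->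
  partial a (fun y => atan (f y)) x = (1 + f x ^+ 2)^-1 * partial a f x.
Proof. by move=> df; have H := is_derive_comp1 (is_derive1_atan (f x)) df; rewrite /partial derive_val. Qed.

Lemma derivable_atan (R : realType) (f : 'rV[R]_4 -> R) x v : derivable f x v ->
  derivable (fun y => atan (f y)) x v.
Proof. by move=> df; have H := is_derive_comp1 (is_derive1_atan (f x)) df; exact: ex_derive. Qed.

Opaque partial.

Section SphericalAlgebra.
Variables (R : realFieldType) (h1 h2 h3 r H : R).
Hypothesis r0 : r != 0.
Hypothesis H0 : H != 0.
Hypothesis rE : r ^+ 2 = h1 ^+ 2 + h2 ^+ 2.
Hypothesis HE : H ^+ 2 = h1 ^+ 2 + h2 ^+ 2 + h3 ^+ 2.

Definition sphP a1 a2 a3 := (h1 * a1 + h2 * a2 + h3 * a3) / H.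
Definition sphQ a1 a2 := (h1 * a2 - h2 * a1) / r.
Definition sphW a1 a2 a3 := (h3 * (h1 * a1 + h2 * a2) - r ^+ 2 * a3) / (r * H).

Lemma sph_gram a1 a2 a3 c1 c2 c3 : a1 * c1 + a2 * c2 + a3 * c3 =
  sphP a1 a2 a3 * sphP c1 c2 c3 + sphQ a1 a2 * sphQ c1 c2 + sphW a1 a2 a3 * sphW c1 c2 c3.
Proof.
have -> : a1 * c1 + a2 * c2 + a3 * c3 = (r ^+ 2 * H ^+ 2 * (a1 * c1 + a2 * c2 + a3 * c3)) / (r ^+ 2 * H ^+ 2).
  by field; rewrite r0 H0.
have -> : sphP a1 a2 a3 * sphP c1 c2 c3 + sphQ a1 a2 * sphQ c1 c2 + sphW a1 a2 a3 * sphW c1 c2 c3 =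
  (r ^+ 2 * ((h1 * a1 + h2 * a2 + h3 * a3) * (h1 * c1 + h2 * c2 + h3 * c3))
  + H ^+ 2 * ((h1 * a2 - h2 * a1) * (h1 * c2 - h2 * c1))
  + (h3 * (h1 * a1 + h2 * a2) - r ^+ 2 * a3) * (h3 * (h1 * c1 + h2 * c2) - r ^+ 2 * c3)) / (r ^+ 2 * H ^+ 2).
  by rewrite /sphP /sphQ /sphW; field; rewrite r0 H0.
by congr (_ / _); rewrite HE rE; ring.
Qed.

Lemma sph_vol a1 a2 a3 c1 c2 c3 :
  H * (sphW a1 a2 a3 * sphQ c1 c2 - sphW c1 c2 c3 * sphQ a1 a2) =
  h1 * (a2 * c3 - c2 * a3) + h2 * (a3 * c1 - c3 * a1) + h3 * (a1 * c2 - c1 * a2).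
Proof.
have -> : H * (sphW a1 a2 a3 * sphQ c1 c2 - sphW c1 c2 c3 * sphQ a1 a2) =
  ((h3 * (h1 * a1 + h2 * a2) - r ^+ 2 * a3) * (h1 * c2 - h2 * c1)
  - (h3 * (h1 * c1 + h2 * c2) - r ^+ 2 * c3) * (h1 * a2 - h2 * a1)) / r ^+ 2.
  by rewrite /sphW /sphQ; field; rewrite r0 H0.
have r20 : r ^+ 2 != 0 by rewrite expf_neq0.
by apply: (mulIf r20); rewrite divfK // rE; ring.
Qed.

End SphericalAlgebra.

Definition local_form (R : realType) (U : set 'rV[R]_4) (g : 'rV[R]_4 -> 'M[R]_4)
    (W : set 'rV[R]_4) (h : 'rV[R]_4 -> 'M[R]_4) (x0 : 'rV[R]_4) :=
  exists V F, [/\ open V, V x0, V `<=` U, smooth_map_on V F &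
    forall x, V x -> W (F x) /\ g x = pullback F h x].

Section Pullback.
Variables (R : realType) (F : 'rV[R]_4 -> 'rV[R]_4).

Definition map4 (t0 t1 t2 t3 : 'rV[R]_4 -> R) (y : 'rV[R]_4) : 'rV[R]_4 :=
  \row_i nth 0 [:: t0 y; t1 y; t2 y; t3 y] i.

Lemma co_map4 t0 t1 t2 t3 y : [/\ co 0 (map4 t0 t1 t2 t3 y) = t0 y, co 1 (map4 t0 t1 t2 t3 y) = t1 y,
  co 2 (map4 t0 t1 t2 t3 y) = t2 y & co 3 (map4 t0 t1 t2 t3 y) = t3 y].
Proof. by split; rewrite /co mxE inordK. Qed.

Lemma dco_dmap k x a : (dco R k *m (dmap F x)^T) 0 a = partial a (fun y => co k (F y)) x.
Proof.
rewrite /dco mxE (bigD1 (inord k)) //= big1 => [|i ik]; last by rewrite mxE eqxx (negbTE ik) mul0r.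
by rewrite addr0 !mxE !eqxx mul1r.
Qed.

Lemma pullback_sq (w : 'rV[R]_4) x a c :
  (dmap F x *m sq w *m (dmap F x)^T) a c = (w *m (dmap F x)^T) 0 a * (w *m (dmap F x)^T) 0 c.
Proof.
have -> : dmap F x *m sq w *m (dmap F x)^T = (w *m (dmap F x)^T)^T *m (w *m (dmap F x)^T).
  by rewrite /sq trmx_mul trmxK !mulmxA.
by rewrite mxE big_ord1 mxE.
Qed.

Lemma pullbackD (T S : 'rV[R]_4 -> 'M[R]_4) x a c :
  pullback F (fun y => T y + S y) x a c = pullback F T x a c + pullback F S x a c.
Proof. by rewrite /pullback mulmxDr mulmxDl mxE. Qed.

Lemma pullbackZ (k : 'rV[R]_4 -> R) (T : 'rV[R]_4 -> 'M[R]_4) x a c :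
  pullback F (fun y => k y *: T y) x a c = k (F x) * pullback F T x a c.
Proof. by rewrite /pullback -scalemxAr -scalemxAl mxE. Qed.

Lemma pullbackN (T : 'rV[R]_4 -> 'M[R]_4) x a c :
  pullback F (fun y => - T y) x a c = - pullback F T x a c.
Proof. by rewrite /pullback mulmxN mulNmx mxE. Qed.

Lemma pullback_taub n x a c (p := fun k i => partial i (fun y => co k (F y)) x)
    (rho := co 1 (F x)) (th := co 2 (F x)) :
  pullback F (taub_nut n) x a c =
    4 * n ^+ 2 * ((rho - n) / (rho + n)) * ((p 0%N a + cos th * p 3%N a) * (p 0%N c + cos th * p 3%N c))
    + (rho + n) / (rho - n) * (p 1%N a * p 1%N c)
    + (rho ^+ 2 - n ^+ 2) * (p 2%N a * p 2%N c + sin th ^+ 2 * (p 3%N a * p 3%N c)).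
Proof.
have E k i : (dco R k *m (dmap F x)^T) 0 i = p k i by exact: dco_dmap.
have E2 (k : R) i : ((dco R 0 + k *: dco R 3) *m (dmap F x)^T) 0 i = p 0%N i + k * p 3%N i.
  by rewrite mulmxDl -scalemxAl mxE E [X in _ + X]mxE E.
rewrite /taub_nut pullbackD pullbackD !pullbackZ pullbackD pullbackZ.
by rewrite /pullback !pullback_sq !E !E2.
Qed.

Lemma pullback_gh x a c (p := fun k i => partial i (fun y => co k (F y)) x) :
  pullback F (@linear_gh R) x a c =
    (co 1 (F x))^-1 * ((p 0%N a + co 2 (F x) * p 3%N a) * (p 0%N c + co 2 (F x) * p 3%N c))
    + co 1 (F x) * (p 1%N a * p 1%N c + p 2%N a * p 2%N c + p 3%N a * p 3%N c).
Proof.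
have E k i : (dco R k *m (dmap F x)^T) 0 i = p k i by exact: dco_dmap.
have E2 (k : R) i : ((dco R 0 + k *: dco R 3) *m (dmap F x)^T) 0 i = p 0%N i + k * p 3%N i.
  by rewrite mulmxDl -scalemxAl mxE E [X in _ + X]mxE E.
rewrite /linear_gh pullbackD !pullbackZ !pullbackD.
by rewrite /pullback !pullback_sq !E !E2.
Qed.

End Pullback.

Lemma partial_sqrE (R : realType) (U : set 'rV[R]_4) (f p : 'rV[R]_4 -> R) x a : open U -> U x ->
  smooth_on U f -> (forall y, U y -> f y ^+ 2 = p y) -> partial a p x = 2 * f x * partial a f x.
Proof.
move=> oU Ux sf E; rewrite -(partial_ext a oU Ux (f := fun y => f y * f y)); last by move=> y Uy; rewrite -E // expr2.
have df := @smooth_derivable _ _ _ x a sf Ux.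
by rewrite partialM //; ring.
Qed.

Lemma partial_mulE (R : realType) (U : set 'rV[R]_4) (f k p : 'rV[R]_4 -> R) x a : open U -> U x ->
  smooth_on U f -> smooth_on U k -> (forall y, U y -> f y * k y = p y) ->
  partial a p x = partial a f x * k x + f x * partial a k x.
Proof.
move=> oU Ux sf sk E; rewrite -(partial_ext a oU Ux (f := fun y => f y * k y)) //.
have df := @smooth_derivable _ _ _ x a sf Ux; have dk := @smooth_derivable _ _ _ x a sk Ux.
by rewrite partialM.
Qed.

Lemma cos_colatitude (R : realType) (t k c : R) : 0 < k -> t ^+ 2 + 1 = k ^+ 2 -> c = t / k ->
  [/\ cos (pi / 2 - atan t) = c, sin (pi / 2 - atan t) ^+ 2 = 1 / k ^+ 2 & 0 < pi / 2 - atan t < pi].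
Proof.
move=> k0 tk ->.
have ck : cos (atan t) = k^-1 by rewrite cos_atan addrC tk sqrtr_sqr gtr0_norm.
have st : sin (atan t) = t / k.
  have := atanK t; rewrite /tan ck => /(canRL (mulfVK _)) -> //.
  by rewrite invr_neq0 // gt_eqF.
have E : pi / 2 - atan t = - (atan t) + pi / 2 by rewrite addrC.
split.
- by rewrite E cosDpihalf sinN opprK st.
- by rewrite E sinDpihalf cosN ck exprVn div1r.
- have := atan_gtNpi2 t; have := atan_ltpi2 t; set u := atan t; set p := pi; move=> h1 h2.
  by apply/andP; split; lra.
Qed.

Section LocalForm.
Variables (R : realType) (U : set 'rV[R]_4) (g : 'rV[R]_4 -> 'M[R]_4).
Variables (f1 f2 f3 h1 h2 h3 S N : 'rV[R]_4 -> R) (b : 'I_4 -> 'rV[R]_4 -> R) (N0 m : R).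

Record gh_system : Prop := GHSystem {
  gh_open : open U;
  gh_f : [/\ smooth_on U f1, smooth_on U f2 & smooth_on U f3];
  gh_h : [/\ smooth_on U h1, smooth_on U h2 & smooth_on U h3];
  gh_S : smooth_on U S;
  gh_b : forall a, smooth_on U (b a);
  gh_S0 : forall x, U x -> 0 < S x;
  gh_N0 : forall x, U x -> 0 < N x;
  gh_N : forall x, U x -> N x = N0 - 2 * m / Num.sqrt (S x);
  gh_dh : forall x a, U x -> [/\ partial a h1 x = - N0 * partial a f1 x,
    partial a h2 x = - N0 * partial a f2 x & partial a h3 x = - N0 * partial a f3 x];
  gh_dS : forall x a, U x -> N x * partial a S x = - 2 * (h1 x * partial a f1 x
    + h2 x * partial a f2 x + h3 x * partial a f3 x);
  gh_g : forall x a c, U x -> N x * g x a c = b a x * b c x + partial a f1 x * partial c f1 x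
    + partial a f2 x * partial c f2 x + partial a f3 x * partial c f3 x;
  gh_norm : forall x, U x -> h1 x ^+ 2 + h2 x ^+ 2 + h3 x ^+ 2 = N x ^+ 2 * S x;
  gh_eta : forall x a c, U x ->
    partial a (fun y => b c y / N y) x - partial c (fun y => b a y / N y) x =
    2 * (m / Num.sqrt (S x)) / (S x * N x ^+ 3) *
     (h1 x * (partial a f2 x * partial c f3 x - partial c f2 x * partial a f3 x)
     + h2 x * (partial a f3 x * partial c f1 x - partial c f3 x * partial a f1 x)
     + h3 x * (partial a f1 x * partial c f2 x - partial c f1 x * partial a f2 x)) }.

End LocalForm.

Lemma gh_rot (R : realType) (U : set 'rV[R]_4) g f1 f2 f3 h1 h2 h3 S N b (N0 m : R) :
  gh_system U g f1 f2 f3 h1 h2 h3 S N b N0 m -> gh_system U g f2 f3 f1 h2 h3 h1 S N b N0 m.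
Proof.
case=> oU [sf1 sf2 sf3] [sh1 sh2 sh3] sS sb S0 n0 NE dh dS gE nE eta; split => //.
- by move=> x a Ux; have [] := dh x a Ux.
- by move=> x a Ux; rewrite dS // -addrA addrC.
- move=> x a c Ux; rewrite gE // -!addrA; congr (_ + _).
  by rewrite addrC addrA.
- by move=> x Ux; rewrite addrC addrA nE.
- by move=> x a c Ux; rewrite eta //; congr (_ * _); rewrite -addrA addrC.
Qed.

Lemma gh_sub (R : realType) (U V : set 'rV[R]_4) g f1 f2 f3 h1 h2 h3 S N b (N0 m : R) :
  open V -> V `<=` U -> gh_system U g f1 f2 f3 h1 h2 h3 S N b N0 m ->
  gh_system V g f1 f2 f3 h1 h2 h3 S N b N0 m.
Proof.
move=> oV VU [oU [sf1 sf2 sf3] [sh1 sh2 sh3] sS sb S0 n0 NE dh dS gE nE eta].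
have ss f : smooth_on U f -> smooth_on V f by exact: smooth_sub.
split; [exact: oV|split; exact: ss|split; exact: ss|exact: ss|by move=> a; apply: ss|..].
- by move=> x /VU; exact: S0.
- by move=> x /VU; exact: n0.
- by move=> x /VU; exact: NE.
- by move=> x a /VU; exact: dh.
- by move=> x a /VU; exact: dS.
- by move=> x a c /VU; exact: gE.
- by move=> x /VU; exact: nE.
- by move=> x a c /VU; exact: eta.
Qed.

Section Spherical.
Variables (R : realType) (U : set 'rV[R]_4) (g : 'rV[R]_4 -> 'M[R]_4).
Variables (f1 f2 f3 h1 h2 h3 S N : 'rV[R]_4 -> R) (b : 'I_4 -> 'rV[R]_4 -> R) (N0 m : R).
Hypothesis gh : gh_system U g f1 f2 f3 h1 h2 h3 S N b N0 m.
Hypothesis h1_neq0 : forall x, U x -> h1 x != 0.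
Let oU := gh_open gh.

Definition sS y := Num.sqrt (S y).
Definition cyl y := Num.sqrt (h1 y ^+ 2 + h2 y ^+ 2).
Definition sph y := N y * sS y.

Lemma sS_gt0 x : U x -> 0 < sS x.
Proof. by move=> Ux; rewrite /sS sqrtr_gt0 (gh_S0 gh). Qed.

Lemma sS_sqr x : U x -> sS x ^+ 2 = S x.
Proof. by move=> Ux; rewrite /sS sqr_sqrtr // ltW // (gh_S0 gh). Qed.

Lemma smooth_sS : smooth_on U sS.
Proof. by apply: smooth_sqrt; [exact: oU|exact: gh_S gh|exact: gh_S0 gh]. Qed.

Lemma smooth_N : smooth_on U N.
Proof.
have sN0 y : U y -> sS y != 0 by move=> Uy; rewrite gt_eqF // sS_gt0.
have := smoothB oU (smooth_cst oU N0) (smoothM oU (smooth_cst oU (2 * m)) (smoothV oU smooth_sS sN0)).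
by apply: smooth_ext => // x Ux; rewrite (gh_N gh).
Qed.

Lemma cyl_pos x : U x -> 0 < h1 x ^+ 2 + h2 x ^+ 2.
Proof.
move=> Ux; rewrite ltr_wpDr ?sqr_ge0 //; by rewrite lt_def sqrf_eq0 h1_neq0 // sqr_ge0.
Qed.

Lemma cyl_gt0 x : U x -> 0 < cyl x.
Proof. by move=> Ux; rewrite /cyl sqrtr_gt0 cyl_pos. Qed.

Lemma cyl_sqr x : U x -> cyl x ^+ 2 = h1 x ^+ 2 + h2 x ^+ 2.
Proof. by move=> Ux; rewrite /cyl sqr_sqrtr // ltW // cyl_pos. Qed.

Lemma smooth_cyl : smooth_on U cyl.
Proof.
have [s1 s2 s3] := gh_h gh.
by apply: smooth_sqrt; [exact: oU|exact: (smoothD oU (smoothX oU 2 s1) (smoothX oU 2 s2))|exact: cyl_pos].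
Qed.

Lemma sph_gt0 x : U x -> 0 < sph x.
Proof. by move=> Ux; rewrite mulr_gt0 ?sS_gt0 // (gh_N0 gh). Qed.

Lemma sph_sqr x : U x -> sph x ^+ 2 = h1 x ^+ 2 + h2 x ^+ 2 + h3 x ^+ 2.
Proof. by move=> Ux; rewrite (gh_norm gh) // /sph exprMn sS_sqr. Qed.

Lemma smooth_sph : smooth_on U sph.
Proof. by apply: smoothM; [exact: oU|exact: smooth_N|exact: smooth_sS]. Qed.

Notation P x a := (sphP (h1 x) (h2 x) (h3 x) (sph x) (partial a h1 x) (partial a h2 x) (partial a h3 x)).
Notation Q x a := (sphQ (h1 x) (h2 x) (cyl x) (partial a h1 x) (partial a h2 x)).
Notation W x a := (sphW (h1 x) (h2 x) (h3 x) (cyl x) (sph x) (partial a h1 x) (partial a h2 x) (partial a h3 x)).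

Lemma partial_cyl x a : U x -> partial a cyl x = (h1 x * partial a h1 x + h2 x * partial a h2 x) / cyl x.
Proof.
move=> Ux; have [s1 s2 s3] := gh_h gh; have c0 : cyl x != 0 by rewrite gt_eqF // cyl_gt0.
have d (k : 'rV[R]_4 -> R) : smooth_on U k -> derivable k x (delta_mx 0 a).
  by move=> sk; exact: (@smooth_derivable _ _ _ x a sk Ux).
have E := partial_sqrE a oU Ux smooth_cyl cyl_sqr.
have E1 := partial_sqrE a oU Ux s1 (fun y _ => erefl).
have E2 := partial_sqrE a oU Ux s2 (fun y _ => erefl).
move: E; rewrite partialD; [|exact: d (smoothX oU 2 s1)|exact: d (smoothX oU 2 s2)].
rewrite E1 E2 => E; apply: (mulIf c0); rewrite divfK //; move: E.
set u := partial a cyl x; set v := partial a h1 x; set w := partial a h2 x.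
by move: (h1 x) (h2 x) (cyl x) => p q r; clearbody u v w; lra.
Qed.

Lemma partial_sph x a : U x -> partial a sph x = P x a.
Proof.
move=> Ux; have [s1 s2 s3] := gh_h gh; have c0 : sph x != 0 by rewrite gt_eqF // sph_gt0.
have d (k : 'rV[R]_4 -> R) : smooth_on U k -> derivable k x (delta_mx 0 a).
  by move=> sk; exact: (@smooth_derivable _ _ _ x a sk Ux).
have E := partial_sqrE a oU Ux smooth_sph sph_sqr.
have E1 := partial_sqrE a oU Ux s1 (fun y _ => erefl).
have E2 := partial_sqrE a oU Ux s2 (fun y _ => erefl).
have E3 := partial_sqrE a oU Ux s3 (fun y _ => erefl).
move: E; rewrite partialD; [|exact: d (smoothD oU (smoothX oU 2 s1) (smoothX oU 2 s2))|exact: d (smoothX oU 2 s3)].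
rewrite partialD; [|exact: d (smoothX oU 2 s1)|exact: d (smoothX oU 2 s2)].
rewrite E1 E2 E3 /sphP => E; apply: (mulIf c0); rewrite divfK //; move: E.
set u := partial a sph x; set v := partial a h1 x; set w := partial a h2 x; set z := partial a h3 x.
by move: (h1 x) (h2 x) (h3 x) (sph x) => p q t r; clearbody u v w z; lra.
Qed.

Definition cosc y := h3 y / sph y.

Lemma smooth_cosc : smooth_on U cosc.
Proof.
have [s1 s2 s3] := gh_h gh; apply: (smoothM oU s3); apply: smoothV; [exact: oU|exact: smooth_sph|].
by move=> x Ux; rewrite gt_eqF // sph_gt0.
Qed.

Lemma partial_cosc x a : U x -> partial a cosc x = - (cyl x / sph x ^+ 2) * W x a.
Proof.
move=> Ux; have c0 : sph x != 0 by rewrite gt_eqF // sph_gt0.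
have r0 : cyl x != 0 by rewrite gt_eqF // cyl_gt0.
have E := partial_mulE a oU Ux smooth_cosc smooth_sph (p := h3).
have := E (fun y Uy => divfK (negbT (gt_eqF (sph_gt0 Uy))) (h3 y)).
rewrite partial_sph // => /esym; rewrite {2}/cosc => {}E.
have r2 := cyl_sqr Ux; have H2 := sph_sqr Ux.
have -> : partial a cosc x = (partial a h3 x - h3 x / sph x * P x a) / sph x.
  by apply: (canRL (mulfK c0)); apply: (canRL (addrK _)); exact: E.
rewrite /sphP /sphW; move: (partial a h1 x) (partial a h2 x) (partial a h3 x) => a1 a2 a3.
move: c0 r0 r2 H2; move: (h1 x) (h2 x) (h3 x) (sph x) (cyl x) => k1 k2 k3 H r H0 r0 r2 H2.
have -> : (a3 - k3 / H * ((k1 * a1 + k2 * a2 + k3 * a3) / H)) / H =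
  (a3 * H ^+ 2 - k3 * (k1 * a1 + k2 * a2 + k3 * a3)) / H ^+ 3 by field.
have -> : - (r / H ^+ 2) * ((k3 * (k1 * a1 + k2 * a2) - r ^+ 2 * a3) / (r * H)) =
  (r ^+ 2 * a3 - k3 * (k1 * a1 + k2 * a2)) / H ^+ 3 by field; rewrite H0.
by congr (_ / _); rewrite H2 r2; ring.
Qed.

Definition azimuth y := atan (h2 y / h1 y).

Lemma smooth_azimuth : smooth_on U azimuth.
Proof.
have [s1 s2 s3] := gh_h gh; apply: smooth_atan; first exact: oU.
by apply: (smoothM oU s2); apply: smoothV; [exact: oU|exact: s1|exact: h1_neq0].
Qed.

Lemma partial_azimuth x a : U x -> partial a azimuth x = Q x a / cyl x.
Proof.
move=> Ux; have [s1 s2 s3] := gh_h gh.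
have st : smooth_on U (fun y => h2 y / h1 y).
  by apply: (smoothM oU s2); apply: smoothV; [exact: oU|exact: s1|exact: h1_neq0].
have dt := @smooth_derivable _ _ _ x a st Ux.
have := partial_mulE a oU Ux st s1 (p := h2) (fun y Uy => divfK (h1_neq0 Uy) (h2 y)).
rewrite (partial_atan dt).
move=> E; have k0 := h1_neq0 Ux.
have -> : partial a (fun y => h2 y / h1 y) x = (partial a h2 x - h2 x / h1 x * partial a h1 x) / h1 x.
  by apply: (canRL (mulfK k0)); apply: (canRL (addrK _)); rewrite E.
rewrite /sphQ; have r2 := cyl_sqr Ux; have r0 : cyl x != 0 by rewrite gt_eqF // cyl_gt0.
have -> : (h1 x * partial a h2 x - h2 x * partial a h1 x) / cyl x / cyl x =
   (h1 x * partial a h2 x - h2 x * partial a h1 x) / (h1 x ^+ 2 + h2 x ^+ 2).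
  by rewrite -r2 expr2 invfM mulrA.
have s0 : h1 x ^+ 2 + h2 x ^+ 2 != 0 by rewrite -r2 expf_neq0.
move: (partial a h1 x) (partial a h2 x) k0 s0 => a1 a2; move: (h1 x) (h2 x) => k1 k2 k0 s0.
by field; rewrite k0 s0.
Qed.

Definition colatitude y := pi / 2 - atan (h3 y / cyl y).

Lemma smooth_colatitude : smooth_on U colatitude.
Proof.
have [s1 s2 s3] := gh_h gh; apply: (smoothB oU (smooth_cst oU _)); apply: smooth_atan; first exact: oU.
apply: (smoothM oU s3); apply: smoothV; [exact: oU|exact: smooth_cyl|].
by move=> x Ux; rewrite gt_eqF // cyl_gt0.
Qed.

Lemma partial_colatitude x a : U x -> partial a colatitude x = W x a / sph x.
Proof.
move=> Ux; have [s1 s2 s3] := gh_h gh.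
have c0 y : U y -> cyl y != 0 by move=> Uy; rewrite gt_eqF // cyl_gt0.
have st : smooth_on U (fun y => h3 y / cyl y).
  by apply: (smoothM oU s3); apply: smoothV; [exact: oU|exact: smooth_cyl|exact: c0].
have dt := @smooth_derivable _ _ _ x a st Ux.
have := partial_mulE a oU Ux st smooth_cyl (p := h3) (fun y Uy => divfK (c0 y Uy) (h3 y)).
have da := derivable_atan dt.
have -> : partial a colatitude x = - ((1 + (h3 x / cyl x) ^+ 2)^-1 * partial a (fun y => h3 y / cyl y) x).
  rewrite /colatitude partialD; [|exact: derivable_cst|exact: derivableN].
  by rewrite partialC add0r partialN // partial_atan.
move=> E; have k0 := c0 x Ux.
have -> : partial a (fun y => h3 y / cyl y) x = (partial a h3 x - h3 x / cyl x * partial a cyl x) / cyl x.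
  by apply: (canRL (mulfK k0)); apply: (canRL (addrK _)); rewrite E.
rewrite partial_cyl // /sphW; have r2 := cyl_sqr Ux; have H2 := sph_sqr Ux; rewrite -r2 in H2.
have H0 : sph x != 0 by rewrite gt_eqF // sph_gt0.
move: (partial a h1 x) (partial a h2 x) (partial a h3 x) k0 H0 H2 => a1 a2 a3 {r2 E dt da st}.
move: (h1 x) (h2 x) (h3 x) (cyl x) (sph x) => k1 k2 k3 r s r0 s0 H2.
have w2 : r ^+ 2 + k3 ^+ 2 != 0 by rewrite -H2 expf_neq0.
have -> : (k3 * (k1 * a1 + k2 * a2) - r ^+ 2 * a3) / (r * s) / s =
  (k3 * (k1 * a1 + k2 * a2) - r ^+ 2 * a3) / (r * (r ^+ 2 + k3 ^+ 2)) by rewrite -H2; field; rewrite s0.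
by field; rewrite r0 w2.
Qed.

Lemma colatitudeE x : U x -> [/\ cos (colatitude x) = cosc x,
  sin (colatitude x) ^+ 2 = cyl x ^+ 2 / sph x ^+ 2 & 0 < colatitude x < pi].
Proof.
move=> Ux; have r0 := cyl_gt0 Ux; have s0 := sph_gt0 Ux.
have r2 := cyl_sqr Ux; have H2 := sph_sqr Ux; rewrite -r2 in H2.
have [||| -> -> ->] := @cos_colatitude R (h3 x / cyl x) (sph x / cyl x) (cosc x).
- by rewrite divr_gt0.
- by rewrite !expr_div_n H2; field; rewrite gt_eqF.
- by rewrite /cosc; field; rewrite !gt_eqF.
- by split => //; rewrite expr_div_n; field; rewrite !gt_eqF.
Qed.

End Spherical.

Lemma taub_alg (R : realFieldType) (N0 m e al s N ba bc pa pc qa qc wa wc r H n rho : R) :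
  N0 != 0 -> m != 0 -> e ^+ 2 = 1 -> al ^+ 2 * (e * N0) = 1 -> s != 0 -> N != 0 -> r != 0 ->
  N = N0 - 2 * m / s -> H = N * s -> n = al * m / N0 -> rho = al * s - n ->
  4 * n ^+ 2 * ((rho - n) / (rho + n)) *
      ((- (N0 ^+ 2 / (2 * m)) * (ba / N)) * (- (N0 ^+ 2 / (2 * m)) * (bc / N)))
    + (rho + n) / (rho - n) * ((al * (pa / N0)) * (al * (pc / N0)))
    + (rho ^+ 2 - n ^+ 2) * (wa / H * (wc / H) + r ^+ 2 / H ^+ 2 * (qa / r * (qc / r)))
  = e * ((ba * bc + (pa * pc + qa * qc + wa * wc) / N0 ^+ 2) / N).
Proof.
move=> N00 m0 e2 ale s0 n0 r0 NE HE nE rE.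
have al0 : al != 0 by apply: contra_eq_neq ale => ->; rewrite expr0n mul0r eq_sym oner_eq0.
have rp : rho + n = al * s by rewrite rE subrK.
have rm : rho - n = al * s * N / N0 by rewrite rE nE NE; field; rewrite s0 N00.
have r2 : rho ^+ 2 - n ^+ 2 = al ^+ 2 * (s ^+ 2 * N / N0) by rewrite subr_sqr rp rm; field.
have q1 : (rho - n) / (rho + n) = N / N0 by rewrite rp rm; field; rewrite N00 al0 s0.
have q2 : (rho + n) / (rho - n) = N0 / N by rewrite rp rm; field; rewrite N00 al0 s0 n0.
have a2 : al ^+ 2 = e / N0.
  apply: (mulIf N00); rewrite divfK //.
  by rewrite -[LHS]mulr1 -e2 expr2 mulrA -[in LHS](mulrA (al ^+ 2)) (mulrC N0) ale mul1r.
rewrite q1 q2 r2 nE HE.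
have -> : 4 * (al * m / N0) ^+ 2 * (N / N0) * (- (N0 ^+ 2 / (2 * m)) * (ba / N) * (- (N0 ^+ 2 / (2 * m)) * (bc / N)))
  = al ^+ 2 * (N0 * (ba * bc) / N) by field; rewrite m0 n0 N00.
have -> : N0 / N * (al * (pa / N0) * (al * (pc / N0))) = al ^+ 2 * (pa * pc / (N * N0)) by field; rewrite n0 N00.
have -> : al ^+ 2 * (s ^+ 2 * N / N0) * (wa / (N * s) * (wc / (N * s)) + r ^+ 2 / (N * s) ^+ 2 * (qa / r * (qc / r)))
  = al ^+ 2 * ((wa * wc + qa * qc) / (N * N0)) by field; rewrite n0 N00 s0 r0.
by rewrite a2; field; rewrite n0 N00.
Qed.

Section TaubForm.
Variables (R : realType) (U : set 'rV[R]_4) (g : 'rV[R]_4 -> 'M[R]_4).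
Variables (f1 f2 f3 h1 h2 h3 S N : 'rV[R]_4 -> R) (b : 'I_4 -> 'rV[R]_4 -> R) (N0 m : R).
Hypothesis gh : gh_system U g f1 f2 f3 h1 h2 h3 S N b N0 m.
Hypothesis h1_neq0 : forall x, U x -> h1 x != 0.
Hypothesis N0_neq0 : N0 != 0.
Hypothesis m_neq0 : m != 0.
Variable x0 : 'rV[R]_4.
Hypothesis Ux0 : U x0.
Let oU := gh_open gh.

Notation s := (sS S).
Notation r := (cyl h1 h2).
Notation H := (sph S N).
Notation P x a := (sphP (h1 x) (h2 x) (h3 x) (H x) (partial a h1 x) (partial a h2 x) (partial a h3 x)).
Notation Q x a := (sphQ (h1 x) (h2 x) (r x) (partial a h1 x) (partial a h2 x)).
Notation W x a := (sphW (h1 x) (h2 x) (h3 x) (r x) (H x) (partial a h1 x) (partial a h2 x) (partial a h3 x)).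
Notation C := (cosc h3 S N).
Notation az := (azimuth h1 h2).
Notation col := (colatitude h1 h2 h3).

Lemma partial_fE x a : U x -> [/\ partial a f1 x = - partial a h1 x / N0,
  partial a f2 x = - partial a h2 x / N0 & partial a f3 x = - partial a h3 x / N0].
Proof.
by move=> Ux; have [-> -> ->] := gh_dh gh a Ux; split; field.
Qed.

Lemma partial_sS x a : U x -> partial a s x = P x a / N0.
Proof.
move=> Ux; have s0 := sS_gt0 gh Ux; have n0 := gh_N0 gh Ux.
have E := partial_sqrE a oU Ux (smooth_sS gh) (fun y Uy => sS_sqr gh Uy).
have := gh_dS gh a Ux; have [-> -> ->] := partial_fE a Ux; rewrite E /sphP /sph.
move: (partial a s x) (partial a h1 x) (partial a h2 x) (partial a h3 x) s0 n0.
move: (h1 x) (h2 x) (h3 x) (s x) (N x) => k1 k2 k3 t n ds a1 a2 a3 t0 n0 e.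
have c0 : 2 * (n * t) != 0 by rewrite !mulf_neq0 ?gt_eqF // pnatr_eq0.
apply: (mulfI c0); have -> : 2 * (n * t) * ds = n * (2 * t * ds) by ring.
by rewrite e; field; rewrite N0_neq0 !gt_eqF.
Qed.

Definition gh_alpha a y := - (N0 ^+ 2 / (2 * m)) * (b a y / N y) - C y * partial a az y.

Let sNV : smooth_on U (fun y => (N y)^-1).
Proof. by apply: smoothV; [exact: oU|exact: smooth_N gh|move=> x Ux; rewrite gt_eqF // (gh_N0 gh)]. Qed.

Lemma smooth_alpha a : smooth_on U (gh_alpha a).
Proof.
apply: smoothB => //; first by apply: smoothM => //; [exact: smooth_cst|apply: smoothM => //; exact: gh_b gh a].
apply: smoothM => //; first exact: smooth_cosc gh.
exact: smooth_partial (smooth_azimuth gh h1_neq0).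
Qed.

Lemma alpha_closed a c x : U x -> partial a (gh_alpha c) x = partial c (gh_alpha a) x.
Proof.
move=> Ux; have sC := smooth_cosc gh; have saz := smooth_azimuth gh h1_neq0.
have se j : smooth_on U (fun y => b j y / N y) by apply: smoothM => //; exact: gh_b gh j.
have E i j : partial i (gh_alpha j) x = - (N0 ^+ 2 / (2 * m)) * partial i (fun y => b j y / N y) x
    - (partial i C x * partial j az x + C x * partial i (partial j az) x).
  have d1 := @smooth_derivable _ _ _ x i (se j) Ux.
  have d2 := @smooth_derivable _ _ _ x i sC Ux.
  have d3 := @smooth_derivable _ _ _ x i (smooth_partial j saz) Ux.
  have d4 : derivable (fun y => - (N0 ^+ 2 / (2 * m)) * (b j y / N y)) x (delta_mx 0 i).
    exact: (@smooth_derivable _ _ _ x i (smoothM oU (smooth_cst oU _) (se j)) Ux).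
  have d5 : derivable (fun y => C y * partial j az y) x (delta_mx 0 i).
    exact: (@smooth_derivable _ _ _ x i (smoothM oU sC (smooth_partial j saz)) Ux).
  rewrite /gh_alpha partialD; [|exact: d4|exact: derivableN].
  congr (_ + _); last by rewrite (partialN d5); congr (- _); exact: (partialM d2 d3).
  have dc : derivable (fun=> - (N0 ^+ 2 / (2 * m))) x (delta_mx 0 i) by exact: derivable_cst.
  by apply: (etrans (partialM dc d1)); rewrite partialC mul0r add0r.
rewrite !E (schwarz a c oU saz Ux) !(partial_azimuth gh h1_neq0 _ Ux) !(partial_cosc gh h1_neq0 _ Ux).
have := gh_eta gh a c Ux; have [-> -> ->] := partial_fE a Ux; have [-> -> ->] := partial_fE c Ux.
have H0 : H x != 0 by rewrite gt_eqF // (sph_gt0 gh).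
have r0 : r x != 0 by rewrite gt_eqF // (cyl_gt0 h2 h1_neq0 Ux).
have V := sph_vol (h3 x) r0 H0 (cyl_sqr h2 h1_neq0 Ux) (partial a h1 x) (partial a h2 x) (partial a h3 x) (partial c h1 x) (partial c h2 x) (partial c h3 x).
have s0 : s x != 0 by rewrite gt_eqF // (sS_gt0 gh).
have n0 : N x != 0 by rewrite gt_eqF // (gh_N0 gh).
have -> : Num.sqrt (S x) = s x by []. 
rewrite -(sS_sqr gh Ux).
have HE : H x = N x * s x by [].
move: V HE H0 r0 s0 n0; move: (W x a) (W x c) (Q x a) (Q x c) => wa wc qa qc.
move: (H x) (r x) (s x) (N x) (C x) => hh rr ss nn cc.
move: (partial a h1 x) (partial a h2 x) (partial a h3 x) (partial c h1 x) (partial c h2 x) (partial c h3 x) => a1 a2 a3 c1 c2 c3.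
move: (partial c (partial a az) x) (partial a (fun y => b c y / N y) x) (partial c (fun y => b a y / N y) x) => z u v.
move: (h1 x) (h2 x) (h3 x) => k1 k2 k3 V HE H0 r0 s0 n0 e.
apply/eqP; rewrite -subr_eq0; apply/eqP.
have -> : - (N0 ^+ 2 / (2 * m)) * u - (- (rr / hh ^+ 2) * wa * (qc / rr) + cc * z) -
  (- (N0 ^+ 2 / (2 * m)) * v - (- (rr / hh ^+ 2) * wc * (qa / rr) + cc * z)) =
  - (N0 ^+ 2 / (2 * m)) * (u - v) + (hh * (wa * qc - wc * qa)) / hh ^+ 3.
  by field; rewrite r0 m_neq0 H0.
by rewrite e V HE; field; rewrite m_neq0 s0 n0 N0_neq0.
Qed.

Lemma taub_form (e al n : R) : e ^+ 2 = 1 -> al ^+ 2 * (e * N0) = 1 -> n = al * m / N0 ->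
  exists V F, [/\ open V, V x0, V `<=` U, smooth_map_on V F &
    forall x, V x -> [/\ co 1 (F x) = al * s x - n, 0 < co 2 (F x) < pi &
      forall a c, pullback F (taub_nut n) x a c = e * g x a c]].
Proof.
move=> e2 ale nE.
have [d [tau [d0 BU stau tauE]]] := poincare oU Ux0 smooth_alpha alpha_closed.
pose rho y := al * s y - n.
have sub f : smooth_on U f -> smooth_on (ball x0 d) f by exact: smooth_sub.
have oB : open (ball x0 d) by exact: ball_open.
have srho : smooth_on (ball x0 d) rho.
  apply: (smoothB oB (smoothM oB (smooth_cst oB al) (sub _ (smooth_sS gh))) (smooth_cst oB n)).
exists (ball x0 d), (map4 tau rho col az); split => //; first exact: ballxx.
  have sc := sub _ (smooth_colatitude gh h1_neq0); have sa := sub _ (smooth_azimuth gh h1_neq0).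
  rewrite /smooth_map_on => i; have [k kE] : exists k, k = nat_of_ord i by exists i.
  move: (ltn_ord i); rewrite -kE; case: k kE => [|[|[|[|//]]]] kE _.
  - by apply: (smooth_ext oB _ stau) => y _; rewrite mxE -kE.
  - by apply: (smooth_ext oB _ srho) => y _; rewrite mxE -kE.
  - by apply: (smooth_ext oB _ sc) => y _; rewrite mxE -kE.
  - by apply: (smooth_ext oB _ sa) => y _; rewrite mxE -kE.
move=> x Bx; have Ux := BU _ Bx; have [c0 c1 c2 c3] := co_map4 tau rho col az x.
have [cE sE cp] := colatitudeE gh h1_neq0 Ux.
split; rewrite ?c1 ?c2 // => a c; rewrite pullback_taub c1 c2 cE sE.
have pE i : [/\ partial i (fun y => co 0 (map4 tau rho col az y)) x = gh_alpha i x,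
    partial i (fun y => co 1 (map4 tau rho col az y)) x = al * (P x i / N0),
    partial i (fun y => co 2 (map4 tau rho col az y)) x = W x i / H x &
    partial i (fun y => co 3 (map4 tau rho col az y)) x = Q x i / r x].
  split.
  - rewrite -tauE //; congr (partial i _ x); apply/funext => y; by have [] := co_map4 tau rho col az y.
  - have -> : (fun y => co 1 (map4 tau rho col az y)) = rho.
      by apply/funext => y; have [] := co_map4 tau rho col az y.
    have ds := @smooth_derivable _ _ _ x i (smooth_sS gh) Ux.
    have ds2 := @smooth_derivable _ _ _ x i (smoothM oU (smooth_cst oU al) (smooth_sS gh)) Ux.
    rewrite /rho partialD; [|exact: ds2|exact: derivable_cst].
    rewrite partialC addr0 partialM; [|exact: derivable_cst|exact: ds].
    by rewrite partialC mul0r add0r partial_sS.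
  - rewrite -(partial_colatitude gh h1_neq0) //; congr (partial i _ x); apply/funext => y; by have [] := co_map4 tau rho col az y.
  - rewrite -(partial_azimuth gh h1_neq0) //; congr (partial i _ x); apply/funext => y; by have [] := co_map4 tau rho col az y.
have [-> -> -> ->] := pE a; have [-> -> -> ->] := pE c.
rewrite /gh_alpha !(partial_azimuth gh h1_neq0 _ Ux).
rewrite (subrK (C x * (Q x a / r x)) (- (N0 ^+ 2 / (2 * m)) * (b a x / N x))).
rewrite (subrK (C x * (Q x c / r x)) (- (N0 ^+ 2 / (2 * m)) * (b c x / N x))).
have s0 : s x != 0 by rewrite gt_eqF // (sS_gt0 gh).
have n0 : N x != 0 by rewrite gt_eqF // (gh_N0 gh).
have r0 : r x != 0 by rewrite gt_eqF // (cyl_gt0 h2 h1_neq0 Ux).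
have H0 : H x != 0 by rewrite gt_eqF // (sph_gt0 gh).
rewrite (@taub_alg R N0 m e al (s x) (N x) (b a x) (b c x) (P x a) (P x c) (Q x a) (Q x c) (W x a) (W x c)
  (r x) (H x) n (rho x) N0_neq0 m_neq0 e2 ale s0 n0 r0 (gh_N gh Ux) erefl nE erefl).
congr (_ * _); have E := gh_g gh a c Ux.
rewrite -(sph_gram r0 H0 (cyl_sqr h2 h1_neq0 Ux) (sph_sqr gh Ux)).
apply: (mulfI n0); rewrite E; have [-> -> ->] := partial_fE a Ux; have [-> -> ->] := partial_fE c Ux.
move: (partial a h1 x) (partial a h2 x) (partial a h3 x) (partial c h1 x) (partial c h2 x) (partial c h3 x) => *.
by field; rewrite n0 N0_neq0.
Qed.

End TaubForm.

Lemma linear_alg (R : realFieldType) (m n ba bc pa pc qa qc wa wc lam : R) :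
  lam != 0 -> n != 0 -> m != 0 -> lam ^+ 3 = - 2 * m ->
  (- 2 * m / (n * lam))^-1 * ((lam * (ba / n)) * (lam * (bc / n)))
    + (- 2 * m / (n * lam)) * (- pa / lam * (- pc / lam) + qa / lam * (qc / lam) + wa / lam * (wc / lam))
  = (ba * bc + (pa * pc + qa * qc + wa * wc)) / n.
Proof.
move=> l0 n0 m0 <-.
by field; rewrite n0 l0.
Qed.

Section LinearForm.
Variables (R : realType) (U : set 'rV[R]_4) (g : 'rV[R]_4 -> 'M[R]_4).
Variables (f1 f2 f3 h1 h2 h3 S N : 'rV[R]_4 -> R) (b : 'I_4 -> 'rV[R]_4 -> R) (m : R).
Variables (k1 k2 k3 : R).
Hypothesis gh : gh_system U g f1 f2 f3 h1 h2 h3 S N b 0 m.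
Hypothesis hE : forall x, U x -> [/\ h1 x = k1, h2 x = k2 & h3 x = k3].
Hypothesis k1_neq0 : k1 != 0.
Hypothesis m_neq0 : m != 0.
Variable x0 : 'rV[R]_4.
Hypothesis Ux0 : U x0.
Let oU := gh_open gh.

Let H := - 2 * m.
Let r := Num.sqrt (k1 ^+ 2 + k2 ^+ 2).
Notation s := (sS S).

Lemma lin_N x : U x -> N x * s x = H.
Proof.
move=> Ux; rewrite (gh_N gh Ux) sub0r mulNr divfK /H ?mulNr //.
by rewrite gt_eqF // (sS_gt0 gh Ux).
Qed.

Lemma lin_H : 0 < H.
Proof. by rewrite -(lin_N Ux0) mulr_gt0 ?(gh_N0 gh) // (sS_gt0 gh). Qed.

Lemma lin_sqr : H ^+ 2 = k1 ^+ 2 + k2 ^+ 2 + k3 ^+ 2.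
Proof. by have := sph_sqr gh Ux0; have [-> -> ->] := hE Ux0; rewrite /sph lin_N. Qed.

Lemma lin_cyl : 0 < r /\ r ^+ 2 = k1 ^+ 2 + k2 ^+ 2.
Proof.
have p : 0 < k1 ^+ 2 + k2 ^+ 2 by rewrite ltr_wpDr ?sqr_ge0 // lt_def sqrf_eq0 k1_neq0 // sqr_ge0.
by rewrite /r sqrtr_gt0 sqr_sqrtr // ltW.
Qed.

Notation P a1 a2 a3 := (sphP k1 k2 k3 H a1 a2 a3).
Notation Q a1 a2 := (sphQ k1 k2 r a1 a2).
Notation W a1 a2 a3 := (sphW k1 k2 k3 r H a1 a2 a3).

Lemma lin_partial_s x a : U x -> partial a s x = - P (partial a f1 x) (partial a f2 x) (partial a f3 x).
Proof.
move=> Ux; have s0 := sS_gt0 gh Ux; have n0 := gh_N0 gh Ux; have H0 := lin_H.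
have E := partial_sqrE a oU Ux (smooth_sS gh) (fun y Uy => sS_sqr gh Uy).
have := gh_dS gh a Ux; have [-> -> ->] := hE Ux; rewrite E /sphP -(lin_N Ux).
move: (partial a s x) (partial a f1 x) (partial a f2 x) (partial a f3 x) s0 n0.
move: (s x) (N x) => t n ds a1 a2 a3 t0 n0 e.
have c0 : 2 * (n * t) != 0 by rewrite !mulf_neq0 ?gt_eqF // pnatr_eq0.
apply: (mulfI c0); have -> : 2 * (n * t) * ds = n * (2 * t * ds) by ring.
by rewrite e; field; rewrite !gt_eqF.
Qed.

Variable lam : R.
Hypothesis lam_gt0 : 0 < lam.
Hypothesis lamE : lam ^+ 3 = H.

Definition comb3 (c1 c2 c3 : R) y := c1 * f1 y + c2 * f2 y + c3 * f3 y.

Lemma smooth_comb3 c1 c2 c3 : smooth_on U (comb3 c1 c2 c3).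
Proof.
have [q1 q2 q3] := gh_f gh; have M c f : smooth_on U f -> smooth_on U (fun y => c * f y).
  by move=> sf; apply: smoothM => //; exact: smooth_cst.
by apply: smoothD => //; [apply: smoothD => //|]; exact: M.
Qed.

Lemma partial_comb3 c1 c2 c3 x a : U x ->
  partial a (comb3 c1 c2 c3) x = c1 * partial a f1 x + c2 * partial a f2 x + c3 * partial a f3 x.
Proof.
move=> Ux; have [q1 q2 q3] := gh_f gh.
have M c f : smooth_on U f -> smooth_on U (fun y => c * f y).
  by move=> sf; apply: smoothM => //; exact: smooth_cst.
have d (k : 'rV[R]_4 -> R) : smooth_on U k -> derivable k x (delta_mx 0 a).
  by move=> sk; exact: (@smooth_derivable _ _ _ x a sk Ux).
have Z c f : smooth_on U f -> partial a (fun y => c * f y) x = c * partial a f x.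
  move=> sf; rewrite partialM; [by rewrite partialC mul0r add0r|exact: derivable_cst|exact: d].
rewrite /comb3 partialD; [|exact: d (smoothD oU (M c1 _ q1) (M c2 _ q2))|exact: d (M c3 _ q3)].
rewrite partialD; [|exact: d (M c1 _ q1)|exact: d (M c2 _ q2)].
by rewrite !Z.
Qed.

Definition X2 := comb3 (- k2 / (r * lam)) (k1 / (r * lam)) 0.
Definition X3 := comb3 (k3 * k1 / (r * H * lam)) (k3 * k2 / (r * H * lam)) (- r / (H * lam)).

Lemma partial_X2 x a : U x -> partial a X2 x = Q (partial a f1 x) (partial a f2 x) / lam.
Proof.
move=> Ux; rewrite partial_comb3 // /sphQ; have [r0 _] := lin_cyl.
move: (partial a f1 x) (partial a f2 x) (partial a f3 x) => *.
by field; rewrite !gt_eqF.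
Qed.

Lemma partial_X3 x a : U x -> partial a X3 x = W (partial a f1 x) (partial a f2 x) (partial a f3 x) / lam.
Proof.
move=> Ux; rewrite partial_comb3 // /sphW; have [r0 _] := lin_cyl; have H0 := lin_H.
move: (partial a f1 x) (partial a f2 x) (partial a f3 x) => *.
by field; rewrite !gt_eqF.
Qed.

Definition lin_alpha a y := lam * (b a y / N y) - X2 y * partial a X3 y.

Lemma smooth_lin_alpha a : smooth_on U (lin_alpha a).
Proof.
have nV : smooth_on U (fun y => (N y)^-1).
  by apply: smoothV; [exact: oU|exact: smooth_N gh|move=> x Ux; rewrite gt_eqF // (gh_N0 gh)].
apply: smoothB => //; first by apply: smoothM => //; [exact: smooth_cst|apply: smoothM => //; exact: gh_b gh a].
apply: smoothM => //; first exact: smooth_comb3.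
exact: smooth_partial (smooth_comb3 _ _ _).
Qed.

Lemma lin_alpha_closed a c x : U x -> partial a (lin_alpha c) x = partial c (lin_alpha a) x.
Proof.
move=> Ux; have s2 : smooth_on U X2 := smooth_comb3 _ _ _; have s3 : smooth_on U X3 := smooth_comb3 _ _ _.
have nV : smooth_on U (fun y => (N y)^-1).
  by apply: smoothV; [exact: oU|exact: smooth_N gh|move=> y Uy; rewrite gt_eqF // (gh_N0 gh)].
have se j : smooth_on U (fun y => b j y / N y) by apply: smoothM => //; exact: gh_b gh j.
have E i j : partial i (lin_alpha j) x = lam * partial i (fun y => b j y / N y) x
    - (partial i X2 x * partial j X3 x + X2 x * partial i (partial j X3) x).
  have d1 := @smooth_derivable _ _ _ x i (se j) Ux.
  have d2 := @smooth_derivable _ _ _ x i s2 Ux.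
  have d3 := @smooth_derivable _ _ _ x i (smooth_partial j s3) Ux.
  have d4 : derivable (fun y => lam * (b j y / N y)) x (delta_mx 0 i).
    exact: (@smooth_derivable _ _ _ x i (smoothM oU (smooth_cst oU _) (se j)) Ux).
  have d5 : derivable (fun y => X2 y * partial j X3 y) x (delta_mx 0 i).
    exact: (@smooth_derivable _ _ _ x i (smoothM oU s2 (smooth_partial j s3)) Ux).
  rewrite /lin_alpha partialD; [|exact: d4|exact: derivableN].
  congr (_ + _); last by rewrite (partialN d5); congr (- _); exact: (partialM d2 d3).
  have dc : derivable (fun=> lam) x (delta_mx 0 i) by exact: derivable_cst.
  by apply: (etrans (partialM dc d1)); rewrite partialC mul0r add0r.
rewrite !E (schwarz a c oU s3 Ux) (partial_X2 a Ux) (partial_X2 c Ux) (partial_X3 a Ux) (partial_X3 c Ux).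
have := gh_eta gh a c Ux; have [-> -> ->] := hE Ux.
have H0 : H != 0 by rewrite gt_eqF // lin_H.
have [rp r2] := lin_cyl; have r0 : r != 0 by rewrite gt_eqF.
have V := sph_vol k3 r0 H0 r2 (partial a f1 x) (partial a f2 x) (partial a f3 x) (partial c f1 x) (partial c f2 x) (partial c f3 x).
have s0 : s x != 0 by rewrite gt_eqF // (sS_gt0 gh).
have n0 : N x != 0 by rewrite gt_eqF // (gh_N0 gh).
have -> : Num.sqrt (S x) = s x by [].
rewrite -(sS_sqr gh Ux) -V => e.
have nE : N x = H / s x by rewrite -(lin_N Ux) mulfK.
have mE : 2 * (m / s x) / (s x ^+ 2 * N x ^+ 3) = - (H ^+ 2)^-1.
  by rewrite nE /H; field; rewrite ?m_neq0 ?s0.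
rewrite mE in e; apply/eqP; rewrite -subr_eq0; apply/eqP; move: e.
move: (W _ _ _) (W (partial c f1 x) _ _) (Q _ _) (Q (partial c f1 x) _) => wa wc qa qc.
move: (partial c (partial a X3) x) (X2 x) => z z2.
set u := partial a (fun y => b c y / N y) x; set v := partial c (fun y => b a y / N y) x => e.
have l0 : lam != 0 by rewrite gt_eqF.
have -> : lam * u - (qa / lam * (wc / lam) + z2 * z) - (lam * v - (qc / lam * (wa / lam) + z2 * z)) =
  lam * (u - v) - (qa * wc - qc * wa) / lam ^+ 2 by field.
by rewrite e -lamE; field.
Qed.

Lemma linear_form : local_form U g (@linear_gh_dom R) (@linear_gh R) x0.
Proof.
have [d [tau [d0 BU stau tauE]]] := poincare oU Ux0 smooth_lin_alpha lin_alpha_closed.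
have l0 : lam != 0 by rewrite gt_eqF.
pose rho y := lam^-1 * s y.
have sub f : smooth_on U f -> smooth_on (ball x0 d) f by exact: smooth_sub.
have oB : open (ball x0 d) by exact: ball_open.
have srho : smooth_on (ball x0 d) rho.
  exact: (smoothM oB (smooth_cst oB _) (sub _ (smooth_sS gh))).
exists (ball x0 d), (map4 tau rho X2 X3); split => //; first exact: ballxx.
  have sc := sub _ (smooth_comb3 (- k2 / (r * lam)) (k1 / (r * lam)) 0).
  have sa := sub _ (smooth_comb3 (k3 * k1 / (r * H * lam)) (k3 * k2 / (r * H * lam)) (- r / (H * lam))).
  rewrite /smooth_map_on => i; have [k kE] : exists k, k = nat_of_ord i by exists i.
  move: (ltn_ord i); rewrite -kE; case: k kE => [|[|[|[|//]]]] kE _.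
  - by apply: (smooth_ext oB _ stau) => y _; rewrite mxE -kE.
  - by apply: (smooth_ext oB _ srho) => y _; rewrite mxE -kE.
  - by apply: (smooth_ext oB _ sc) => y _; rewrite mxE -kE.
  - by apply: (smooth_ext oB _ sa) => y _; rewrite mxE -kE.
move=> x Bx; have Ux := BU _ Bx; have [c0 c1 c2 c3] := co_map4 tau rho X2 X3 x.
have s0 := sS_gt0 gh Ux; have n0 : N x != 0 by rewrite gt_eqF // (gh_N0 gh).
split; first by rewrite /linear_gh_dom /= c1 mulr_gt0 // invr_gt0.
apply/matrixP => a c; rewrite pullback_gh c1 c2.
have pE i : [/\ partial i (fun y => co 0 (map4 tau rho X2 X3 y)) x = lin_alpha i x,
    partial i (fun y => co 1 (map4 tau rho X2 X3 y)) x = - P (partial i f1 x) (partial i f2 x) (partial i f3 x) / lam,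
    partial i (fun y => co 2 (map4 tau rho X2 X3 y)) x = Q (partial i f1 x) (partial i f2 x) / lam &
    partial i (fun y => co 3 (map4 tau rho X2 X3 y)) x = W (partial i f1 x) (partial i f2 x) (partial i f3 x) / lam].
  split.
  - rewrite -tauE //; congr (partial i _ x); apply/funext => y; by have [] := co_map4 tau rho X2 X3 y.
  - have -> : (fun y => co 1 (map4 tau rho X2 X3 y)) = rho.
      by apply/funext => y; have [] := co_map4 tau rho X2 X3 y.
    have ds := @smooth_derivable _ _ _ x i (smooth_sS gh) Ux.
    rewrite /rho partialM; [|exact: derivable_cst|exact: ds].
    by rewrite partialC mul0r add0r lin_partial_s // mulrC.
  - rewrite -partial_X2 //; congr (partial i _ x); apply/funext => y; by have [] := co_map4 tau rho X2 X3 y.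
  - rewrite -partial_X3 //; congr (partial i _ x); apply/funext => y; by have [] := co_map4 tau rho X2 X3 y.
have [-> -> -> ->] := pE a; have [-> -> -> ->] := pE c.
rewrite /lin_alpha (partial_X3 a Ux) (partial_X3 c Ux). rewrite !subrK.
have H0 : H != 0 by rewrite gt_eqF // lin_H.
have [rp r2] := lin_cyl; have r0 : r != 0 by rewrite gt_eqF.
have -> : rho x = - 2 * m / (N x * lam).
  by rewrite /rho -/H -(lin_N Ux); field; rewrite n0 l0.
rewrite (linear_alg _ _ _ _ _ _ _ _ l0 n0 m_neq0 lamE) -(sph_gram r0 H0 r2 lin_sqr).
apply: (mulfI n0); rewrite (gh_g gh a c Ux).
by rewrite [RHS]mulrC divfK // !addrA.
Qed.

End LinearForm.

Lemma local_form_sub (R : realType) (U V : set 'rV[R]_4) g W h x0 :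
  V `<=` U -> local_form V g W h x0 -> local_form U g W h x0.
Proof. by move=> VU [V' [F [oV' Vx V'V sF H]]]; exists V', F; split => //; exact: subset_trans VU. Qed.

Definition gh_charge (R : realType) (N0 m : R) := m / (Num.sqrt `|N0| * N0).

Definition gh_model (R : realType) (N0 m : R) (U : set 'rV[R]_4) g x0 :=
  [/\ 0 < N0 -> local_form U g (taub_nut_dom (gh_charge N0 m)) (taub_nut (gh_charge N0 m)) x0,
      N0 < 0 -> local_form U g (taub_nut_inner_dom (gh_charge N0 m)) (fun x => - taub_nut (gh_charge N0 m) x) x0 &
      N0 = 0 -> local_form U g (@linear_gh_dom R) (@linear_gh R) x0].

Lemma gh_model_sub (R : realType) (N0 m : R) (U V : set 'rV[R]_4) g x0 : V `<=` U ->
  gh_model N0 m V g x0 -> gh_model N0 m U g x0.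
Proof. by move=> VU [p1 p2 p3]; split => q; apply: (local_form_sub VU); [exact: p1|exact: p2|exact: p3]. Qed.

Lemma cube_root (R : realType) (H : R) : 0 < H -> exists2 l : R, 0 < l & l ^+ 3 = H.
Proof.
move=> H0; exists (expR (ln H / 3)); first exact: expR_gt0.
by rewrite -expRM_natr -mulrA mulVf ?mulr1 ?lnK // pnatr_eq0.
Qed.

Lemma gh_local_form1 (R : realType) (U : set 'rV[R]_4) g f1 f2 f3 h1 h2 h3 S N b (N0 m : R) x0 :
  gh_system U g f1 f2 f3 h1 h2 h3 S N b N0 m -> m != 0 -> U x0 -> h1 x0 != 0 -> gh_model N0 m U g x0.
Proof.
move=> gh m0 Ux0 hx0; have oU := gh_open gh; have [sh1 sh2 sh3] := gh_h gh.
have : \forall y \near x0, U y /\ h1 y != 0.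
  apply: filterI; first exact: (open_near oU Ux0).
  exact: (cvgr_neq0 _ (smooth_continuous sh1 Ux0) hx0).
move=> /nbhs_ballP[d d0 HB].
have VU : ball x0 d `<=` U by move=> y /HB[].
apply: (gh_model_sub VU); have Bx := ballxx x0 d0.
have {}gh := gh_sub (ball_open x0 d) VU gh.
have hne y : ball x0 d y -> h1 y != 0 by move=> /HB[].
have ex_al e : e ^+ 2 = 1 -> `|N0| = e * N0 -> N0 != 0 -> exists al, [/\ 0 < al, al ^+ 2 * (e * N0) = 1 & gh_charge N0 m = al * m / N0].
  move=> e2 eN NN; have p : 0 < `|N0| by rewrite normr_gt0.
  have sp : 0 < Num.sqrt `|N0| by rewrite sqrtr_gt0.
  exists (Num.sqrt `|N0|)^-1; split; first by rewrite invr_gt0.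
    by rewrite exprVn sqr_sqrtr ?normr_ge0 // -eN mulVf // gt_eqF.
  by rewrite /gh_charge; field; rewrite NN gt_eqF.
have mono x : ball x0 d x -> [/\ 0 < sS S x, 0 < N x & N x = N0 - 2 * m / sS S x].
  by move=> Bx'; split; [exact: (sS_gt0 gh Bx')|exact: (gh_N0 gh Bx')|exact: (gh_N gh Bx')].
split.
- move=> Np; have N00 : N0 != 0 by rewrite gt_eqF.
  have [al [al0 alE nE]] := ex_al 1 (expr1n _ _) (etrans (gtr0_norm Np) (esym (mul1r _))) N00.
  have [V [F [oV Vx VB sF HF]]] := taub_form gh hne N00 m0 Bx (expr1n _ 2) alE nE.
  exists V, F; split => // x Vx'; have [r1 r2 r3] := HF x Vx'.
  have [s0 n0 NE] := mono x (VB _ Vx').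
  split; last by apply/matrixP => a c; rewrite r3 mul1r.
  split; last by [].
  rewrite r1 ltr_norml nE; apply/andP; split.
    by rewrite opprB ltrBlDr ltrDl mulr_gt0.
  have -> : al * sS S x - al * m / N0 = al * m / N0 + al * sS S x * N x / N0.
    by rewrite NE; field; rewrite N00 gt_eqF.
  by rewrite ltrDl divr_gt0 // !mulr_gt0.
- move=> Nn; have N00 : N0 != 0 by rewrite lt_eqF.
  have e2 : (-1 : R) ^+ 2 = 1 by rewrite sqrrN expr1n.
  have [al [al0 alE nE]] := ex_al (-1) e2 (etrans (ltr0_norm Nn) (esym (mulN1r _))) N00.
  have [V [F [oV Vx VB sF HF]]] := taub_form gh hne N00 m0 Bx e2 alE nE.
  exists V, F; split => // x Vx'; have [r1 r2 r3] := HF x Vx'.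
  have [s0 n0 NE] := mono x (VB _ Vx').
  split; last by apply/matrixP => a c; rewrite pullbackN r3 mulN1r opprK.
  split; last by [].
  rewrite r1 -ltr_sqr ?nnegrE ?normr_ge0 // !real_normK ?num_real // -subr_lt0 subr_sqr subrK nE.
  have -> : al * sS S x - al * m / N0 - al * m / N0 = al * sS S x * N x / N0.
    by rewrite NE; field; rewrite N00 gt_eqF.
  rewrite mulrAC -[ltRHS](mulr0 (al * sS S x * N x * (al * sS S x))).
  by rewrite ltr_pM2l ?invr_lt0 // !mulr_gt0.
- move=> NZ; rewrite NZ in gh.
  have const h : smooth_on (ball x0 d) h -> (forall y a, ball x0 d y -> partial a h y = 0) ->
    forall y, ball x0 d y -> h y = h x0 := fun sh z => constant_on_ball sh z.
  have [q1 q2 q3] := gh_h gh.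
  have hE y : ball x0 d y -> [/\ h1 y = h1 x0, h2 y = h2 x0 & h3 y = h3 x0].
    move=> By; split; apply: const => // z a Bz; have [p1 p2 p3] := gh_dh gh a Bz.
    - by rewrite p1 oppr0 mul0r.
    - by rewrite p2 oppr0 mul0r.
    - by rewrite p3 oppr0 mul0r.
  have [l l0 lE] := cube_root (lin_H gh Bx).
  exact: (linear_form gh hE hx0 m0 Bx l0 lE).
Qed.

Lemma gh_local_form (R : realType) (U : set 'rV[R]_4) g f1 f2 f3 h1 h2 h3 S N b (N0 m : R) x0 :
  gh_system U g f1 f2 f3 h1 h2 h3 S N b N0 m -> m != 0 -> U x0 -> gh_model N0 m U g x0.
Proof.
move=> gh m0 Ux0; have [h10|] := eqVneq (h1 x0) 0; last exact: (gh_local_form1 gh).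
have gh2 := gh_rot gh; have [h20|] := eqVneq (h2 x0) 0; last exact: (gh_local_form1 gh2).
have gh3 := gh_rot gh2; have [h30|] := eqVneq (h3 x0) 0; last exact: (gh_local_form1 gh3).
have := gh_norm gh Ux0; rewrite h10 h20 h30 expr0n /= !addr0 => /esym/eqP.
by rewrite mulf_eq0 sqrf_eq0 (gt_eqF (gh_N0 gh Ux0)) (gt_eqF (gh_S0 gh Ux0)).
Qed.

(** * Quaternionic linear algebra in dimension four *)

Notation o0 := (@Ordinal 4 0 isT).
Notation o1 := (@Ordinal 4 1 isT).
Notation o2 := (@Ordinal 4 2 isT).
Notation o3 := (@Ordinal 4 3 isT).

Lemma all4 (P : 'I_4 -> Prop) : P o0 -> P o1 -> P o2 -> P o3 -> forall i, P i.
Proof.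
move=> p0 p1 p2 p3 [[|[|[|[|//]]]] lt];
  [move: p0|move: p1|move: p2|move: p3]; congr P; exact: val_inj.
Qed.

Lemma sum4 (V : nmodType) (F : 'I_4 -> V) : \sum_i F i = F o0 + F o1 + F o2 + F o3.
Proof.
rewrite !big_ord_recl big_ord0 addr0 !addrA.
by congr (F _ + F _ + F _ + F _); exact: val_inj.
Qed.

Lemma mx4_entries (R : Type) (A B : 'M[R]_4) : A = B ->
  [/\ [/\ A o0 o0 = B o0 o0, A o0 o1 = B o0 o1, A o0 o2 = B o0 o2 & A o0 o3 = B o0 o3],
      [/\ A o1 o0 = B o1 o0, A o1 o1 = B o1 o1, A o1 o2 = B o1 o2 & A o1 o3 = B o1 o3],
      [/\ A o2 o0 = B o2 o0, A o2 o1 = B o2 o1, A o2 o2 = B o2 o2 & A o2 o3 = B o2 o3] &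
      [/\ A o3 o0 = B o3 o0, A o3 o1 = B o3 o1, A o3 o2 = B o3 o2 & A o3 o3 = B o3 o3]].
Proof. by move=> ->. Qed.

Section QuaternionicAlgebra.
Variable R : realFieldType.
Implicit Types (M G : 'M[R]_4) (u v xi : 'rV[R]_4).

Definition M4 (a00 a01 a02 a03 a10 a11 a12 a13 a20 a21 a22 a23 a30 a31 a32 a33 : R) : 'M[R]_4 := \matrix_(i, j) nth 0 (nth [::]
  [:: [:: a00; a01; a02; a03]; [:: a10; a11; a12; a13]; [:: a20; a21; a22; a23]; [:: a30; a31; a32; a33]] i) j.

Lemma M4_eta (M : 'M[R]_4) : M = M4 (M o0 o0) (M o0 o1) (M o0 o2) (M o0 o3) (M o1 o0) (M o1 o1) (M o1 o2) (M o1 o3)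
  (M o2 o0) (M o2 o1) (M o2 o2) (M o2 o3) (M o3 o0) (M o3 o1) (M o3 o2) (M o3 o3).
Proof. by apply/matrixP; apply: all4; apply: all4; rewrite mxE. Qed.

Lemma M4_inj a00 a01 a02 a03 a10 a11 a12 a13 a20 a21 a22 a23 a30 a31 a32 a33 b00 b01 b02 b03 b10 b11 b12 b13 b20 b21 b22 b23 b30 b31 b32 b33 :
  M4 a00 a01 a02 a03 a10 a11 a12 a13 a20 a21 a22 a23 a30 a31 a32 a33 = M4 b00 b01 b02 b03 b10 b11 b12 b13 b20 b21 b22 b23 b30 b31 b32 b33 ->
  [/\ [/\ a00 = b00, a01 = b01, a02 = b02 & a03 = b03],
      [/\ a10 = b10, a11 = b11, a12 = b12 & a13 = b13],
      [/\ a20 = b20, a21 = b21, a22 = b22 & a23 = b23] &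
      [/\ a30 = b30, a31 = b31, a32 = b32 & a33 = b33]].
Proof. by move/mx4_entries; rewrite !mxE. Qed.

Lemma M4D a00 a01 a02 a03 a10 a11 a12 a13 a20 a21 a22 a23 a30 a31 a32 a33 b00 b01 b02 b03 b10 b11 b12 b13 b20 b21 b22 b23 b30 b31 b32 b33 :
  M4 a00 a01 a02 a03 a10 a11 a12 a13 a20 a21 a22 a23 a30 a31 a32 a33 + M4 b00 b01 b02 b03 b10 b11 b12 b13 b20 b21 b22 b23 b30 b31 b32 b33 =
  M4 (a00 + b00) (a01 + b01) (a02 + b02) (a03 + b03) (a10 + b10) (a11 + b11) (a12 + b12) (a13 + b13) (a20 + b20) (a21 + b21) (a22 + b22) (a23 + b23) (a30 + b30) (a31 + b31) (a32 + b32) (a33 + b33).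
Proof. by apply/matrixP; apply: all4; apply: all4; rewrite !mxE. Qed.

Lemma M4Z c a00 a01 a02 a03 a10 a11 a12 a13 a20 a21 a22 a23 a30 a31 a32 a33 : c *: M4 a00 a01 a02 a03 a10 a11 a12 a13 a20 a21 a22 a23 a30 a31 a32 a33 = M4 (c * a00) (c * a01) (c * a02) (c * a03) (c * a10) (c * a11) (c * a12) (c * a13) (c * a20) (c * a21) (c * a22) (c * a23) (c * a30) (c * a31) (c * a32) (c * a33).
Proof. by apply/matrixP; apply: all4; apply: all4; rewrite !mxE. Qed.

Lemma M4N a00 a01 a02 a03 a10 a11 a12 a13 a20 a21 a22 a23 a30 a31 a32 a33 : - M4 a00 a01 a02 a03 a10 a11 a12 a13 a20 a21 a22 a23 a30 a31 a32 a33 = M4 (- a00) (- a01) (- a02) (- a03) (- a10) (- a11) (- a12) (- a13) (- a20) (- a21) (- a22) (- a23) (- a30) (- a31) (- a32) (- a33).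
Proof. by apply/matrixP; apply: all4; apply: all4; rewrite !mxE. Qed.

Lemma M4T a00 a01 a02 a03 a10 a11 a12 a13 a20 a21 a22 a23 a30 a31 a32 a33 : (M4 a00 a01 a02 a03 a10 a11 a12 a13 a20 a21 a22 a23 a30 a31 a32 a33)^T = M4 a00 a10 a20 a30 a01 a11 a21 a31 a02 a12 a22 a32 a03 a13 a23 a33.
Proof. by apply/matrixP; apply: all4; apply: all4; rewrite !mxE. Qed.

Lemma M4_1 : 1%:M = M4 1 0 0 0 0 1 0 0 0 0 1 0 0 0 0 1.
Proof. by apply/matrixP; apply: all4; apply: all4; rewrite !mxE. Qed.

Lemma M4_0 : 0 = M4 0 0 0 0 0 0 0 0 0 0 0 0 0 0 0 0.
Proof. by apply/matrixP; apply: all4; apply: all4; rewrite !mxE. Qed.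

Lemma M4_tr a00 a01 a02 a03 a10 a11 a12 a13 a20 a21 a22 a23 a30 a31 a32 a33 : \tr (M4 a00 a01 a02 a03 a10 a11 a12 a13 a20 a21 a22 a23 a30 a31 a32 a33) = a00 + a11 + a22 + a33.
Proof. by rewrite /mxtrace sum4 !mxE. Qed.

Lemma M4M a00 a01 a02 a03 a10 a11 a12 a13 a20 a21 a22 a23 a30 a31 a32 a33 b00 b01 b02 b03 b10 b11 b12 b13 b20 b21 b22 b23 b30 b31 b32 b33 :
  M4 a00 a01 a02 a03 a10 a11 a12 a13 a20 a21 a22 a23 a30 a31 a32 a33 *m M4 b00 b01 b02 b03 b10 b11 b12 b13 b20 b21 b22 b23 b30 b31 b32 b33 = M4
   (a00 * b00 + a01 * b10 + a02 * b20 + a03 * b30) (a00 * b01 + a01 * b11 + a02 * b21 + a03 * b31) (a00 * b02 + a01 * b12 + a02 * b22 + a03 * b32) (a00 * b03 + a01 * b13 + a02 * b23 + a03 * b33) (a10 * b00 + a11 * b10 + a12 * b20 + a13 * b30) (a10 * b01 + a11 * b11 + a12 * b21 + a13 * b31) (a10 * b02 + a11 * b12 + a12 * b22 + a13 * b32) (a10 * b03 + a11 * b13 + a12 * b23 + a13 * b33) (a20 * b00 + a21 * b10 + a22 * b20 + a23 * b30) (a20 * b01 + a21 * b11 + a22 * b21 + a23 * b31) (a20 * b02 + a21 * b12 + a22 * b22 + a23 * b32) (a20 * b03 + a21 * b13 + a22 * b23 + a23 * b33) (a30 * b00 + a31 * b10 + a32 * b20 + a33 * b30) (a30 * b01 +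 a31 * b11 + a32 * b21 + a33 * b31) (a30 * b02 + a31 * b12 + a32 * b22 + a33 * b32) (a30 * b03 + a31 * b13 + a32 * b23 + a33 * b33).
Proof. by apply/matrixP; apply: all4; apply: all4; rewrite !mxE sum4 !mxE. Qed.

Definition Q1 := M4 0 1 0 0 (-1) 0 0 0 0 0 0 (-1) 0 0 1 0.
Definition Q2 := M4 0 0 1 0 0 0 0 1 (-1) 0 0 0 0 (-1) 0 0.
Definition Q3 := M4 0 0 0 1 0 0 (-1) 0 0 1 0 0 (-1) 0 0 0.

Record quaternionic (G I1 I2 I3 : 'M[R]_4) : Prop := Quaternionic {
  q_sym : G^T = G;
  q_pos : forall v, v != 0 -> 0 < (v *m G *m v^T) 0 0;
  q_12 : I1 *m I2 = I3;
  q_21 : I2 *m I1 = - I3;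
  q_11 : I1 *m I1 = - 1%:M;
  q_22 : I2 *m I2 = - 1%:M;
  q_33 : I3 *m I3 = - 1%:M;
  q_skew1 : (I1 *m G)^T = - (I1 *m G);
  q_skew2 : (I2 *m G)^T = - (I2 *m G);
  q_skew3 : (I3 *m G)^T = - (I3 *m G)
}.

Definition M4E := (M4D, M4Z, M4N, M4T, M4_1, M4M).

Definition simp4 := (@mulr0 R, @mul0r R, @mulr1 R, @mul1r R, @mulrN1 R, @mulN1r R, @oppr0 R, @addr0 R, @add0r R, @opprK R).

Lemma skew4_eta (M : 'M[R]_4) : M^T = - M -> exists a b c d e f,
  M = M4 0 a b c (- a) 0 d e (- b) (- d) 0 f (- c) (- e) (- f) 0.
Proof.
have z (x : R) : x = - x -> x = 0 by move=> H; lra.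
rewrite (M4_eta M); move: (M o0 o0) (M o0 o1) (M o0 o2) (M o0 o3) (M o1 o0) (M o1 o1) (M o1 o2) (M o1 o3)
  (M o2 o0) (M o2 o1) (M o2 o2) (M o2 o3) (M o3 o0) (M o3 o1) (M o3 o2) (M o3 o3).
move=> a00 a01 a02 a03 a10 a11 a12 a13 a20 a21 a22 a23 a30 a31 a32 a33.
rewrite !M4E => /M4_inj[[/z -> -> -> ->] [_ /z -> -> ->] [_ _ /z -> ->] [_ _ _ /z ->]].
by exists a01, a02, a03, a12, a13, a23.
Qed.

Lemma sym4_eta (M : 'M[R]_4) : M^T = M -> exists a b c d e f g h i j,
  M = M4 a b c d b e f g c f h i d g i j.
Proof.
rewrite (M4_eta M); move: (M o0 o0) (M o0 o1) (M o0 o2) (M o0 o3) (M o1 o0) (M o1 o1) (M o1 o2) (M o1 o3)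
  (M o2 o0) (M o2 o1) (M o2 o2) (M o2 o3) (M o3 o0) (M o3 o1) (M o3 o2) (M o3 o3).
move=> a00 a01 a02 a03 a10 a11 a12 a13 a20 a21 a22 a23 a30 a31 a32 a33.
rewrite !M4E => /M4_inj[[_ <- <- <-] [_ _ <- <-] [_ _ _ <-] _].
by exists a00, a10, a20, a30, a11, a21, a31, a22, a32, a33.
Qed.

Lemma std_scalar (M : 'M[R]_4) : M^T = M -> M *m Q1 = Q1 *m M -> M *m Q2 = Q2 *m M ->
  exists c, M = c%:M.
Proof.
move=> /sym4_eta[a [b [c [d [e [f [g [h [i [j ->]]]]]]]]]].
rewrite /Q1 /Q2 !M4E !simp4.
move=> /M4_inj[[e1 e2 e3 e4] _ [_ _ e5 e6] _] /M4_inj[[f1 f2 f3 f4] _ _ _].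
exists a; rewrite -scalemx1 !M4E !simp4.
have b0 : b = 0 by clear -e1; lra.
have c0 : c = 0 by clear -f1; lra.
have d0 : d = 0 by clear -e3 f2; lra.
have f0 : f = 0 by clear -e3 f2; lra.
have g0 : g = 0 by clear -e4 c0; lra.
have i0 : i = 0 by clear -e5; lra.
have ea : e = a by clear -e2; lra.
have ha : h = a by clear -f3; lra.
have ja : j = a by clear -e6 ha; lra.
by rewrite b0 c0 d0 f0 g0 i0 ea ha ja.
Qed.

Lemma std_commute (M : 'M[R]_4) : M^T = - M ->
  \tr (M *m Q1) = 0 -> \tr (M *m Q2) = 0 -> \tr (M *m Q3) = 0 ->
  [/\ M *m Q1 = Q1 *m M, M *m Q2 = Q2 *m M & M *m Q3 = Q3 *m M].
Proof.
move=> /skew4_eta[a [b [c [d [e [f ->]]]]]].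
rewrite /Q1 /Q2 /Q3 !M4E !M4_tr !simp4 => t1 t2 t3.
have -> : f = a by lra.
have -> : e = - b by lra.
have -> : d = c by lra.
by rewrite !simp4.
Qed.

Lemma std_skew_span (M : 'M[R]_4) : M^T = - M -> M *m Q1 + Q1 *m M = 0 ->
  exists b c, M = b *: Q2 + c *: Q3.
Proof.
move=> /skew4_eta[a [b [c [d [e [f ->]]]]]].
rewrite /Q1 /Q2 /Q3 M4_0 !M4E !simp4 => /M4_inj[[h1 h2 h3 h4] [_ _ h5 h6] [_ _ h7 _] _].
exists b, c; rewrite !M4E !simp4.
have a0 : a = 0 by clear -h1; lra.
have e0 : e = b by clear -h4; lra.
have d0 : d = - c by clear -h3; lra.
have f0 : f = 0 by clear -h7; lra.
by rewrite a0 e0 d0 f0 !simp4.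
Qed.

Lemma std_skew_span2 (M : 'M[R]_4) : M^T = - M -> M *m Q2 + Q2 *m M = 0 ->
  exists b c, M = b *: Q1 + c *: Q3.
Proof.
move=> /skew4_eta[a [b [c [d [e [f ->]]]]]].
rewrite /Q1 /Q2 /Q3 M4_0 !M4E !simp4 => /M4_inj[[h1 h2 h3 h4] [_ h5 h6 h7] _ _].
exists a, c; rewrite !M4E !simp4.
have b0 : b = 0 by clear -h1; lra.
have f0 : f = - a by clear -h4; lra.
have d0 : d = - c by clear -h2; lra.
have e0 : e = 0 by clear -h5; lra.
by rewrite b0 e0 d0 f0 !simp4.
Qed.

Lemma std_three_form (T : 'I_4 -> 'M[R]_4) :
  (forall a, (T a)^T = - T a) -> (forall a b c, T a b c = - T b a c) ->
  (forall a, \tr (T a *m Q1) = 0) -> forall a, T a = 0.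
Proof.
move=> sT aT tT.
have A2 a b c : T a b c = - T a c b by have /matrixP/(_ c b) := sT a; rewrite !mxE.
have z (x : R) : x = - x -> x = 0 by move=> H; lra.
have d1 a c : T a a c = 0 by apply: z; exact: aT.
have d2 a b : T a b b = 0 by apply: z; exact: A2.
have d3 a b : T a b a = 0 by rewrite A2 d1 oppr0.
have tr1 a : T a o0 o1 = T a o2 o3.
  have H := tT a; rewrite (M4_eta (T a)) /Q1 M4E M4_tr !simp4 (A2 a o1 o0) (A2 a o3 o2) in H; lra.
have P a b c : T a b c = 0 -> [/\ T a c b = 0, T b a c = 0, T b c a = 0, T c a b = 0 & T c b a = 0].
  move=> H; have H1 : T a c b = 0 by rewrite A2 H oppr0.
  have H2 : T b a c = 0 by rewrite aT H oppr0.
  have H3 : T b c a = 0 by rewrite A2 H2 oppr0.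
  have H4 : T c a b = 0 by rewrite aT H1 oppr0.
  by have H5 : T c b a = 0; [rewrite A2 H4 oppr0|].
have /P[? ? ? ? ?] : T o0 o2 o3 = 0 by rewrite -tr1 d1.
have /P[? ? ? ? ?] : T o1 o2 o3 = 0 by rewrite -tr1 d3.
have /P[? ? ? ? ?] : T o2 o0 o1 = 0 by rewrite tr1 d1.
have /P[? ? ? ? ?] : T o3 o0 o1 = 0 by rewrite tr1 d3.
have h1 : T o0 o2 o3 = 0 by rewrite -tr1 d1.
have h2 : T o1 o2 o3 = 0 by rewrite -tr1 d3.
have h3 : T o2 o0 o1 = 0 by rewrite tr1 d1.
have h4 : T o3 o0 o1 = 0 by rewrite tr1 d3.
by apply: all4; apply/matrixP; apply: all4; apply: all4; rewrite [RHS]mxE ?d1 ?d2 ?d3.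
Qed.

Lemma std_closed_forms (P T S : 'I_4 -> R) :
  (forall a b c, P a * Q2 b c + T a * Q3 b c + (P b * Q2 c a + T b * Q3 c a)
     + (P c * Q2 a b + T c * Q3 a b) = 0) ->
  (forall a b c, - P a * Q1 b c + S a * Q3 b c + (- P b * Q1 c a + S b * Q3 c a)
     + (- P c * Q1 a b + S c * Q3 a b) = 0) ->
  (forall a b c, - T a * Q1 b c - S a * Q2 b c + (- T b * Q1 c a - S b * Q2 c a)
     + (- T c * Q1 a b - S c * Q2 a b) = 0) ->
  [/\ forall a, P a = 0, forall a, T a = 0 & forall a, S a = 0].
Proof.
move=> k1 k2 k3.
have a1 := k1 o0 o1 o2; have a2 := k1 o0 o1 o3; have a3 := k1 o0 o2 o3; have a4 := k1 o1 o2 o3.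
have b1 := k2 o0 o1 o2; have b2 := k2 o0 o1 o3; have b3 := k2 o0 o2 o3; have b4 := k2 o1 o2 o3.
have c1 := k3 o0 o1 o2; have c2 := k3 o0 o1 o3; have c3 := k3 o0 o2 o3; have c4 := k3 o1 o2 o3.
rewrite /Q1 /Q2 /Q3 !mxE /= ?simp4 in a1 a2 a3 a4 b1 b2 b3 b4 c1 c2 c3 c4.
clear k1 k2 k3.
by split; apply: all4; lra.
Qed.

Lemma mulmx_deltaT (w : 'rV[R]_4) i : (w *m (delta_mx 0 i : 'rV[R]_4)^T) 0 0 = w 0 i.
Proof. by rewrite trmx_delta -colE mxE. Qed.

Section Structure.
Variables (G I1 I2 I3 : 'M[R]_4).
Hypothesis q : quaternionic G I1 I2 I3.

Lemma q_31 : I3 *m I1 = I2.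
Proof. by rewrite -(q_12 q) -mulmxA (q_21 q) -(q_12 q) mulmxN mulmxA (q_11 q) mulNmx mul1mx opprK. Qed.
Lemma q_13 : I1 *m I3 = - I2.
Proof. by rewrite -(q_12 q) mulmxA (q_11 q) mulNmx mul1mx. Qed.
Lemma q_23 : I2 *m I3 = I1.
Proof. by rewrite -(q_12 q) mulmxA (q_21 q) -(q_12 q) mulNmx -mulmxA (q_22 q) mulmxN mulmx1 opprK. Qed.
Lemma q_32 : I3 *m I2 = - I1.
Proof. by rewrite -(q_12 q) -mulmxA (q_22 q) mulmxN mulmx1. Qed.

Lemma q_rot : quaternionic G I2 I3 I1.
Proof. by case: q => *; split=> //; [exact: q_23|exact: q_32]. Qed.

Lemma q_unit : G \in unitmx.
Proof.
rewrite -row_free_unit -kermx_eq0; apply/rowV0P => v /sub_kermxP vG.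
by apply/eqP; apply: contraT => /(q_pos q); rewrite vG mul0mx mxE ltxx.
Qed.

Lemma skew_tr (M : 'M[R]_4) : (M *m G)^T = - (M *m G) -> G *m M^T = - (M *m G).
Proof. by rewrite trmx_mul (q_sym q). Qed.

Lemma skew_quad (A : 'M[R]_4) v : A^T = - A -> (v *m A *m v^T) 0 0 = 0.
Proof.
move=> sA; have H : (v *m A *m v^T)^T = - (v *m A *m v^T).
  by rewrite !trmx_mul trmxK sA mulNmx mulmxN mulmxA.
have /matrixP/(_ 0 0) := H; rewrite !mxE => E; lra.
Qed.

Lemma skew_pair (A : 'M[R]_4) u v : A^T = - A -> (u *m A *m v^T) 0 0 = - (v *m A *m u^T) 0 0.
Proof.
move=> sA; have -> : u *m A *m v^T = - (v *m A *m u^T)^T.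
  by rewrite !trmx_mul trmxK sA mulNmx mulmxN opprK mulmxA.
by rewrite [LHS]mxE [X in - X]mxE.
Qed.

Lemma q_pairing (A B : 'M[R]_4) v : (B *m G)^T = - (B *m G) ->
  v *m A *m G *m (v *m B)^T = - (v *m (A *m B) *m G *m v^T).
Proof.
by move=> /skew_tr H; rewrite trmx_mul -!mulmxA (mulmxA G) H !mulNmx !mulmxN !mulmxA.
Qed.

Definition frame v : 'M[R]_4 := \matrix_i nth 0 [:: v; v *m I1; v *m I2; v *m I3] i.

Lemma mx11P (A B : 'M[R]_1) : A 0 0 = B 0 0 -> A = B.
Proof. by move=> H; apply/matrixP => i j; rewrite !ord1. Qed.

Lemma frame_gram v : frame v *m G *m (frame v)^T = (v *m G *m v^T) 0 0 *: 1%:M.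
Proof.
have s1 := skew_quad v (q_skew1 q); have s2 := skew_quad v (q_skew2 q); have s3 := skew_quad v (q_skew3 q).
have p := @q_pairing.
apply/matrixP => i j.
have -> : (frame v *m G *m (frame v)^T) i j = (row i (frame v) *m G *m (row j (frame v))^T) 0 0.
  by rewrite -!row_mul tr_row !mxE; apply: eq_bigr => k _; rewrite !mxE.
have D A B C c : (B *m G)^T = - (B *m G) -> A *m B = c *: C ->
    ((v *m A *m G *m (v *m B)^T) 0 0) = - c * (v *m C *m G *m v^T) 0 0.
  by move=> sB AB; rewrite q_pairing // AB -scalemxAr -!scalemxAl !mxE mulNr.
have S0 C : (C *m G)^T = - (C *m G) -> (v *m C *m G *m v^T) 0 0 = 0.
  by move=> sC; rewrite -(mulmxA v) skew_quad.
have vv : v = v *m 1%:M by rewrite mulmx1.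
have k1 := q_skew1 q; have k2 := q_skew2 q; have k3 := q_skew3 q.
move: i j; apply: all4; apply: all4; rewrite !rowK /= [RHS]mxE [X in _ = _ * X]mxE /= ?mulr1 ?mulr0.
- by [].
- by rewrite {1}vv (D _ _ I1 1) ?mul1mx ?scale1r // S0 ?mulr0.
- by rewrite {1}vv (D _ _ I2 1) ?mul1mx ?scale1r // S0 ?mulr0.
- by rewrite {1}vv (D _ _ I3 1) ?mul1mx ?scale1r // S0 ?mulr0.
- by rewrite S0.
- by rewrite (D _ _ 1%:M (-1)) ?mulmx1 ?opprK ?mul1r // scaleN1r (q_11 q).
- by rewrite (D _ _ I3 1) ?scale1r ?(q_12 q) // S0 ?mulr0.
- by rewrite (D _ _ I2 (-1)) ?scaleN1r ?q_13 // S0 ?mulr0.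
- by rewrite S0.
- by rewrite (D _ _ I3 (-1)) ?scaleN1r ?(q_21 q) // S0 ?mulr0.
- by rewrite (D _ _ 1%:M (-1)) ?mulmx1 ?opprK ?mul1r // scaleN1r (q_22 q).
- by rewrite (D _ _ I1 1) ?scale1r ?q_23 // S0 ?mulr0.
- by rewrite S0.
- by rewrite (D _ _ I2 1) ?scale1r ?q_31 // S0 ?mulr0.
- by rewrite (D _ _ I1 (-1)) ?scaleN1r ?q_32 // S0 ?mulr0.
- by rewrite (D _ _ 1%:M (-1)) ?mulmx1 ?opprK ?mul1r // scaleN1r (q_33 q).
Qed.

Lemma frame_mul v : [/\ frame v *m I1 = Q1 *m frame v, frame v *m I2 = Q2 *m frame v & frame v *m I3 = Q3 *m frame v].
Proof.
split; apply/row_matrixP; apply: all4; rewrite row_mul [RHS]row_mul [RHS]mulmx_sum_row [RHS]sum4 !rowK /= /Q1 /Q2 /Q3 !mxE /=;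
  rewrite ?scale0r ?scale1r ?scaleN1r ?addr0 ?add0r // -mulmxA
    ?(q_12 q) ?(q_21 q) ?(q_11 q) ?(q_22 q) ?(q_33 q) ?q_13 ?q_31 ?q_23 ?q_32 ?mulmxN ?mulmx1 //.
Qed.

Let v0 : 'rV[R]_4 := delta_mx 0 0.
Let n0 : R := (v0 *m G *m v0^T) 0 0.
Definition fr := frame v0.
Definition frV := n0^-1 *: (G *m fr^T).

Lemma v0_neq0 : v0 != 0.
Proof. by apply/eqP => /matrixP/(_ 0 0); rewrite !mxE !eqxx => /eqP; rewrite oner_eq0. Qed.

Lemma n0_gt0 : 0 < n0.
Proof. exact: (q_pos q v0_neq0). Qed.

Lemma frK : fr *m frV = 1%:M.
Proof. by rewrite /frV -scalemxAr mulmxA frame_gram scalerA mulVf ?scale1r // gt_eqF ?n0_gt0. Qed.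

Lemma frVK : frV *m fr = 1%:M.
Proof. exact: mulmx1C frK. Qed.

Lemma frT : fr^T = n0 *: (invmx G *m frV).
Proof. by rewrite /frV -scalemxAr mulKmx ?q_unit // scalerA mulfV ?scale1r // gt_eqF ?n0_gt0. Qed.

Definition hat (M : 'M[R]_4) := fr *m M *m frV.

Lemma hatM A B : hat (A *m B) = hat A *m hat B.
Proof. by rewrite /hat !mulmxA -(mulmxA (fr *m A) frV fr) frVK mulmx1. Qed.

Lemma hat_inj A B : hat A = hat B -> A = B.
Proof.
move=> /(congr1 (fun M => frV *m M *m fr)).
by rewrite /hat !mulmxA frVK !mul1mx -!mulmxA frVK !mulmx1.
Qed.

Lemma hat_I : [/\ hat I1 = Q1, hat I2 = Q2 & hat I3 = Q3].
Proof. by have [h1 h2 h3] := frame_mul v0; rewrite /hat /fr h1 h2 h3 -!mulmxA frK !mulmx1. Qed.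

Lemma hat_scalar c : hat c%:M = c%:M.
Proof. by rewrite /hat mul_mx_scalar -scalemxAl frK scalemx1. Qed.

Lemma hat_tr M : \tr (hat M) = \tr M.
Proof. by rewrite /hat mxtrace_mulC mulmxA frVK mul1mx. Qed.

Lemma hatD A B : hat (A + B) = hat A + hat B.
Proof. by rewrite /hat mulmxDr mulmxDl. Qed.

Lemma hatZ c A : hat (c *: A) = c *: hat A.
Proof. by rewrite /hat -[fr *m (c *: A)]scalemxAr -[LHS]scalemxAl. Qed.

Lemma hatE M : hat M = n0^-1 *: (fr *m (M *m G) *m fr^T).
Proof. by rewrite /hat /frV -!scalemxAr !mulmxA. Qed.

Lemma hat_skew M : (M *m G)^T = - (M *m G) -> (hat M)^T = - hat M.
Proof.
by move=> H; rewrite hatE linearZ /= trmx_mul trmxK trmx_mul H mulNmx mulmxN scalerN mulmxA.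
Qed.

Lemma hat_sym M : (M *m G)^T = M *m G -> (hat M)^T = hat M.
Proof. by move=> H; rewrite hatE linearZ /= trmx_mul trmxK trmx_mul H mulmxA. Qed.

Lemma commuting_sym_scalar M : (M *m G)^T = M *m G -> M *m I1 = I1 *m M -> M *m I2 = I2 *m M ->
  M = (\tr M / 4)%:M.
Proof.
move=> sM c1 c2; have [h1 h2 h3] := hat_I.
have [||c E] := std_scalar (hat_sym sM); rewrite -?h1 -?h2 -?hatM ?c1 ?c2 //.
apply: hat_inj; rewrite hat_scalar -hat_tr E mxtrace_scalar.
by congr (_%:M); rewrite -[c *+ 4]mulr_natr mulfK ?pnatr_eq0.
Qed.

Lemma skew_commute M : (M *m G)^T = - (M *m G) ->
  \tr (M *m I1) = 0 -> \tr (M *m I2) = 0 -> \tr (M *m I3) = 0 ->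
  [/\ M *m I1 = I1 *m M, M *m I2 = I2 *m M & M *m I3 = I3 *m M].
Proof.
move=> sM t1 t2 t3; have [h1 h2 h3] := hat_I.
have [|||c1 c2 c3] := std_commute (hat_skew sM); rewrite -?h1 -?h2 -?h3 -?hatM ?hat_tr //.
by split; apply: hat_inj; rewrite !hatM ?h1 ?h2 ?h3.
Qed.

Lemma tr_I : [/\ \tr I1 = 0, \tr I2 = 0 & \tr I3 = 0].
Proof.
have [h1 h2 h3] := hat_I.
by split; [rewrite -(hat_tr I1) h1|rewrite -(hat_tr I2) h2|rewrite -(hat_tr I3) h3];
  rewrite /Q1 /Q2 /Q3 M4_tr !addr0.
Qed.

Lemma gram_expand v : (v *m G *m v^T) 0 0 *: G =
  (v *m G)^T *m (v *m G) + (v *m I1 *m G)^T *m (v *m I1 *m G)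
  + (v *m I2 *m G)^T *m (v *m I2 *m G) + (v *m I3 *m G)^T *m (v *m I3 *m G).
Proof.
have [->|v_neq0] := eqVneq v 0; first by rewrite !mul0mx mxE scale0r trmx0 mul0mx !addr0.
have n_gt0 := q_pos q v_neq0; set n := (v *m G *m v^T) 0 0 in n_gt0 *.
have gr := frame_gram v; rewrite -/n in gr.
have inv : n^-1 *: (G *m (frame v)^T) *m frame v = 1%:M.
  by apply: mulmx1C; rewrite -scalemxAr mulmxA gr scalerA mulVf ?scale1r // gt_eqF.
have -> : n *: G = G *m (frame v)^T *m frame v *m G.
  move/(congr1 (fun M => n *: (M *m G))): inv; rewrite mul1mx => <-.
  by rewrite -!scalemxAl scalerA mulfV ?scale1r // gt_eqF.
have -> : G *m (frame v)^T *m frame v *m G = (frame v *m G)^T *m (frame v *m G).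
  by rewrite trmx_mul (q_sym q) !mulmxA.
apply/matrixP => i j; rewrite !mxE sum4 !big_ord1 !mxE.
by congr (_ * _ + _ * _ + _ * _ + _ * _); apply: eq_bigr => k _; rewrite [frame v _ _]mxE.
Qed.

Lemma quat_skew_span M : (M *m G)^T = - (M *m G) -> M *m I1 + I1 *m M = 0 ->
  exists b c, M = b *: I2 + c *: I3.
Proof.
move=> sM aM; have [h1 h2 h3] := hat_I.
have [|b [c E]] := std_skew_span (hat_skew sM).
  by rewrite -h1 -!hatM -hatD aM /hat mulmx0 mul0mx.
by exists b, c; apply: hat_inj; rewrite hatD !hatZ h2 h3.
Qed.

Lemma quat_skew_span2 M : (M *m G)^T = - (M *m G) -> M *m I2 + I2 *m M = 0 ->
  exists b c, M = b *: I1 + c *: I3.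
Proof.
move=> sM aM; have [h1 h2 h3] := hat_I.
have [|b [c E]] := std_skew_span2 (hat_skew sM).
  by rewrite -h2 -!hatM -hatD aM /hat mulmx0 mul0mx.
by exists b, c; apply: hat_inj; rewrite hatD !hatZ h1 h3.
Qed.

Lemma sum3_rot (F : 'I_4 -> 'I_4 -> 'I_4 -> R) :
  \sum_j \sum_k \sum_i F i j k = \sum_i \sum_j \sum_k F i j k.
Proof.
rewrite [RHS]exchange_big /=; apply: eq_bigr => j _.
by rewrite [RHS]exchange_big.
Qed.

Definition hat3 (w : 'I_4 -> 'I_4 -> 'I_4 -> R) a b c :=
  \sum_i \sum_j \sum_k fr a i * fr b j * fr c k * w i j k.

Lemma hat3_prod (al : 'I_4 -> R) (W : 'M[R]_4) a b c :
  hat3 (fun i j k => al i * W j k) a b c = (\sum_i fr a i * al i) * (fr *m W *m fr^T) b c.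
Proof.
rewrite mulr_suml; apply: eq_bigr => i _.
rewrite [(fr *m W *m fr^T) b c]mxE mulr_sumr exchange_big /=; apply: eq_bigr => k _.
rewrite [(fr *m W) b k]mxE [fr^T k c]mxE mulr_suml mulr_sumr; apply: eq_bigr => j _.
by ring.
Qed.

Lemma hat3_cyc (w : 'I_4 -> 'I_4 -> 'I_4 -> R) :
  (forall a b c, w a b c + w b c a + w c a b = 0) ->
  forall a b c, hat3 w a b c + hat3 w b c a + hat3 w c a b = 0.
Proof.
move=> H a b c.
have E1 : hat3 w b c a = \sum_i \sum_j \sum_k fr a i * fr b j * fr c k * w j k i.
  rewrite -sum3_rot; apply: eq_bigr => j _; apply: eq_bigr => k _; apply: eq_bigr => i _.
  by ring.
have E2 : hat3 w c a b = \sum_i \sum_j \sum_k fr a i * fr b j * fr c k * w k i j.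
  rewrite -sum3_rot -sum3_rot; apply: eq_bigr => k _; apply: eq_bigr => i _; apply: eq_bigr => j _.
  by ring.
rewrite E1 E2 -!big_split /= big1 // => i _; rewrite -!big_split /= big1 // => j _.
by rewrite -!big_split /= big1 // => k _; rewrite -!mulrDr H mulr0.
Qed.

Lemma fr_eq0 (al : 'I_4 -> R) : (forall a, \sum_i fr a i * al i = 0) -> forall i, al i = 0.
Proof.
move=> H i; have E : fr *m (\col_i al i) = 0.
  apply/matrixP => a k; rewrite [LHS]mxE [RHS]mxE -[RHS](H a); apply: eq_bigr => j _.
  by rewrite [(\col_i0 al i0) j k]mxE.
have : (\col_i al i) = 0 :> 'cV[R]_4 by rewrite -[LHS]mul1mx -frVK -mulmxA E mulmx0.
by move=> /matrixP/(_ i 0); rewrite !mxE.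
Qed.

Lemma fr_form M Q : hat M = Q -> fr *m (M *m G) *m fr^T = n0 *: Q.
Proof. by move=> <-; rewrite hatE scalerA mulfV ?scale1r // gt_eqF ?n0_gt0. Qed.

(* Hitchin's lemma at a point: for C_i a = nabla_a I_i this says that three
   closed fundamental forms are parallel. *)
Lemma closed_forms_parallel (C1 C2 C3 : 'I_4 -> 'M[R]_4) :
  (forall a, (C1 a *m G)^T = - (C1 a *m G)) -> (forall a, (C2 a *m G)^T = - (C2 a *m G)) ->
  (forall a, C1 a *m I1 + I1 *m C1 a = 0) -> (forall a, C2 a *m I2 + I2 *m C2 a = 0) ->
  (forall a, C1 a *m I2 + I1 *m C2 a = C3 a) -> (forall a, C2 a *m I1 + I2 *m C1 a = - C3 a) ->
  (forall a b c, (C1 a *m G) b c + (C1 b *m G) c a + (C1 c *m G) a b = 0) ->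
  (forall a b c, (C2 a *m G) b c + (C2 b *m G) c a + (C2 c *m G) a b = 0) ->
  (forall a b c, (C3 a *m G) b c + (C3 b *m G) c a + (C3 c *m G) a b = 0) ->
  forall a, [/\ C1 a = 0, C2 a = 0 & C3 a = 0].
Proof.
move=> s1 s2 a1 a2 e12 e21 d1 d2 d3.
have /choice[p /choice[r C1E]] : forall a, exists b c, C1 a = b *: I2 + c *: I3.
  by move=> a; exact: quat_skew_span.
have /choice[p' /choice[s C2E]] : forall a, exists b c, C2 a = b *: I1 + c *: I3.
  by move=> a; exact: quat_skew_span2.
have sc (c : R) (A : 'M[R]_4) : c *: A = c%:M *m A by rewrite mul_scalar_mx.
have E12 a : C3 a = - (p a + p' a)%:M - (r a *: I1 + s a *: I2).
  rewrite -e12 C1E C2E mulmxDl mulmxDr -!scalemxAl -!scalemxAr (q_22 q) q_32 q_13 (q_11 q).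
  by rewrite !scalerN !scalemx1 raddfD /= !opprD addrACA.
have E21 a : - C3 a = - (p a + p' a)%:M + (r a *: I1 + s a *: I2).
  rewrite -e21 C1E C2E mulmxDl mulmxDr -!scalemxAl -!scalemxAr (q_22 q) q_31 q_23 (q_11 q).
  by rewrite !scalerN !scalemx1 raddfD /= opprD addrACA [- (p' a)%:M + _]addrC [s a *: I2 + _]addrC.
have p'E a : p' a = - p a.
  have /matrixP/(_ 0 0) : C3 a + - C3 a = - (2 * (p a + p' a))%:M.
    by rewrite {1}E12 E21 addrACA addNr addr0 -opprD mulr_natl mulr2n -raddfD.
  rewrite subrr !mxE mulr1n => H; lra.
have C3E a : C3 a = - (r a *: I1 + s a *: I2).
  by rewrite E12 p'E subrr raddf0 oppr0 add0r.
have hD (w w' : 'I_4 -> 'I_4 -> 'I_4 -> R) a b c :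
    hat3 (fun i j k => w i j k + w' i j k) a b c = hat3 w a b c + hat3 w' a b c.
  rewrite /hat3 -big_split; apply: eq_bigr => i _; rewrite -big_split; apply: eq_bigr => j _.
  by rewrite -big_split; apply: eq_bigr => k _; rewrite mulrDr.
have [h1 h2 h3] := hat_I.
have hE (al be : 'I_4 -> R) (A B A' B' : 'M[R]_4) (C : 'I_4 -> 'M[R]_4) : hat A = A' -> hat B = B' ->
    (forall a, C a = al a *: A + be a *: B) ->
    (forall a b c, (C a *m G) b c + (C b *m G) c a + (C c *m G) a b = 0) ->
    forall a b c, (\sum_i fr a i * al i) * A' b c + (\sum_i fr a i * be i) * B' b c
      + ((\sum_i fr b i * al i) * A' c a + (\sum_i fr b i * be i) * B' c a)
      + ((\sum_i fr c i * al i) * A' a b + (\sum_i fr c i * be i) * B' a b) = 0.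
  move=> hA hB CE dC a b c.
  have CGE i j k : (C i *m G) j k = al i * (A *m G) j k + be i * (B *m G) j k.
    by rewrite CE mulmxDl -!scalemxAl [LHS]mxE; congr (_ + _); rewrite [LHS]mxE.
  have X x y z : hat3 (fun i j k => (C i *m G) j k) x y z
     = n0 * ((\sum_i fr x i * al i) * A' y z + (\sum_i fr x i * be i) * B' y z).
    have -> : (fun i j k => (C i *m G) j k) =
        (fun i j k => al i * (A *m G) j k + be i * (B *m G) j k).
      by apply/funext => i; apply/funext => j; apply/funext => k; exact: CGE.
    rewrite hD !hat3_prod (fr_form hA) (fr_form hB) [(n0 *: A') y z]mxE [(n0 *: B') y z]mxE.
    by rewrite mulrDr; congr (_ + _); rewrite mulrCA.
  have := hat3_cyc dC a b c; rewrite !X -!mulrDr => /eqP.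
  by rewrite mulf_eq0 (gt_eqF n0_gt0) /= => /eqP.
have C2E' a : C2 a = (fun a => - p a) a *: I1 + s a *: I3 by rewrite C2E p'E.
have C3E' a : C3 a = (fun a => - r a) a *: I1 + (fun a => - s a) a *: I2.
  by rewrite C3E opprD !scaleNr.
have K1 := hE _ _ _ _ _ _ _ h2 h3 C1E d1.
have K2 := hE _ _ _ _ _ _ _ h1 h3 C2E' d2.
have K3 := hE _ _ _ _ _ _ _ h1 h2 C3E' d3.
have sN (f : 'I_4 -> R) a : \sum_i fr a i * - f i = - \sum_i fr a i * f i.
  by rewrite -sumrN; apply: eq_bigr => i _; rewrite mulrN.
pose P a := \sum_i fr a i * p i; pose S a := \sum_i fr a i * s i; pose T a := \sum_i fr a i * r i.
have [Pz Tz Sz] : [/\ forall a, P a = 0, forall a, T a = 0 & forall a, S a = 0].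
  apply: std_closed_forms.
  - by move=> a b c; exact: K1.
  - by move=> a b c; rewrite /P -!sN; exact: K2.
  - by move=> a b c; rewrite /T /S -!mulNr -!sN; exact: K3.
move=> a; have pz := fr_eq0 Pz a; have rz := fr_eq0 Tz a; have sz := fr_eq0 Sz a.
by rewrite C1E C2E C3E p'E pz rz sz oppr0 !scale0r !addr0 oppr0.
Qed.

Lemma three_form_eq0 (T : 'I_4 -> 'M[R]_4) :
  (forall a, (T a)^T = - T a) -> (forall a b c, T a b c = - T b a c) ->
  (forall a, \tr (T a *m invmx G *m I1) = 0) -> forall a, T a = 0.
Proof.
move=> sT aT tT.
pose X a := \sum_k fr a k *: T k.
have XE a b c : (fr *m X a *m fr^T) b c = hat3 (fun i j k => T i j k) a b c.
  rewrite /hat3 -sum3_rot [LHS]mxE exchange_big /=; apply: eq_bigr => k _.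
  rewrite [(fr *m X a) b k]mxE [fr^T k c]mxE mulr_suml; apply: eq_bigr => j _.
  rewrite /X summxE mulr_sumr mulr_suml; apply: eq_bigr => i _.
  by rewrite [(fr a i *: T i) j k]mxE; ring.
have sX a : (X a)^T = - X a.
  rewrite /X raddf_sum -sumrN; apply: eq_bigr => k _ /=.
  by rewrite linearZ /= sT scalerN.
have Z := @std_three_form (fun a => fr *m X a *m fr^T) _ _ _.
have {}Z a : fr *m X a *m fr^T = 0.
  apply: Z => {a}.
  - by move=> a; rewrite !trmx_mul trmxK sX mulNmx mulmxN mulmxA.
  - move=> a b c; rewrite !XE /hat3 -sumrN exchange_big /=; apply: eq_bigr => i _.
    rewrite -sumrN; apply: eq_bigr => j _; rewrite -sumrN; apply: eq_bigr => k _.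
    by rewrite aT; ring.
  - move=> a; have [<- _ _] := hat_I.
    have -> : fr *m X a *m fr^T *m hat I1 = hat (X a *m fr^T *m fr *m I1) by rewrite /hat !mulmxA.
    have -> : X a *m fr^T *m fr *m I1 = n0 *: (X a *m invmx G *m I1).
      by rewrite frT -[X a *m _]scalemxAr -2![in LHS]scalemxAl !mulmxA -(mulmxA (X a *m invmx G) frV) frVK mulmx1.
    rewrite hat_tr mxtraceZ -mulmxA.
    rewrite /X mulmx_suml raddf_sum big1 ?mulr0 // => k _ /=.
    by rewrite -[_ *m (_ *m I1)]scalemxAl mxtraceZ mulmxA tT mulr0.
have X0 a : X a = 0.
  have := congr1 (fun M => frV *m M *m (frV)^T) (Z a); rewrite mulmx0 mul0mx !mulmxA frVK mul1mx.
  by rewrite -mulmxA -trmx_mul frVK trmx1 mulmx1.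
move=> a; apply/matrixP => b c; rewrite [RHS]mxE.
apply: (fr_eq0 (al := fun k => T k b c)) => d.
have H := congr1 (fun M : 'M[R]_4 => M b c) (X0 d); rewrite /X summxE [RHS]mxE in H.
by rewrite -[RHS]H; apply: eq_bigr => k _; rewrite [RHS]mxE.
Qed.

Definition volume_contraction xi a : 'M[R]_4 :=
  2 *: ((row a G)^T *m (xi *m G) - (xi *m G)^T *m row a G)
  + 2 *: ((xi *m I1 *m G) 0 a *: (I1 *m G) + (xi *m I2 *m G) 0 a *: (I2 *m G)
          + (xi *m I3 *m G) 0 a *: (I3 *m G)).

Lemma q_sym_quad u v : (u *m G *m v^T) 0 0 = (v *m G *m u^T) 0 0.
Proof.
have -> : u *m G *m v^T = (v *m G *m u^T)^T by rewrite !trmx_mul trmxK (q_sym q) mulmxA.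
by rewrite mxE.
Qed.

Lemma volume_contractionE xi a b c : volume_contraction xi a b c =
  2 * (G a b * (xi *m G) 0 c - (xi *m G) 0 b * G a c)
  + 2 * ((xi *m I1 *m G) 0 a * (I1 *m G) b c + (xi *m I2 *m G) 0 a * (I2 *m G) b c
          + (xi *m I3 *m G) 0 a * (I3 *m G) b c).
Proof.
have eD (A B : 'M[R]_4) : (A + B) b c = A b c + B b c by rewrite mxE.
have eN (A : 'M[R]_4) : (- A) b c = - A b c by rewrite mxE.
have eZ (k : R) (A : 'M[R]_4) : (k *: A) b c = k * A b c by rewrite mxE.
have eP (u v : 'rV[R]_4) : (u^T *m v) b c = u 0 b * v 0 c by rewrite !mxE big_ord1 !mxE.
by rewrite /volume_contraction !(eD, eZ, eN) !eP ![row a G _ _]mxE.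
Qed.

Lemma q_entry : [/\ forall i j, G i j = G j i, forall i j, (I1 *m G) i j = - (I1 *m G) j i,
  forall i j, (I2 *m G) i j = - (I2 *m G) j i & forall i j, (I3 *m G) i j = - (I3 *m G) j i].
Proof.
have sk (A : 'M[R]_4) i j : A^T = - A -> A i j = - A j i.
  by move=> /matrixP/(_ j i); rewrite [LHS]mxE [RHS]mxE.
split=> i j; [|exact: sk (q_skew1 q)|exact: sk (q_skew2 q)|exact: sk (q_skew3 q)].
by have /matrixP/(_ j i) := q_sym q; rewrite mxE.
Qed.

Lemma volume_contraction_skew xi a : (volume_contraction xi a)^T = - volume_contraction xi a.
Proof.
have [_ k1 k2 k3] := q_entry.
apply/matrixP => b c; rewrite [LHS]mxE [RHS]mxE !volume_contractionE (k1 c b) (k2 c b) (k3 c b); ring.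
Qed.

Lemma gram_polar xi a b c : 2 * G a b * (xi *m G) 0 c =
  (xi *m G) 0 a * G b c + (xi *m G) 0 b * G a c
  - ((xi *m I1 *m G) 0 a * (I1 *m G) b c + (xi *m I1 *m G) 0 b * (I1 *m G) a c)
  - ((xi *m I2 *m G) 0 a * (I2 *m G) b c + (xi *m I2 *m G) 0 b * (I2 *m G) a c)
  - ((xi *m I3 *m G) 0 a * (I3 *m G) b c + (xi *m I3 *m G) 0 b * (I3 *m G) a c).
Proof.
have m11 (A : 'M[R]_1) (w : 'rV[R]_4) : (A *m w) 0 c = A 0 0 * w 0 c.
  by rewrite mxE big_ord1.
have tr11 (A : 'M[R]_1) : A^T = A by apply: mx11P; rewrite mxE.
have E v : (v *m G *m v^T) 0 0 * (xi *m G) 0 c = (v *m (xi *m G)^T) 0 0 * (v *m G) 0 c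
   - (v *m (xi *m I1 *m G)^T) 0 0 * (v *m (I1 *m G)) 0 c
   - (v *m (xi *m I2 *m G)^T) 0 0 * (v *m (I2 *m G)) 0 c
   - (v *m (xi *m I3 *m G)^T) 0 0 * (v *m (I3 *m G)) 0 c.
  have sk (I : 'M[R]_4) : (I *m G)^T = - (I *m G) -> xi *m (v *m I *m G)^T = - (v *m (xi *m I *m G)^T).
    move=> sI; rewrite -[LHS]tr11 trmx_mul trmxK -!mulmxA trmx_mul sI mulNmx mulmxN opprK.
    by rewrite !mulmxA.
  have s0 : xi *m (v *m G)^T = v *m (xi *m G)^T.
    by rewrite -[LHS]tr11 trmx_mul trmxK trmx_mul (q_sym q) mulmxA.
  have -> : (v *m G *m v^T) 0 0 * (xi *m G) 0 c = (xi *m ((v *m G *m v^T) 0 0 *: G)) 0 c.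
    by rewrite -[xi *m (_ *: G)]scalemxAr [RHS]mxE.
  rewrite gram_expand.
  rewrite !mulmxDr !(mulmxA xi) s0 (sk _ (q_skew1 q)) (sk _ (q_skew2 q)) (sk _ (q_skew3 q)).
  have eD (A B : 'rV[R]_4) : (A + B) 0 c = A 0 c + B 0 c by rewrite mxE.
  have eN (A : 'M[R]_1) : (- A) 0 0 = - A 0 0 by rewrite mxE.
  by rewrite !eD !m11 !eN !mulNr !mulmxA.
have dl m (A : 'M[R]_(4, m)) i k : ((delta_mx 0 i : 'rV[R]_4) *m A) 0 k = A i k.
  by rewrite -rowE mxE.
have dD m (A : 'M[R]_(4, m)) k : ((delta_mx 0 a + delta_mx 0 b : 'rV[R]_4) *m A) 0 k = A a k + A b k.
  by rewrite mulmxDl mxE !dl.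
have tE (w : 'rV[R]_4) i : w^T i 0 = w 0 i by rewrite mxE.
have qd := mulmx_deltaT.
have := E (delta_mx 0 a + delta_mx 0 b); have := E (delta_mx 0 a); have := E (delta_mx 0 b).
have [gs _ _ _] := q_entry.
have qD (u v w : 'rV[R]_4) : (w *m (u + v)^T) 0 0 = (w *m u^T) 0 0 + (w *m v^T) 0 0.
  by rewrite linearD /= mulmxDr mxE.
rewrite qD !qd !dD !dl !tE (gs b a) => e1 e2 e3; lra.
Qed.

Lemma volume_contraction_alt xi a b c : volume_contraction xi a b c = - volume_contraction xi b a c.
Proof.
have [gs _ _ _] := q_entry.
have := gram_polar xi a b c; rewrite !volume_contractionE (gs b a) => e; lra.
Qed.

Lemma tr_volume_contraction xi a :
  \tr (volume_contraction xi a *m invmx G *m I1) = - 4 * (xi *m I1 *m G) 0 a.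
Proof.
have gK (A : 'M[R]_4) : A *m G *m invmx G = A by rewrite mulmxK ?q_unit.
have [t1 t2 t3] := tr_I.
have E u v : \tr ((u *m G)^T *m (v *m G) *m invmx G *m I1) = (v *m I1 *m G *m u^T) 0 0.
  rewrite -!mulmxA mxtrace_mulC mulKVmx ?q_unit // !mulmxA /mxtrace big_ord1.
  by rewrite trmx_mul (q_sym q) !mulmxA.
rewrite /volume_contraction !mulmxDl -!scalemxAl !mulmxDl !mulNmx -!scalemxAl !gK.
have tN (A : 'M[R]_4) : \tr (- A) = - \tr A by exact: raddfN.
rewrite (q_11 q) (q_21 q) q_31 !(mxtraceD, mxtraceZ, tN) mxtrace1 t2 t3 rowE !E.
have p1 := mulmx_deltaT (xi *m I1 *m G) a.
have p2 : ((delta_mx 0 a : 'rV[R]_4) *m I1 *m G *m xi^T) 0 0 = - (xi *m I1 *m G) 0 a.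
  by rewrite -p1 -!(mulmxA _ I1) skew_pair ?(q_skew1 q).
rewrite p1 p2; set f := (xi *m I1 *m G) 0 a; lra.
Qed.

Lemma three_form_decomp (T : 'I_4 -> 'M[R]_4) :
  (forall a, (T a)^T = - T a) -> (forall a b c, T a b c = - T b a c) ->
  exists xi, forall a, T a = volume_contraction xi a.
Proof.
move=> sT aT.
pose phi : 'rV[R]_4 := \row_a (- (\tr (T a *m invmx G *m I1) / 4)).
pose xi := - (phi *m invmx G *m I1).
have phiE : xi *m I1 *m G = phi.
  by rewrite /xi !mulNmx -(mulmxA _ I1 I1) (q_11 q) mulmxN mulmx1 mulNmx opprK mulmxKV ?q_unit.
have phiD a : phi 0 a = - (\tr (T a *m invmx G *m I1) / 4) by rewrite mxE.
clearbody xi; clearbody phi.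
exists xi => a; apply/eqP; rewrite -subr_eq0; apply/eqP.
apply: (three_form_eq0 (T := fun a => T a - volume_contraction xi a)) => {a}.
- by move=> a; rewrite linearB /= sT volume_contraction_skew opprB opprK addrC.
- move=> a b c; have eB (A B : 'M[R]_4) i j : (A - B) i j = A i j - B i j by rewrite mxE [X in _ + X]mxE.
  by rewrite !eB aT volume_contraction_alt opprD.
- move=> a; rewrite !mulmxBl linearB /= tr_volume_contraction phiE phiD; lra.
Qed.

Lemma commute_of_sym (A : 'M[R]_4) : (A *m I1 *m G)^T = A *m I1 *m G ->
  (A *m I2 *m G)^T = A *m I2 *m G -> (A *m I3 *m G)^T = A *m I3 *m G ->
  [/\ A *m I1 = I1 *m A, A *m I2 = I2 *m A, A *m I3 = I3 *m A & (A *m G)^T = - (A *m G)].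
Proof.
move=> s1 s2 s3; pose B := G *m A^T *m invmx G.
have BE (I : 'M[R]_4) : I *m I = - 1%:M -> (I *m G)^T = - (I *m G) ->
    (A *m I *m G)^T = A *m I *m G -> B = I *m A *m I.
  move=> II sI sA; have E : A *m I = - (I *m B).
    apply: (can_inj (mulmxK q_unit)); rewrite -sA -mulmxA trmx_mul sI !mulNmx /B.
    by rewrite !mulmxA mulmxKV ?q_unit.
  by rewrite -mulmxA E mulmxN mulmxA II mulNmx mul1mx opprK.
have B1 := BE _ (q_11 q) (q_skew1 q) s1; have B2 := BE _ (q_22 q) (q_skew2 q) s2.
have B3 := BE _ (q_33 q) (q_skew3 q) s3.
have cm (I J L : 'M[R]_4) : I *m J = L -> J *m I = - L -> J *m J = - 1%:M -> L *m L = - 1%:M ->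
    B = I *m A *m I -> B = J *m A *m J -> A *m L = L *m A.
  move=> IJ JI JJ LL BI BJ.
  have E : J *m B *m J = A.
    by rewrite BJ -!mulmxA JJ !mulmxA JJ mulmxN mulmx1 mulNmx mul1mx opprK.
  rewrite BI !mulmxA JI -!mulmxA IJ !mulNmx in E.
  by rewrite -{1}E mulNmx -!mulmxA LL !mulmxN mulmx1 opprK.
have c3 := cm _ _ _ (q_12 q) (q_21 q) (q_22 q) (q_33 q) B1 B2.
have c1 := cm _ _ _ q_23 q_32 (q_33 q) (q_11 q) B2 B3.
have c2 := cm _ _ _ q_31 q_13 (q_11 q) (q_22 q) B3 B1.
split=> //; rewrite trmx_mul (q_sym q) -[G *m A^T](mulmxKV q_unit) -/B B3 -c3.
by rewrite -(mulmxA A) (q_33 q) mulmxN mulmx1 mulNmx.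
Qed.

Lemma skew_mul_tr (A B : 'M[R]_4) : (A *m G)^T = - (A *m G) -> (B *m G)^T = - (B *m G) ->
  (A *m B *m G)^T = B *m A *m G.
Proof.
move=> /skew_tr sA sB; rewrite -(mulmxA A) trmx_mul sB mulNmx -(mulmxA B G) sA mulmxN opprK; exact: mulmxA.
Qed.

Lemma dot_I1 v : [/\ (v *m I1 *m G *m (v *m I1)^T) 0 0 = (v *m G *m v^T) 0 0,
  (v *m I1 *m G *m (v *m I2)^T) 0 0 = 0 & (v *m I1 *m G *m (v *m I3)^T) 0 0 = 0].
Proof.
have k1 := q_skew1 q; have k2 := q_skew2 q; have k3 := q_skew3 q.
split; rewrite q_pairing // ?(q_11 q) ?(q_12 q) ?q_13.
- by rewrite mulmxN mulmx1 !mulNmx opprK.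
- by rewrite -(mulmxA v) [LHS]mxE skew_quad // oppr0.
- by rewrite mulmxN !mulNmx opprK -(mulmxA v) skew_quad.
Qed.

Lemma tr_volume_contraction_skew xi a K : (K *m G)^T = - (K *m G) ->
  \tr (K *m I1) = 0 -> \tr (K *m I2) = 0 -> \tr (K *m I3) = 0 ->
  \tr (volume_contraction xi a *m invmx G *m K) = 4 * (xi *m K *m G) 0 a.
Proof.
move=> sK t1 t2 t3.
have gK (A : 'M[R]_4) : A *m G *m invmx G = A by rewrite mulmxK ?q_unit.
have E u v : \tr ((u *m G)^T *m (v *m G) *m invmx G *m K) = (v *m K *m G *m u^T) 0 0.
  rewrite -!mulmxA mxtrace_mulC mulKVmx ?q_unit // !mulmxA /mxtrace big_ord1.
  by rewrite trmx_mul (q_sym q) !mulmxA.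
rewrite /volume_contraction !mulmxDl -!scalemxAl !mulmxDl !mulNmx -!scalemxAl !gK.
have tN (A : 'M[R]_4) : \tr (- A) = - \tr A by exact: raddfN.
rewrite !(mxtraceD, mxtraceZ, tN) rowE !E (mxtrace_mulC I1) (mxtrace_mulC I2) (mxtrace_mulC I3) t1 t2 t3.
have p1 := mulmx_deltaT (xi *m K *m G) a.
have p2 : ((delta_mx 0 a : 'rV[R]_4) *m K *m G *m xi^T) 0 0 = - (xi *m K *m G) 0 a.
  by rewrite -p1 -!(mulmxA _ K) skew_pair.
rewrite p1 p2; set f := (xi *m K *m G) 0 a; lra.
Qed.

Lemma volume_contraction_apply xi a :
  xi *m (volume_contraction xi a - ((xi *m I1 *m G) 0 a *: (I1 *m G) + (xi *m I2 *m G) 0 a *: (I2 *m G)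
     + (xi *m I3 *m G) 0 a *: (I3 *m G))) =
  - ((xi *m I1 *m G) 0 a *: (xi *m I1 *m G) + (xi *m I2 *m G) 0 a *: (xi *m I2 *m G)
     + (xi *m I3 *m G) 0 a *: (xi *m I3 *m G)).
Proof.
have gr := congr1 (row a) (gram_expand xi).
have rT (u : 'rV[R]_4) : row a (u^T *m u) = u 0 a *: u.
  by apply/rowP => j; rewrite !mxE big_ord1 !mxE.
rewrite linearZ /= !linearD /= !rT in gr.
have e1 : xi *m (row a G)^T *m (xi *m G) = (xi *m G) 0 a *: (xi *m G).
  have -> : xi *m (row a G)^T = ((xi *m G) 0 a)%:M.
    apply: mx11P; rewrite [RHS]mxE eqxx mulr1n !mxE; apply: eq_bigr => k _; rewrite !mxE.
    by have [gs _ _ _] := q_entry; rewrite gs.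
  by rewrite mul_scalar_mx.
have e2 : xi *m ((xi *m G)^T *m row a G) = (xi *m G *m xi^T) 0 0 *: row a G.
  have -> : xi *m ((xi *m G)^T *m row a G) = ((xi *m G *m xi^T) 0 0)%:M *m row a G.
    rewrite mulmxA; congr (_ *m _); apply: mx11P; rewrite [RHS]mxE eqxx mulr1n.
    by rewrite trmx_mul (q_sym q) mulmxA.
  by rewrite mul_scalar_mx.
rewrite mulmxBr /volume_contraction mulmxDr -!scalemxAr mulmxBr (mulmxA xi (row a G)^T (xi *m G)) e1 e2 gr.
rewrite !mulmxDr -!scalemxAr !mulmxA.
by apply/rowP => j; rewrite !mxE; ring.
Qed.

End Structure.
End QuaternionicAlgebra.

Lemma std_asd (R : realFieldType) (M : 'M[R]_4) : M^T = - M -> M *m Q1 R = Q1 R *m M -> M *m Q2 R = Q2 R *m M ->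
  exists a b c, M = M4 0 a b c (- a) 0 c (- b) (- b) (- c) 0 a (- c) b (- a) 0.
Proof.
move=> /skew4_eta[a [b [c [d [e [f ->]]]]]].
rewrite /Q1 /Q2 !M4E !(@simp4 R) => /M4_inj[[h1 h2 h3 h4] [_ _ h5 h6] [_ _ h7 _] _].
move=> /M4_inj[[k1 k2 k3 k4] [_ _ k5 k6] [_ _ k7 _] _].
have dc : d = c by clear -h1 h2 h3 h4 h5 h6 h7 k1 k2 k3 k4 k5 k6 k7; lra.
have eb : e = - b by clear -h1 h2 h3 h4 h5 h6 h7 k1 k2 k3 k4 k5 k6 k7; lra.
have fa : f = a by clear -h1 h2 h3 h4 h5 h6 h7 k1 k2 k3 k4 k5 k6 k7; lra.
by exists a, b, c; rewrite dc eb fa !opprK.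
Qed.

Section AntiSelfDual.
Variables (R : realFieldType) (G I1 I2 I3 K : 'M[R]_4).
Hypothesis q : quaternionic G I1 I2 I3.
Hypothesis skK : (K *m G)^T = - (K *m G).
Hypothesis cK1 : K *m I1 = I1 *m K.
Hypothesis cK2 : K *m I2 = I2 *m K.
Variable v : 'rV[R]_4.

Local Notation n := ((v *m G *m v^T) 0 0).
Local Notation hh I := ((v *m I *m G *m (v *m K)^T) 0 0).

Lemma asd_expand : v != 0 -> exists T : 'M[R]_4,
  [/\ n *: T = M4 0 (hh I1) (hh I2) (hh I3) (- hh I1) 0 (hh I3) (- hh I2)
        (- hh I2) (- hh I3) 0 (hh I1) (- hh I3) (hh I2) (- hh I1) 0,
      frame I1 I2 I3 v *m K = T *m frame I1 I2 I3 v,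
      n *: (K *m G) = (frame I1 I2 I3 v *m G)^T *m T *m (frame I1 I2 I3 v *m G) &
      forall s, K *m K = s%:M -> T *m T = s%:M].
Proof.
move=> v_neq0; have n_gt0 := q_pos q v_neq0.
have gr := frame_gram q v; have [f1 f2 f3] := frame_mul q v.
have [r0 r1 r2 r3] : [/\ row o0 (frame I1 I2 I3 v) = v, row o1 (frame I1 I2 I3 v) = v *m I1,
    row o2 (frame I1 I2 I3 v) = v *m I2 & row o3 (frame I1 I2 I3 v) = v *m I3].
  by split; rewrite rowK.
move: gr f1 f2 f3 r0 r1 r2 r3; set F := frame I1 I2 I3 v; set k := n in n_gt0 *; clearbody F.
move=> gr f1 f2 f3 r0 r1 r2 r3.
have k0 : k != 0 by rewrite gt_eqF.
pose F' := k^-1 *: (G *m F^T).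
have FF' : F *m F' = 1%:M by rewrite /F' -scalemxAr mulmxA gr scalerA mulVf ?scale1r.
have F'F := mulmx1C FF'.
pose T := F *m K *m F'.
have kT : k *: T = F *m (K *m G) *m F^T.
  by rewrite /T /F' -scalemxAr scalerA mulfV // scale1r !mulmxA.
have FG : (F *m G)^T = k *: F' by rewrite /F' scalerA mulfV // scale1r trmx_mul (q_sym q).
clearbody F'.
have cT I Q : F *m I = Q *m F -> K *m I = I *m K -> T *m Q = Q *m T.
  move=> FI cI; rewrite -[in LHS](mulmx1 Q) -FF' (mulmxA Q) -FI /T.
  by rewrite !mulmxA -(mulmxA _ F' F) F'F mulmx1 -(mulmxA F K) cI !mulmxA FI.
have skT : T^T = - T.
  apply: (can_inj (scalerK k0)); rewrite -linearZ /= kT !trmx_mul trmxK -trmx_mul skK.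
  by rewrite scalerN kT !mulNmx !mulmxN mulmxA.
have [a [b [c E]]] := std_asd skT (cT _ _ f1 cK1) (cT _ _ f2 cK2).
have ent i : (k *: T) o0 i = (row i F *m G *m (v *m K)^T) 0 0.
  rewrite kT (_ : (_ *m _ *m _) o0 i = (row o0 F *m (K *m G) *m (row i F)^T) 0 0).
    rewrite r0 (skew_pair _ _ skK) trmx_mul [row i F *m G *m (K^T *m v^T)]mulmxA -(mulmxA _ G K^T) (skew_tr q skK) mulmxN mulNmx.
    by rewrite [RHS]mxE.
  rewrite -row_mul; set B := F *m (K *m G); rewrite !mxE; apply: eq_bigr => j _; by rewrite !mxE.
exists T; split.
- have e1 := ent o1; have e2 := ent o2; have e3 := ent o3.
  rewrite r1 in e1; rewrite r2 in e2; rewrite r3 in e3.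
  by rewrite -e1 -e2 -e3 E M4Z !mxE /= mulr0 !mulrN.
- by rewrite /T -!mulmxA F'F mulmx1.
- rewrite FG.
  by rewrite -!scalemxAl /T !mulmxA F'F mul1mx -(mulmxA K) F'F mulmx1.
- move=> s sK; rewrite /T !mulmxA -(mulmxA (F *m K) F') F'F mulmx1 -(mulmxA F K K) sK.
  by rewrite mul_mx_scalar -scalemxAl FF' scalemx1.
Qed.

End AntiSelfDual.

(** * The Levi-Civita connection of a hyper-Kaehler chart *)

Section MatrixCalculus.
Variables (R : realType) (U : set 'rV[R]_4).
Hypothesis oU : open U.

Definition partial_mx m n (a : 'I_4) (T : 'rV[R]_4 -> 'M[R]_(m, n)) x : 'M[R]_(m, n) :=
  \matrix_(i, j) partial a (fun y => T y i j) x.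

Definition smooth_mat m n (T : 'rV[R]_4 -> 'M[R]_(m, n)) :=
  forall i j, smooth_on U (fun y => T y i j).

Lemma smooth_matM m n p (A : 'rV[R]_4 -> 'M[R]_(m, n)) (B : 'rV[R]_4 -> 'M[R]_(n, p)) :
  smooth_mat A -> smooth_mat B -> smooth_mat (fun y => A y *m B y).
Proof.
move=> sA sB i j; have S : smooth_on U (fun y => \sum_k A y i k * B y k j).
  by apply: smooth_sum => // k; apply: smoothM.
by apply: smooth_ext S => // x Ux; rewrite mxE.
Qed.

Lemma smooth_matD m n (A B : 'rV[R]_4 -> 'M[R]_(m, n)) :
  smooth_mat A -> smooth_mat B -> smooth_mat (fun y => A y + B y).
Proof.
by move=> sA sB i j; apply: smooth_ext (smoothD oU (sA i j) (sB i j)) => // x Ux; rewrite mxE.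
Qed.

Lemma smooth_matN m n (A : 'rV[R]_4 -> 'M[R]_(m, n)) :
  smooth_mat A -> smooth_mat (fun y => - A y).
Proof. by move=> sA i j; apply: smooth_ext (smoothN oU (sA i j)) => // x Ux; rewrite mxE. Qed.

Lemma smooth_matZ m n (f : 'rV[R]_4 -> R) (A : 'rV[R]_4 -> 'M[R]_(m, n)) :
  smooth_on U f -> smooth_mat A -> smooth_mat (fun y => f y *: A y).
Proof.
by move=> sf sA i j; apply: smooth_ext (smoothM oU sf (sA i j)) => // x Ux; rewrite mxE.
Qed.

Lemma smooth_matT m n (A : 'rV[R]_4 -> 'M[R]_(m, n)) :
  smooth_mat A -> smooth_mat (fun y => (A y)^T).
Proof. by move=> sA i j; apply: smooth_ext (sA j i) => // x Ux; rewrite mxE. Qed.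

Lemma smooth_mat_cst m n (A : 'M[R]_(m, n)) : smooth_mat (fun=> A).
Proof. by move=> i j; exact: smooth_cst. Qed.

Lemma smooth_trace n (A : 'rV[R]_4 -> 'M[R]_n) : smooth_mat A -> smooth_on U (fun y => \tr (A y)).
Proof. by move=> sA; apply: smooth_sum => // i; exact: sA. Qed.

Lemma smooth_det n (A : 'rV[R]_4 -> 'M[R]_n) : smooth_mat A -> smooth_on U (fun y => \det (A y)).
Proof.
move=> sA; apply: smooth_sum => // s; apply: smoothM => //; first exact: smooth_cst.
by apply: smooth_prod => // i; exact: sA.
Qed.

Lemma smooth_invmx n (A : 'rV[R]_4 -> 'M[R]_n) : smooth_mat A ->
  (forall x, U x -> A x \in unitmx) -> smooth_mat (fun y => invmx (A y)).
Proof.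
move=> sA uA i j.
have S : smooth_on U (fun y => (\det (A y))^-1 * cofactor (A y) j i).
  apply: smoothM => //.
    by apply: smoothV => //; [exact: smooth_det|move=> x /uA; rewrite unitmxE unitfE].
  apply: smoothM => //; first exact: smooth_cst.
  by apply: smooth_det => k l; apply: smooth_ext (sA (lift j k) (lift i l)) => // x _; rewrite !mxE.
by apply: smooth_ext S => // x Ux; rewrite /invmx uA // !mxE.
Qed.

Lemma smooth_partial_mx m n a (A : 'rV[R]_4 -> 'M[R]_(m, n)) :
  smooth_mat A -> smooth_mat (partial_mx a A).
Proof.
by move=> sA i j; apply: smooth_ext (smooth_partial a (sA i j)) => // x _; rewrite mxE.
Qed.

Lemma partial_mx_ext m n a (A B : 'rV[R]_4 -> 'M[R]_(m, n)) x : U x ->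
  (forall y, U y -> A y = B y) -> partial_mx a A x = partial_mx a B x.
Proof.
move=> Ux AB; apply/matrixP => i j; rewrite !mxE.
by apply: (partial_ext a oU Ux) => y Uy; rewrite AB.
Qed.

Lemma partial_sum (I : finType) a (F : I -> 'rV[R]_4 -> R) x : U x ->
  (forall i, smooth_on U (F i)) -> partial a (fun y => \sum_i F i y) x = \sum_i partial a (F i) x.
Proof.
move=> Ux sF; elim: (index_enum I) => [|i r IH].
  have -> : (fun y => \sum_(i <- [::]) F i y) = (fun=> 0) by apply/funext => y; rewrite big_nil.
  by rewrite big_nil partialC.
rewrite big_cons -IH -partialD; last 2 first.
- exact: smooth_derivable (sF i) Ux.
- exact: smooth_derivable (smooth_sum oU r xpredT sF) Ux.
by congr (partial a _ x); apply/funext => y; rewrite big_cons.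
Qed.

Lemma partial_mxM m n p a (A : 'rV[R]_4 -> 'M[R]_(m, n)) (B : 'rV[R]_4 -> 'M[R]_(n, p)) x :
  smooth_mat A -> smooth_mat B -> U x ->
  partial_mx a (fun y => A y *m B y) x = partial_mx a A x *m B x + A x *m partial_mx a B x.
Proof.
move=> sA sB Ux; apply/matrixP => i j; rewrite !mxE -big_split /=.
have -> : (fun y => (A y *m B y) i j) = (fun y => \sum_k A y i k * B y k j).
  by apply/funext => y; rewrite mxE.
rewrite partial_sum //; last by move=> k; exact: smoothM.
apply: eq_bigr => k _; rewrite !mxE partialM //; [exact: smooth_derivable (sA i k) Ux|].
exact: smooth_derivable (sB k j) Ux.
Qed.

Lemma partial_mxD m n a (A B : 'rV[R]_4 -> 'M[R]_(m, n)) x : smooth_mat A -> smooth_mat B -> U x ->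
  partial_mx a (fun y => A y + B y) x = partial_mx a A x + partial_mx a B x.
Proof.
move=> sA sB Ux; apply/matrixP => i j; rewrite !mxE -partialD; last 2 first.
- exact: smooth_derivable (sA i j) Ux.
- exact: smooth_derivable (sB i j) Ux.
by congr (partial a _ x); apply/funext => y; rewrite mxE.
Qed.

Lemma partial_mxN m n a (A : 'rV[R]_4 -> 'M[R]_(m, n)) x : smooth_mat A -> U x ->
  partial_mx a (fun y => - A y) x = - partial_mx a A x.
Proof.
move=> sA Ux; apply/matrixP => i j; rewrite !mxE -partialN; last exact: smooth_derivable (sA i j) Ux.
by congr (partial a _ x); apply/funext => y; rewrite mxE.
Qed.

Lemma partial_mxZ m n a (f : 'rV[R]_4 -> R) (A : 'rV[R]_4 -> 'M[R]_(m, n)) x :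
  smooth_on U f -> smooth_mat A -> U x ->
  partial_mx a (fun y => f y *: A y) x = partial a f x *: A x + f x *: partial_mx a A x.
Proof.
move=> sf sA Ux; apply/matrixP => i j; rewrite !mxE -partialM; last 2 first.
- exact: smooth_derivable sf Ux.
- exact: smooth_derivable (sA i j) Ux.
by congr (partial a _ x); apply/funext => y; rewrite mxE.
Qed.

Lemma partial_mxT m n a (A : 'rV[R]_4 -> 'M[R]_(m, n)) x :
  partial_mx a (fun y => (A y)^T) x = (partial_mx a A x)^T.
Proof.
by apply/matrixP => i j; rewrite !mxE; congr (partial a _ x); apply/funext => y; rewrite mxE.
Qed.

Lemma partial_mx_cst m n a (A : 'M[R]_(m, n)) x : partial_mx a (fun=> A) x = 0.
Proof. by apply/matrixP => i j; rewrite !mxE partialC. Qed.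

Lemma partial_trace n a (A : 'rV[R]_4 -> 'M[R]_n) x : smooth_mat A -> U x ->
  partial a (fun y => \tr (A y)) x = \tr (partial_mx a A x).
Proof. by move=> sA Ux; rewrite partial_sum //; apply: eq_bigr => i _; rewrite mxE. Qed.

Lemma mxE_partial m n a (A : 'rV[R]_4 -> 'M[R]_(m, n)) x i j :
  partial_mx a A x i j = partial a (fun y => A y i j) x.
Proof. by rewrite mxE. Qed.

End MatrixCalculus.

Section Connection.
Variables (R : realType) (U : set 'rV[R]_4) (g : 'rV[R]_4 -> 'M[R]_4).
Hypothesis oU : open U.
Hypothesis sg : smooth_mat U g.
Hypothesis gT : forall x, U x -> (g x)^T = g x.
Hypothesis gU : forall x, U x -> g x \in unitmx.

Definition Gam a x : 'M[R]_4 := \matrix_(b, c) christoffel g x c a b.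

Lemma GamE a x i j : Gam a x i j = christoffel g x j a i.
Proof. by rewrite mxE. Qed.

Lemma metric_symm x i j : U x -> g x i j = g x j i.
Proof. by move=> /gT/matrixP/(_ j i); rewrite mxE. Qed.

Lemma partial_metric_symm x a i j : U x ->
  partial a (fun y => g y i j) x = partial a (fun y => g y j i) x.
Proof. by move=> Ux; apply: (partial_ext a oU Ux) => y Uy; exact: metric_symm. Qed.

Lemma Gam_symm a b c x : U x -> Gam a x b c = Gam b x a c.
Proof.
move=> Ux; rewrite !mxE /christoffel; congr (_ * _); apply: eq_bigr => l _; congr (_ * _).
by rewrite (partial_metric_symm l b a Ux) [X in X - _]addrC.
Qed.

Lemma Gam_lower a b c x : U x -> (Gam a x *m g x) b c =
  2^-1 * (partial a (fun y => g y c b) x + partial b (fun y => g y c a) x - partial c (fun y => g y a b) x).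
Proof.
move=> Ux; pose d l := partial a (fun y => g y l b) x + partial b (fun y => g y l a) x - partial l (fun y => g y a b) x.
have -> : (Gam a x *m g x) b c = 2^-1 * (\sum_l d l * (invmx (g x) *m g x) l c).
  rewrite mxE; under eq_bigr => k _ do rewrite mxE /christoffel -mulrA mulr_suml.
  rewrite -mulr_sumr exchange_big /=; congr (_ * _); apply: eq_bigr => l _.
  rewrite mxE mulr_sumr; apply: eq_bigr => k _; rewrite -/(d l).
  have -> : invmx (g x) k l = invmx (g x) l k.
    have : (invmx (g x))^T = invmx (g x) by rewrite trmx_inv gT.
    by move=> /matrixP/(_ l k); rewrite mxE.
  by ring.
rewrite mulVmx ?gU //; congr (_ * _).
by rewrite (bigD1 c) //= mxE eqxx mulr1 big1 ?addr0 // => l /negbTE lc; rewrite mxE lc mulr0.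
Qed.

Lemma metric_compat a x : U x -> partial_mx a g x = Gam a x *m g x + g x *m (Gam a x)^T.
Proof.
move=> Ux; have -> : g x *m (Gam a x)^T = (Gam a x *m g x)^T by rewrite trmx_mul gT.
apply/matrixP => b c; rewrite [RHS]mxE [X in _ + X]mxE !Gam_lower // mxE.
rewrite (partial_metric_symm a c b Ux) (partial_metric_symm b a c Ux) (partial_metric_symm c a b Ux).
by field.
Qed.

Lemma smooth_Gam_mat a : smooth_mat U (Gam a).
Proof.
move=> i j; have si := smooth_invmx oU sg gU.
have S : smooth_on U (fun y => christoffel g y j a i).
  apply: smoothM => //; first exact: smooth_cst.
  apply: smooth_sum => // l; apply: smoothM => //; apply: smoothB => //.
    by apply: smoothD => //; apply: smooth_partial; exact: sg.
  by apply: smooth_partial; exact: sg.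
by apply: smooth_ext S => // x _; rewrite mxE.
Qed.

Definition nabla_form a (T : 'rV[R]_4 -> 'M[R]_4) x :=
  partial_mx a T x - Gam a x *m T x - T x *m (Gam a x)^T.
Definition nabla_endo a (J : 'rV[R]_4 -> 'M[R]_4) x :=
  partial_mx a J x + J x *m Gam a x - Gam a x *m J x.
Definition nabla_vect a (v : 'rV[R]_4 -> 'rV[R]_4) x :=
  partial_mx a v x + v x *m Gam a x.

Lemma nablaE (T : 'rV[R]_4 -> 'M[R]_4) x a b c : nabla g T x a b c = nabla_form a T x b c.
Proof.
have eB (A B C : 'M[R]_4) : (A - B - C) b c = A b c - (B b c + C b c).
  by rewrite opprD addrA [LHS]mxE [X in X + _]mxE [X in _ + X + _]mxE [X in _ + _ + X]mxE.
rewrite /nabla /nabla_form eB [partial_mx _ _ _ _ _]mxE; congr (_ - _).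
rewrite 2!mxE -big_split /=; apply: eq_bigr => d _; rewrite !mxE; congr (_ + _); exact: mulrC.
Qed.

Lemma nabla_lower a J x : smooth_mat U J -> U x ->
  nabla_form a (fun y => J y *m g y) x = nabla_endo a J x *m g x.
Proof.
move=> sJ Ux; rewrite /nabla_form /nabla_endo (partial_mxM oU) // metric_compat //.
rewrite mulmxBl mulmxDl mulmxDr !mulmxA addrA.
by rewrite [X in X - _ = _]addrAC addrK.
Qed.

Lemma nabla_endoM a A B x : smooth_mat U A -> smooth_mat U B -> U x ->
  nabla_endo a (fun y => A y *m B y) x = nabla_endo a A x *m B x + A x *m nabla_endo a B x.
Proof.
move=> sA sB Ux; rewrite /nabla_endo (partial_mxM oU) //.
rewrite mulmxBl mulmxDl mulmxBr mulmxDr !mulmxA.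
set p := _ *m B x; set q' := A x *m _ ; set s := A x *m Gam a x *m B x; set t := Gam a x *m _ *m _.
set u := _ *m Gam a x.
by apply/matrixP => i j; rewrite !mxE; ring.
Qed.

Lemma nabla_form_skew a w x : smooth_mat U w -> U x -> (forall y, U y -> (w y)^T = - w y) ->
  (nabla_form a w x)^T = - nabla_form a w x.
Proof.
move=> sw Ux kw; rewrite /nabla_form !linearB /= !trmx_mul trmxK kw //.
have -> : (partial_mx a w x)^T = - partial_mx a w x.
  by rewrite -partial_mxT -(@partial_mxN _ U) //; apply: (@partial_mx_ext _ U).
by rewrite mulNmx mulmxN !opprK addrAC.
Qed.

Lemma ext_derivE w x a b c : U x -> (forall y, U y -> (w y)^T = - w y) ->
  ext_deriv w x a b c = nabla_form a w x b c + nabla_form b w x c a + nabla_form c w x a b.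
Proof.
move=> Ux kw.
have eB i j k : nabla_form i w x j k =
    partial i (fun y => w y j k) x - (Gam i x *m w x) j k + (Gam i x *m w x) k j.
  rewrite /nabla_form.
  have -> : w x *m (Gam i x)^T = - (Gam i x *m w x)^T by rewrite trmx_mul kw // mulNmx opprK.
  by rewrite opprK [LHS]mxE [X in X + _]mxE [X in _ + X]mxE mxE [X in _ + X + _]mxE.
have gs i j k : (Gam i x *m w x) j k = (Gam j x *m w x) i k.
  by rewrite !mxE; apply: eq_bigr => l _; rewrite Gam_symm.
have alg (p q r s t u : R) : p + q + r = p - s + t + (q - u + s) + (r - t + u) by ring.
rewrite /ext_deriv; apply: etrans (alg _ _ _ ((Gam a x *m w x) b c) ((Gam a x *m w x) c b) ((Gam b x *m w x) c a)) _.
congr (_ + _ + _).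
- exact: esym (eB a b c).
- by apply: etrans _ (esym (eB b c a)); congr (_ - _ + _); exact: gs.
- by apply: etrans _ (esym (eB c a b)); congr (_ - _ + _); exact: gs.
Qed.

Lemma nabla_endo_ext a A B x : U x -> (forall y, U y -> A y = B y) ->
  nabla_endo a A x = nabla_endo a B x.
Proof. by move=> Ux AB; rewrite /nabla_endo (@partial_mx_ext _ U oU _ _ a A B x Ux AB) AB. Qed.

Lemma nabla_endo_cst a (A : 'M[R]_4) x : nabla_endo a (fun=> A) x = A *m Gam a x - Gam a x *m A.
Proof. by rewrite /nabla_endo partial_mx_cst add0r. Qed.

Lemma nabla_endoN a A x : smooth_mat U A -> U x -> nabla_endo a (fun y => - A y) x = - nabla_endo a A x.
Proof.
by move=> sA Ux; rewrite /nabla_endo (@partial_mxN _ U) // mulNmx mulmxN opprB opprD opprK addrC addrA addrAC addrC addrA.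
Qed.

Lemma nabla_endoD a A B x : smooth_mat U A -> smooth_mat U B -> U x ->
  nabla_endo a (fun y => A y + B y) x = nabla_endo a A x + nabla_endo a B x.
Proof.
move=> sA sB Ux; rewrite /nabla_endo (@partial_mxD _ U) // mulmxDl mulmxDr opprD.
have E (p p' q q' s s' : 'M[R]_4) : p + p' + (q + q') + (s + s') = p + q + s + (p' + q' + s').
  by apply/matrixP => i j; rewrite !mxE; ring.
exact: E.
Qed.

Lemma nabla_endoZ a f A x : smooth_on U f -> smooth_mat U A -> U x ->
  nabla_endo a (fun y => f y *: A y) x = partial a f x *: A x + f x *: nabla_endo a A x.
Proof.
move=> sf sA Ux; rewrite /nabla_endo (@partial_mxZ _ U) // -scalemxAl -scalemxAr.
by rewrite -addrA -addrA -scalerBr -scalerDr addrA.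
Qed.

Lemma nabla_form_ext a T S x : U x -> (forall y, U y -> T y = S y) ->
  nabla_form a T x = nabla_form a S x.
Proof. by move=> Ux TS; rewrite /nabla_form (@partial_mx_ext _ U oU _ _ a T S x Ux TS) TS. Qed.

Lemma trace_nabla a (M : 'rV[R]_4 -> 'M[R]_4) x : \tr (nabla_endo a M x) = \tr (partial_mx a M x).
Proof. by rewrite /nabla_endo linearB linearD /= mxtrace_mulC addrK. Qed.

Lemma partial_nabla_vect a v x : partial_mx a v x = nabla_vect a v x - v x *m Gam a x.
Proof. by rewrite /nabla_vect addrK. Qed.

Lemma partial_nabla_endo a J x : partial_mx a J x = nabla_endo a J x + Gam a x *m J x - J x *m Gam a x.
Proof. by rewrite /nabla_endo addrNK addrK. Qed.

Lemma partial_covector a v J x : smooth_mat U v -> smooth_mat U J -> U x ->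
  partial_mx a (fun y => v y *m J y *m g y) x =
  nabla_vect a v x *m J x *m g x + v x *m nabla_endo a J x *m g x + v x *m J x *m g x *m (Gam a x)^T.
Proof.
move=> sv sJ Ux; have svJ := smooth_matM oU sv sJ.
rewrite (@partial_mxM _ U) // (@partial_mxM _ U oU _ _ _ a v J) // metric_compat //.
rewrite partial_nabla_vect partial_nabla_endo.
rewrite !(mulmxBr, mulmxDl, mulmxDr, mulmxBl, mulmxN, mulNmx, mulmxA).
have E (p q r s t u : 'rV[R]_4) : p - q + (r + q - s) + (s + t) = p + r + t.
  by apply/rowP => j; rewrite !mxE; ring.
exact: E.
Qed.

Lemma partial_vect_endo a v J x : smooth_mat U v -> smooth_mat U J -> U x ->
  partial_mx a (fun y => v y *m J y) x =
  nabla_vect a v x *m J x + v x *m nabla_endo a J x - v x *m J x *m Gam a x.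
Proof.
move=> sv sJ Ux; rewrite (@partial_mxM _ U oU _ _ _ a v J) // partial_nabla_vect partial_nabla_endo.
rewrite !(mulmxBr, mulmxDl, mulmxDr, mulmxBl, mulmxN, mulNmx, mulmxA).
have E (p q r s : 'rV[R]_4) : p - q + (r + q - s) = p + r - s.
  by apply/rowP => j; rewrite !mxE; ring.
exact: E.
Qed.

Lemma Gam_covector_symm (w : 'rV[R]_4) a b x : U x ->
  (w *m (Gam a x)^T) 0 b = (w *m (Gam b x)^T) 0 a.
Proof.
by move=> Ux; rewrite !mxE; apply: eq_bigr => c _; rewrite [(Gam a x)^T _ _]mxE [(Gam b x)^T _ _]mxE Gam_symm.
Qed.

End Connection.

Lemma nabla_formE (R : realType) (g : 'rV[R]_4 -> 'M[R]_4) a (T : 'rV[R]_4 -> 'M[R]_4) x :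
  nabla_form g a T x = partial_mx a T x - Gam g a x *m T x - T x *m (Gam g a x)^T.
Proof. by []. Qed.

Opaque nabla_form nabla_endo Gam partial_mx.

Section HyperkahlerChart.
Variables (R : realType) (U : set 'rV[R]_4) (g J1 J2 J3 : 'rV[R]_4 -> 'M[R]_4).

Record hk_chart : Prop := HkChart {
  hk_open : open U;
  hk_g : smooth_mat U g;
  hk_J1 : smooth_mat U J1;
  hk_J2 : smooth_mat U J2;
  hk_J3 : smooth_mat U J3;
  hk_q : forall x, U x -> quaternionic (g x) (J1 x) (J2 x) (J3 x);
  hk_d1 : forall x, U x -> forall a b c, ext_deriv (fun y => J1 y *m g y) x a b c = 0;
  hk_d2 : forall x, U x -> forall a b c, ext_deriv (fun y => J2 y *m g y) x a b c = 0;
  hk_d3 : forall x, U x -> forall a b c, ext_deriv (fun y => J3 y *m g y) x a b c = 0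
}.
End HyperkahlerChart.

Section HyperkahlerConnection.
Variables (R : realType) (U : set 'rV[R]_4) (g J1 J2 J3 : 'rV[R]_4 -> 'M[R]_4).
Hypothesis hk : hk_chart U g J1 J2 J3.

Lemma hk_rot : hk_chart U g J2 J3 J1.
Proof. by case: hk => *; split=> // x Ux; apply: q_rot; auto. Qed.

Lemma hk_sym x : U x -> (g x)^T = g x.
Proof. by move=> /(hk_q hk)/q_sym. Qed.
Lemma hk_unit x : U x -> g x \in unitmx.
Proof. by move=> /(hk_q hk)/q_unit. Qed.

Let oU := hk_open hk.
Let sg := hk_g hk.

Lemma parallel_J x a : U x -> [/\ nabla_endo g a J1 x = 0, nabla_endo g a J2 x = 0 & nabla_endo g a J3 x = 0].
Proof.
move=> Ux; have q := hk_q hk Ux; have s1 := hk_J1 hk; have s2 := hk_J2 hk; have s3 := hk_J3 hk.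
have low J b : smooth_mat U J -> nabla_form g b (fun y => J y *m g y) x = nabla_endo g b J x *m g x.
  by move=> sJ; apply: (nabla_lower oU) => //; [exact: hk_sym|exact: hk_unit].
have sk J b : smooth_mat U J -> (forall y, U y -> (J y *m g y)^T = - (J y *m g y)) ->
    (nabla_endo g b J x *m g x)^T = - (nabla_endo g b J x *m g x).
  move=> sJ kJ; rewrite -low //; apply: (@nabla_form_skew R U g oU b (fun y => J y *m g y) x) => //.
  exact: smooth_matM.
have cl J b c d : smooth_mat U J -> (forall y, U y -> (J y *m g y)^T = - (J y *m g y)) ->
    ext_deriv (fun y => J y *m g y) x b c d = 0 ->
    (nabla_endo g b J x *m g x) c d + (nabla_endo g c J x *m g x) d b + (nabla_endo g d J x *m g x) b c = 0.
  move=> sJ kJ dJ; apply: etrans _ dJ.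
  rewrite (@ext_derivE R U g oU hk_sym (fun y => J y *m g y) x b c d Ux kJ).
  by rewrite (low J b sJ) (low J c sJ) (low J d sJ).
have nM A B C b : smooth_mat U A -> smooth_mat U B -> (forall y, U y -> A y *m B y = C y) ->
    nabla_endo g b A x *m B x + A x *m nabla_endo g b B x = nabla_endo g b C x.
  move=> sA sB ABC; rewrite -(@nabla_endoM R U g oU b A B x sA sB Ux); exact: (@nabla_endo_ext R U g oU b _ _ x).
have nC b (c : 'M[R]_4) : (forall A : 'M[R]_4, c *m A = A *m c) -> nabla_endo g b (fun=> c) x = 0.
  by move=> cc; rewrite nabla_endo_cst cc subrr.
have cc : forall A : 'M[R]_4, - 1%:M *m A = A *m - 1%:M by move=> A; rewrite mulNmx mulmxN mul1mx mulmx1.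
move: a; apply: (@closed_forms_parallel R (g x) (J1 x) (J2 x) (J3 x) q (fun b => nabla_endo g b J1 x)
  (fun b => nabla_endo g b J2 x) (fun b => nabla_endo g b J3 x)).
- by move=> b; apply: sk => // y /(hk_q hk)/q_skew1.
- by move=> b; apply: sk => // y /(hk_q hk)/q_skew2.
- by move=> b; rewrite (nM _ _ (fun=> - 1%:M)) ?nC // => y /(hk_q hk)/q_11.
- by move=> b; rewrite (nM _ _ (fun=> - 1%:M)) ?nC // => y /(hk_q hk)/q_22.
- by move=> b; apply: nM => // y /(hk_q hk)/q_12.
- move=> b; rewrite (nM _ _ (fun y => - J3 y) b s2 s1); last by move=> y /(hk_q hk)/q_21.
  exact: (@nabla_endoN R U g b J3 x).
- by move=> b c d; apply: cl (hk_d1 hk _ _ _ _) => // y /(hk_q hk)/q_skew1.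
- by move=> b c d; apply: cl (hk_d2 hk _ _ _ _) => // y /(hk_q hk)/q_skew2.
- by move=> b c d; apply: cl (hk_d3 hk _ _ _ _) => // y /(hk_q hk)/q_skew3.
Qed.

End HyperkahlerConnection.

(** * Killing-Yano forms on a chart *)

Section KillingYanoDefs.
Variables (R : realType) (g J1 J2 J3 Y : 'rV[R]_4 -> 'M[R]_4).

(* Kend raises an index of Y; moment J is the component of Y along the form J *m g. *)
Definition Kend y : 'M[R]_4 := Y y *m invmx (g y).
Definition moment (J : 'rV[R]_4 -> 'M[R]_4) y : R := - (\tr (Kend y *m J y) / 4).
Definition dmoment J y : 'rV[R]_4 := \row_a partial a (moment J) y.
Definition kvect y : 'rV[R]_4 := - (dmoment J1 y *m invmx (g y) *m J1 y).
Definition Kasd y : 'M[R]_4 :=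
  Kend y - (moment J1 y *: J1 y + moment J2 y *: J2 y + moment J3 y *: J3 y).
Definition kform y : 'rV[R]_4 := kvect y *m g y.
Definition Aend y : 'M[R]_4 := \matrix_a nabla_vect g a kvect y.
Definition knorm y : R := (kvect y *m g y *m (kvect y)^T) 0 0.
Definition S2 y : R := - (\tr (Kasd y *m Kasd y) / 4).
Definition mu y : R := - (\tr (Aend y *m Kasd y) / 4).
Definition hfun (J : 'rV[R]_4 -> 'M[R]_4) y : R := (kvect y *m J y *m g y *m (kvect y *m Kasd y)^T) 0 0.

End KillingYanoDefs.

Section KillingYano.
Variables (R : realType) (U : set 'rV[R]_4) (g J1 J2 J3 Y : 'rV[R]_4 -> 'M[R]_4).
Hypothesis hk : hk_chart U g J1 J2 J3.
Hypothesis sY : smooth_mat U Y.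
Hypothesis Yskew : forall x, U x -> (Y x)^T = - Y x.
Hypothesis KY : forall x, U x -> forall a b c, nabla g Y x a b c + nabla g Y x b a c = 0.

Let oU := hk_open hk.
Let sg := hk_g hk.
Let s1 := hk_J1 hk.
Let s2 := hk_J2 hk.
Let s3 := hk_J3 hk.
Let gT := hk_sym hk.
Let gU := hk_unit hk.

Notation Ken := (Kend g Y).
Notation f := (moment g Y).
Notation df := (dmoment g Y).
Notation xi := (kvect g J1 Y).
Notation K := (Kasd g J1 J2 J3 Y).
Notation A := (Aend g J1 Y).

Lemma smooth_Kend : smooth_mat U Ken.
Proof. by apply: smooth_matM => //; apply: smooth_invmx. Qed.

Lemma smooth_moment J : smooth_mat U J -> smooth_on U (f J).
Proof.
move=> sJ; have S : smooth_on U (fun y => \tr (Ken y *m J y)).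
  by apply: smooth_trace => //; apply: smooth_matM => //; exact: smooth_Kend.
have := smoothM oU (smooth_cst oU (- 4^-1)) S.
by apply: smooth_ext => // x Ux; rewrite /moment mulNr mulrC.
Qed.

Lemma smooth_dmoment J : smooth_mat U J -> smooth_mat U (df J).
Proof.
move=> sJ i j; apply: smooth_ext (smooth_partial j (smooth_moment sJ)) => // x Ux; by rewrite mxE.
Qed.

Lemma smooth_kvect : smooth_mat U xi.
Proof.
apply: smooth_matN => //; apply: smooth_matM => //; apply: smooth_matM => //; first exact: smooth_dmoment.
exact: smooth_invmx.
Qed.

Lemma smooth_Kasd : smooth_mat U K.
Proof.
apply: smooth_matD => //; first exact: smooth_Kend.
apply: smooth_matN => //; apply: smooth_matD => //.
  by apply: smooth_matD => //; apply: smooth_matZ => //; exact: smooth_moment.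
by apply: smooth_matZ => //; exact: smooth_moment.
Qed.

Lemma KendK x : U x -> Ken x *m g x = Y x.
Proof. by move=> Ux; rewrite /Kend mulmxKV ?gU. Qed.

Lemma nabla_Kend a x : U x -> nabla_endo g a Ken x *m g x = nabla_form g a Y x.
Proof.
move=> Ux; rewrite -(@nabla_lower R U g oU sg gT gU a Ken x smooth_Kend Ux).
by apply: (@nabla_form_ext R U g oU) => // y Uy; rewrite KendK.
Qed.

Lemma partial_moment a J x : smooth_mat U J -> U x -> nabla_endo g a J x = 0 ->
  partial a (f J) x = - (\tr (nabla_form g a Y x *m invmx (g x) *m J x) / 4).
Proof.
move=> sJ Ux pJ; have sK := smooth_Kend.
have S : smooth_mat U (fun y => Ken y *m J y) by exact: smooth_matM.
have -> : partial a (f J) x = partial a (fun y => - 4^-1 * \tr (Ken y *m J y)) x.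
  by apply: (partial_ext a oU Ux) => y _; rewrite /moment mulNr mulrC.
rewrite partialM; last 2 first.
- exact: derivable_cst.
- exact: smooth_derivable (smooth_trace oU S) Ux.
rewrite partialC mul0r add0r (partial_trace oU) // -(trace_nabla g).
rewrite (@nabla_endoM R U g oU a Ken J x sK sJ Ux) pJ mulmx0 addr0 -nabla_Kend // mulmxK ?gU //.
by rewrite mulNr mulrC.
Qed.

Lemma nabla_Y x : U x ->
  [/\ forall a, nabla_form g a Y x = volume_contraction (g x) (J1 x) (J2 x) (J3 x) (xi x) a,
      df J1 x = xi x *m J1 x *m g x, df J2 x = xi x *m J2 x *m g x & df J3 x = xi x *m J3 x *m g x].
Proof.
move=> Ux; have q := hk_q hk Ux.
have [v vE] : exists v, forall a, nabla_form g a Y x = volume_contraction (g x) (J1 x) (J2 x) (J3 x) v a.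
  apply: (three_form_decomp q (T := fun a => nabla_form g a Y x)).
    by move=> a; apply: (@nabla_form_skew R U g oU a Y x).
  move=> a b c; have := KY Ux a b c; rewrite !nablaE => /eqP; rewrite addr_eq0 => /eqP //.
have vr a : volume_contraction (g x) (J1 x) (J2 x) (J3 x) v a = volume_contraction (g x) (J2 x) (J3 x) (J1 x) v a.
  by rewrite /volume_contraction; congr (_ + _ *: _); rewrite -addrA addrC.
have vr' a : volume_contraction (g x) (J2 x) (J3 x) (J1 x) v a = volume_contraction (g x) (J3 x) (J1 x) (J2 x) v a.
  by rewrite /volume_contraction; congr (_ + _ *: _); rewrite -addrA addrC.
have q2 := q_rot q; have q3 := q_rot q2.
have E (k : R) : - (- 4 * k / 4) = k by field.
have d1 : df J1 x = v *m J1 x *m g x.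
  apply/rowP => a; have [p1 _ _] := parallel_J hk a Ux.
  by rewrite mxE (partial_moment s1) // vE tr_volume_contraction.
have d2 : df J2 x = v *m J2 x *m g x.
  apply/rowP => a; have [_ p2 _] := parallel_J hk a Ux.
  by rewrite mxE (partial_moment s2) // vE vr tr_volume_contraction.
have d3 : df J3 x = v *m J3 x *m g x.
  apply/rowP => a; have [_ _ p3] := parallel_J hk a Ux.
  by rewrite mxE (partial_moment s3) // vE vr vr' tr_volume_contraction.
have xv : xi x = v.
  by rewrite /kvect d1 mulmxK ?gU // -mulmxA (q_11 q) mulmxN mulmx1 opprK.
by rewrite xv; split.
Qed.

Notation b := (kform g J1 Y).
Notation N := (knorm g J1 Y).
Notation S := (S2 g J1 J2 J3 Y).
Notation m := (mu g J1 J2 J3 Y).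
Notation h := (hfun g J1 J2 J3 Y).
Notation phi J x := (xi x *m J x *m g x).

Lemma Kasd_skew x : U x -> (K x *m g x)^T = - (K x *m g x).
Proof.
move=> Ux; have q := hk_q hk Ux; rewrite /Kasd mulmxBl KendK // !mulmxDl -!scalemxAl.
rewrite [LHS]linearB /= Yskew // !linearD !linearZ /= (q_skew1 q) (q_skew2 q) (q_skew3 q) !scalerN.
by [].
Qed.

Lemma Kasd_trace x : U x -> [/\ \tr (K x *m J1 x) = 0, \tr (K x *m J2 x) = 0 & \tr (K x *m J3 x) = 0].
Proof.
move=> Ux; have q := hk_q hk Ux; have [t1 t2 t3] := tr_I q.
have tN (B : 'M[R]_4) : \tr (- B) = - \tr B by exact: raddfN.
have tB (B C : 'M[R]_4) : \tr (B - C) = \tr B - \tr C by exact: raddfB.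
rewrite /Kasd !mulmxBl !mulmxDl -!scalemxAl !(tB, mxtraceD, mxtraceZ) (q_11 q) (q_22 q) (q_33 q)
  (q_12 q) (q_21 q) (q_13 q) (q_31 q) (q_23 q) (q_32 q) !tN mxtrace1 t1 t2 t3 /moment.
by split; field.
Qed.

Lemma Kasd_comm x : U x -> [/\ K x *m J1 x = J1 x *m K x, K x *m J2 x = J2 x *m K x & K x *m J3 x = J3 x *m K x].
Proof.
move=> Ux; have [t1 t2 t3] := Kasd_trace Ux.
exact: (skew_commute (hk_q hk Ux) (Kasd_skew Ux)).
Qed.

Lemma Kasd_sqr x : U x -> K x *m K x = - (S x)%:M.
Proof.
move=> Ux; have q := hk_q hk Ux; have [c1 c2 _] := Kasd_comm Ux; have sk := Kasd_skew Ux.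
rewrite [LHS](commuting_sym_scalar q).
- by rewrite /S2 raddfN /= opprK.
- exact: (skew_mul_tr q sk sk).
- by rewrite -mulmxA c1 mulmxA c1 mulmxA.
- by rewrite -mulmxA c2 mulmxA c2 mulmxA.
Qed.

Lemma nabla_Kasd a x : U x -> nabla_endo g a K x *m g x =
  volume_contraction (g x) (J1 x) (J2 x) (J3 x) (xi x) a -
  ((phi J1 x) 0 a *: (J1 x *m g x) + (phi J2 x) 0 a *: (J2 x *m g x) + (phi J3 x) 0 a *: (J3 x *m g x)).
Proof.
move=> Ux; have [vc d1 d2 d3] := nabla_Y Ux; have [p1 p2 p3] := parallel_J hk a Ux.
have sK := smooth_Kend; have m1 := smooth_moment s1; have m2 := smooth_moment s2; have m3 := smooth_moment s3.
have z1 : smooth_mat U (fun y => f J1 y *: J1 y) by exact: smooth_matZ.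
have z2 : smooth_mat U (fun y => f J2 y *: J2 y) by exact: smooth_matZ.
have z3 : smooth_mat U (fun y => f J3 y *: J3 y) by exact: smooth_matZ.
have z12 : smooth_mat U (fun y => f J1 y *: J1 y + f J2 y *: J2 y) by exact: smooth_matD.
have z123 : smooth_mat U (fun y => f J1 y *: J1 y + f J2 y *: J2 y + f J3 y *: J3 y) by exact: smooth_matD.
have z0 := smooth_matN oU z123.
have E J : (df J x) 0 a = partial a (f J) x by rewrite mxE.
rewrite /Kasd (@nabla_endoD R U g a _ _ x sK z0 Ux) (@nabla_endoN R U g a _ x z123 Ux).
rewrite (@nabla_endoD R U g a _ _ x z12 z3 Ux) (@nabla_endoD R U g a _ _ x z1 z2 Ux).
rewrite (@nabla_endoZ R U g a _ _ x m1 s1 Ux) (@nabla_endoZ R U g a _ _ x m2 s2 Ux) (@nabla_endoZ R U g a _ _ x m3 s3 Ux).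
by rewrite p1 p2 p3 !scaler0 !addr0 -!E d1 d2 d3 mulmxBl nabla_Kend // vc !mulmxDl -!scalemxAl.
Qed.

Lemma row_Aend a x : row a (A x) = nabla_vect g a xi x.
Proof. by rewrite /Aend rowK. Qed.

Lemma partial_phi a J x : smooth_mat U J -> U x -> nabla_endo g a J x = 0 ->
  partial_mx a (fun y => phi J y) x = row a (A x) *m J x *m g x + phi J x *m (Gam g a x)^T.
Proof.
move=> sJ Ux pJ; rewrite (@partial_covector R U g oU sg gT gU a xi J x smooth_kvect sJ Ux) pJ.
by rewrite mulmx0 mul0mx addr0 row_Aend.
Qed.

Lemma phi_sym J x : smooth_mat U J -> U x -> (forall a, nabla_endo g a J x = 0) ->
  (forall y, U y -> df J y = phi J y) -> (A x *m J x *m g x)^T = A x *m J x *m g x.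
Proof.
move=> sJ Ux pJ dJ; apply/matrixP => i j; rewrite mxE.
have E a c : (A x *m J x *m g x) a c = partial a (partial c (f J)) x - (phi J x *m (Gam g a x)^T) 0 c.
  have -> : (A x *m J x *m g x) a c = (row a (A x) *m J x *m g x) 0 c by rewrite -!row_mul [RHS]mxE.
  have -> : partial a (partial c (f J)) x = (partial_mx a (fun y => phi J y) x) 0 c.
    rewrite [RHS]mxE_partial; apply: (partial_ext a oU Ux) => y Uy.
    by rewrite -dJ // mxE.
  by rewrite (partial_phi sJ) // [X in _ = X - _]mxE addrK.
rewrite !E (schwarz i j oU (smooth_moment sJ) Ux); congr (_ - _).
exact: (@Gam_covector_symm R U g oU gT).
Qed.

Lemma Aend_comm x : U x -> [/\ A x *m J1 x = J1 x *m A x, A x *m J2 x = J2 x *m A x,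
  A x *m J3 x = J3 x *m A x & (A x *m g x)^T = - (A x *m g x)].
Proof.
move=> Ux; apply: (commute_of_sym (hk_q hk Ux)); apply: phi_sym => //.
- by move=> a; have [] := parallel_J hk a Ux.
- by move=> y /nabla_Y[].
- by move=> a; have [] := parallel_J hk a Ux.
- by move=> y /nabla_Y[].
- by move=> a; have [] := parallel_J hk a Ux.
- by move=> y /nabla_Y[].
Qed.

End KillingYano.

Section KillingYano.
Variables (R : realType) (U : set 'rV[R]_4) (g J1 J2 J3 Y : 'rV[R]_4 -> 'M[R]_4).
Hypothesis hk : hk_chart U g J1 J2 J3.
Hypothesis sY : smooth_mat U Y.
Hypothesis Yskew : forall x, U x -> (Y x)^T = - Y x.
Hypothesis KY : forall x, U x -> forall a b c, nabla g Y x a b c + nabla g Y x b a c = 0.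

Let oU := hk_open hk.
Let sg := hk_g hk.
Let s1 := hk_J1 hk.
Let s2 := hk_J2 hk.
Let s3 := hk_J3 hk.
Let gT := hk_sym hk.
Let gU := hk_unit hk.

Notation Ken := (Kend g Y).
Notation f := (moment g Y).
Notation df := (dmoment g Y).
Notation xi := (kvect g J1 Y).
Notation K := (Kasd g J1 J2 J3 Y).
Notation A := (Aend g J1 Y).

Notation b := (kform g J1 Y).
Notation N := (knorm g J1 Y).
Notation S := (S2 g J1 J2 J3 Y).
Notation m := (mu g J1 J2 J3 Y).
Notation h := (hfun g J1 J2 J3 Y).
Notation phi J x := (xi x *m J x *m g x).

Let sxi := smooth_kvect hk sY.
Let sK := smooth_Kasd hk sY.

Lemma smooth_Gam a : smooth_mat U (Gam g a).
Proof. exact: smooth_Gam_mat. Qed.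

Lemma smooth_Aend : smooth_mat U A.
Proof.
move=> i j.
have H : smooth_mat U (fun y => partial_mx i xi y + xi y *m Gam g i y).
  by apply: smooth_matD => //; [exact: smooth_partial_mx|apply: smooth_matM => //; exact: smooth_Gam].
by apply: smooth_ext (H 0 j) => // x Ux; rewrite /Aend -[RHS]/(_) [RHS]mxE.
Qed.

Lemma smooth_kform : smooth_mat U b.
Proof. exact: smooth_matM. Qed.

Lemma smooth_phi J : smooth_mat U J -> smooth_mat U (fun x => phi J x).
Proof. by move=> sJ; apply: smooth_matM => //; apply: smooth_matM. Qed.

Lemma smooth_zeta : smooth_mat U (fun x => xi x *m K x *m g x).
Proof. by apply: smooth_matM => //; apply: smooth_matM. Qed.

Lemma smooth_S2 : smooth_on U S.
Proof.
have H : smooth_on U (fun y => \tr (K y *m K y)) by apply: smooth_trace => //; exact: smooth_matM.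
have := smoothM oU (smooth_cst oU (- 4^-1)) H.
by apply: smooth_ext => // x Ux; rewrite /S2 mulNr mulrC.
Qed.

Lemma smooth_mu : smooth_on U m.
Proof.
have H : smooth_on U (fun y => \tr (A y *m K y)).
  by apply: smooth_trace => //; apply: smooth_matM => //; exact: smooth_Aend.
have := smoothM oU (smooth_cst oU (- 4^-1)) H.
by apply: smooth_ext => // x Ux; rewrite /mu mulNr mulrC.
Qed.

Lemma smooth_knorm : smooth_on U N.
Proof.
have H : smooth_mat U (fun y => xi y *m g y *m (xi y)^T).
  by apply: smooth_matM => //; [exact: smooth_kform|exact: smooth_matT].
exact: H.
Qed.

Lemma smooth_hfun J : smooth_mat U J -> smooth_on U (h J).
Proof.
move=> sJ; have H : smooth_mat U (fun y => xi y *m J y *m g y *m (xi y *m K y)^T).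
  exact: (smooth_matM oU (smooth_phi sJ) (smooth_matT oU (smooth_matM oU sxi sK))).
exact: H.
Qed.

Lemma partial_S2 a x : U x -> partial a S x = - 2 * (xi x *m K x *m g x) 0 a.
Proof.
move=> Ux; have q := hk_q hk Ux; have [t1 t2 t3] := Kasd_trace Y hk Ux.
have tcm (B C : 'M[R]_4) : \tr (B *m C) = \tr (C *m B) by exact: mxtrace_mulC.
have sKK : smooth_mat U (fun y => K y *m K y) by exact: smooth_matM.
have -> : partial a S x = partial a (fun y => - 4^-1 * \tr (K y *m K y)) x.
  by apply: (partial_ext a oU Ux) => y _; rewrite /S2 mulNr mulrC.
rewrite partialM; last 2 first.
- exact: derivable_cst.
- exact: smooth_derivable (smooth_trace oU sKK) Ux.
rewrite partialC mul0r add0r (partial_trace oU) // -(trace_nabla g).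
rewrite (@nabla_endoM R U g oU a K K x sK sK Ux) mxtraceD (tcm (K x)).
have -> : nabla_endo g a K x = nabla_endo g a K x *m g x *m invmx (g x) by rewrite mulmxK ?gU.
have VC := tr_volume_contraction_skew q (xi x) a (Kasd_skew hk Yskew Ux) t1 t2 t3.
rewrite (nabla_Kasd hk sY Yskew KY) //; move: VC; set W := volume_contraction _ _ _ _ _ _; clearbody W => VC.
rewrite !mulmxBl !mulmxDl -!scalemxAl !(mulmxK (gU Ux)).
have tB (B C : 'M[R]_4) : \tr (B - C) = \tr B - \tr C by exact: raddfB.
rewrite tB !mxtraceD !mxtraceZ (tcm (J1 x)) (tcm (J2 x)) (tcm (J3 x)) t1 t2 t3 VC.
by set z := (xi x *m K x *m g x) 0 a; field.
Qed.

Lemma xi_nabla_K a x : U x -> xi x *m nabla_endo g a K x *m g x =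
  - ((phi J1 x) 0 a *: phi J1 x + (phi J2 x) 0 a *: phi J2 x + (phi J3 x) 0 a *: phi J3 x).
Proof.
by move=> Ux; rewrite -mulmxA (nabla_Kasd hk sY Yskew KY) // (volume_contraction_apply (hk_q hk Ux)).
Qed.

Lemma partial_zeta a x : U x -> partial_mx a (fun y => xi y *m K y *m g y) x =
  row a (A x) *m K x *m g x
  - ((phi J1 x) 0 a *: phi J1 x + (phi J2 x) 0 a *: phi J2 x + (phi J3 x) 0 a *: phi J3 x)
  + xi x *m K x *m g x *m (Gam g a x)^T.
Proof.
by move=> Ux; rewrite (@partial_covector R U g oU sg gT gU a xi K x sxi sK Ux) xi_nabla_K // row_Aend.
Qed.

Lemma AendKasd x : U x -> A x *m K x = - (m x)%:M.
Proof.
move=> Ux; have q := hk_q hk Ux; have skK := Kasd_skew hk Yskew Ux.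
have [a1 a2 a3 skA] := Aend_comm hk sY Yskew KY Ux; have [c1 c2 c3] := Kasd_comm hk Yskew Ux.
have sym : (A x *m K x *m g x)^T = A x *m K x *m g x.
  apply/matrixP => i j; rewrite mxE.
  have E a c : (A x *m K x *m g x) a c = - 2^-1 * partial a (partial c S) x
      + ((phi J1 x) 0 a * (phi J1 x) 0 c + (phi J2 x) 0 a * (phi J2 x) 0 c + (phi J3 x) 0 a * (phi J3 x) 0 c)
      - (xi x *m K x *m g x *m (Gam g a x)^T) 0 c.
    have -> : (A x *m K x *m g x) a c = (row a (A x) *m K x *m g x) 0 c by rewrite -!row_mul [RHS]mxE.
    have -> : partial a (partial c S) x = - 2 * (partial_mx a (fun y => xi y *m K y *m g y) x) 0 c.
      rewrite [X in _ * X]mxE_partial.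
      have -> : partial a (partial c S) x = partial a (fun y => - 2 * (xi y *m K y *m g y) 0 c) x.
        by apply: (partial_ext a oU Ux) => y Uy; rewrite partial_S2.
      rewrite partialM; last 2 first.
      - exact: derivable_cst.
      - exact: smooth_derivable (smooth_zeta 0 c) Ux.
      by rewrite partialC mul0r add0r.
    have eD (B C : 'rV[R]_4) : (B + C) 0 c = B 0 c + C 0 c by rewrite mxE.
    have eN (B : 'rV[R]_4) : (- B) 0 c = - B 0 c by rewrite mxE.
    have eZ (k : R) (B : 'rV[R]_4) : (k *: B) 0 c = k * B 0 c by rewrite mxE.
    rewrite partial_zeta // !(eD, eN, eZ).
    set p := (row a _ *m _ *m _) 0 c; set r := (_ *m (Gam g a x)^T) 0 c.
    by field.
  rewrite !E (schwarz i j oU smooth_S2 Ux) (@Gam_covector_symm R U g oU gT _ i j x Ux).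
  by congr (_ + _ - _); rewrite [(phi J1 x) 0 i * _]mulrC [(phi J2 x) 0 i * _]mulrC [(phi J3 x) 0 i * _]mulrC.
rewrite [LHS](commuting_sym_scalar q sym).
- by rewrite /mu raddfN /= opprK.
- by rewrite -mulmxA c1 mulmxA a1 mulmxA.
- by rewrite -mulmxA c2 mulmxA a2 mulmxA.
Qed.

Lemma S2_Aend x : U x -> S x *: A x = m x *: K x.
Proof.
move=> Ux; have := congr1 (fun B => B *m K x) (AendKasd Ux).
rewrite -mulmxA (Kasd_sqr hk Yskew) // mulmxN mulNmx mul_mx_scalar mul_scalar_mx => /eqP.
by rewrite eqr_opp => /eqP.
Qed.

Lemma partial_knorm a x : U x -> partial a N x = - 2 * (xi x *m A x *m g x) 0 a.
Proof.
move=> Ux; have q := hk_q hk Ux; have [_ _ _ skA] := Aend_comm hk sY Yskew KY Ux.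
have -> : partial a N x = (partial_mx a (fun y => xi y *m g y *m (xi y)^T) x) 0 0 by rewrite mxE_partial.
have s1m : smooth_mat U (fun=> (1%:M : 'M[R]_4)) by exact: smooth_mat_cst.
have n1 : nabla_endo g a (fun=> 1%:M) x = 0 by rewrite nabla_endo_cst mul1mx mulmx1 subrr.
have sb := smooth_kform.
rewrite (@partial_mxM R U oU _ _ _ a b (fun y => (xi y)^T) x sb (smooth_matT oU sxi) Ux) partial_mxT.
have -> : partial_mx a b x = row a (A x) *m g x + xi x *m g x *m (Gam g a x)^T.
  have -> : partial_mx a b x = partial_mx a (fun y => xi y *m 1%:M *m g y) x.
    by apply: (partial_mx_ext oU) => // y _; rewrite mulmx1.
  by rewrite (@partial_covector R U g oU sg gT gU a xi (fun=> 1%:M) x sxi s1m Ux) n1 mulmx0 mul0mx addr0 !mulmx1 row_Aend.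
rewrite (partial_nabla_vect g) -row_Aend linearB /= mulmxDl mulmxBr trmx_mul /kform !mulmxA addrACA subrr addr0.
have -> : xi x *m g x *m (row a (A x))^T = row a (A x) *m g x *m (xi x)^T.
  by apply: mx11P; exact: (q_sym_quad q).
rewrite -mulr2n -scaler_nat mxE mulNr -mulrN; congr (_ * _).
have -> : row a (A x) *m g x *m (xi x)^T = (delta_mx 0 a : 'rV[R]_4) *m (A x *m g x) *m (xi x)^T.
  by rewrite (rowE a (A x)) !mulmxA.
by rewrite skew_pair // mulmx_deltaT mulmxA.
Qed.

Lemma S2_partial_knorm a x : U x -> S x * partial a N x = m x * partial a S x.
Proof.
move=> Ux; rewrite partial_knorm // partial_S2 // mulrCA [RHS]mulrCA; congr (_ * _).
have eZ (k : R) (B : 'M[R]_4) : k * (xi x *m B *m g x) 0 a = (xi x *m (k *: B) *m g x) 0 a.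
  by rewrite -scalemxAr -scalemxAl [in RHS]mxE.
by rewrite !eZ S2_Aend.
Qed.

Lemma partial_hfun a J x : smooth_mat U J -> U x -> nabla_endo g a J x = 0 ->
  (J x *m g x)^T = - (J x *m g x) -> K x *m J x = J x *m K x ->
  xi x *m J x *m ((phi J1 x) 0 a *: phi J1 x + (phi J2 x) 0 a *: phi J2 x + (phi J3 x) 0 a *: phi J3 x)^T
    = ((phi J x) 0 a * N x)%:M ->
  partial a (h J) x = - (N x + 2 * m x) * (phi J x) 0 a.
Proof.
move=> sJ Ux pJ skJ cJ dJ; have q := hk_q hk Ux; have skK := Kasd_skew hk Yskew Ux.
have -> : partial a (h J) x =
    (partial_mx a (fun y => xi y *m J y *m g y *m (xi y *m K y)^T) x) 0 0 by rewrite mxE_partial.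
have sxK : smooth_mat U (fun y => xi y *m K y) by exact: smooth_matM.
rewrite (@partial_mxM R U oU _ _ _ a (fun y => phi J y) (fun y => (xi y *m K y)^T) x (smooth_phi sJ) (smooth_matT oU sxK) Ux).
rewrite partial_mxT (@partial_covector R U g oU sg gT gU a xi J x sxi sJ Ux) pJ mulmx0 mul0mx addr0.
rewrite (@partial_vect_endo R U g oU a xi K x sxi sK Ux) -row_Aend.
set ra := row a (A x).
have raK : ra *m K x = - m x *: (delta_mx 0 a : 'rV[R]_4).
  rewrite /ra rowE -(mulmxA _ (A x)) AendKasd // mulmxN mul_mx_scalar. by rewrite [RHS]scaleNr.
move: (m x) raK => mm raK.
have E0 : ra *m J x *m g x *m (xi x *m K x)^T = ((- mm) * (phi J x) 0 a)%:M.
  rewrite trmx_mul -!mulmxA (mulmxA (g x)) (skew_tr q skK) mulNmx !mulmxN !mulmxA -(mulmxA ra) -cJ.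
  rewrite !mulmxA raK -!scalemxAl scaleNr opprK.
  apply: mx11P; rewrite [LHS]mxE [RHS]mxE eqxx mulr1n mulNr -mulrN; congr (_ * _).
  by rewrite -(mulmxA (delta_mx 0 a)) skew_pair // mulmx_deltaT mulmxA.
have E1 : phi J x *m (ra *m K x)^T = ((- mm) * (phi J x) 0 a)%:M.
  rewrite raK linearZ /= -scalemxAr; apply: mx11P.
  by rewrite [LHS]mxE mulmx_deltaT [RHS]mxE eqxx mulr1n.
have E2 : phi J x *m (xi x *m nabla_endo g a K x)^T = (- ((phi J x) 0 a * N x))%:M.
  have -> : phi J x *m (xi x *m nabla_endo g a K x)^T
      = xi x *m J x *m (xi x *m nabla_endo g a K x *m g x)^T.
    by rewrite [in RHS]trmx_mul gT // mulmxA.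
  by rewrite xi_nabla_K // linearN /= mulmxN dJ raddfN.
have tE (u p r t : 'rV[R]_4) : u *m (p + r - t)^T = u *m p^T + u *m r^T - u *m t^T.
  by rewrite linearB /= mulmxBr linearD /= mulmxDr.
rewrite mulmxDl E0 tE E1 E2 [(xi x *m K x *m Gam g a x)^T]trmx_mul !mulmxA.
have eD (B C : 'M[R]_1) : (B + C) 0 0 = B 0 0 + C 0 0 by rewrite mxE.
have eN (B : 'M[R]_1) : (- B) 0 0 = - B 0 0 by rewrite mxE.
rewrite !(eD, eN) ![_%:M 0 0]mxE eqxx !mulr1n.
set t := (_ *m (Gam g a x)^T *m _) 0 0; ring.
Qed.

Lemma dot_phi x : U x -> [/\ xi x *m J1 x *m (phi J1 x)^T = (N x)%:M, xi x *m J1 x *m (phi J2 x)^T = 0 & xi x *m J1 x *m (phi J3 x)^T = 0].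
Proof.
move=> Ux; have [e1 e2 e3] := dot_I1 (hk_q hk Ux) (xi x).
have E (u w : 'rV[R]_4) : u *m (w *m g x)^T = u *m g x *m w^T by rewrite trmx_mul gT // mulmxA.
split; rewrite E.
- by apply: mx11P; rewrite e1 [RHS]mxE eqxx mulr1n.
- by apply: mx11P; rewrite e2 [RHS]mxE.
- by apply: mx11P; rewrite e3 [RHS]mxE.
Qed.

End KillingYano.

Record ky_chart (R : realType) (U : set 'rV[R]_4) (g J1 J2 J3 Y : 'rV[R]_4 -> 'M[R]_4) : Prop := KYChart {
  ky_hk : hk_chart U g J1 J2 J3;
  ky_Y : smooth_mat U Y;
  ky_skew : forall x, U x -> (Y x)^T = - Y x;
  ky_KY : forall x, U x -> forall a b c, nabla g Y x a b c + nabla g Y x b a c = 0 }.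

Section Rotation.
Variables (R : realType) (U : set 'rV[R]_4) (g J1 J2 J3 Y : 'rV[R]_4 -> 'M[R]_4).
Hypothesis ky : ky_chart U g J1 J2 J3 Y.

Lemma ky_rot : ky_chart U g J2 J3 J1 Y.
Proof. by case: ky => h *; split => //; exact: hk_rot. Qed.

Lemma kvect_rot x : U x -> kvect g J2 Y x = kvect g J1 Y x.
Proof.
move=> Ux; have [_ _ d2 _] := nabla_Y (ky_hk ky) (ky_Y ky) (ky_skew ky) (ky_KY ky) Ux.
rewrite [LHS]/kvect d2 mulmxK ?(hk_unit (ky_hk ky)) // -mulmxA (q_22 (hk_q (ky_hk ky) Ux)).
by rewrite mulmxN mulmx1 opprK.
Qed.

Lemma Kasd_rot x : Kasd g J2 J3 J1 Y x = Kasd g J1 J2 J3 Y x.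
Proof. by rewrite /Kasd; congr (_ - _); rewrite [LHS]addrC addrA. Qed.

Lemma hfun_rot J x : U x -> hfun g J2 J3 J1 Y J x = hfun g J1 J2 J3 Y J x.
Proof. by move=> Ux; rewrite /hfun Kasd_rot kvect_rot. Qed.

Lemma knorm_rot x : U x -> knorm g J2 Y x = knorm g J1 Y x.
Proof. by move=> Ux; rewrite /knorm kvect_rot. Qed.

Lemma Aend_rot x : U x -> Aend g J2 Y x = Aend g J1 Y x.
Proof.
move=> Ux; apply/row_matrixP => a; rewrite !row_Aend /nabla_vect (kvect_rot Ux).
congr (_ + _); apply: (partial_mx_ext (hk_open (ky_hk ky))); first exact: Ux.
by move=> y Uy; exact: kvect_rot.
Qed.

Lemma mu_rot x : U x -> mu g J2 J3 J1 Y x = mu g J1 J2 J3 Y x.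
Proof. by move=> Ux; rewrite /mu Kasd_rot Aend_rot. Qed.

End Rotation.

Section Unfolding.
Variables (R : realType) (g J1 J2 J3 Y J : 'rV[R]_4 -> 'M[R]_4) (x : 'rV[R]_4).
Lemma knormE : knorm g J1 Y x = (kvect g J1 Y x *m g x *m (kvect g J1 Y x)^T) 0 0. Proof. by []. Qed.
Lemma kformE : kform g J1 Y x = kvect g J1 Y x *m g x. Proof. by []. Qed.
Lemma hfunE : hfun g J1 J2 J3 Y J x =
  (kvect g J1 Y x *m J x *m g x *m (kvect g J1 Y x *m Kasd g J1 J2 J3 Y x)^T) 0 0. Proof. by []. Qed.
Lemma kvectE : kvect g J1 Y x = - (dmoment g Y J1 x *m invmx (g x) *m J1 x). Proof. by []. Qed.
Lemma momentE : moment g Y J x = - (\tr (Kend g Y x *m J x) / 4). Proof. by []. Qed.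
Lemma KasdE : Kasd g J1 J2 J3 Y x = Kend g Y x -
  (moment g Y J1 x *: J1 x + moment g Y J2 x *: J2 x + moment g Y J3 x *: J3 x). Proof. by []. Qed.
Lemma muE : mu g J1 J2 J3 Y x = - (\tr (Aend g J1 Y x *m Kasd g J1 J2 J3 Y x) / 4). Proof. by []. Qed.
Lemma S2E : S2 g J1 J2 J3 Y x = - (\tr (Kasd g J1 J2 J3 Y x *m Kasd g J1 J2 J3 Y x) / 4). Proof. by []. Qed.
Lemma dmomentE a : dmoment g Y J x 0 a = partial a (moment g Y J) x. Proof. by rewrite mxE. Qed.
End Unfolding.
Opaque Kend moment dmoment kvect Kasd Aend kform knorm S2 mu hfun.

Lemma tr_lin3 (R : realType) (u p q r : 'rV[R]_4) (a c d : R) :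
  u *m (a *: p + c *: q + d *: r)^T = a *: (u *m p^T) + c *: (u *m q^T) + d *: (u *m r^T).
Proof.
have tZ (k : R) (w : 'rV[R]_4) : u *m (k *: w)^T = k *: (u *m w^T) by rewrite linearZ /= -scalemxAr.
by rewrite linearD /= mulmxDr linearD /= mulmxDr !tZ.
Qed.

Lemma schwarz_mul (R : realType) (U : set 'rV[R]_4) (f h p : 'rV[R]_4 -> R) :
  open U -> smooth_on U f -> smooth_on U h -> smooth_on U p ->
  (forall x a, U x -> partial a h x = - p x * partial a f x) ->
  forall x a b, U x -> partial b p x * partial a f x = partial a p x * partial b f x.
Proof.
move=> oU sf sh sp H x a b Ux.
have E c d : partial c (partial d h) x = - (partial c p x * partial d f x + p x * partial c (partial d f) x).
  rewrite (partial_ext c oU Ux (g := fun y => - p y * partial d f y)); last by move=> y Uy; rewrite H.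
  rewrite partialM; last 2 first.
  - exact: smooth_derivable (smoothN oU sp) Ux.
  - exact: smooth_derivable (smooth_partial _ sf) Ux.
  rewrite partialN; last exact: smooth_derivable sp Ux.
  by rewrite !mulNr opprD.
have := schwarz a b oU sh Ux; rewrite !E (schwarz a b oU sf Ux) => /oppr_inj/addIr/esym H2.
exact: H2.
Qed.

Section Main.
Variables (R : realType) (U : set 'rV[R]_4) (g J1 J2 J3 Y : 'rV[R]_4 -> 'M[R]_4).
Hypothesis ky : ky_chart U g J1 J2 J3 Y.

Let hk := ky_hk ky.
Let sY := ky_Y ky.
Let Yskew := ky_skew ky.
Let KY := ky_KY ky.
Let oU := hk_open hk.
Let gU := hk_unit hk.

Notation f := (moment g Y).
Notation xi := (kvect g J1 Y).
Notation K := (Kasd g J1 J2 J3 Y).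
Notation A := (Aend g J1 Y).
Notation b := (kform g J1 Y).
Notation N := (knorm g J1 Y).
Notation S := (S2 g J1 J2 J3 Y).
Notation m := (mu g J1 J2 J3 Y).
Notation h := (hfun g J1 J2 J3 Y).
Notation phi J x := (xi x *m J x *m g x).

Let sN := smooth_knorm hk sY.
Let sm := smooth_mu hk sY.
Let sS := smooth_S2 hk sY.
Let sf1 := smooth_moment hk sY (hk_J1 hk).
Let sf2 := smooth_moment hk sY (hk_J2 hk).
Let sf3 := smooth_moment hk sY (hk_J3 hk).

Lemma partial_f x a : U x -> [/\ partial a (f J1) x = phi J1 x 0 a,
  partial a (f J2) x = phi J2 x 0 a & partial a (f J3) x = phi J3 x 0 a].
Proof. by move=> /(nabla_Y hk sY Yskew KY)[_ e1 e2 e3]; split; rewrite -dmomentE ?e1 ?e2 ?e3. Qed.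

Lemma smooth_h : [/\ smooth_on U (h J1), smooth_on U (h J2) & smooth_on U (h J3)].
Proof.
by split; apply: (smooth_hfun hk sY); [exact: hk_J1 hk|exact: hk_J2 hk|exact: hk_J3 hk].
Qed.

End Main.

Section Main1.
Variables (R : realType) (U : set 'rV[R]_4) (g J1 J2 J3 Y : 'rV[R]_4 -> 'M[R]_4).
Hypothesis ky : ky_chart U g J1 J2 J3 Y.

Lemma partial_h1 a x : U x -> partial a (hfun g J1 J2 J3 Y J1) x =
  - (knorm g J1 Y x + 2 * mu g J1 J2 J3 Y x) * partial a (moment g Y J1) x.
Proof.
move=> Ux; have [hk sY Yskew KY] := ky; have q := hk_q hk Ux.
have [-> _ _] := partial_f ky a Ux; have [c1 _ _] := Kasd_comm hk Yskew Ux.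
have [p1 _ _] := parallel_J hk a Ux.
apply: (partial_hfun hk sY Yskew KY (hk_J1 hk) Ux p1 (q_skew1 q) c1).
have [d1 d2 d3] := dot_phi Y hk Ux.
by rewrite tr_lin3 d1 d2 d3 !scaler0 !addr0 scale_scalar_mx.
Qed.
End Main1.

Section Main2.
Variables (R : realType) (U : set 'rV[R]_4) (g J1 J2 J3 Y : 'rV[R]_4 -> 'M[R]_4).
Hypothesis ky : ky_chart U g J1 J2 J3 Y.
Let ky2 := ky_rot ky.
Let ky3 := ky_rot ky2.
Let oU := hk_open (ky_hk ky).

Notation f := (moment g Y).
Notation xi := (kvect g J1 Y).
Notation K := (Kasd g J1 J2 J3 Y).
Notation A := (Aend g J1 Y).
Notation b := (kform g J1 Y).
Notation N := (knorm g J1 Y).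
Notation S := (S2 g J1 J2 J3 Y).
Notation m := (mu g J1 J2 J3 Y).
Notation h := (hfun g J1 J2 J3 Y).
Notation phi J x := (xi x *m J x *m g x).

Lemma partial_h a x : U x -> [/\ partial a (h J1) x = - (N x + 2 * m x) * partial a (f J1) x,
  partial a (h J2) x = - (N x + 2 * m x) * partial a (f J2) x &
  partial a (h J3) x = - (N x + 2 * m x) * partial a (f J3) x].
Proof.
move=> Ux; split; first exact: (partial_h1 ky).
- have := partial_h1 ky2 a Ux; rewrite (knorm_rot ky Ux) (mu_rot ky Ux) => <-.
  by apply: (partial_ext a oU Ux) => y Uy; rewrite (hfun_rot ky).
- have := partial_h1 ky3 a Ux; rewrite (knorm_rot ky2 Ux) (mu_rot ky2 Ux) (knorm_rot ky Ux) (mu_rot ky Ux) => <-.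
  by apply: (partial_ext a oU Ux) => y Uy; rewrite (hfun_rot ky2) // (hfun_rot ky).
Qed.

Definition psifun x := N x + 2 * m x.
Notation psi := psifun.

Lemma smooth_psi : smooth_on U psi.
Proof.
have [hk sY _ _] := ky; apply: (smoothD oU (smooth_knorm hk sY)).
exact: (smoothM oU (smooth_cst oU 2) (smooth_mu hk sY)).
Qed.

Lemma partial_psi0 a x : U x -> N x != 0 -> partial a psi x = 0.
Proof.
move=> Ux Nx; have [hk sY Yskew KY] := ky; have sp := smooth_psi.
have [sh1 sh2 sh3] := smooth_h ky.
have sf1 := smooth_moment hk sY (hk_J1 hk); have sf2 := smooth_moment hk sY (hk_J2 hk).
have H1 := @schwarz_mul R U _ _ _ oU sf1 sh1 sp (fun y c Uy => and3_rec (fun e _ _ => e) (partial_h c Uy)) x.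
have H2 := @schwarz_mul R U _ _ _ oU sf2 sh2 sp (fun y c Uy => and3_rec (fun _ e _ => e) (partial_h c Uy)) x.
pose v := xi x *m J1 x.
have dv (w : 'rV[R]_4) : \sum_c v 0 c * w 0 c = (v *m w^T) 0 0.
  by rewrite mxE; apply: eq_bigr => c _; rewrite [w^T _ _]mxE.
have [d1 d2 _] := dot_phi Y hk Ux.
have e1 : \sum_c v 0 c * partial c (f J1) x = N x.
  rewrite (eq_bigr (fun c => v 0 c * phi J1 x 0 c)); last by move=> c _; have [-> _ _] := partial_f ky c Ux.
  by rewrite dv /v d1 mxE eqxx mulr1n.
have e2 : \sum_c v 0 c * partial c (f J2) x = 0.
  rewrite (eq_bigr (fun c => v 0 c * phi J2 x 0 c)); last by move=> c _; have [_ -> _] := partial_f ky c Ux.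
  by rewrite dv /v d2 mxE.
pose s := \sum_c v 0 c * partial c psi x.
have E (ff : 'rV[R]_4 -> R) c : (forall a0 b0 : 'I_4, U x ->
    partial b0 psi x * partial a0 ff x = partial a0 psi x * partial b0 ff x) ->
   partial c psi x * (\sum_d v 0 d * partial d ff x) = s * partial c ff x.
  move=> H; rewrite mulr_sumr mulr_suml; apply: eq_bigr => d _.
  by rewrite mulrCA H // mulrA.
have s0 : s = 0.
  have z c : s * partial c (f J2) x = 0 by rewrite -E // e2 mulr0.
  have [//|sn0] := eqVneq s 0.
  have w0 : phi J2 x = 0.
    apply/rowP => c; have [_ <- _] := partial_f ky c Ux; rewrite [RHS]mxE.
    by have := z c => /eqP; rewrite mulf_eq0 (negbTE sn0) => /eqP.
  have [d2' _ _] := dot_phi Y (ky_hk ky2) Ux.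
  move: d2'; rewrite (kvect_rot ky) // w0 trmx0 mulmx0 (knorm_rot ky) // => /matrixP/(_ 0 0).
  by rewrite !mxE eqxx mulr1n => e; move: Nx; rewrite -e eqxx.
have := E _ a (H1); rewrite e1 s0 mul0r => /eqP; rewrite mulf_eq0 (negbTE Nx) orbF => /eqP //.
Qed.

End Main2.

Section IsolatedFixed.
Variables (R : realType) (U : set 'rV[R]_4) (F : 'rV[R]_4 -> 'rV[R]_4) (x : 'rV[R]_4).
Hypothesis oU : open U.
Hypothesis Ux : U x.
Hypothesis sF : smooth_mat U F.

Lemma isolated_fixed : (forall a b, partial a (fun y => F y 0 b) x = 0) -> F x = 0 ->
  exists2 r : R, 0 < r & forall y, ball x r y -> F y = x - y -> y = x.
Proof.
move=> D0 F0.
have cF a b : \forall y \near x, `|partial a (fun z => F z 0 b) y| < 8^-1.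
  have c := smooth_continuous (smooth_partial a (sF 0 b)) Ux.
  have H := (cvgrPdist_lt _ _).1 c 8^-1; rewrite D0 in H.
  have e8 : (0 : R) < 8^-1 by rewrite invr_gt0 ltr0n.
  have := H (nbhs_filter x) e8.
  by apply: filterS => y; rewrite sub0r normrN.
have : \forall y \near x, U y /\ forall a b, `|partial a (fun z => F z 0 b) y| < 8^-1.
  apply: filterI; first exact: (open_near oU Ux).
  by apply: near_all4 => a; apply: near_all4 => b; exact: cF.
move=> /nbhs_ballP[r r0 H]; exists r => // y By Fy.
have seg (t : R) : 0 <= t <= 1 -> ball x r (x + t *: (y - x)).
  by move=> t01; apply: ball_segment => //; exact: ballxx.
have bnd b : `|F y 0 b| <= 2^-1 * `|y - x|.
  have -> : F y 0 b = F (x + (y - x)) 0 b - F x 0 b by rewrite F0 [X in _ - X]mxE subr0 addrC subrK.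
  apply: (line_mvt (f := fun z => F z 0 b)) => t t01.
  have [Uz dz] := H _ (seg _ t01).
  have df := is_derive_dir (y - x) (smooth_differentiable oU (sF 0 b) Uz).
  split; first exact: ex_derive.
  rewrite derive_val; apply: le_trans (ler_norm_sum _ _ _) _.
  have e4 : 2^-1 * `|y - x| = \sum_(i < 4) 8^-1 * `|y - x|.
    by rewrite sumr_const card_ord -mulr_natl; field.
  rewrite e4; apply: ler_sum => a _; rewrite normrM mulrC.
  apply: ler_pM => //; [exact: ltW (dz a b)|exact: normrV_coord].
have : `|y - x| <= 2^-1 * `|y - x|.
  apply: normrV_le => [|b]; first by rewrite mulr_ge0 // invr_ge0 ler0n.
  apply: le_trans (bnd b); rewrite Fy -normrN -[in leRHS]opprB [in leRHS]mxE //.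
move=> H2; apply/eqP; rewrite -subr_eq0 -normr_le0.
by move: H2; set n := `|_|; lra.
Qed.
End IsolatedFixed.

Section IsolatedZero.
Variables (R : realType) (U : set 'rV[R]_4) (F : 'rV[R]_4 -> 'rV[R]_4) (x : 'rV[R]_4).
Hypothesis oU : open U.
Hypothesis Ux : U x.
Hypothesis sF : smooth_mat U F.

Lemma isolated_zero : F x = 0 -> (\matrix_(a, b) partial a (fun y => F y 0 b) x) \in unitmx ->
  exists2 r : R, 0 < r & forall y, ball x r y -> F y = 0 -> y = x.
Proof.
move=> F0; set D : 'M[R]_4 := \matrix_(_, _) _ => Du.
pose H (y : 'rV[R]_4) : 'rV[R]_4 := F y *m invmx D.
have sH : smooth_mat U H by apply: smooth_matM => //; exact: smooth_mat_cst.
pose T := fun y : 'rV[R]_4 => H y + (x - y).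
have sT : forall b, smooth_on U (fun y => (x - y) 0 b).
  move=> b; apply: smooth_ext (smoothB oU (smooth_cst oU (x 0 b)) (smooth_coord oU b)) => // y _.
  by rewrite !mxE.
have sTT : smooth_mat U T.
  apply: smooth_matD => // i b; rewrite ord1; exact: sT.
have D0 a b : partial a (fun y => T y 0 b) x = 0.
  have -> : partial a (fun y => T y 0 b) x = (partial_mx a T x) 0 b by rewrite mxE_partial.
  have sX : smooth_mat U (fun y : 'rV[R]_4 => x - y) by move=> i c; rewrite ord1; exact: sT.
  have sC := @smooth_mat_cst R U oU 4 4 (invmx D).
  rewrite (partial_mxD a sH sX Ux) (partial_mxM oU a sF sC Ux).
  rewrite partial_mx_cst mulmx0 addr0.
  have -> : partial_mx a F x = row a D.
    by apply/rowP => c; rewrite mxE_partial !mxE.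
  have -> : partial_mx a (fun y : 'rV[R]_4 => x - y) x = - delta_mx 0 a.
    apply/rowP => c; rewrite mxE_partial.
    rewrite (@partial_ext R U a _ (fun y : 'rV[R]_4 => x 0 c + - (y 0 c)) x oU Ux) => [|y _]; last by rewrite !mxE.
    have dc := is_derive_coord c x (delta_mx 0 a).
    have dy : derivable (fun y : 'rV[R]_4 => y 0 c : R) x (delta_mx 0 a) by exact: ex_derive.
    rewrite partialD; [|exact: derivable_cst|exact: derivableN].
    rewrite partialC add0r partialN // partial_coord !mxE eqxx /=; by rewrite eq_sym.
  by rewrite -row_mul mulmxV // rowE mulmx1 subrr mxE.
have [r r0 Hr] := isolated_fixed oU Ux sTT D0 ltac:(by rewrite /T /H F0 mul0mx add0r subrr).
exists r => // y By Fy; apply: Hr => //; by rewrite /T /H Fy mul0mx add0r.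
Qed.
End IsolatedZero.

Lemma invP_alg (R : realFieldType) (M s p r : R) : s * p = M * r ->
  (- 2^-1 * p * M + M * (- 2^-1 * p)) * s + M ^+ 2 * r = 0.
Proof.
move=> E; have -> : (- 2^-1 * p * M + M * (- 2^-1 * p)) * s + M ^+ 2 * r = M * (M * r - s * p) by field.
by rewrite E subrr mulr0.
Qed.

Lemma riemann_alg (R : realFieldType) (P Q S T : 'M[R]_4) c d :
  P - S = Q - T -> S c d - T c d + (Q - P) c d = 0.
Proof.
move=> /eqP; rewrite subr_eq => /eqP ->; rewrite !mxE.
by set p := Q c d; set r := S c d; set t := T c d; ring.
Qed.

Section Main3.
Variables (R : realType) (U : set 'rV[R]_4) (g J1 J2 J3 Y : 'rV[R]_4 -> 'M[R]_4).
Hypothesis ky : ky_chart U g J1 J2 J3 Y.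
Let hk := ky_hk ky.
Let sY := ky_Y ky.
Let Yskew := ky_skew ky.
Let KY := ky_KY ky.
Let oU := hk_open hk.
Let gU := hk_unit hk.
Let sxi := smooth_kvect hk sY.
Let sK := smooth_Kasd hk sY.

Notation f := (moment g Y).
Notation xi := (kvect g J1 Y).
Notation K := (Kasd g J1 J2 J3 Y).
Notation A := (Aend g J1 Y).
Notation b := (kform g J1 Y).
Notation N := (knorm g J1 Y).
Notation S := (S2 g J1 J2 J3 Y).
Notation m := (mu g J1 J2 J3 Y).
Notation h := (hfun g J1 J2 J3 Y).
Notation phi J x := (xi x *m J x *m g x).
Notation psi := (psifun g J1 J2 J3 Y).

Lemma knorm_gt0 x : U x -> N x != 0 -> 0 < N x.
Proof.
move=> Ux; rewrite knormE => n0; apply: (q_pos (hk_q hk Ux)); apply: contraNneq n0 => ->.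
by rewrite !mul0mx mxE.
Qed.

Lemma knorm_eq0 x : U x -> (N x == 0) = (xi x == 0).
Proof.
move=> Ux; apply/eqP/eqP => [n0|x0]; last by rewrite knormE x0 !mul0mx mxE.
by apply/eqP; apply: contra_eqT n0 => x0; rewrite knormE gt_eqF // (q_pos (hk_q hk Ux)).
Qed.

Lemma Aend_eq0 V x : open V -> V x -> (forall y, V y -> xi y = 0) -> A x = 0.
Proof.
move=> oV Vx H; apply/row_matrixP => a; rewrite row_Aend /nabla_vect H // mul0mx addr0.
by rewrite (@partial_mx_ext R V oV _ _ a xi (fun=> 0) x Vx H) partial_mx_cst row0.
Qed.

Lemma near_ball x (P : 'rV[R]_4 -> Prop) : U x -> (\forall y \near x, P y) ->
  exists V, [/\ open V, V x & forall y, V y -> U y /\ P y].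
Proof.
move=> Ux H; have : \forall y \near x, U y /\ P y by apply: filterI => //; exact: (open_near oU Ux).
move=> /nbhs_ballP[r r0 HV]; exists (ball x r); split=> //; [exact: ball_open|exact: ballxx].
Qed.

Lemma near_neq0 (p : 'rV[R]_4 -> R) x : U x -> smooth_on U p -> p x != 0 ->
  exists V, [/\ open V, V x & forall y, V y -> U y /\ p y != 0].
Proof.
move=> Ux sp p0; apply: near_ball => //.
have c := smooth_continuous sp Ux; have H := (cvgr_neq0 _ c p0).
exact: H.
Qed.

Lemma partial_psi a x : U x -> partial a psi x = 0.
Proof.
move=> Ux; apply/eqP; apply/negP => /negP p0.
have [V [oV Vx HV]] := near_neq0 Ux (smooth_partial a (smooth_psi ky)) p0.
have x0 y : V y -> xi y = 0.
  move=> Vy; have [Uy py] := HV y Vy; apply/eqP; rewrite -knorm_eq0 //.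
  by apply: contraNT py => /(partial_psi0 ky a Uy) ->.
have ps0 y : V y -> psi y = 0.
  move=> Vy; rewrite /psifun knormE x0 // !mul0mx mxE add0r muE (Aend_eq0 oV Vy x0) mul0mx.
  by rewrite mxtrace0 mul0r oppr0 mulr0.
by move: p0; rewrite (partial_ext a oV Vx (g := fun=> 0)) // partialC eqxx.
Qed.

Lemma partial_mu a x : U x -> partial a m x = - 2^-1 * partial a N x.
Proof.
move=> Ux; have := partial_psi a Ux.
have dN := @smooth_derivable _ _ _ x a (smooth_knorm hk sY) Ux.
have dm := @smooth_derivable _ _ _ x a (smooth_mu hk sY) Ux.
have d2m : derivable (fun y => 2 * m y) x (delta_mx 0 a).
  exact: (@smooth_derivable _ _ _ x a (smoothM oU (smooth_cst oU 2) (smooth_mu hk sY)) Ux).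
have -> : partial a psi x = partial a N x + 2 * partial a m x.
  rewrite /psifun partialD; [|exact: dN|exact: d2m]; congr (_ + _).
  by rewrite partialM; [rewrite partialC mul0r add0r|exact: derivable_cst|exact: dm].
set p := partial a N x; set r := partial a m x; by clearbody p r; lra.
Qed.

Definition invP x := m x ^+ 2 * S x.

Lemma partial_invP a x : U x -> partial a invP x = 0.
Proof.
move=> Ux; have sm := smooth_mu hk sY; have sS := smooth_S2 hk sY.
have dm := @smooth_derivable _ _ _ x a sm Ux; have dS := @smooth_derivable _ _ _ x a sS Ux.
have dm2 : derivable (fun y => m y ^+ 2) x (delta_mx 0 a) := @smooth_derivable _ _ _ x a (smoothX oU 2 sm) Ux.
rewrite /invP partialM // (partial_ext a oU Ux (g := fun y => m y * m y)); last by move=> *; rewrite expr2.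
rewrite partialM // partial_mu //.
have E := S2_partial_knorm hk sY Yskew KY a Ux.
exact: invP_alg E.
Qed.

Lemma S2_quad (v : 'rV[R]_4) x : U x -> (v *m K x *m g x *m (v *m K x)^T) 0 0 = S x * (v *m g x *m v^T) 0 0.
Proof.
move=> Ux; rewrite (q_pairing (hk_q hk Ux) (K x) v (Kasd_skew hk Yskew Ux)) (Kasd_sqr hk Yskew Ux).
by rewrite mulmxN mul_mx_scalar !mulNmx opprK -!scalemxAl mxE.
Qed.

Lemma S2_ge0 x : U x -> 0 <= S x.
Proof.
move=> Ux; have q := hk_q hk Ux; set v : 'rV[R]_4 := delta_mx 0 0; have := S2_quad v Ux.
have v0 : v != 0 by apply/eqP => /rowP/(_ 0); rewrite !mxE !eqxx => /eqP; rewrite oner_eq0.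
have vp := q_pos q v0.
have [->|w0] := eqVneq (v *m K x) 0.
  by rewrite !mul0mx mxE => /esym/eqP; rewrite mulf_eq0 (gt_eqF vp) orbF => /eqP ->.
have := q_pos q w0 => wp E; rewrite E in wp; move: wp; rewrite pmulr_lgt0 //; exact: ltW.
Qed.

Lemma S2_eq0 x : U x -> S x = 0 -> K x = 0.
Proof.
move=> Ux S0; have q := hk_q hk Ux; apply/row_matrixP => i; rewrite row0 rowE.
apply/eqP; apply/negP => /negP w0; have := q_pos q w0.
by rewrite S2_quad // S0 mul0r ltxx.
Qed.

Lemma invP0_Aend : (forall x, U x -> invP x = 0) -> forall x, U x -> A x = 0.
Proof.
move=> P0 x Ux; apply/matrixP => i j; rewrite [RHS]mxE; apply/eqP; apply/negP => /negP A0.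
have [V [oV Vx HV]] := near_neq0 Ux (smooth_Aend hk sY i j) A0.
have K0 y : V y -> K y = 0.
  move=> Vy; have [Uy Ay] := HV y Vy; apply: S2_eq0 => //.
  have := P0 y Uy; rewrite /invP => /eqP; rewrite mulf_eq0 sqrf_eq0 => /orP[/eqP m0|/eqP //].
  have := S2_Aend hk sY Yskew KY Uy; rewrite m0 scale0r => /matrixP/(_ i j); rewrite [LHS]mxE [RHS]mxE => /eqP.
  by rewrite mulf_eq0 (negbTE Ay) orbF => /eqP.
have x0 y : V y -> xi y = 0.
  move=> Vy; have [Uy _] := HV y Vy; apply/eqP; rewrite -knorm_eq0 //.
  have [d1 d2 d3] := dot_phi Y hk Uy.
  have n0 a : N y * phi J1 y 0 a = 0.
    have := xi_nabla_K hk sY Yskew KY a Uy.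
    have -> : nabla_endo g a K y = 0.
      rewrite (@nabla_endo_ext R V g oV a K (fun=> 0) y Vy K0) nabla_endo_cst mul0mx mulmx0 subrr //.
    rewrite mulmx0 mul0mx => /esym/eqP; rewrite oppr_eq0 => /eqP E.
    have := congr1 (fun w => (xi y *m J1 y *m w^T) 0 0) E.
    rewrite tr_lin3 d1 d2 d3 !scaler0 !addr0 scale_scalar_mx trmx0 mulmx0 [RHS]mxE mxE eqxx mulr1n mulrC.
    by [].
  apply/negPn/negP => ny; have p0 : phi J1 y = 0.
    by apply/rowP => a; rewrite [RHS]mxE; have /eqP := n0 a; rewrite mulf_eq0 (negbTE ny) => /eqP.
  move: d1; rewrite p0 trmx0 mulmx0 => /matrixP/(_ 0 0); rewrite !mxE eqxx mulr1n => e.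
  by move: ny; rewrite -e eqxx.
by move: A0; rewrite (Aend_eq0 oV Vx x0) mxE eqxx.
Qed.

Lemma Aend0_knorm a x : U x -> A x = 0 -> partial a N x = 0.
Proof.
move=> Ux A0; rewrite (partial_knorm hk sY Yskew KY a Ux) A0 mulmx0 mul0mx [X in _ * X]mxE.
by rewrite mulr0.
Qed.

Lemma knorm_isolated x : U x -> N x = 0 -> m x != 0 ->
  exists2 r : R, 0 < r & forall y, ball x r y -> U y -> N y = 0 -> y = x.
Proof.
move=> Ux /eqP; rewrite knorm_eq0 // => /eqP x0 m0.
have [|r r0 H] := isolated_zero oU Ux sxi x0.
  have -> : (\matrix_(a, c) partial a (fun y => xi y 0 c) x) = A x.
    apply/row_matrixP => a; rewrite row_Aend /nabla_vect x0 mul0mx addr0.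
    by apply/rowP => c; rewrite mxE_partial !mxE.
  have E : A x *m (- (m x)^-1 *: K x) = 1%:M.
    rewrite -scalemxAr (AendKasd hk sY Yskew KY Ux) scaleNr scalerN opprK.
    by rewrite scale_scalar_mx mulVf.
  by case: (mulmx1_unit E).
by exists r => // y By Uy /eqP; rewrite knorm_eq0 // => /eqP; exact: H.
Qed.

Lemma smooth_frame : smooth_mat U (fun y => frame (J1 y) (J2 y) (J3 y) (xi y)).
Proof.
move=> i j; have q1 := smooth_matM oU sxi (hk_J1 hk); have q2 := smooth_matM oU sxi (hk_J2 hk).
have q3 := smooth_matM oU sxi (hk_J3 hk).
move: i; apply: all4.
- by apply: smooth_ext (sxi 0 j) => // y _; rewrite [RHS]mxE.
- by apply: smooth_ext (q1 0 j) => // y _; rewrite [RHS]mxE.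
- by apply: smooth_ext (q2 0 j) => // y _; rewrite [RHS]mxE.
- by apply: smooth_ext (q3 0 j) => // y _; rewrite [RHS]mxE.
Qed.

Lemma partial_frame a x : (forall y, U y -> A y = 0) -> U x ->
  partial_mx a (fun y => frame (J1 y) (J2 y) (J3 y) (xi y)) x = - (frame (J1 x) (J2 x) (J3 x) (xi x) *m Gam g a x).
Proof.
move=> A0 Ux; have [p1 p2 p3] := parallel_J hk a Ux.
have px : partial_mx a xi x = - (xi x *m Gam g a x).
  by rewrite (partial_nabla_vect g) -row_Aend A0 // row0 sub0r.
have row_p (F : 'rV[R]_4 -> 'M[R]_4) i : row i (partial_mx a F x) = partial_mx a (fun y => row i (F y)) x.
  apply/rowP => c; rewrite [RHS]mxE_partial [LHS]mxE mxE_partial; congr (partial a _ x).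
  by apply/funext => y; rewrite [RHS]mxE.
have pJ J : smooth_mat U J -> nabla_endo g a J x = 0 ->
    partial_mx a (fun y => xi y *m J y) x = - (xi x *m J x *m Gam g a x).
  move=> sJ J0; rewrite (@partial_vect_endo R U g oU a xi J x sxi sJ Ux) J0 mulmx0 addr0 -row_Aend A0 //.
  by rewrite row0 mul0mx sub0r.
have rN (B : 'M[R]_4) i : row i (- B) = - row i B by apply/rowP => c; rewrite !mxE.
have rE y : [/\ row o0 (frame (J1 y) (J2 y) (J3 y) (xi y)) = xi y,
  row o1 (frame (J1 y) (J2 y) (J3 y) (xi y)) = xi y *m J1 y,
  row o2 (frame (J1 y) (J2 y) (J3 y) (xi y)) = xi y *m J2 y &
  row o3 (frame (J1 y) (J2 y) (J3 y) (xi y)) = xi y *m J3 y] by split; rewrite rowK.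
apply/row_matrixP => i; rewrite row_p rN row_mul; move: i; apply: all4.
- have [-> _ _ _] := rE x; rewrite -px; congr (partial_mx a _ x).
  by apply/funext => y; have [-> _ _ _] := rE y.
- have [_ -> _ _] := rE x; rewrite -(pJ _ (hk_J1 hk) p1); congr (partial_mx a _ x).
  by apply/funext => y; have [_ -> _ _] := rE y.
- have [_ _ -> _] := rE x; rewrite -(pJ _ (hk_J2 hk) p2); congr (partial_mx a _ x).
  by apply/funext => y; have [_ _ -> _] := rE y.
- have [_ _ _ ->] := rE x; rewrite -(pJ _ (hk_J3 hk) p3); congr (partial_mx a _ x).
  by apply/funext => y; have [_ _ _ ->] := rE y.
Qed.

Lemma parallel_frame_flat (F : 'rV[R]_4 -> 'M[R]_4) x : smooth_mat U F ->
  (forall y a, U y -> partial_mx a F y = - (F y *m Gam g a y)) -> U x -> F x \in unitmx ->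
  forall d c a e, riemann g x d c a e = 0.
Proof.
move=> sF H Ux Fu d c a e.
have sG i := @smooth_Gam R U g J1 J2 J3 hk i.
have E i j : partial_mx i (partial_mx j F) x
    = F x *m (Gam g i x *m Gam g j x - partial_mx i (Gam g j) x).
  rewrite (@partial_mx_ext R U oU _ _ i (partial_mx j F) (fun y => - (F y *m Gam g j y)) x Ux); last by move=> y Uy; rewrite H.
  rewrite (partial_mxN i (smooth_matM oU sF (sG j)) Ux) (partial_mxM oU i sF (sG j) Ux) H //.
  by rewrite mulNmx mulmxBr opprD opprK mulmxA.
have sw : partial_mx a (partial_mx e F) x = partial_mx e (partial_mx a F) x.
  apply/matrixP => i j.
  have P k : (fun y => partial_mx k F y i j) = partial k (fun y => F y i j).
    by apply/funext => y; rewrite mxE_partial.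
  have Q k l : partial_mx k (partial_mx l F) x i j = partial k (partial l (fun y => F y i j)) x.
    exact: (etrans (mxE_partial _ _ _ _ _) (congr1 (fun q => partial k q x) (P l))).
  exact: (etrans (Q a e) (etrans (schwarz a e oU (sF i j) Ux) (esym (Q e a)))).
move: sw; rewrite !E => /(can_inj (mulKmx Fu)) sw.
have Gp i j k l : partial i (fun y => christoffel g y k j l) x = partial_mx i (Gam g j) x l k.
  by rewrite mxE_partial; congr (partial i _ x); apply/funext => y; rewrite GamE.
rewrite /riemann !Gp.
have -> : \sum_e0 (christoffel g x d a e0 * christoffel g x e0 e c
            - christoffel g x d e e0 * christoffel g x e0 a c) =
   (Gam g e x *m Gam g a x - Gam g a x *m Gam g e x) c d.
  rewrite [RHS]mxE [X in X + _]mxE [X in _ + X]mxE [X in _ - X]mxE sumrB; congr (_ - _); apply: eq_bigr => k _; rewrite mulrC !GamE //.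
exact: riemann_alg sw.
Qed.

End Main3.

Lemma asd_entries (R : realFieldType) (G I1 I2 I3 K : 'M[R]_4) (v : 'rV[R]_4) (s : R) :
  quaternionic G I1 I2 I3 -> (K *m G)^T = - (K *m G) ->
  K *m I1 = I1 *m K -> K *m I2 = I2 *m K -> K *m K = s%:M -> v != 0 ->
  let n := (v *m G *m v^T) 0 0 in
  let h I := (v *m I *m G *m (v *m K)^T) 0 0 in
  let b a := (v *m G) 0 a in let p I a := (v *m I *m G) 0 a in
  [/\ h I1 ^+ 2 + h I2 ^+ 2 + h I3 ^+ 2 = - n ^+ 2 * s,
      forall a, n * (v *m K *m G) 0 a = h I1 * p I1 a + h I2 * p I2 a + h I3 * p I3 a &
      forall a c, n ^+ 2 * (K *m G) a c =
        h I1 * (b a * p I1 c - b c * p I1 a + p I2 a * p I3 c - p I2 c * p I3 a)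
        + h I2 * (b a * p I2 c - b c * p I2 a + p I3 a * p I1 c - p I3 c * p I1 a)
        + h I3 * (b a * p I3 c - b c * p I3 a + p I1 a * p I2 c - p I1 c * p I2 a)].
Proof.
move=> q sk c1 c2 sK v0; have [T [nT FK nKG TT]] := asd_expand q sk c1 c2 v0.
move=> n h b p; move: nT nKG; rewrite -/n -/(h I1) -/(h I2) -/(h I3) => nT nKG.
move: (h I1) (h I2) (h I3) nT => h1 h2 h3 nT; clear h.
have frE i (w : 'rV[R]_4) a : row i (frame I1 I2 I3 v) = w -> (frame I1 I2 I3 v *m G) i a = (w *m G) 0 a.
  by move=> <-; rewrite -row_mul [RHS]mxE.
have fr0 a : (frame I1 I2 I3 v *m G) o0 a = b a.
  by apply: frE; rewrite rowK.
have fr1 a : (frame I1 I2 I3 v *m G) o1 a = p I1 a.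
  by apply: frE; rewrite rowK.
have fr2 a : (frame I1 I2 I3 v *m G) o2 a = p I2 a.
  by apply: frE; rewrite rowK.
have fr3 a : (frame I1 I2 I3 v *m G) o3 a = p I3 a.
  by apply: frE; rewrite rowK.
split.
- have /matrixP/(_ o0 o0) : (n *: T) *m (n *: T) = (n ^+ 2 * s)%:M.
    by rewrite -scalemxAl -scalemxAr (TT _ sK) scalerA scale_scalar_mx expr2.
  rewrite nT M4M !mxE /= ; rewrite mulr1n => E; rewrite mulNr -E; ring.
- move=> a; have /matrixP/(_ o0 a) : n *: (frame I1 I2 I3 v *m K *m G) = (n *: T) *m (frame I1 I2 I3 v *m G).
    by rewrite FK -scalemxAl mulmxA.
  rewrite nT [LHS]mxE [RHS]mxE sum4 fr0 fr1 fr2 fr3.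
  rewrite [X in X * b a]mxE [X in X * p I1 a]mxE [X in X * p I2 a]mxE [X in X * p I3 a]mxE /= mul0r add0r => <-.
  congr (_ * _); have rE w : row o0 (frame I1 I2 I3 v) = w -> (w *m K *m G) 0 a = (frame I1 I2 I3 v *m K *m G) o0 a.
    by move=> <-; rewrite -!row_mul [LHS]mxE.
  by apply: rE; rewrite rowK.
- move=> a c; have /matrixP/(_ a c) : n ^+ 2 *: (K *m G) = (frame I1 I2 I3 v *m G)^T *m (n *: T) *m (frame I1 I2 I3 v *m G).
    by rewrite expr2 -scalerA nKG -scalemxAr -scalemxAl.
  move: fr0 fr1 fr2 fr3; set F := frame _ _ _ _ *m G; clearbody F => fr0 fr1 fr2 fr3.
  rewrite nT [LHS]mxE => ->; rewrite [LHS]mxE sum4 fr0 fr1 fr2 fr3.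
  have E j : (F^T *m M4 0 h1 h2 h3 (- h1) 0 h3 (- h2) (- h2) (- h3) 0 h1 (- h3) h2 (- h1) 0) a j =
    b a * M4 0 h1 h2 h3 (- h1) 0 h3 (- h2) (- h2) (- h3) 0 h1 (- h3) h2 (- h1) 0 o0 j
    + p I1 a * M4 0 h1 h2 h3 (- h1) 0 h3 (- h2) (- h2) (- h3) 0 h1 (- h3) h2 (- h1) 0 o1 j
    + p I2 a * M4 0 h1 h2 h3 (- h1) 0 h3 (- h2) (- h2) (- h3) 0 h1 (- h3) h2 (- h1) 0 o2 j
    + p I3 a * M4 0 h1 h2 h3 (- h1) 0 h3 (- h2) (- h2) (- h3) 0 h1 (- h3) h2 (- h1) 0 o3 j.
    by rewrite [LHS]mxE sum4 ![F^T a _]mxE fr0 fr1 fr2 fr3.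
  rewrite !E /M4 ![(\matrix_(i, j) _) _ _]mxE /=.
  move: (b a) (b c) (p I1 a) (p I2 a) (p I3 a) (p I1 c) (p I2 c) (p I3 c) => *; ring.
Qed.

Section System.
Variables (R : realType) (U : set 'rV[R]_4) (g J1 J2 J3 Y : 'rV[R]_4 -> 'M[R]_4).
Hypothesis ky : ky_chart U g J1 J2 J3 Y.
Let hk := ky_hk ky.
Let sY := ky_Y ky.
Let Yskew := ky_skew ky.
Let KY := ky_KY ky.
Let oU := hk_open hk.
Let gT := hk_sym hk.
Let gU := hk_unit hk.
Let sxi := smooth_kvect hk sY.
Let sK := smooth_Kasd hk sY.

Notation f := (moment g Y).
Notation xi := (kvect g J1 Y).
Notation K := (Kasd g J1 J2 J3 Y).
Notation A := (Aend g J1 Y).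
Notation b := (kform g J1 Y).
Notation N := (knorm g J1 Y).
Notation S := (S2 g J1 J2 J3 Y).
Notation m := (mu g J1 J2 J3 Y).
Notation h := (hfun g J1 J2 J3 Y).
Notation phi J x := (xi x *m J x *m g x).
Notation psi := (psifun g J1 J2 J3 Y).

Lemma dkform x a c : U x ->
  partial a (fun y => b y 0 c) x - partial c (fun y => b y 0 a) x = 2 * (A x *m g x) a c.
Proof.
move=> Ux; have [_ _ _ skA] := Aend_comm hk sY Yskew KY Ux.
have s1 : smooth_mat U (fun=> (1%:M : 'M[R]_4)) by exact: smooth_mat_cst.
have n1 i : nabla_endo g i (fun=> 1%:M) x = 0 by rewrite nabla_endo_cst mul1mx mulmx1 subrr.
have E i j : partial i (fun y => b y 0 j) x = (A x *m g x) i j + (xi x *m g x *m (Gam g i x)^T) 0 j.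
  have -> : partial i (fun y => b y 0 j) x = partial_mx i (fun y => xi y *m 1%:M *m g y) x 0 j.
    rewrite mxE_partial; apply: (partial_ext i oU Ux) => y _; by rewrite kformE mulmx1.
  rewrite (@partial_covector R U g oU (hk_g hk) gT gU i xi (fun=> 1%:M) x sxi s1 Ux) n1 mulmx0 mul0mx addr0 !mulmx1 -row_Aend.
  by rewrite [LHS]mxE -row_mul [X in X + _]mxE.
rewrite !E (@Gam_covector_symm R U g oU gT _ a c x Ux).
have /matrixP/(_ c a) := skA; rewrite [LHS]mxE [RHS]mxE.
set p := (A x *m g x) a c; set r := (A x *m g x) c a; set s := (_ *m _) 0 a.
by clearbody p r s; lra.
Qed.

Record ky_eqs x : Prop := KYEqs {
  eq_h : forall a, [/\ partial a (h J1) x = - psi x * partial a (f J1) x,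
    partial a (h J2) x = - psi x * partial a (f J2) x &
    partial a (h J3) x = - psi x * partial a (f J3) x];
  eq_S : forall a, N x * partial a S x = - 2 * (h J1 x * partial a (f J1) x
    + h J2 x * partial a (f J2) x + h J3 x * partial a (f J3) x);
  eq_g : forall a c, N x * g x a c = b x 0 a * b x 0 c + partial a (f J1) x * partial c (f J1) x
    + partial a (f J2) x * partial c (f J2) x + partial a (f J3) x * partial c (f J3) x;
  eq_norm : h J1 x ^+ 2 + h J2 x ^+ 2 + h J3 x ^+ 2 = N x ^+ 2 * S x;
  eq_eta : S x != 0 -> forall a c,
    partial a (fun y => b y 0 c / N y) x - partial c (fun y => b y 0 a / N y) x =
    2 * m x / (S x * N x ^+ 3) *
     (h J1 x * (partial a (f J2) x * partial c (f J3) x - partial c (f J2) x * partial a (f J3) x)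
     + h J2 x * (partial a (f J3) x * partial c (f J1) x - partial c (f J3) x * partial a (f J1) x)
     + h J3 x * (partial a (f J1) x * partial c (f J2) x - partial c (f J1) x * partial a (f J2) x)) }.

Lemma eta_alg (s n m0 h1 h2 h3 ba bc a1 a2 a3 c1 c2 c3 za zc na nc pb pc kac aac : R) :
  s != 0 -> n != 0 -> pb - pc = 2 * aac -> s * aac = m0 * kac ->
  s * na = m0 * (- 2 * za) -> s * nc = m0 * (- 2 * zc) ->
  n * za = h1 * a1 + h2 * a2 + h3 * a3 -> n * zc = h1 * c1 + h2 * c2 + h3 * c3 ->
  n ^+ 2 * kac = h1 * (ba * c1 - bc * a1 + a2 * c3 - c2 * a3)
        + h2 * (ba * c2 - bc * a2 + a3 * c1 - c3 * a1)
        + h3 * (ba * c3 - bc * a3 + a1 * c2 - c1 * a2) ->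
  (pb / n + bc * (- na / n ^+ 2)) - (pc / n + ba * (- nc / n ^+ 2)) =
  2 * m0 / (s * n ^+ 3) * (h1 * (a2 * c3 - c2 * a3) + h2 * (a3 * c1 - c3 * a1) + h3 * (a1 * c2 - c1 * a2)).
Proof.
move=> s0 n0 Eb Ea Ena Enc Eza Ezc Ek.
have eb : pb = pc + 2 * aac by rewrite -Eb addrC subrK.
have ea : aac = m0 * kac / s by apply: (mulfI s0); rewrite Ea; field.
have ena : na = m0 * (- 2 * za) / s by apply: (mulfI s0); rewrite Ena; field.
have enc : nc = m0 * (- 2 * zc) / s by apply: (mulfI s0); rewrite Enc; field.
have eza : za = (h1 * a1 + h2 * a2 + h3 * a3) / n by apply: (mulfI n0); rewrite Eza; field.
have ezc : zc = (h1 * c1 + h2 * c2 + h3 * c3) / n by apply: (mulfI n0); rewrite Ezc; field.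
have n20 : n ^+ 2 != 0 by rewrite expf_neq0.
have ek : kac = (h1 * (ba * c1 - bc * a1 + a2 * c3 - c2 * a3)
        + h2 * (ba * c2 - bc * a2 + a3 * c1 - c3 * a1)
        + h3 * (ba * c3 - bc * a3 + a1 * c2 - c1 * a2)) / n ^+ 2 by apply: (mulfI n20); rewrite Ek; field.
rewrite eb ea ena enc eza ezc ek; field.
by rewrite s0 n0.
Qed.

Lemma ky_system x : U x -> N x != 0 -> ky_eqs x.
Proof.
move=> Ux n0; have q := hk_q hk Ux; have [c1 c2 _] := Kasd_comm hk Yskew Ux.
have x0 : xi x != 0 by rewrite -(knorm_eq0 ky).
have sK2 : K x *m K x = (- S x)%:M by rewrite (Kasd_sqr hk Yskew Ux) -scaleN1r scale_scalar_mx mulN1r.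
have := asd_entries q (Kasd_skew hk Yskew Ux) c1 c2 sK2 x0.
rewrite /= -!hfunE -knormE => -[e1 e2 e3].
have pf a := partial_f ky a Ux.
have eS a : partial a S x = - 2 * (xi x *m K x *m g x) 0 a by exact: (partial_S2 hk sY Yskew KY a Ux).
split.
- by move=> a; exact: (partial_h ky).
- move=> a; rewrite eS mulrCA e2; have [-> -> ->] := pf a; exact: erefl.
- move=> a c; have [-> -> ->] := pf a; have [-> -> ->] := pf c.
  have := gram_expand q (xi x); rewrite -knormE => /matrixP/(_ a c).
  have eD (B C : 'M[R]_4) : (B + C) a c = B a c + C a c by rewrite mxE.
  have eT (u : 'rV[R]_4) : (u^T *m u) a c = u 0 a * u 0 c by rewrite mxE big_ord1 mxE.
  by rewrite [LHS]mxE => ->; rewrite !eD !eT kformE.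
- by rewrite e1 mulrNN.
- move=> s0 a c.
  have sN := smooth_knorm hk sY; have sb := smooth_kform hk sY.
  have E i j : partial i (fun y => b y 0 j / N y) x =
      partial i (fun y => b y 0 j) x / N x + b x 0 j * (- partial i N x / N x ^+ 2).
    have dN := @smooth_derivable _ _ _ x i sN Ux.
    have dV : derivable (fun y => (N y)^-1) x (delta_mx 0 i) by exact: derivableV.
    rewrite partialM; [|exact: smooth_derivable (sb 0 j) Ux|exact: dV].
    by rewrite partialV.
  rewrite !E; have [p1 p2 p3] := pf a; have [r1 r2 r3] := pf c.
  rewrite p1 p2 p3 r1 r2 r3.
  have eA : S x * (A x *m g x) a c = m x * (K x *m g x) a c.
    have eZ (k : R) (B : 'M[R]_4) : k * (B *m g x) a c = ((k *: B) *m g x) a c.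
      by rewrite -scalemxAl [RHS]mxE.
    by rewrite !eZ (S2_Aend hk sY Yskew KY Ux).
  have eN i := S2_partial_knorm hk sY Yskew KY i Ux.
  have ea := eN a; have ec := eN c; rewrite eS in ea; rewrite eS in ec.
  exact: (eta_alg s0 n0 (dkform a c Ux) eA ea ec (e2 a) (e2 c) (e3 a c)).
Qed.

End System.

(* mathcomp's vector library also has a [coord]. *)
Import Defs.

(** * Global constants and local forms *)

Section Charts.
Variables (R : realType) (M : manifold4 R).

Lemma coord_inj (i : chart M) p q : dom i p -> dom i q -> coord i p = coord i q -> p = q.
Proof. by move=> dp dq E; rewrite -(coordK dp) -(coordK dq) E. Qed.

Lemma cimg_coord (i : chart M) p : dom i p -> cimg i (coord i p).
Proof. by move=> dp; exists p. Qed.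

Lemma paramK (i : chart M) x : cimg i x -> dom i (param i x) /\ coord i (param i x) = x.
Proof. by case=> p dp <-; rewrite coordK. Qed.

Lemma overlapP (i j : chart M) x : overlap i j x <-> cimg i x /\ dom j (param i x).
Proof.
split=> [[p [di dj] <-]|[[p di <-]]]; first by split; [exact: cimg_coord|rewrite coordK].
by rewrite coordK // => dj; exists p.
Qed.

Lemma open_cimg (i : chart M) : open (cimg i).
Proof. exact: cimg_open. Qed.

Lemma open_overlap (i j : chart M) : open (overlap i j).
Proof.
rewrite openE => x /overlapP[cx dj]; rewrite /interior.
have c := param_continuous cx; have oj := @dom_open R M j.
have H : nbhs x (param i @^-1` dom j) by apply: c; exact: open_nbhs_nbhs.
have H2 : nbhs x (cimg i) by apply: open_nbhs_nbhs; split => //; exact: open_cimg.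
apply: filterS (filterI H H2) => y [Hj Hi]; exact/overlapP.
Qed.

Lemma trans_coord (i j : chart M) p : dom i p -> trans i j (coord i p) = coord j p.
Proof. by move=> dp; rewrite /trans /= coordK. Qed.

Lemma cimg_trans (i j : chart M) x : overlap i j x -> cimg j (trans i j x).
Proof. by case=> p [di dj] <-; rewrite trans_coord //; exact: cimg_coord. Qed.

Lemma overlap_coord (i j : chart M) p : dom i p -> dom j p -> overlap i j (coord i p).
Proof. by move=> di dj; exists p. Qed.

Lemma overlap_cimg (i j : chart M) x : overlap i j x -> cimg i x.
Proof. by case/overlapP. Qed.

Lemma near_coord (i : chart M) p (P : 'rV[R]_4 -> Prop) : dom i p ->
  (\forall y \near coord i p, P y) -> \forall q \near p, dom i q /\ P (coord i q).
Proof.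
move=> dp H; apply: filterI; first by apply: open_nbhs_nbhs; split => //; exact: dom_open.
exact: (coord_continuous dp H).
Qed.

Lemma locally_constant (F : chart M -> 'rV[R]_4 -> R) :
  (forall i, smooth_on (cimg i) (F i)) ->
  (forall i a x, cimg i x -> partial a (F i) x = 0) ->
  (forall i j x, overlap i j x -> F i x = F j (trans i j x)) ->
  forall i j x y, cimg i x -> cimg j y -> F i x = F j y.
Proof.
move=> sF dF FE.
have [k kE] : exists k : M -> chart M, forall p, dom (k p) p.
  by exists (fun p => projT1 (cid (dom_cover p))) => p; case: (cid _).
pose v p := F (k p) (coord (k p) p).
have vE i p : dom i p -> v p = F i (coord i p).
  by move=> dp; rewrite /v (FE _ i) ?trans_coord //; exact: overlap_coord.
have loc p : \forall q \near p, v q = v p.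
  have dp := kE p; set i := k p in dp.
  have /nbhs_ballP[r r0 HB] : nbhs (coord i p) (cimg i).
    by apply: open_nbhs_nbhs; split; [exact: open_cimg|exact: cimg_coord].
  have sB : smooth_on (ball (coord i p) r) (F i) by exact: smooth_sub (sF i).
  have C := constant_on_ball sB (fun y a By => dF i a y (HB y By)).
  have H : \forall y \near coord i p, F i y = F i (coord i p).
    by apply/nbhs_ballP; exists r => // y; exact: C.
  apply: filterS (near_coord dp H) => q [dq qE]; by rewrite (vE i) // (vE i p).
move=> i j x y cx cy.
have [dpx xE] := paramK cx; have [dpy yE] := paramK cy.
have : [set q | v q = v (param i x)] = [set: M].
  apply: (@connectedM R M).
  - by exists (param i x).
  - exists [set q | v q = v (param i x)]; last by rewrite setTI.
    rewrite openE => q /= vq; rewrite /interior; apply: filterS (loc q) => q' /= ->; exact: vq.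
  - exists [set q | v q = v (param i x)]; last by rewrite setTI.
    rewrite -[X in closed X]setCK; apply: open_closedC.
    rewrite openE => q /= vq; rewrite /interior; apply: filterS (loc q) => q' /= ->; exact: vq.
move=> /seteqP[_ H]; have := H (param j y) Logic.I; rewrite /= (vE j) // (vE i) // xE yE => E.
by rewrite -E.
Qed.

End Charts.

Section Transition.
Variables (R : realType).
Variables (U U' O : set 'rV[R]_4) (F : 'rV[R]_4 -> 'rV[R]_4).
Variables (g J1 J2 J3 Y g' J1' J2' J3' Y' : 'rV[R]_4 -> 'M[R]_4).
Hypothesis ky : ky_chart U g J1 J2 J3 Y.
Hypothesis ky' : ky_chart U' g' J1' J2' J3' Y'.
Hypothesis oO : open O.
Hypothesis OU : O `<=` U.
Hypothesis FO : forall x, O x -> U' (F x).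
Hypothesis sF : smooth_map_on O F.
Hypothesis gF : forall x, O x -> g x = pullback F g' x.
Hypothesis YF : forall x, O x -> Y x = pullback F Y' x.
Hypothesis JF1 : forall x, O x -> J1 x *m dmap F x = dmap F x *m J1' (F x).
Hypothesis JF2 : forall x, O x -> J2 x *m dmap F x = dmap F x *m J2' (F x).
Hypothesis JF3 : forall x, O x -> J3 x *m dmap F x = dmap F x *m J3' (F x).

Notation D x := (dmap F x).
Let gU x : O x -> g x \in unitmx. Proof. by move=> /OU; exact: (hk_unit (ky_hk ky)). Qed.
Let gU' x : O x -> g' (F x) \in unitmx. Proof. by move=> /FO; exact: (hk_unit (ky_hk ky')). Qed.

Lemma trans_unit x : O x -> D x \in unitmx.
Proof. by move=> Ox; have := gU Ox; rewrite gF // /pullback -mulmxA unitmx_mul => /andP[]. Qed.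

Lemma trans_endo (A A' : 'M[R]_4) x : O x -> A *m g x = D x *m (A' *m g' (F x)) *m (D x)^T ->
  A *m D x = D x *m A'.
Proof.
move=> Ox; have ut : (D x)^T \in unitmx by rewrite unitmx_tr trans_unit.
rewrite gF // /pullback !mulmxA => E.
exact: (can_inj (mulmxK (gU' Ox)) (can_inj (mulmxK ut) E)).
Qed.

Lemma trans_Kend x : O x -> Kend g Y x *m D x = D x *m Kend g' Y' (F x).
Proof.
move=> Ox; apply: trans_endo => //; have Ux := OU Ox; have Ux' := FO Ox.
by rewrite (KendK Y (ky_hk ky) Ux) (KendK Y' (ky_hk ky') Ux') YF.
Qed.

Lemma trans_trace (A A' : 'M[R]_4) x : O x -> A *m D x = D x *m A' -> \tr A = \tr A'.
Proof.
move=> Ox E; have u := trans_unit Ox.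
have -> : A = D x *m A' *m invmx (D x) by rewrite -E mulmxK.
by rewrite mxtrace_mulC mulmxA mulVmx // mul1mx.
Qed.

Lemma trans_mul (A B A' B' : 'M[R]_4) x : A *m D x = D x *m A' -> B *m D x = D x *m B' ->
  A *m B *m D x = D x *m (A' *m B').
Proof. by move=> EA EB; rewrite -mulmxA EB mulmxA EA mulmxA. Qed.

Lemma trans_moment J J' x : (forall x, O x -> J x *m D x = D x *m J' (F x)) -> O x ->
  moment g Y J x = moment g' Y' J' (F x).
Proof.
move=> JF Ox; rewrite !momentE; congr (- (_ / _)); apply: (trans_trace Ox).
by apply: trans_mul; [exact: trans_Kend|exact: JF].
Qed.

Lemma partial_trans (k k' : 'rV[R]_4 -> R) x a : O x -> (forall x, O x -> k x = k' (F x)) ->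
  smooth_on U' k' -> partial a k x = \sum_b D x a b * partial b k' (F x).
Proof.
move=> Ox kE sk'; rewrite (partial_ext a oO Ox kE) partial_comp //.
  exact: (smooth_differentiable (hk_open (ky_hk ky')) sk' (FO Ox)).
by move=> b; exact: (@smooth_derivable _ _ _ x a (sF b) Ox).
Qed.

Lemma trans_dmoment J J' x : smooth_mat U' J' -> (forall x, O x -> J x *m D x = D x *m J' (F x)) -> O x ->
  dmoment g Y J x = dmoment g' Y' J' (F x) *m (D x)^T.
Proof.
move=> sJ' JF Ox; apply/rowP => a; rewrite dmomentE.
rewrite (partial_trans a Ox (fun y Oy => trans_moment JF Oy) (smooth_moment (ky_hk ky') (ky_Y ky') sJ')).
by rewrite [RHS]mxE; apply: eq_bigr => b _; rewrite dmomentE [(D x)^T b a]mxE mulrC.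
Qed.

Lemma trans_kvect x : O x -> kvect g J1 Y x *m D x = kvect g' J1' Y' (F x).
Proof.
move=> Ox; have u := trans_unit Ox; have ut : (D x)^T \in unitmx by rewrite unitmx_tr.
rewrite !kvectE (trans_dmoment (hk_J1 (ky_hk ky')) JF1 Ox) mulNmx -!mulmxA JF1 //.
congr (- (_ *m _)).
have gi : invmx (g x) *m D x = invmx ((D x)^T) *m invmx (g' (F x)).
  apply: (can_inj (mulKmx (gU Ox))); rewrite mulmxA mulmxV ?gU // mul1mx gF // /pullback.
  by rewrite -!mulmxA mulKVmx // mulmxV ?gU' // mulmx1.
by rewrite (mulmxA (invmx (g x))) gi -mulmxA mulKVmx.
Qed.

Lemma trans_Kasd x : O x -> Kasd g J1 J2 J3 Y x *m D x = D x *m Kasd g' J1' J2' J3' Y' (F x).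
Proof.
move=> Ox; rewrite !KasdE mulmxBl !mulmxDl mulmxBr !mulmxDr -!scalemxAl -!scalemxAr.
rewrite trans_Kend // JF1 // JF2 // JF3 //.
by rewrite (trans_moment JF1) // (trans_moment JF2) // (trans_moment JF3).
Qed.

Lemma trans_kform x : O x -> kform g J1 Y x = kform g' J1' Y' (F x) *m (D x)^T.
Proof. by move=> Ox; rewrite !kformE -trans_kvect // gF // /pullback !mulmxA. Qed.

Lemma trans_knorm x : O x -> knorm g J1 Y x = knorm g' J1' Y' (F x).
Proof.
move=> Ox; rewrite !knormE -trans_kvect // gF // /pullback trmx_mul !mulmxA //.
Qed.

Lemma trans_S2 x : O x -> S2 g J1 J2 J3 Y x = S2 g' J1' J2' J3' Y' (F x).
Proof.
move=> Ox; rewrite !S2E; congr (- (_ / _)); apply: (trans_trace Ox).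
by apply: trans_mul; exact: trans_Kasd.
Qed.

Lemma trans_Aend x : O x -> Aend g J1 Y x *m D x = D x *m Aend g' J1' Y' (F x).
Proof.
move=> Ox; apply: trans_endo => //; rewrite -!mulmxA.
have sb := smooth_kform (ky_hk ky') (ky_Y ky').
set b := kform g J1 Y; set b' := kform g' J1' Y'.
have E a c : partial a (fun y => b y 0 c) x = \sum_d (partial a (partial c (fun y => F y 0 d)) x * b' (F x) 0 d
    + D x c d * \sum_e D x a e * partial e (fun y => b' y 0 d) (F x)).
  have -> : partial a (fun y => b y 0 c) x = partial a (fun y => \sum_d D y c d * b' (F y) 0 d) x.
    apply: (partial_ext a oO Ox) => y Oy; rewrite /b trans_kform // [LHS]mxE; apply: eq_bigr => d _.
    by rewrite [(D y)^T d c]mxE mulrC.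
  have sD d : smooth_on O (fun y => D y c d).
    by apply: (smooth_ext oO _ (smooth_partial c (sF d))) => y _; rewrite mxE.
  have dbF d : derivable (fun y => b' (F y) 0 d) x (delta_mx 0 a).
    have dF e : derivable (fun y => F y 0 e) x (delta_mx 0 a) by exact: (@smooth_derivable _ _ _ x a (sF e) Ox).
    have H := is_derive_comp (smooth_differentiable (hk_open (ky_hk ky')) (sb 0 d) (FO Ox)) dF.
    exact: ex_derive.
  have P d : partial a (fun y => D y c d * b' (F y) 0 d) x = partial a (partial c (fun y => F y 0 d)) x * b' (F x) 0 d
      + D x c d * \sum_e D x a e * partial e (fun y => b' y 0 d) (F x).
    rewrite partialM; [|exact: (@smooth_derivable _ _ _ x a (sD d) Ox)|exact: dbF].
    congr (_ * _ + _ * _); first by congr (partial a _ x); apply/funext => y; rewrite mxE.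
    rewrite (partial_comp (f := fun y => b' y 0 d)) //.
      exact: (smooth_differentiable (hk_open (ky_hk ky')) (sb 0 d) (FO Ox)).
    by move=> e; exact: (@smooth_derivable _ _ _ x a (sF e) Ox).
  rewrite -(eq_bigr _ (fun d _ => P d)).
  apply: partial_sum_derivable => d.
  by apply: derivableM; [exact: (@smooth_derivable _ _ _ x a (sD d) Ox)|exact: dbF].
have two : (2 : R) != 0 by rewrite pnatr_eq0.
apply/matrixP => a c; apply: (mulfI two).
have -> : 2 * (Aend g J1 Y x *m g x) a c = partial a (fun y => b y 0 c) x - partial c (fun y => b y 0 a) x.
  by rewrite (dkform ky a c (OU Ox)).
rewrite !E -sumrB.
have -> : 2 * (D x *m (Aend g' J1' Y' (F x) *m (g' (F x) *m (D x)^T))) a c =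
  \sum_d \sum_e D x a e * D x c d * (partial e (fun y => b' y 0 d) (F x) - partial d (fun y => b' y 0 e) (F x)).
  rewrite (mulmxA (Aend _ _ _ _)) [in LHS]mxE mulr_sumr exchange_big /=; apply: eq_bigr => e _.
  have -> : (Aend g' J1' Y' (F x) *m g' (F x) *m (D x)^T) e c =
      \sum_d (Aend g' J1' Y' (F x) *m g' (F x)) e d * D x c d.
    by rewrite [LHS]mxE; apply: eq_bigr => d _; rewrite [(D x)^T d c]mxE.
  rewrite 2!mulr_sumr; apply: eq_bigr => d _.
  by rewrite (dkform ky' e d (FO Ox)); ring.
have sw d : partial c (partial a (fun y => F y 0 d)) x = partial a (partial c (fun y => F y 0 d)) x.
  exact: (schwarz c a oO (sF d) Ox).
transitivity (\sum_d (\sum_e D x a e * D x c d * partial e (fun y => b' y 0 d) (F x)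
   - \sum_e D x c e * D x a d * partial e (fun y => b' y 0 d) (F x))).
  apply: eq_bigr => d _; rewrite sw opprD addrACA subrr add0r !mulr_sumr; congr (_ - _); apply: eq_bigr => e _; ring.
rewrite sumrB [X in _ - X]exchange_big -sumrB; apply: eq_bigr => d _; rewrite -sumrB; apply: eq_bigr => e _.
by rewrite mulrBr (mulrC (D x c d)).
Qed.

Lemma trans_mu x : O x -> mu g J1 J2 J3 Y x = mu g' J1' J2' J3' Y' (F x).
Proof.
move=> Ox; rewrite !muE; congr (- (_ / _)); apply: (trans_trace Ox).
by apply: trans_mul; [exact: trans_Aend|exact: trans_Kasd].
Qed.

End Transition.

Lemma near_punctured (T : topologicalType) (p : T) (Q : T -> Prop) :
  (\forall q \near p, q <> p -> Q q) -> \forall q \near p^', Q q.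
Proof. by move=> H; apply: filterS H => q H /eqP; exact: H. Qed.

Section Global.
Variables (R : realType) (M : manifold4 R) (g I1 I2 I3 Y : mxfield M).
Hypothesis rg : riemannian g.
Hypothesis endo : [/\ endomorphism I1, endomorphism I2 & endomorphism I3].
Hypothesis quat : forall i x, cimg i x -> I1 i x *m I2 i x = I3 i x /\ I2 i x *m I1 i x = - I3 i x.
Hypothesis kah : forall a b c : R, a ^+ 2 + b ^+ 2 + c ^+ 2 = 1 ->
  kahler g (fun i x => a *: I1 i x + b *: I2 i x + c *: I3 i x).

Lemma hermitian_skew (G J : 'M[R]_4) : J *m J = - 1%:M -> J *m G *m J^T = G -> G^T = G ->
  (J *m G)^T = - (J *m G).
Proof.
move=> JJ JGJ GT; rewrite trmx_mul GT -[in RHS]JGJ !mulmxA JJ mulNmx mul1mx mulNmx opprK //.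
Qed.

Lemma kahler_units i x : cimg i x ->
  [/\ [/\ I1 i x *m I1 i x = - 1%:M, I2 i x *m I2 i x = - 1%:M & I3 i x *m I3 i x = - 1%:M],
      [/\ (I1 i x *m g i x)^T = - (I1 i x *m g i x), (I2 i x *m g i x)^T = - (I2 i x *m g i x)
        & (I3 i x *m g i x)^T = - (I3 i x *m g i x)] &
      forall a b c, [/\ ext_deriv (fun y => I1 i y *m g i y) x a b c = 0,
        ext_deriv (fun y => I2 i y *m g i y) x a b c = 0 &
        ext_deriv (fun y => I3 i y *m g i y) x a b c = 0]].
Proof.
move=> cx; have gT : (g i x)^T = g i x by have [_ /(_ i x cx)[]] := rg.
have e1 : 1 ^+ 2 + 0 ^+ 2 + 0 ^+ 2 = 1 :> R by rewrite expr1n expr0n /= !addr0.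
have e2 : 0 ^+ 2 + 1 ^+ 2 + 0 ^+ 2 = 1 :> R by rewrite expr1n expr0n /= addr0 add0r.
have e3 : 0 ^+ 2 + 0 ^+ 2 + 1 ^+ 2 = 1 :> R by rewrite expr1n expr0n /= !add0r.
have [_ /(_ i x cx)[a1 a2 _ a3]] := kah e1.
have [_ /(_ i x cx)[b1 b2 _ b3]] := kah e2.
have [_ /(_ i x cx)[c1 c2 _ c3]] := kah e3.
have z1 y : 1 *: I1 i y + 0 *: I2 i y + 0 *: I3 i y = I1 i y by rewrite scale1r !scale0r !addr0.
have z2 y : 0 *: I1 i y + 1 *: I2 i y + 0 *: I3 i y = I2 i y by rewrite scale1r !scale0r addr0 add0r.
have z3 y : 0 *: I1 i y + 0 *: I2 i y + 1 *: I3 i y = I3 i y by rewrite scale1r !scale0r !add0r.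
rewrite z1 in a1 a2; rewrite z2 in b1 b2; rewrite z3 in c1 c2.
have F (J K : 'rV[R]_4 -> 'M[R]_4) : (forall y, J y = K y) -> (fun y => J y *m g i y) = (fun y => K y *m g i y).
  by move=> E; apply/funext => y; rewrite E.
split; [by []|by split; apply: hermitian_skew|].
move=> a b c; have := a3 a b c; have := b3 a b c; have := c3 a b c.
by rewrite (F _ _ z1) (F _ _ z2) (F _ _ z3).
Qed.

Lemma hk_of_kahler i : hk_chart (cimg i) (g i) (I1 i) (I2 i) (I3 i).
Proof.
have [[s1 _] [s2 _] [s3 _]] := endo; have [[sg _] rp] := rg.
split; [exact: open_cimg|exact: sg|exact: s1|exact: s2|exact: s3|..].
- move=> x cx; have [[u1 u2 u3] [k1 k2 k3] _] := kahler_units cx.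
  have [gT gp] := rp i x cx; have [q1 q2] := quat cx.
  by split.
- by move=> x cx a b c; have [_ _ /(_ a b c)[]] := kahler_units cx.
- by move=> x cx a b c; have [_ _ /(_ a b c)[]] := kahler_units cx.
- by move=> x cx a b c; have [_ _ /(_ a b c)[]] := kahler_units cx.
Qed.

Hypothesis kyY : killing_yano g Y.

Lemma ky_of_global i : ky_chart (cimg i) (g i) (I1 i) (I2 i) (I3 i) (Y i).
Proof.
have [[sY _] HY] := kyY; split; [exact: hk_of_kahler|exact: sY|..].
- by move=> x cx; have [] := HY i x cx.
- by move=> x cx; have [] := HY i x cx.
Qed.

Notation N i := (knorm (g i) (I1 i) (Y i)).
Notation S i := (S2 (g i) (I1 i) (I2 i) (I3 i) (Y i)).
Notation m i := (mu (g i) (I1 i) (I2 i) (I3 i) (Y i)).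
Notation A i := (Aend (g i) (I1 i) (Y i)).

Lemma invariants i j x : overlap i j x ->
  [/\ N i x = N j (trans i j x), S i x = S j (trans i j x) & m i x = m j (trans i j x)].
Proof.
move=> ox; have oO := @open_overlap R M i j; have OU : overlap i j `<=` cimg i by move=> y; exact: overlap_cimg.
have FO y : overlap i j y -> cimg j (trans i j y) by exact: cimg_trans.
have sF := @trans_smooth R M i j.
have [[_ gF] _] := rg; have [[_ YF] _] := kyY; have [[_ JF1] [_ JF2] [_ JF3]] := endo.
have k := ky_of_global i; have k' := ky_of_global j.
split.
- by apply: (trans_knorm k k' oO OU FO sF) ox => // y; [exact: gF|exact: YF|exact: JF1].
- apply: (trans_S2 k k' OU FO) ox => // y; [exact: gF|exact: YF|exact: JF1|exact: JF2|exact: JF3].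
- apply: (trans_mu k k' oO OU FO sF) ox => // y; [exact: gF|exact: YF|exact: JF1|exact: JF2|exact: JF3].
Qed.

Lemma psi_const : exists N0, forall i x, cimg i x -> N i x + 2 * m i x = N0.
Proof.
have [[p _]|E] := pselect (exists p : {i : chart M & {x | cimg i x}}, True); last first.
  by exists 0 => i x cx; case: E; exists (existT _ i (exist _ x cx)).
case: p => i [x cx]; exists (N i x + 2 * m i x) => j y cy.
apply: (@locally_constant R M (fun i x => N i x + 2 * m i x)) => //.
- by move=> k; exact: (smooth_psi (ky_of_global k)).
- by move=> k a z cz; exact: (partial_psi (ky_of_global k) a cz).
- by move=> k l z oz; have [-> _ ->] := invariants oz.
Qed.

Lemma invP_const : exists P, forall i x, cimg i x -> m i x ^+ 2 * S i x = P.
Proof.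
have [[p _]|E] := pselect (exists p : {i : chart M & {x | cimg i x}}, True); last first.
  by exists 0 => i x cx; case: E; exists (existT _ i (exist _ x cx)).
case: p => i [x cx]; exists (m i x ^+ 2 * S i x) => j y cy.
apply: (@locally_constant R M (fun i x => m i x ^+ 2 * S i x)) => //.
- move=> k; have [hk sY _ _] := ky_of_global k; have oU := hk_open hk.
  exact: (smoothM oU (smoothX oU 2 (smooth_mu hk sY)) (smooth_S2 hk sY)).
- by move=> k a z cz; exact: (partial_invP (ky_of_global k) a cz).
- by move=> k l z oz; have [_ -> ->] := invariants oz.
Qed.

Lemma nonparallel_knorm : ~ parallel g Y -> exists i x, cimg i x /\ N i x != 0.
Proof.
move=> np; apply: contrapT => H; apply: np => i x cx a b c.
have N0 : N i x = 0.
  by apply/eqP/negPn/negP => n0; apply: H; exists i, x.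
have [hk sY sk KY] := ky_of_global i; have [vc _ _ _] := nabla_Y hk sY sk KY cx.
have x0 : kvect (g i) (I1 i) (Y i) x = 0.
  by apply/eqP; rewrite -(knorm_eq0 (ky_of_global i)) // N0.
rewrite nablaE vc x0 volume_contractionE !mul0mx ![(0 : 'rV[R]_4) _ _]mxE.
by rewrite !(mul0r, mulr0, subr0, addr0).
Qed.

Lemma invP_neq0 : ~ flat g -> ~ parallel g Y -> forall i x, cimg i x -> m i x ^+ 2 * S i x != 0.
Proof.
move=> nf np i x cx; apply/negP => /eqP P0; have [P HP] := invP_const.
have {}P0 j y : cimg j y -> m j y ^+ 2 * S j y = 0 by move=> cy; rewrite HP // -(HP _ _ cx).
have A0 j y : cimg j y -> A j y = 0 by apply: (invP0_Aend (ky_of_global j)) => z; exact: P0.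
have [k [z [cz nz]]] := nonparallel_knorm np.
apply: nf => j y cy; have ky := ky_of_global j; have [hk sY sk KY] := ky.
have Ny : N j y != 0.
  rewrite -(_ : N k z = N j y) //; apply: (@locally_constant R M (fun i x => N i x)) => //.
  - by move=> l; have [hk' sY' _ _] := ky_of_global l; exact: (smooth_knorm hk' sY').
  - by move=> l a w cw; exact: (Aend0_knorm (ky_of_global l) a cw (A0 _ _ cw)).
  - by move=> l l' w ow; have [-> _ _] := invariants ow.
apply: (parallel_frame_flat ky (smooth_frame ky) _ cy).
  by move=> w a cw; exact: (partial_frame ky a (A0 j) cw).
have := frame_gram (hk_q hk cy) (kvect (g j) (I1 j) (Y j) y); rewrite -knormE => E.
have : (N j y *: 1%:M : 'M[R]_4) \in unitmx by rewrite unitmxZ ?unitmx1 // unitfE.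
by rewrite -E -mulmxA unitmx_mul => /andP[].
Qed.

Section Constants.
Variables (N0 m0 : R).
Hypothesis N0E : forall i x, cimg i x -> N i x + 2 * m i x = N0.
Hypothesis S_gt0 : forall i x, cimg i x -> 0 < S i x.
Hypothesis m0E : forall i x, cimg i x -> m i x * Num.sqrt (S i x) = m0.
Hypothesis m0_neq0 : m0 != 0.

Lemma global_gh i : gh_system (cimg i `&` [set x | N i x != 0]) (g i)
  (moment (g i) (Y i) (I1 i)) (moment (g i) (Y i) (I2 i)) (moment (g i) (Y i) (I3 i))
  (hfun (g i) (I1 i) (I2 i) (I3 i) (Y i) (I1 i)) (hfun (g i) (I1 i) (I2 i) (I3 i) (Y i) (I2 i))
  (hfun (g i) (I1 i) (I2 i) (I3 i) (Y i) (I3 i))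
  (S i) (N i) (fun a y => kform (g i) (I1 i) (Y i) y 0 a) N0 m0.
Proof.
have ky := ky_of_global i; have [hk sY sk KY] := ky.
set V := cimg i `&` _; have VU : V `<=` cimg i by move=> y [].
have ss f : smooth_on (cimg i) f -> smooth_on V f by exact: smooth_sub.
have [sh1 sh2 sh3] := smooth_h ky.
have psiE x : cimg i x -> psifun (g i) (I1 i) (I2 i) (I3 i) (Y i) x = N0 by exact: N0E.
have mE x : cimg i x -> m i x = m0 / Num.sqrt (S i x).
  by move=> cx; rewrite -(m0E cx) mulfK // gt_eqF // sqrtr_gt0 S_gt0.
split.
- rewrite openE => x [cx nx]; rewrite /interior; apply: filterI.
    by apply: open_nbhs_nbhs; split => //; exact: open_cimg.
  exact: (cvgr_neq0 _ (smooth_continuous (smooth_knorm hk sY) cx) nx).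
- by split; apply: ss; apply: (smooth_moment hk sY); [exact: hk_J1 hk|exact: hk_J2 hk|exact: hk_J3 hk].
- by split; apply: ss.
- by apply: ss; exact: (smooth_S2 hk sY).
- by move=> a; apply: ss; exact: (smooth_kform hk sY).
- by move=> x [cx _]; exact: S_gt0.
- by move=> x [cx nx]; exact: (knorm_gt0 ky).
- by move=> x [cx _]; rewrite -mulrA -mE // -(N0E cx) addrK.
- by move=> x a [cx nx]; have [-> -> ->] := eq_h (ky_system ky cx nx) a; rewrite psiE.
- by move=> x a [cx nx]; exact: (eq_S (ky_system ky cx nx)).
- by move=> x a c [cx nx]; exact: (eq_g (ky_system ky cx nx)).
- by move=> x [cx nx]; exact: (eq_norm (ky_system ky cx nx)).
- move=> x a c [cx nx]; rewrite -mE //.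
  by apply: (eq_eta (ky_system ky cx nx)); rewrite gt_eqF // S_gt0.
Qed.

Lemma m_neq0 i x : cimg i x -> m i x != 0.
Proof. by move=> cx; apply: contra_neq m0_neq0 => m00; rewrite -(m0E cx) m00 mul0r. Qed.

Lemma global_form :
  [/\ 0 < N0 -> has_form g (taub_nut_dom (gh_charge N0 m0)) (taub_nut (gh_charge N0 m0)),
      N0 < 0 -> has_form g (taub_nut_inner_dom (gh_charge N0 m0)) (fun x => - taub_nut (gh_charge N0 m0) x) &
      N0 = 0 -> has_form g (@linear_gh_dom R) (@linear_gh R)].
Proof.
have H W h : (forall i x, cimg i x -> N i x != 0 -> local_form (cimg i) (g i) W h x) -> has_form g W h.
  move=> L p; apply: near_punctured; have [i dp] := dom_cover p.
  have cp := cimg_coord dp; have ky := ky_of_global i; have [hk sY sk KY] := ky.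
  have key : \forall y \near coord i p, y <> coord i p -> cimg i y -> N i y != 0.
    have [n0|n0] := eqVneq (N i (coord i p)) 0.
      have [r r0 Hr] := knorm_isolated ky cp n0 (m_neq0 cp).
      apply/nbhs_ballP; exists r => // y By ny cy; apply/negP => /eqP ny0.
      by apply: ny; exact: Hr.
    have [V [oV Vp HV]] := near_neq0 ky cp (smooth_knorm hk sY) n0.
    have /nbhs_ballP[r r0 Hr] : nbhs (coord i p) V by apply: open_nbhs_nbhs; split.
    by apply/nbhs_ballP; exists r => // y /Hr/HV[].
  apply: filterS (near_coord dp key) => q [dq Hq] nq.
  have cq := cimg_coord dq.
  have nq0 : N i (coord i q) != 0 by apply: Hq => // E; apply: nq; exact: (coord_inj dq dp E).
  have [V [F [oV Vq VU sF HF]]] := L i _ cq nq0.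
  exists i; split => //; exists V, F; split => //.
have G i x : cimg i x -> N i x != 0 -> gh_model N0 m0 (cimg i) (g i) x.
  move=> cx nx; apply: (@gh_model_sub R N0 m0 (cimg i) (cimg i `&` [set x | N i x != 0])); first by move=> y [].
  exact: (gh_local_form (global_gh i) m0_neq0).
by split => h; apply: H => i x cx nx; have [p1 p2 p3] := G i x cx nx; auto.
Qed.

End Constants.

Lemma charge_const k z : (forall i x, cimg i x -> 0 < S i x) -> cimg k z ->
  forall i x, cimg i x -> m i x * Num.sqrt (S i x) = m k z * Num.sqrt (S k z).
Proof.
move=> S0 cz i x cx; apply: (@locally_constant R M (fun i x => m i x * Num.sqrt (S i x))) => //.
- move=> l; have [hk sY _ _] := ky_of_global l; have oU := hk_open hk.
  apply: (smoothM oU (smooth_mu hk sY)); apply: (smooth_sqrt oU (smooth_S2 hk sY)) => w; exact: S0.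
- move=> l a w cw; have ky := ky_of_global l; have [hk sY sk KY] := ky; have oU := hk_open hk.
  have ssq : smooth_on (cimg l) (fun y => Num.sqrt (S l y)).
    by apply: (smooth_sqrt oU (smooth_S2 hk sY)) => v; exact: S0.
  have sq y : cimg l y -> Num.sqrt (S l y) ^+ 2 = S l y by move=> cy; rewrite sqr_sqrtr // ltW // S0.
  have E := partial_sqrE a oU cw ssq sq.
  rewrite (partial_mulE a oU cw (smooth_mu hk sY) ssq (fun _ _ => erefl)).
  have pm := partial_mu ky a cw; have SN := S2_partial_knorm hk sY sk KY a cw.
  have s0 : 0 < Num.sqrt (S l w) by rewrite sqrtr_gt0 S0.
  rewrite pm; move: SN; rewrite E; move: (sq _ cw) s0.
  move: (S l w) (partial a (N l) w) (partial a (fun y => Num.sqrt (S l y)) w) (Num.sqrt (S l w)) (m l w) => ss dN ds s mm <- s0 e.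
  have s20 : 2 * s != 0 by rewrite mulf_neq0 ?pnatr_eq0 // gt_eqF.
  apply: (mulfI s20); rewrite mulr0.
  have -> : 2 * s * (- 2^-1 * dN * s + mm * ds) = mm * (2 * s * ds) - s ^+ 2 * dN by field.
  by rewrite e subrr.
- by move=> l l' w ow; have [_ -> ->] := invariants ow.
Qed.

Lemma global_constants : ~ flat g -> ~ parallel g Y -> exists N0 m0,
  [/\ forall i x, cimg i x -> N i x + 2 * m i x = N0,
      forall i x, cimg i x -> 0 < S i x,
      forall i x, cimg i x -> m i x * Num.sqrt (S i x) = m0 & m0 != 0].
Proof.
move=> nf np; have [N0 N0E] := psi_const; have [k [z [cz nz]]] := nonparallel_knorm np.
have PN := invP_neq0 nf np.
have S0 i x : cimg i x -> 0 < S i x.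
  move=> cx; rewrite lt_def (S2_ge0 (ky_of_global i)) // andbT.
  by apply: contra_neq (PN i x cx) => ->; rewrite mulr0.
exists N0, (m k z * Num.sqrt (S k z)); split => //; last first.
  rewrite mulf_neq0 //; last by rewrite gt_eqF // sqrtr_gt0 S0.
  by apply: contra_neq (PN _ _ cz) => ->; rewrite expr0n mul0r.
exact: charge_const.
Qed.

End Global.

(** * Curves, distance and incompleteness *)

Lemma near_near (T : topologicalType) (t : T) (P : T -> Prop) :
  (\forall s \near t, P s) -> \forall s \near t, \forall u \near s, P u.
Proof. exact: nbhs_interior. Qed.

Lemma near_forall (T : topologicalType) (t : T) (P : T -> Prop) : (forall s, P s) -> \forall s \near t, P s.
Proof. by move=> H; apply: (@filterE _ (nbhs t)). Qed.

Section C1.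
Variable R : realType.
Implicit Types f h : R -> R.

Definition C1 f t := (\forall s \near t, derivable f s 1) /\ {for t, continuous (derive1 f)}.

Lemma derive1_ext f h t : (\forall s \near t, f s = h s) -> derive1 f t = derive1 h t.
Proof. by move=> E; rewrite !derive1E; apply: near_eq_derive. Qed.

Lemma C1_ext f h t : (\forall s \near t, f s = h s) -> C1 f t -> C1 h t.
Proof.
move=> E [df cf]; have E2 := near_near E; split.
  by apply: filterS2 df E2 => s ds Es; exact: near_eq_derivable Es ds.
have e0 := derive1_ext E.
have H : derive1 h @ t --> derive1 h t; last exact: H.
rewrite -e0; apply: cvg_trans cf; apply: near_eq_cvg.
by apply: filterS E2 => s Es; rewrite (derive1_ext Es).
Qed.

Lemma C1_of f (df : R -> R) (t : R) : (\forall s \near t, is_derive (s : R) (1 : R) f (df s)) -> {for t, continuous df} ->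
  C1 f t /\ derive1 f t = df t.
Proof.
move=> H cd; have E : \forall s \near t, derive1 f s = df s.
  by apply: filterS H => s Hs; rewrite derive1E derive_val.
have e0 : derive1 f t = df t by exact: nbhs_singleton E.
split=> //; split; first by apply: filterS H => s [].
have H2 : derive1 f @ t --> derive1 f t; last exact: H2.
rewrite e0; apply: cvg_trans cd; apply: near_eq_cvg.
by apply: filterS E => s ->.
Qed.

Lemma C1_derive f (t : R) : C1 f t -> \forall s \near t, is_derive (s : R) (1 : R) f (derive1 f s).
Proof. by move=> [df _]; apply: filterS df => s ds; rewrite derive1E; exact: derivableP. Qed.

Lemma C1D f h t : C1 f t -> C1 h t -> C1 (fun s => f s + h s) t /\ derive1 (fun s => f s + h s) t = derive1 f t + derive1 h t.
Proof.
move=> cf ch; apply: (C1_of (df := fun s => derive1 f s + derive1 h s)).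
  by apply: filterS2 (C1_derive cf) (C1_derive ch) => s H1 H2; exact: is_deriveD.
by have [_ c1] := cf; have [_ c2] := ch; exact: cvgD.
Qed.

Lemma C1_cst (c t : R) : C1 (fun=> c) t /\ derive1 (fun=> c) t = 0.
Proof. apply: (C1_of (df := fun=> 0)); [by apply: near_forall => s; exact: is_derive_cst|exact: cvg_cst]. Qed.

Lemma C1_affine f (k a t : R) : C1 f (k * t + a) ->
  C1 (fun s => f (k * s + a)) t /\ derive1 (fun s => f (k * s + a)) t = k * derive1 f (k * t + a).
Proof.
move=> cf; apply: (C1_of (df := fun s => k * derive1 f (k * s + a))).
  have ca : {for t, continuous (fun s => k * s + a)}.
    by apply: cvgD; [apply: cvgMr; exact: cvg_id|exact: cvg_cst].
  have H : \forall s \near t, is_derive (k * s + a) (1 : R) f (derive1 f (k * s + a)) := ca _ (C1_derive cf).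
  apply: filterS H => s Hs.
  have da : is_derive s 1 (fun s => k * s + a) k.
    have := is_deriveD (is_deriveM (is_derive_cst k s 1) (is_derive_id s 1)) (is_derive_cst a s 1).
    by rewrite !(scaler0, addr0) [k *: 1]mulr1.
  have := @is_derive1_comp R f (fun s => k * s + a) s _ _ Hs da => /is_derive_eq; apply; exact: mulrC.
have [_ c1] := cf.
apply: cvgMr; apply: (@continuous_comp _ _ _ (fun s => k * s + a) (derive1 f)); last exact: c1.
by apply: cvgD; [apply: cvgMr; exact: cvg_id|exact: cvg_cst].
Qed.

Lemma C1_right_cst f (t c : R) : C1 f t -> (forall s, t <= s -> f s = c) -> derive1 f t = 0.
Proof.
move=> [_ cf] H; apply/eqP/negPn/negP => d0.
have : \forall s \near t, derive1 f s != 0 by exact: (cvgr_neq0 _ cf d0).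
move=> /nbhs_ballP[r r0 Hr].
have Bs : ball t r (t + r / 2).
  by rewrite /ball /= opprD addrA subrr sub0r normrN gtr0_norm ?divr_gt0 // ltr_pdivrMr // ltr_pMr // ltr1n.
have := Hr _ Bs; rewrite /= (derive1_ext (h := fun=> c)) ?(C1_cst c _).2 ?eqxx //.
have : t < t + r / 2 by rewrite ltrDl divr_gt0.
by move=> /lt_nbhsr; apply: filterS => s /ltW; exact: H.
Qed.

Lemma C1_left_cst f (t c : R) : C1 f t -> (forall s, s <= t -> f s = c) -> derive1 f t = 0.
Proof.
move=> [_ cf] H; apply/eqP/negPn/negP => d0.
have : \forall s \near t, derive1 f s != 0 by exact: (cvgr_neq0 _ cf d0).
move=> /nbhs_ballP[r r0 Hr].
have Bs : ball t r (t - r / 2).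
  by rewrite /ball /= opprB addrC subrK gtr0_norm ?divr_gt0 // ltr_pdivrMr // ltr_pMr // ltr1n.
have := Hr _ Bs; rewrite /= (derive1_ext (h := fun=> c)) ?(C1_cst c _).2 ?eqxx //.
have : t - r / 2 < t by rewrite ltrBlDr ltrDl divr_gt0.
by move=> /lt_nbhsl; apply: filterS => s /ltW; exact: H.
Qed.

Definition maxsq (t : R) : R := Num.max 0 t ^+ 2.

Lemma is_derive_maxsq (t : R) : is_derive t 1 maxsq (2 * Num.max 0 t).
Proof.
have [t0|t0|->] := ltrgtP t 0.
- rewrite mulr0; have H0 : is_derive t 1 ((fun=> 0) : R -> R) 0 := is_derive_cst (0 : R) t 1.
  apply: near_eq_is_derive H0.
  by apply: filterS (lt_nbhsl t0) => s s0; rewrite /maxsq max_l ?expr0n // ltW.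
- have H0 : is_derive t 1 ((fun s => s * s) : R -> R) (2 * t).
    have := is_deriveM (is_derive_id t 1) (is_derive_id t 1) => /is_derive_eq; apply.
    by rewrite [t *: 1]mulr1 mulr_natl mulr2n.
  apply: near_eq_is_derive H0.
  by apply: filterS (lt_nbhsr t0) => s s0; rewrite /maxsq max_r ?expr2 // ltW.
- rewrite mulr0.
  have H : (fun h : R => h^-1 *: (maxsq (h *: (1 : R) + 0) - maxsq 0)) @ 0^' --> (0 : R).
    have cm : (fun h : R => Num.max 0 h) @ (0 : R)^' --> (0 : R).
      apply: cvg_within_filter.
      have c : {for (0 : R), continuous (fun h : R => Num.max 0 h)}.
        by apply: continuous_max; [exact: cvg_cst|exact: cvg_id].
      have H : (fun h : R => Num.max 0 h) @ (0 : R) --> (Num.max 0 0 : R) := c.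
      by rewrite maxxx in H.
    apply: cvg_trans cm; apply: near_eq_cvg; near=> h.
    have h0 : h != 0 by near: h; exact: nbhs_dnbhs_neq.
    rewrite /maxsq addr0 [h *: 1]mulr1 maxxx expr0n subr0.
    have [hp|hn] := leP 0 h; first by rewrite expr2 [h^-1 *: _]mulKf.
    by rewrite expr0n scaler0.
  split; first by apply/cvg_ex; exists 0.
  exact: cvg_lim H.
Unshelve. all: by end_near. Qed.

Definition ramp (t : R) : R := 2 * maxsq t - 4 * maxsq (t - 2^-1) + 2 * maxsq (t - 1).
Definition dramp (t : R) : R := 4 * Num.max 0 t - 8 * Num.max 0 (t - 2^-1) + 4 * Num.max 0 (t - 1).

Lemma is_derive_ramp (t : R) : is_derive t 1 ramp (dramp t).
Proof.
have S (a : R) : is_derive t 1 (fun s => maxsq (s - a)) (2 * Num.max 0 (t - a)).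
  have da : is_derive t 1 (fun s => s - a) 1.
    by have := is_deriveB (is_derive_id t 1) (is_derive_cst a t 1); rewrite subr0.
  have := @is_derive1_comp R maxsq (fun s => s - a) t _ _ (is_derive_maxsq (t - a)) da.
  by move=> /is_derive_eq; apply; exact: mulr1.
have Z (c d : R) f : is_derive t 1 f d -> is_derive t 1 (fun s => c * f s) (c * d).
  move=> H; have := is_deriveM (is_derive_cst c t 1) H => /is_derive_eq; apply.
  by rewrite scaler0 addr0.
have := is_deriveD (is_deriveB (Z 2 _ _ (is_derive_maxsq t)) (Z 4 _ _ (S 2^-1))) (Z 2 _ _ (S 1)).
move=> /is_derive_eq; apply; rewrite /dramp; ring.
Qed.

Lemma continuous_dramp (t : R) : {for t, continuous dramp}.
Proof.
have S (a : R) : {for t, continuous (fun s : R => Num.max 0 (s - a))}.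
  by apply: continuous_max; [exact: cvg_cst|apply: cvgB; [exact: cvg_id|exact: cvg_cst]].
have S0 : {for t, continuous (fun s : R => Num.max 0 s)}.
  by apply: continuous_max; [exact: cvg_cst|exact: cvg_id].
by apply: cvgD; [apply: cvgB|]; apply: cvgMr; [exact: S0|exact: S|exact: S].
Qed.

Lemma rampP (t : R) : [/\ t <= 0 -> ramp t = 0, 1 <= t -> ramp t = 1, 0 <= ramp t <= 1 & 0 <= dramp t <= 2].
Proof.
rewrite /ramp /dramp /maxsq.
have [t0|t0] := leP t 0.
  by rewrite !max_l ?subr_le0; [split; try (by []); try lra|lra..].
have [t1|t1] := leP t 2^-1.
  rewrite !max_l ?subr_le0; [|lra..]; split; try (by []); try lra.
  by apply/andP; split; nra.
have [t2|t2] := leP t 1.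
  rewrite (@max_r _ _ _ (t - 2^-1)) ?(@max_l _ _ _ (t - 1)) ?subr_le0 ?subr_ge0; [|lra..].
  split; try (by []); try lra; last by apply/andP; split; nra.
  by move=> ?; have e : t = 1; [lra|rewrite e; lra].
rewrite !max_r ?subr_ge0; [|lra..]; split; try (by []); try lra.
Qed.

Lemma C1_ramp (k a y v t : R) : C1 (fun s => y + ramp (k * s + a) * v) t /\
  derive1 (fun s => y + ramp (k * s + a) * v) t = k * dramp (k * t + a) * v.
Proof.
have cr (u : R) : C1 ramp u /\ derive1 ramp u = dramp u.
  by apply: C1_of; [apply: near_forall => s; exact: is_derive_ramp|exact: continuous_dramp].
have [c1 e1] := C1_affine (cr (k * t + a)).1.
have c2 : C1 (fun s => ramp (k * s + a) * v) t /\ derive1 (fun s => ramp (k * s + a) * v) t = k * dramp (k * t + a) * v.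
  have [||c d] := @C1_of (fun s => ramp (k * s + a) * v) (fun s => derive1 (fun u => ramp (k * u + a)) s * v) t.
  - apply: filterS (C1_derive c1) => s H.
    have := is_deriveM H (is_derive_cst v s 1) => /is_derive_eq; apply.
    by rewrite scaler0 add0r [v *: _]mulrC.
  - by have [_ c] := c1; apply: cvgMl.
  by split => //; rewrite d e1 (cr _).2.
have [c3 e3] := C1D (C1_cst y t).1 c2.1.
by split => //; rewrite e3 (C1_cst y t).2 add0r c2.2.
Qed.

End C1.

Section Curves.
Variables (R : realType) (M : manifold4 R) (g : mxfield M).
Hypothesis rg : riemannian g.
Implicit Types (gam : R -> M) (i j : chart M).

Definition crd (c : R -> 'rV[R]_4) (b : 'I_4) (s : R) : R := c s 0 b.
Definition vel (c : R -> 'rV[R]_4) (t : R) : 'rV[R]_4 := \row_b derive1 (crd c b) t.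
Definition speed i (c : R -> 'rV[R]_4) (t : R) : R := (vel c t *m g i (c t) *m (vel c t)^T) 0 0.

Definition regular gam (t : R) := {for t, continuous gam} /\
  exists i, [/\ dom i (gam t), forall b, C1 (crd (coord i \o gam) b) t & speed i (coord i \o gam) t <= 1].

Lemma dom_near i gam (t : R) : {for t, continuous gam} -> dom i (gam t) -> \forall s \near t, dom i (gam s).
Proof.
move=> c di; have : nbhs (gam t) (dom i) by apply: open_nbhs_nbhs; split => //; exact: dom_open.
exact: c.
Qed.

Lemma regular_chart gam (t : R) j : regular gam t -> dom j (gam t) ->
  (forall b, C1 (crd (coord j \o gam) b) t) /\ speed j (coord j \o gam) t <= 1.
Proof.
move=> [cg [i [di C sp]]] dj; pose F := trans i j; pose ci := coord i \o gam.
have oO : open (overlap i j) by exact: open_overlap.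
have nd : \forall s \near t, dom i (gam s) /\ dom j (gam s).
  by apply: filterI; exact: dom_near.
have sF b : smooth_on (overlap i j) (fun y => F y 0 b) := @trans_smooth R M i j b.
have cE b : \forall s \near t, F (ci s) 0 b = crd (coord j \o gam) b s.
  by apply: filterS nd => s [d1 d2]; rewrite /F trans_coord.
have cci : {for t, continuous ci}.
  by apply: continuous_comp => //; exact: coord_continuous.
have Ot : overlap i j (ci t) by exact: overlap_coord.
have dall : \forall s \near t, forall a, derivable (crd ci a) s 1.
  have H a : \forall s \near t, derivable (crd ci a) s 1 by have [] := C a.
  exact: filter_forall H.
have E b : C1 (fun s => F (ci s) 0 b) t /\
    derive1 (fun s => F (ci s) 0 b) t = \sum_a derive1 (crd ci a) t * partial a (fun y => F y 0 b) (ci t).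
  apply: (C1_of (df := fun s => \sum_a derive1 (crd ci a) s * partial a (fun y => F y 0 b) (ci s))).
    apply: filterS2 nd dall => s [d1 d2] dc.
    have Os : overlap i j (ci s) by exact: overlap_coord.
    have dc' : derivable ci s 1 by apply/derivable_mxP => k l; rewrite ord1; exact: dc.
    have := is_derive_curve (smooth_differentiable oO (sF b) Os) dc' => /is_derive_eq; apply.
    by apply: eq_bigr => a _; rewrite (derive_mx dc') mxE derive1E.
  apply: continuous_sum => a; apply: continuousM; first by have [_] := C a.
  apply: (continuous_comp cci); exact: smooth_continuous (smooth_partial a (sF b)) Ot.
split.
  by move=> b; have [c _] := E b; exact: C1_ext (cE b) c.
have vE : vel (coord j \o gam) t = vel ci t *m dmap F (ci t).
  apply/rowP => b; rewrite mxE -(derive1_ext (cE b)) (E b).2 mxE; apply: eq_bigr => a _.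
  by rewrite !mxE.
move: sp; rewrite /speed vE -/ci; have [[_ gF] _] := rg.
have -> : (coord j \o gam) t = F (ci t) by rewrite /F /ci /= trans_coord.
by rewrite (gF i j (ci t) Ot) /pullback trmx_mul !mulmxA.
Qed.

Lemma regular_ext gam gam' (t : R) : (\forall s \near t, gam s = gam' s) -> regular gam t -> regular gam' t.
Proof.
move=> E [cg [i [di C sp]]]; have Et : gam t = gam' t := nbhs_singleton E.
have Eb b : \forall s \near t, crd (coord i \o gam) b s = crd (coord i \o gam') b s.
  by apply: filterS E => s Es; rewrite /crd /= Es.
split.
  have H : gam' @ t --> gam' t; last exact: H.
  by rewrite -Et; apply: cvg_trans cg; apply: near_eq_cvg; apply: filterS E => s ->.
exists i; rewrite -Et; split => //; first by move=> b; exact: C1_ext (Eb b) (C b).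
suff <- : speed i (coord i \o gam) t = speed i (coord i \o gam') t by [].
have vE : vel (coord i \o gam) t = vel (coord i \o gam') t.
  by apply/rowP => b; rewrite !mxE (derive1_ext (Eb b)).
by rewrite /speed vE /= Et.
Qed.

Lemma regular_affine gam (k a t : R) : k ^+ 2 = 1 -> regular gam (k * t + a) -> regular (fun s => gam (k * s + a)) t.
Proof.
move=> k2 [cg [i [di C sp]]]; split.
  apply: (@continuous_comp _ _ _ (fun s => k * s + a) gam); last exact: cg.
  by apply: cvgD; [apply: cvgMr; exact: cvg_id|exact: cvg_cst].
exists i; split; [exact: di|by move=> b; exact: (C1_affine (C b)).1|].
have vE : vel (coord i \o (fun s => gam (k * s + a))) t = k *: vel (coord i \o gam) (k * t + a).
  by apply/rowP => b; rewrite !mxE; exact: (C1_affine (C b)).2.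
rewrite /speed vE /= -!scalemxAl linearZ /= -scalemxAr scalerA -expr2 k2 scale1r.
exact: sp.
Qed.

Lemma regular_cst (p : M) (t : R) : regular (fun=> p) t.
Proof.
have [i di] := dom_cover p; split; first exact: cvg_cst.
exists i; split => //; first by move=> b; exact: (C1_cst _ _).1.
have -> : speed i (coord i \o (fun=> p)) t = 0; last exact: ler01.
rewrite /speed (_ : vel _ _ = 0) ?mul0mx ?mxE //.
by apply/rowP => b; rewrite !mxE; exact: (C1_cst _ _).2.
Qed.

Definition jpath (p q : M) (L : R) := 0 <= L /\ exists gam,
  [/\ forall t : R, t <= 0 -> gam t = p, forall t : R, L <= t -> gam t = q & forall t : R, regular gam t].

Lemma jpath_refl p : jpath p p 0.
Proof. by split => //; exists (fun=> p); split => // t; exact: regular_cst. Qed.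

Lemma jpath_sym p q L : jpath p q L -> jpath q p L.
Proof.
move=> [L0 [gam [g0 gL gr]]]; split => //; exists (fun s => gam (-1 * s + L)); split.
- by move=> t t0; apply: gL; lra.
- by move=> t t0; apply: g0; lra.
- by move=> t; apply: regular_affine => //; rewrite sqrrN expr1n.
Qed.

Lemma jpath_trans p q r L1 L2 : jpath p q L1 -> jpath q r L2 -> jpath p r (L1 + L2).
Proof.
move=> [L10 [g1 [g10 g1L g1r]]] [L20 [g2 [g20 g2L g2r]]]; split; first exact: addr_ge0.
pose gam s := if s <= L1 then g1 s else g2 (1 * s + - L1).
exists gam; split.
- move=> t t0; rewrite /gam; case: ifP => [_|/negP]; first exact: g10.
  by move=> H; case: H; exact: le_trans L10.
- move=> t tL; rewrite /gam; case: ifP => [t1|_]; last by apply: g2L; lra.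
  have L2z : L2 = 0 by lra.
  have -> : g1 t = q by apply: g1L; lra.
  by rewrite -(g20 0) //; apply: g2L; rewrite L2z.
move=> t; have [tL|Lt|tL] := ltrgtP t L1.
- by apply: regular_ext (g1r t); apply: filterS (lt_nbhsl tL) => s sL; rewrite /gam ltW.
- apply: (@regular_ext (fun s => g2 (1 * s + - L1))); last by apply: regular_affine; rewrite ?expr1n.
  by apply: filterS (lt_nbhsr Lt) => s sL; rewrite /gam leNgt sL.
have [i di] := dom_cover q.
have e1 : g1 L1 = q by exact: g1L. have e2 : g2 0 = q by exact: g20.
have d1 : dom i (g1 L1) by rewrite e1. have d2 : dom i (g2 0) by rewrite e2.
have [C1a _] := regular_chart (g1r L1) d1; have [C2a _] := regular_chart (g2r 0) d2.
pose x b := coord i q 0 b.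
have z1 b : derive1 (crd (coord i \o g1) b) L1 = 0.
  by apply: (C1_right_cst (c := x b) (C1a b)) => s Ls; rewrite /crd /= g1L.
have z2 b : derive1 (crd (coord i \o g2) b) 0 = 0.
  by apply: (C1_left_cst (c := x b) (C2a b)) => s Ls; rewrite /crd /= g20.
have e0 : 1 * t + - L1 = 0 by rewrite tL; lra.
have cE b : (fun s => crd (coord i \o g1) b s + (crd (coord i \o g2) b (1 * s + - L1) + - x b)) = crd (coord i \o gam) b.
  apply/funext => s; rewrite /crd /gam /=; case: ifP => sL.
    by rewrite (g20 (1 * s + - L1)); [rewrite subrr addr0|lra].
  by rewrite (g1L s); [rewrite addrC subrK|move/negbT: sL; rewrite -ltNge => /ltW].
have CC b : C1 (crd (coord i \o gam) b) t /\ derive1 (crd (coord i \o gam) b) t = 0.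
  rewrite -cE.
  have Ct : C1 (crd (coord i \o g2) b) (1 * t + - L1) by rewrite e0; exact: C2a.
  have [c3 d3] := C1_affine Ct; have [c4 d4] := C1_cst (- x b) t.
  have [c5 d5] := C1D c3 c4; have c6 : C1 (crd (coord i \o g1) b) t by rewrite tL; exact: C1a.
  have [c7 d7] := C1D c6 c5; split; first exact: c7.
  by rewrite d7 d5 d3 d4 e0 z2 tL z1 mulr0 !addr0.
split.
  have k1 : {for t, continuous g1} by have [] := g1r t.
  have k2 : {for t, continuous (fun s : R => g2 (1 * s + - L1))}.
    have gr : regular g2 (1 * t + - L1) by exact: g2r.
    by have [] := regular_affine (expr1n _ 2) gr.
  have gt : gam t = q by rewrite /gam tL lexx.
  have H : gam @ t --> gam t; last exact: H.
  rewrite gt => A nA.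
  have a1 : \forall s \near t, A (g1 s) by apply: k1; rewrite tL e1.
  have a2 : \forall s \near t, A (g2 (1 * s + - L1)) by apply: k2; rewrite e0 e2.
  by apply: filterS2 a1 a2 => s A1 A2; rewrite /= /gam; case: ifP.
exists i; split.
- by rewrite /gam tL lexx.
- by move=> b; exact: (CC b).1.
- have -> : speed i (coord i \o gam) t = 0; last exact: ler01.
  rewrite /speed (_ : vel _ _ = 0) ?mul0mx ?mxE //.
  by apply/rowP => b; rewrite !mxE; exact: (CC b).2.
Qed.

Lemma jpath_joined p q L : jpath p q L -> joined g p q L.
Proof.
move=> [L0 [gam [g0 gL gr]]]; split => //; exists gam; split; [exact: g0|exact: gL|].
move=> t _; split; first by have [] := gr t.
move=> i di c; have [C sp] := regular_chart (gr t) di.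
have dall : \forall s \near t, forall a, derivable (crd c a) s 1.
  have H a : \forall s \near t, derivable (crd c a) s 1 by have [] := C a.
  exact: filter_forall H.
have dc : \forall s \near t, derivable c s 1.
  by apply: filterS dall => s ds; apply/derivable_mxP => k l; rewrite ord1; exact: ds.
have vE : \forall s \near t, derive1 c s = vel c s.
  by apply: filterS dc => s ds; apply/rowP => b; rewrite derive1E (derive_mx ds) !mxE derive1E.
have vt : derive1 c t = vel c t := nbhs_singleton vE.
split => //; last by rewrite vt; exact: sp.
have H : derive1 c @ t --> derive1 c t; last exact: H.
rewrite vt; apply: (@cvg_trans _ (vel c @ t)).
  by apply: near_eq_cvg; apply: filterS vE => s ->.
have H2 : vel c @ t --> vel c t; last exact: H2.
apply/cvgrPdist_le => e e0; have e1 := ltW e0.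
have Hb b : \forall s \near t, `|derive1 (crd c b) t - derive1 (crd c b) s| <= e.
  have [_ cb] := C b; exact: ((cvgrPdist_le _ _).1 cb e e0).
have Hn : \forall s \near t, `|vel c t - vel c s| <= e; last exact: Hn.
have HB : \forall s \near t, forall b, `|derive1 (crd c b) t - derive1 (crd c b) s| <= e.
  exact: filter_forall Hb.
apply: filterS HB => s hs; apply: normrV_le => // b.
by rewrite !mxE; exact: hs.
Qed.

Lemma jpath_segment i (y w : 'rV[R]_4) (C L : R) : 0 <= C -> 0 < L -> 2 * C <= L ->
  (forall t, 0 <= t <= 1 -> cimg i (y + t *: w)) ->
  (forall t, 0 <= t <= 1 -> (w *m g i (y + t *: w) *m w^T) 0 0 <= C ^+ 2) ->
  jpath (param i y) (param i (y + w)) L.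
Proof.
move=> C0 L0 CL cy cw; split; first exact: ltW.
pose ph s := ramp (L^-1 * s + 0).
have ph01 s : 0 <= ph s <= 1 by have [] := rampP (L^-1 * s + 0).
pose gam s := param i (y + ph s *: w).
exists gam; split.
- move=> t t0; have [H _ _ _] := rampP (L^-1 * t + 0).
  by rewrite /gam /ph H ?scale0r ?addr0 // mulr_ge0_le0 // invr_ge0 ltW.
- move=> t t0; have [_ H _ _] := rampP (L^-1 * t + 0).
  by rewrite /gam /ph H ?scale1r // addr0 mulrC ler_pdivlMr // mul1r.
move=> t.
have dg s : dom i (gam s) /\ coord i (gam s) = y + ph s *: w by apply: paramK; exact: cy (ph01 s).
have cE b : crd (coord i \o gam) b = (fun s => y 0 b + ramp (L^-1 * s + 0) * w 0 b).
  by apply/funext => s; rewrite /crd /= (dg s).2 !mxE.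
have CC b : C1 (crd (coord i \o gam) b) t /\
    derive1 (crd (coord i \o gam) b) t = L^-1 * dramp (L^-1 * t + 0) * w 0 b.
  by rewrite cE; exact: C1_ramp.
split.
  have cp : {for y + ph t *: w, continuous (param i)} by exact: param_continuous (cy _ (ph01 t)).
  apply: (@continuous_comp _ _ _ (fun s => y + ph s *: w) (param i)); last exact: cp.
  have cph : {for t, continuous ph}.
    have [[d _] _] := C1_ramp (L^-1) 0 0 1 t.
    have d0 := nbhs_singleton d.
    have : {for t, continuous (fun s : R => 0 + ramp (L^-1 * s + 0) * 1)}.
      by apply: differentiable_continuous; apply/derivable1_diffP; exact: d0.
    by rewrite (_ : (fun s => 0 + ramp (L^-1 * s + 0) * 1) = ph) //; apply/funext => s; rewrite add0r mulr1.
  by apply: cvgD; [exact: cvg_cst|apply: cvgZl; exact: cph].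
exists i; split; [exact: (dg t).1|by move=> b; exact: (CC b).1|].
set k := L^-1 * dramp (L^-1 * t + 0).
have vE : vel (coord i \o gam) t = k *: w by apply/rowP => b; rewrite !mxE (CC b).2.
rewrite /speed vE /= (dg t).2 -!scalemxAl linearZ /= -scalemxAr scalerA mxE.
have [_ _ _ /andP[r0 r2]] := rampP (L^-1 * t + 0).
have k0 : 0 <= k by rewrite mulr_ge0 // invr_ge0 ltW.
have kC : k * C <= 1.
  rewrite /k -mulrA mulrC ler_pdivrMr // mul1r; apply: le_trans CL; exact: ler_wpM2r.
apply: (@le_trans _ _ (k * k * C ^+ 2)).
  by apply: ler_wpM2l; [exact: mulr_ge0|exact: cw (ph01 t)].
have -> : k * k * C ^+ 2 = (k * C) ^+ 2 by rewrite exprMn !expr2.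
by rewrite expr_le1 // mulr_ge0.
Qed.

Lemma dist_le p q L : jpath p q L -> riemannian_dist g p q <= L.
Proof. by move=> H; apply: ge_inf; [exists 0 => l []|exact: jpath_joined]. Qed.

End Curves.

Section Descent.
Variables (R : realType) (M : manifold4 R) (g : mxfield M).
Hypothesis rg : riemannian g.
Variable s : M -> R.
Hypothesis s_gt0 : forall p, 0 < s p.
Hypothesis s_cont : continuous s.
Variables (p0 : M) (ep : R).
Hypothesis ep_gt0 : 0 < ep.
Hypothesis descend : forall p, s p <= s p0 ->
  exists q L, [/\ jpath g p q L, 0 < L & s q <= s p - 2 * ep * L].
Hypothesis close : forall (p : M) (d : R), 0 < d -> \forall q \near p, jpath g q p d.

Definition below p q := exists L, jpath g p q L /\ s q <= s p - ep * L.

Lemma below_refl p : below p p.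
Proof. by exists 0; split; [exact: jpath_refl|rewrite mulr0 subr0]. Qed.

Lemma below_trans p q r : below p q -> below q r -> below p r.
Proof.
move=> [L1 [j1 s1]] [L2 [j2 s2]]; exists (L1 + L2); split; first exact: jpath_trans j1 j2.
by rewrite mulrDr opprD addrA; apply: le_trans s2 _; rewrite lerD2r.
Qed.

Lemma below_le p q : below p q -> s q <= s p.
Proof. by move=> [L [[L0 _] H]]; apply: le_trans H _; rewrite gerBl mulr_ge0 // ltW. Qed.

Lemma below_next p (e : R) : 0 < e -> exists q, below p q /\ forall r, below p r -> s q <= s r + e.
Proof.
move=> e0; pose E := [set s q | q in [set q | below p q]].
have hE : has_inf E.
  split; first by exists (s p), p => //; exact: below_refl.
  by exists 0 => _ [q _ <-]; exact: ltW.
have [_ [q bq <-] Hq] := inf_adherent e0 hE.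
exists q; split => // r br; apply: ltW; apply: lt_le_trans Hq _; rewrite lerD2r.
by apply: ge_inf; [case: hE|exists r].
Qed.

Lemma incomplete_of_descent : ~ complete_metric g.
Proof.
move=> cg.
pose P (pk : M * nat) q := below pk.1 q /\ forall r, below pk.1 r -> s q <= s r + pk.2.+1%:R^-1.
have pos n : (0 : R) < n.+1%:R^-1 by rewrite invr_gt0 ltr0Sn.
have [nx nxP] : exists f : M * nat -> M, forall pk, P pk (f pk).
  exists (fun pk => projT1 (cid (below_next pk.1 (pos pk.2)))) => pk.
  by case: cid.
pose fix u n := if n is n'.+1 then nx (u n', n') else p0.
have uS n : below (u n) (u n.+1) by have [] := nxP (u n, n).
have uI n r : below (u n) r -> s (u n.+1) <= s r + n.+1%:R^-1 by have [_] := nxP (u n, n); apply.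
have ub k l : (k <= l)%N -> below (u k) (u l).
  elim: l => [|l IH]; first by rewrite leqn0 => /eqP ->; exact: below_refl.
  rewrite leq_eqVlt => /predU1P[->|]; first exact: below_refl.
  by rewrite ltnS => /IH H; exact: below_trans H (uS l).
have umono k l : (k <= l)%N -> s (u l) <= s (u k) by move=> /ub/below_le.
have [a aE] : exists a, forall e : R, 0 < e -> exists n, forall k l, (n <= k)%N -> (n <= l)%N -> s (u k) - s (u l) < e /\ a <= s (u k).
  pose E := range (fun n => s (u n)).
  have hE : has_inf E by split; [exists (s (u 0%N)), 0%N|exists 0 => _ [n _ <-]; exact: ltW].
  exists (inf E) => e e0; have [_ [n _ <-] Hn] := inf_adherent e0 hE.
  exists n => k l nk nl; have lb m : inf E <= s (u m) by apply: ge_inf; [case: hE|exists m].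
  by split => //; have := umono _ _ nk; have := lb l; lra.
have cau : forall e : R, 0 < e -> exists n, forall k l, (n <= k)%N -> (n <= l)%N -> riemannian_dist g (u k) (u l) < e.
  move=> e e0; have [n Hn] := aE (ep * e) (mulr_gt0 ep_gt0 e0); exists n.
  have W k l : (n <= k)%N -> (n <= l)%N -> (k <= l)%N -> riemannian_dist g (u k) (u l) < e /\ riemannian_dist g (u l) (u k) < e.
    move=> nk nl kl; have [L [jL sL]] := ub k l kl; have [H _] := Hn k l nk nl.
    have Le : L < e by rewrite -(ltr_pM2l ep_gt0); lra.
    by split; apply: le_lt_trans Le; apply: dist_le => //; exact: jpath_sym.
  by move=> k l nk nl; have [kl|/ltnW kl] := leqP k l; [exact: (W k l _ _ kl).1|exact: (W l k _ _ kl).2].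
have [p up] := cg u cau.
have sp : (fun n => s (u n)) @ \oo --> s p by apply: continuous_cvg => //; exact: s_cont.
have ple n : s p <= s (u n).
  apply: (cvgr_to_le sp).
  by exists n => // l /= nl; exact: umono.
have [q [L [jL L0 sq]]] := descend (le_trans (ple 0%N) (lexx _)).
have near_u : \forall n \near \oo, jpath g (u n) p L := up _ (close p L0).
have bq : \forall n \near \oo, below (u n) q.
  apply: filterS near_u => n jn; exists (L + L); split; first exact: jpath_trans jn jL.
  by apply: le_trans sq _; have := ple n; rewrite mulrDr -mulrA; lra.
have e1 : \forall n \near \oo, (n.+1%:R^-1 : R) < ep * L.
  by have /cvgrPdist_lt/(_ _ (mulr_gt0 ep_gt0 L0)) := @cvg_harmonic R; apply: filterS => n; rewrite sub0r normrN; exact: le_lt_trans (ler_norm _).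
have [n [b1 b2]] : exists n, below (u n) q /\ n.+1%:R^-1 < ep * L.
  by apply: (@filter_ex _ \oo); exact: filterI.
move: (le_trans (ple n.+1) (uI n q b1)) (mulr_gt0 ep_gt0 L0) sq b2; rewrite -mulrA.
by move: (s q) (s p) (ep * L) (n.+1%:R^-1) => x y z w k1 k2 k3 k4; lra.
Qed.

End Descent.

Lemma quad_bound (R : realFieldType) (A : 'M[R]_4) (v : 'rV[R]_4) (G n : R) :
  0 <= n -> (forall a b, `|A a b| <= G) -> (forall a, `|v 0 a| <= n) ->
  (v *m A *m v^T) 0 0 <= 16 * G * n ^+ 2.
Proof.
move=> n0 HA Hv; have G0 : 0 <= G := le_trans (normr_ge0 _) (HA o0 o0).
apply: le_trans (ler_norm _) _; rewrite mxE; apply: le_trans (ler_norm_sum _ _ _) _.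
have -> : 16 * G * n ^+ 2 = \sum_(i < 4) 4 * (G * n ^+ 2).
  by rewrite sumr_const card_ord -mulr_natl; ring.
apply: ler_sum => b _; rewrite normrM [v^T _ _]mxE mxE.
apply: (@le_trans _ _ ((\sum_(a < 4) n * G) * n)).
  apply: ler_pM => //; apply: le_trans (ler_norm_sum _ _ _) _.
  by apply: ler_sum => a _; rewrite normrM; apply: ler_pM.
by rewrite sumr_const card_ord -mulr_natl le_eqVlt; apply/orP; left; apply/eqP; ring.
Qed.

Section Short.
Variables (R : realType) (M : manifold4 R) (g : mxfield M).
Hypothesis rg : riemannian g.

Lemma jpath_close (p : M) (d : R) : 0 < d -> \forall q \near p, jpath g q p d.
Proof.
move=> d0; have [i dp] := dom_cover p; pose x := coord i p.
have cx : cimg i x := cimg_coord dp; have [[sg _] _] := rg.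
pose G : R := 1 + \sum_a \sum_b `|g i x a b|.
have G1 : 1 <= G by rewrite lerDl sumr_ge0 // => a _; rewrite sumr_ge0.
have Gab a b : \forall y \near x, `|g i y a b| <= G.
  have gab : `|g i x a b| <= \sum_a \sum_b `|g i x a b|.
    rewrite (bigD1 a) //= (bigD1 b) //= -addrA lerDl addr_ge0 ?sumr_ge0 // => k _; by rewrite ?sumr_ge0.
  have H : \forall y \near x, `|g i x a b - g i y a b| <= 1.
    exact: ((cvgrPdist_le _ _).1 (smooth_continuous (sg i a b) cx) 1 ltr01).
  apply: filterS H => y Hy; have := ler_normD (g i y a b - g i x a b) (g i x a b).
  by rewrite subrK distrC; move: Hy gab; rewrite /G; lra.
have nG : \forall y \near x, (forall a b, `|g i y a b| <= G) /\ cimg i y.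
  apply: filterI; last by apply: (open_near (open_cimg (i := i))).
  by apply: near_all4 => a; apply: near_all4 => b; exact: Gab.
have /nbhs_ballP[r r0 HB] := nG.
pose k := d / (8 * Num.sqrt G); have sG : 0 < Num.sqrt G by rewrite sqrtr_gt0 (lt_le_trans ltr01).
have k0 : 0 < k by rewrite divr_gt0 // mulr_gt0.
have near_x : \forall y \near x, ball x (Num.min r k) y.
  by apply: nbhsx_ballx; rewrite lt_min r0 k0.
apply: filterS (near_coord dp near_x) => q [dq Bq].
have [B1 B2] : ball x r (coord i q) /\ `|x - coord i q| < k.
  have Bq' : `|x - coord i q| < Num.min r k by move: Bq; rewrite -ball_normE.
  by move: Bq'; rewrite lt_min => /andP[b1 b2]; split; rewrite // -ball_normE.
have seg (t : R) : 0 <= t <= 1 -> ball x r (coord i q + t *: (x - coord i q)).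
  by move=> t01; apply: ball_segment => //; exact: ballxx.
have := @jpath_segment R M g i (coord i q) (x - coord i q) (4 * Num.sqrt G * `|x - coord i q|) d.
rewrite (addrC (coord i q)) subrK (coordK dq) (coordK dp); apply => //.
- have : 8 * Num.sqrt G * `|x - coord i q| <= d.
    rewrite mulrC -ler_pdivlMr ?mulr_gt0 //; exact: ltW.
  by set u := Num.sqrt G; set w := `|_|; clearbody u w; lra.
- by move=> t /seg/HB[].
- move=> t /seg/HB[HG _].
  apply: le_trans (quad_bound (normr_ge0 _) HG (fun a => normrV_coord _ a)) _.
  rewrite !exprMn sqr_sqrtr; last exact: le_trans ler01 G1.
  by rewrite le_eqVlt; apply/orP; left; apply/eqP; ring.
Qed.

End Short.

Section Incomplete.
Variables (R : realType) (M : manifold4 R) (g I1 I2 I3 Y : mxfield M).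
Hypothesis rg : riemannian g.
Hypothesis endo : [/\ endomorphism I1, endomorphism I2 & endomorphism I3].
Hypothesis quat : forall i x, cimg i x -> I1 i x *m I2 i x = I3 i x /\ I2 i x *m I1 i x = - I3 i x.
Hypothesis kah : forall a b c : R, a ^+ 2 + b ^+ 2 + c ^+ 2 = 1 ->
  kahler g (fun i x => a *: I1 i x + b *: I2 i x + c *: I3 i x).
Hypothesis kyY : killing_yano g Y.

Notation N i := (knorm (g i) (I1 i) (Y i)).
Notation S i := (S2 (g i) (I1 i) (I2 i) (I3 i) (Y i)).
Notation m i := (mu (g i) (I1 i) (I2 i) (I3 i) (Y i)).
Notation K i := (Kasd (g i) (I1 i) (I2 i) (I3 i) (Y i)).
Notation xi i := (kvect (g i) (I1 i) (Y i)).
Let kyi i := ky_of_global rg endo quat kah kyY i.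

Variables (N0 m0 : R).
Hypothesis N0E : forall i x, cimg i x -> N i x + 2 * m i x = N0.
Hypothesis S_gt0 : forall i x, cimg i x -> 0 < S i x.
Hypothesis m0E : forall i x, cimg i x -> m i x * Num.sqrt (S i x) = m0.

Definition sM (p : M) : R := Num.sqrt (S (projT1 (cid (dom_cover p))) (coord (projT1 (cid (dom_cover p))) p)).

Lemma sME i p : dom i p -> sM p = Num.sqrt (S i (coord i p)).
Proof.
move=> dp; rewrite /sM; case: cid => j dj /=.
have [_ -> _] := invariants rg endo quat kah kyY (overlap_coord dj dp).
by rewrite trans_coord.
Qed.

Lemma sM_gt0 p : 0 < sM p.
Proof.
have [i dp] := dom_cover p; rewrite (sME dp) sqrtr_gt0; apply: S_gt0; exact: cimg_coord.
Qed.

Lemma smooth_sqrtS i : smooth_on (cimg i) (fun y => Num.sqrt (S i y)).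
Proof.
have [hk sY _ _] := kyi i; apply: (smooth_sqrt (hk_open hk) (smooth_S2 hk sY)) => y; exact: S_gt0.
Qed.

Lemma sM_continuous : continuous sM.
Proof.
move=> p; have [i dp] := dom_cover p; have cp := cimg_coord dp.
have c := smooth_continuous (smooth_sqrtS i) cp.
have H : (fun q => Num.sqrt (S i (coord i q))) @ p --> Num.sqrt (S i (coord i p)).
  exact: (continuous_comp (coord_continuous dp) c).
have H2 : sM @ p --> sM p; last exact: H2.
rewrite (sME dp); apply: cvg_trans H; apply: near_eq_cvg.
have : \forall q \near p, dom i q by apply: open_nbhs_nbhs; split => //; exact: dom_open.
by apply: filterS => q dq; rewrite (sME dq).
Qed.

Lemma knorm_sM i p : dom i p -> N i (coord i p) = N0 - 2 * m0 / sM p.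
Proof.
move=> dp; have cp := cimg_coord dp; have s0 := sM_gt0 p.
rewrite (sME dp) in s0 *; rewrite -(m0E cp) -(N0E cp) -mulrA mulfK ?gt_eqF //.
by rewrite addrK.
Qed.

Lemma gradient_sM i x : cimg i x -> 0 < N i x ->
  \sum_b (xi i x *m K i x) 0 b * partial b (fun y => Num.sqrt (S i y)) x = - Num.sqrt (S i x) * N i x /\
  (xi i x *m K i x *m g i x *m (xi i x *m K i x)^T) 0 0 = S i x * N i x.
Proof.
move=> cx nx; have ky := kyi i; have [hk sY sk KY] := ky.
have Q : (xi i x *m K i x *m g i x *m (xi i x *m K i x)^T) 0 0 = S i x * N i x.
  by rewrite (S2_quad ky _ cx) -knormE.
split => //; have s0 : 0 < Num.sqrt (S i x) by rewrite sqrtr_gt0 S_gt0.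
have sq y : cimg i y -> Num.sqrt (S i y) ^+ 2 = S i y by move=> cy; rewrite sqr_sqrtr // ltW // S_gt0.
have E b : partial b (fun y => Num.sqrt (S i y)) x = - (xi i x *m K i x *m g i x) 0 b / Num.sqrt (S i x).
  have := partial_sqrE b (hk_open hk) cx (smooth_sqrtS i) sq.
  rewrite (partial_S2 hk sY sk KY b cx).
  move: (partial b _ x) ((xi i x *m K i x *m g i x) 0 b) s0; move: (Num.sqrt _) => s ds z s0 e.
  have s20 : 2 * s != 0 by rewrite mulf_neq0 ?pnatr_eq0 // gt_eqF.
  by apply: (mulfI s20); rewrite -e; field; rewrite gt_eqF.
under eq_bigr do rewrite E.
have -> : \sum_b (xi i x *m K i x) 0 b * (- (xi i x *m K i x *m g i x) 0 b / Num.sqrt (S i x)) =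
   - (S i x * N i x) / Num.sqrt (S i x).
  rewrite -Q [X in - X / _]mxE mulNr mulr_suml -sumrN; apply: eq_bigr => b _.
  by rewrite [(xi i x *m K i x)^T b 0]mxE mulNr mulrN mulrA [X in - (X / _)]mulrC.
move: (sq _ cx) s0; move: (S i x) (Num.sqrt (S i x)) (N i x) => S' s' n <- s0.
by field; rewrite gt_eqF.
Qed.

Lemma sM_descend (p : M) (nu : R) : 0 < nu -> nu <= N0 - 2 * m0 / sM p ->
  exists q L, [/\ jpath g p q L, 0 < L & sM q <= sM p - 2 * (Num.sqrt nu / 16) * L].
Proof.
move=> nu0; have [i dp] := dom_cover p; rewrite -(knorm_sM dp) => nuN.
pose x := coord i p; have cx : cimg i x := cimg_coord dp; rewrite -/x in nuN.
have Nx : 0 < N i x := lt_le_trans nu0 nuN.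
have [G1 G2] := gradient_sM cx Nx; have sx0 : 0 < Num.sqrt (S i x) by rewrite sqrtr_gt0 S_gt0.
have sE : sM p = Num.sqrt (S i x) by rewrite (sME dp).
have Sx : S i x = Num.sqrt (S i x) ^+ 2 by rewrite sqr_sqrtr // ltW // S_gt0.
move: G1 G2 sx0 sE Sx; set w := xi i x *m K i x; set s := Num.sqrt (S i x) => G1 G2 sx0 sE Sx.
have sS := smooth_sqrtS i; have [[sg _] _] := rg; have oc := open_cimg (i := i).
pose a (y : 'rV[R]_4) := \sum_b w 0 b * partial b (fun y => Num.sqrt (S i y)) y.
pose e (y : 'rV[R]_4) := (w *m g i y *m w^T) 0 0.
have sa : smooth_on (cimg i) a.
  by apply: smooth_sum => // b; apply: smoothM => //; [exact: smooth_cst|exact: smooth_partial].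
have se : smooth_on (cimg i) e.
  have H : smooth_mat (cimg i) (fun y => w *m g i y *m w^T).
    apply: smooth_matM => //; last exact: smooth_mat_cst.
    by apply: smooth_matM => //; [exact: smooth_mat_cst|exact: sg].
  exact: H.
have na : \forall y \near x, a y < - s * N i x / 2.
  apply: (cvgr_lt _ (smooth_continuous sa cx)); rewrite -/(a x) [a x]G1.
  by have := mulr_gt0 sx0 Nx; rewrite !mulNr; set P := s * N i x; clearbody P; lra.
have ne : \forall y \near x, e y < 4 * (S i x * N i x).
  apply: (cvgr_lt _ (smooth_continuous se cx)); rewrite -/(e x) [e x]G2.
  by rewrite ltr_pMl ?ltr1n // mulr_gt0 // S_gt0.
have nn : \forall y \near x, [/\ a y < - s * N i x / 2, e y < 4 * (S i x * N i x) & cimg i y].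
  by apply: filterS2 (filterI na ne) (open_near oc cx (fun y cy => cy)) => y [].
have /nbhs_ballP[r r0 HB] := nn.
pose tau := r / (2 * (1 + `|w|)).
have w1 : 0 < 1 + `|w| by rewrite ltr_pwDl.
have tau0 : 0 < tau by rewrite divr_gt0 // mulr_gt0.
have seg (t : R) : 0 <= t <= 1 -> ball x r (x + t *: (tau *: w)).
  move=> /andP[t0 t1]; rewrite -ball_normE /= opprD addrA subrr sub0r normrN scalerA normrZ normrM.
  rewrite (ger0_norm t0) (gtr0_norm tau0).
  apply: (@le_lt_trans _ _ (1 * tau * (1 + `|w|))).
    apply: ler_pM => //; first by rewrite mulr_ge0 // ltW.
      by apply: ler_wpM2r => //; exact: ltW.
    by rewrite lerDr.
  have -> : 1 * tau * (1 + `|w|) = r / 2 by rewrite /tau; field; rewrite gt_eqF.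
  by rewrite ltr_pdivrMr // ltr_pMr // ltr1n.
pose Cc := 2 * tau * s * Num.sqrt (N i x); pose L := 2 * Cc.
have sqN0 : 0 < Num.sqrt (N i x) by rewrite sqrtr_gt0.
have Cc0 : 0 < Cc by rewrite /Cc !mulr_gt0.
have L0 : 0 < L by rewrite mulr_gt0.
exists (param i (x + tau *: w)), L.
have jp : jpath g (param i x) (param i (x + tau *: w)) L.
  apply: (jpath_segment (ltW Cc0) L0 (lexx _)) => t t01; first by have [] := HB _ (seg t t01).
  have [_ He _] := HB _ (seg t t01).
  have -> (B : 'M[R]_4) : ((tau *: w) *m B *m (tau *: w)^T) 0 0 = tau * tau * (w *m B *m w^T) 0 0.
    by rewrite -!scalemxAl linearZ /= -scalemxAr scalerA mxE.
  rewrite -/(e _).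
  have -> : Cc ^+ 2 = tau * tau * (4 * (S i x * N i x)).
    have q2 : Num.sqrt (N i x) ^+ 2 = N i x by rewrite sqr_sqrtr // ltW.
    rewrite Sx -[in RHS]q2 /Cc; move: (Num.sqrt (N i x)) => z.
    by clearbody s tau; ring.
  by apply: ler_wpM2l; [rewrite mulr_ge0 // ltW|exact: ltW].
split => //; first by rewrite -{1}(coordK dp).
have s01 : 0 <= (1 : R) <= 1 by rewrite ler01 lexx.
have [_ _ c1] := HB _ (seg 1 s01); rewrite scale1r in c1.
have [d1 k1] := paramK c1; rewrite (sME d1) k1 sE.
have D (t : R) : 0 <= t <= 1 -> is_derive t (1 : R) (fun t => Num.sqrt (S i (x + t *: (tau *: w)))) (tau * a (x + t *: (tau *: w))).
  move=> t01; have [_ _ ct] := HB _ (seg t t01).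
  have df := smooth_differentiable oc sS ct.
  have H := is_derive_dir (tau *: w) df.
  have := is_derive_line (ex_derive (is_derive := H)) => /is_derive_eq; apply.
  rewrite (derive_val (is_derive := H)) mulr_sumr; apply: eq_bigr => b _.
  by rewrite mxE mulrA.
have [t t01 E] : exists2 t : R, t \in `]0, 1[ &
    Num.sqrt (S i (x + 1 *: (tau *: w))) - Num.sqrt (S i (x + 0 *: (tau *: w))) = tau * a (x + t *: (tau *: w)) * (1 - 0).
  pose F (t : R) := Num.sqrt (S i (x + t *: (tau *: w))).
  pose dF (t : R) := tau * a (x + t *: (tau *: w)).
  apply: (@MVT R F dF 0 1 ltr01) => [t|].
    by rewrite in_itv /= => /andP[t0 t1]; apply: D; rewrite !ltW.
  apply: derivable_within_continuous => t; rewrite in_itv /= => t01; exact: (ex_derive (is_derive := D t t01)).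
rewrite scale1r scale0r addr0 -/s subr0 mulr1 in E.
have t01' : 0 <= t <= 1 by move: t01; rewrite in_itv /= => /andP[t0 t1]; rewrite !ltW.
have [Ha _ _] := HB _ (seg t t01').
have -> : Num.sqrt (S i (x + tau *: w)) = s + tau * a (x + t *: (tau *: w)) by rewrite -E addrCA subrr addr0.
have H1 : tau * a (x + t *: (tau *: w)) <= tau * (- s * N i x / 2) by rewrite ler_pM2l // ltW.
have sq : Num.sqrt nu <= Num.sqrt (N i x) by rewrite ler_sqrt // ltW.
have H2 : Num.sqrt nu * Num.sqrt (N i x) <= N i x.
  by rewrite -[leRHS](sqr_sqrtr (ltW Nx)) expr2 ler_wpM2r // ltW.
have H3 : tau * s * (Num.sqrt nu * Num.sqrt (N i x)) <= tau * s * N i x by rewrite ler_wpM2l // mulr_ge0 // ltW.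
have -> : 2 * (Num.sqrt nu / 16) * L = tau * s * (Num.sqrt nu * Num.sqrt (N i x)) / 2 by rewrite /L /Cc; field.
have H4 : tau * (- s * N i x / 2) = - (tau * s * N i x) / 2 by field.
rewrite H4 in H1; move: H1 H3.
set A := tau * a _; set B := tau * s * _; set C := tau * s * (_ * _).
by clearbody A B C; lra.
Qed.

Lemma charge_gt0 : m0 != 0 -> ~ parallel g Y -> complete_metric g -> 0 < m0.
Proof.
move=> m00 np cg; rewrite lt_def m00 /= leNgt; apply/negP => mneg.
have [i [x [cx nx]]] := nonparallel_knorm rg endo quat kah kyY np.
have [dp xE] := paramK cx; set p0 := param i x in dp xE.
have Nx : 0 < N i x := knorm_gt0 (kyi i) cx nx.
have Ep := knorm_sM dp; rewrite xE in Ep.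
apply: (@incomplete_of_descent R M g rg sM sM_gt0 sM_continuous p0 (Num.sqrt (N i x) / 16)) => //.
- by rewrite divr_gt0 // sqrtr_gt0.
- move=> p sp; apply: sM_descend => //; rewrite Ep lerB // -!mulrA ler_pM2l //.
  by rewrite ler_nM2l // lef_pV2 ?posrE // sM_gt0.
- by move=> p d d0; exact: jpath_close.
Qed.

End Incomplete.

Section Classification.
Variables (R : realType) (M : manifold4 R) (g : mxfield M).

Lemma hyperkahler_KY_classification : riemannian g -> hyperkahler g -> ~ flat g -> has_nonconstant_KY g ->
  (complete_metric g -> exists n : R, 0 < n /\ is_taub_nut g n) /\
  ((exists n : R, n != 0 /\ is_taub_nut g n) \/
   (exists n : R, n != 0 /\ has_form g (taub_nut_inner_dom n) (fun x => - taub_nut n x)) \/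
   has_form g (@linear_gh_dom R) (@linear_gh R)).
Proof.
move=> rg [I1 [I2 [I3 [endo [quat kah]]]]] nf [Y [kyY np]].
have [N0 [m0 [N0E S0 m0E m00]]] := global_constants rg endo quat kah kyY nf np.
have [fp fn fz] := global_form rg endo quat kah kyY N0E S0 m0E m00.
have n0 : N0 != 0 -> gh_charge N0 m0 != 0.
  by move=> N00; rewrite /gh_charge mulf_neq0 // invr_neq0 // mulf_neq0 // sqrtr_eq0 -ltNge normr_gt0.
split=> [cg|]; last first.
  have [N0n|N0p|N0z] := ltrgtP N0 0.
  - by right; left; exists (gh_charge N0 m0); split; [apply: n0; rewrite lt_eqF|exact: fn].
  - by left; exists (gh_charge N0 m0); split; [apply: n0; rewrite gt_eqF|exact: fp].
  - by right; right; exact: fz.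
have m0p := charge_gt0 rg endo quat kah kyY N0E S0 m0E m00 np cg.
have [i [x [cx nx]]] := nonparallel_knorm rg endo quat kah kyY np.
have N0p : 0 < N0.
  have sS : 0 < Num.sqrt (S2 (g i) (I1 i) (I2 i) (I3 i) (Y i) x) by rewrite sqrtr_gt0 S0.
  have := m0E _ _ cx; have := knorm_gt0 (ky_of_global rg endo quat kah kyY i) cx nx.
  rewrite -(N0E _ _ cx) => N0' mE; rewrite ltr_pwDl ?mulr_ge0 //.
  by rewrite -(pmulr_lge0 _ sS) mE ltW.
exists (gh_charge N0 m0); split; last exact: fp.
by rewrite /gh_charge divr_gt0 // mulr_gt0 ?sqrtr_gt0 ?normr_gt0 // gt_eqF.
Qed.

End Classification.

(** * Taub-NUT on R^4 *)

(* In terms of the Hopf map x : R^4 -> R^3, |x| = tn_r, tn_metric is the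
   Gibbons-Hawking metric of the potential 1 + m / |x|, and the charge is m / 2.
   The fiber direction is dual to tn_s, tnE spans the constant anti-self-dual
   forms in tn_Y, and tn_J Q deforms the constant complex structure Q. *)
Section TaubNutAlgebra.
Variables (R : realType) (m : R).
Hypothesis m_gt0 : 0 < m.
Implicit Types (x v : 'rV[R]_4) (Q : 'M[R]_4).

Definition tnE : 'M[R]_4 := M4 0 1 0 0 (-1) 0 0 0 0 0 0 1 0 0 (-1) 0.
Definition tn_r x : R := (x *m x^T) 0 0.
Definition tn_s x : 'rV[R]_4 := x *m tnE.
Definition tn_S x : 'M[R]_4 := (tn_s x)^T *m tn_s x.
Definition tn_metric x : 'M[R]_4 := (4 * (m + tn_r x))%:M - (4 * (1 + m / (m + tn_r x))) *: tn_S x.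
Definition tn_J Q x : 'M[R]_4 := Q - (m + tn_r x)^-1 *: (tn_S x *m Q) + m^-1 *: (Q *m tn_S x).
Definition tn_Y x : 'M[R]_4 := (2 * (2 * tn_r x + m) * (m + tn_r x)) *: tnE
  - (4 * tn_r x + 6 * m) *: (x^T *m tn_s x - (tn_s x)^T *m x).
Definition tn_K x : 'M[R]_4 := ((2 * tn_r x + m) / 2) *: tnE - 2^-1 *: (x^T *m tn_s x)
  + ((2 * tn_r x + 3 * m) / (2 * (m + tn_r x))) *: ((tn_s x)^T *m x).

Lemma row_scalar (u v w : 'rV[R]_4) : u *m (v^T *m w) = (u *m v^T) 0 0 *: w.
Proof. by rewrite mulmxA [u *m v^T in LHS]mx11_scalar mul_scalar_mx. Qed.

Lemma skew_pair0 Q v : Q^T = - Q -> (v *m Q *m v^T) 0 0 = 0.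
Proof.
move=> QT; have := erefl ((v *m Q *m v^T) 0 0); rewrite -{1}[v *m Q *m v^T]trmxK mxE !trmx_mul trmxK QT mulNmx mulmxN mulmxA.
by rewrite mxE; lra.
Qed.

Lemma tnE_T : tnE^T = - tnE.
Proof. by rewrite /tnE M4T M4N !oppr0 opprK. Qed.

Lemma tnE_sqr : tnE *m tnE = - 1%:M.
Proof. by rewrite /tnE M4M M4_1 M4N !(@simp4 R). Qed.

Lemma tn_r_ge0 x : 0 <= tn_r x.
Proof. by rewrite /tn_r mxE sumr_ge0 // => i _; rewrite mxE -expr2 sqr_ge0. Qed.

Lemma tn_D_gt0 x : 0 < m + tn_r x.
Proof. by rewrite ltr_pwDl // tn_r_ge0. Qed.

Lemma tn_sT x : (tn_s x)^T = - (tnE *m x^T).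
Proof. by rewrite /tn_s trmx_mul tnE_T mulNmx. Qed.

Lemma tn_sE x : tn_s x *m tnE = - x.
Proof. by rewrite /tn_s -mulmxA tnE_sqr mulmxN mulmx1. Qed.

Lemma tnE_sT x : tnE *m (tn_s x)^T = x^T.
Proof. by rewrite tn_sT mulmxN mulmxA tnE_sqr mulNmx mul1mx opprK. Qed.

Lemma tn_xs x : (x *m (tn_s x)^T) 0 0 = 0.
Proof.
have -> : x *m (tn_s x)^T = - (x *m tnE *m x^T) by rewrite tn_sT mulmxN mulmxA.
by rewrite mxE skew_pair0 ?oppr0 // tnE_T.
Qed.

Lemma tn_sx x : (tn_s x *m x^T) 0 0 = 0.
Proof. by rewrite /tn_s skew_pair0 // tnE_T. Qed.

Lemma tn_ss x : (tn_s x *m (tn_s x)^T) 0 0 = tn_r x.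
Proof. by rewrite tn_sT mulmxN mulmxA tn_sE mulNmx opprK. Qed.

Lemma tn_SS x : tn_S x *m tn_S x = tn_r x *: tn_S x.
Proof. by rewrite /tn_S -mulmxA row_scalar tn_ss -scalemxAr. Qed.

Lemma tn_SQS x Q : Q^T = - Q -> tn_S x *m Q *m tn_S x = 0.
Proof.
move=> QT; have -> : tn_S x *m Q *m tn_S x = (tn_s x)^T *m (tn_s x *m Q *m ((tn_s x)^T *m tn_s x)).
  by rewrite /tn_S !mulmxA.
by rewrite row_scalar skew_pair0 // scale0r mulmx0.
Qed.

Lemma tn_ST x : (tn_S x)^T = tn_S x.
Proof. by rewrite /tn_S trmx_mul trmxK. Qed.

Lemma tn_metric_T x : (tn_metric x)^T = tn_metric x.
Proof. by rewrite /tn_metric linearB linearZ /= tr_scalar_mx tn_ST. Qed.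

Lemma tn_metric_quad x v : (v *m tn_metric x *m v^T) 0 0 =
  4 * (m + tn_r x) * tn_r v - 4 * (1 + m / (m + tn_r x)) * (v *m (tn_s x)^T) 0 0 ^+ 2.
Proof.
rewrite /tn_metric mulmxBr mul_mx_scalar -scalemxAr row_scalar mulmxBl -!scalemxAl mxE.
rewrite [X in X + _]mxE [X in _ + X]mxE [X in - X]mxE [X in - (_ * X)]mxE -/(tn_r v); congr (_ - _ * _).
by rewrite expr2; congr (_ * _); rewrite -[tn_s x *m v^T]trmxK mxE trmx_mul trmxK.
Qed.

Lemma cauchy_schwarz (u v : 'rV[R]_4) : (u *m v^T) 0 0 ^+ 2 <= tn_r u * tn_r v.
Proof.
rewrite /tn_r !mxE !sum4 !mxE.
move: (u 0 o0) (u 0 o1) (u 0 o2) (u 0 o3) (v 0 o0) (v 0 o1) (v 0 o2) (v 0 o3) => a b c d a' b' c' d'.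
rewrite -subr_ge0.
have -> : (a * a + b * b + c * c + d * d) * (a' * a' + b' * b' + c' * c' + d' * d')
   - (a * a' + b * b' + c * c' + d * d') ^+ 2 =
   (a * b' - b * a') ^+ 2 + (a * c' - c * a') ^+ 2 + (a * d' - d * a') ^+ 2 + (b * c' - c * b') ^+ 2
   + (b * d' - d * b') ^+ 2 + (c * d' - d * c') ^+ 2 by ring.
by rewrite !addr_ge0 // sqr_ge0.
Qed.

Lemma tn_metric_ge x v : 4 * m ^+ 2 / (m + tn_r x) * tn_r v <= (v *m tn_metric x *m v^T) 0 0.
Proof.
rewrite tn_metric_quad; have D0 := tn_D_gt0 x.
have C : (v *m (tn_s x)^T) 0 0 ^+ 2 <= tn_r v * tn_r x by rewrite -(tn_ss x) -/(tn_r (tn_s x)) cauchy_schwarz.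
have k0 : 0 <= 4 * (1 + m / (m + tn_r x)) by rewrite mulr_ge0 // addr_ge0 // divr_ge0 // ltW.
have := ler_wpM2l k0 C.
have E : 4 * (m + tn_r x) * tn_r v - 4 * (1 + m / (m + tn_r x)) * (tn_r v * tn_r x) =
  4 * m ^+ 2 / (m + tn_r x) * tn_r v by field; rewrite gt_eqF.
rewrite -E; set A := _ * (_ ^+ 2); set B := _ * (tn_r v * _); set C' := _ * tn_r v; lra.
Qed.

Lemma tn_metric_le x v : (v *m tn_metric x *m v^T) 0 0 <= 4 * (m + tn_r x) * tn_r v.
Proof.
rewrite tn_metric_quad gerBl mulr_ge0 ?sqr_ge0 // mulr_ge0 // addr_ge0 // divr_ge0 // ltW //; exact: tn_D_gt0.
Qed.

Lemma tn_r_gt0 v : v != 0 -> 0 < tn_r v.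
Proof.
move=> v0; rewrite lt_def tn_r_ge0 andbT; apply: contra_neq v0 => r0.
move: r0; rewrite /tn_r mxE => /eqP; rewrite psumr_eq0 => [/allP H|i _]; last by rewrite mxE -expr2 sqr_ge0.
by apply/rowP => i; rewrite [RHS]mxE; have := H i (mem_index_enum i); rewrite mxE mulf_eq0 orbb => /eqP.
Qed.

Lemma tn_J_metric Q x : Q^T = - Q ->
  tn_J Q x *m tn_metric x = (4 * (m + tn_r x)) *: Q - 4 *: (tn_S x *m Q + Q *m tn_S x).
Proof.
move=> QT; have D0 := tn_D_gt0 x; rewrite /tn_J /tn_metric mulmxBr mul_mx_scalar -scalemxAr mulmxDl mulmxBl.
rewrite -!scalemxAl tn_SQS // -(mulmxA Q) tn_SS -scalemxAr.
move: (tn_S x *m Q) (Q *m tn_S x) => A B; apply/matrixP => i j; rewrite !mxE.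
by field; rewrite !gt_eqF.
Qed.

Lemma tn_J_mul Q Q' x : Q^T = - Q -> Q'^T = - Q' -> tn_J Q x *m tn_J Q' x =
  Q *m Q' - (m + tn_r x)^-1 *: (tn_S x *m (Q *m Q')) + m^-1 *: (Q *m Q' *m tn_S x)
  - (m * (m + tn_r x))^-1 *: (tn_S x *m (Q *m Q') *m tn_S x).
Proof.
move=> QT QT'; have D0 := tn_D_gt0 x; rewrite /tn_J !(mulmxDl, mulmxDr, mulNmx, mulmxN) -!scalemxAl -!scalemxAr.
have e1 : tn_S x *m Q *m (tn_S x *m Q') = 0 by rewrite mulmxA tn_SQS // mul0mx.
have e2 : Q *m tn_S x *m (Q' *m tn_S x) = 0 
    by rewrite -(mulmxA Q) (mulmxA (tn_S x)) tn_SQS // mulmx0.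
have e3 : Q *m tn_S x *m (tn_S x *m Q') = tn_r x *: (Q *m tn_S x *m Q').
  by rewrite -mulmxA (mulmxA (tn_S x)) tn_SS -scalemxAl -scalemxAr mulmxA.
rewrite e1 e2 e3 !mulmxA.
move: (tn_S x *m Q *m Q' *m tn_S x) (Q *m tn_S x *m Q') (Q *m Q' *m tn_S x) (tn_S x *m Q *m Q') (Q *m Q') => A B C F G.
by apply/matrixP => i j; rewrite !mxE; field; rewrite !gt_eqF.
Qed.

Lemma tn_K_metric x : tn_K x *m tn_metric x = tn_Y x.
Proof.
have D0 := tn_D_gt0 x; rewrite /tn_K /tn_metric /tn_Y mulmxBr mul_mx_scalar -scalemxAr mulmxDl mulmxBl -!scalemxAl.
have -> : tnE *m tn_S x = x^T *m tn_s x by rewrite /tn_S mulmxA tnE_sT.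
have -> : x^T *m tn_s x *m tn_S x = tn_r x *: (x^T *m tn_s x).
  by rewrite -mulmxA /tn_S row_scalar tn_ss -scalemxAr.
have -> : (tn_s x)^T *m x *m tn_S x = 0.
  by rewrite -mulmxA /tn_S row_scalar tn_xs scale0r mulmx0.
move: (x^T *m tn_s x) ((tn_s x)^T *m x) => A B; apply/matrixP => i j; rewrite !mxE.
by field; rewrite !gt_eqF.
Qed.

Lemma tn_Y_skew x : (tn_Y x)^T = - tn_Y x.
Proof.
have T : (x^T *m tn_s x)^T = (tn_s x)^T *m x by rewrite trmx_mul trmxK.
have k (a b : R) (A B : 'M[R]_4) : A^T = - A -> (a *: A - b *: (B - B^T))^T = - (a *: A - b *: (B - B^T)).
  move=> AT; apply/matrixP => i j; have /matrixP/(_ i j) := AT; rewrite !mxE => ->; ring.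
by have := k (2 * (2 * tn_r x + m) * (m + tn_r x)) (4 * tn_r x + 6 * m) tnE (x^T *m tn_s x) tnE_T; rewrite T.
Qed.

End TaubNutAlgebra.

Section SmoothDerivative.
Variables (R : realType) (a : 'I_4) (x : 'rV[R]_4).
Implicit Types (f g : 'rV[R]_4 -> R) (d e c : R).

Definition has_partial f d := smooth_on setT f /\ partial a f x = d.

Let sderiv f : smooth_on setT f -> derivable f x (delta_mx 0 a).
Proof. by move=> sf; exact: (@smooth_derivable _ _ _ x a sf I). Qed.

Lemma has_partial_eq f d e : has_partial f d -> d = e -> has_partial f e.
Proof. by move=> H <-. Qed.

Lemma has_partialC c : has_partial (fun=> c) 0.
Proof. by split; [apply: smooth_cst; exact: openT|exact: partialC]. Qed.

Lemma has_partialX b : has_partial (fun y => y 0 b) (a == b)%:R.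
Proof. by split; [apply: smooth_coord; exact: openT|exact: partial_coord]. Qed.

Lemma has_partialD f g d e : has_partial f d -> has_partial g e -> has_partial (fun y => f y + g y) (d + e).
Proof.
move=> [sf <-] [sg <-]; split; first by apply: smoothD => //; exact: openT.
by rewrite partialD //; exact: sderiv.
Qed.

Lemma has_partialM f g d e : has_partial f d -> has_partial g e ->
  has_partial (fun y => f y * g y) (d * g x + f x * e).
Proof.
move=> [sf <-] [sg <-]; split; first by apply: smoothM => //; exact: openT.
by rewrite partialM //; exact: sderiv.
Qed.

Lemma has_partialN f d : has_partial f d -> has_partial (fun y => - f y) (- d).
Proof.
move=> [sf <-]; split; first by apply: smoothN => //; exact: openT.
by rewrite partialN //; exact: sderiv.
Qed.

Lemma has_partialB f g d e : has_partial f d -> has_partial g e -> has_partial (fun y => f y - g y) (d - e).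
Proof. by move=> H1 H2; exact: (has_partialD H1 (has_partialN H2)). Qed.

Lemma has_partialV f d : has_partial f d -> (forall y, f y != 0) ->
  has_partial (fun y => (f y)^-1) (- d / f x ^+ 2).
Proof.
move=> [sf <-] f0; split; first by apply: (smoothV openT) => // y _; exact: f0.
by rewrite partialV //; exact: sderiv.
Qed.

Lemma has_partial_ext f g d : f =1 g -> has_partial f d -> has_partial g d.
Proof. by move=> /funext ->. Qed.

End SmoothDerivative.

Section Entries.
Variables (R : realType) (p q : nat) (i : 'I_p) (j : 'I_q).
Implicit Types A B : 'M[R]_(p, q).
Lemma mxDE A B : (A + B) i j = A i j + B i j. Proof. by rewrite mxE. Qed.
Lemma mxNE A : (- A) i j = - A i j. Proof. by rewrite mxE. Qed.
Lemma mxZE k A : (k *: A) i j = k * A i j. Proof. by rewrite mxE. Qed.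
Lemma outerE (u : 'rV[R]_p) (v : 'rV[R]_q) : (u^T *m v) i j = u 0 i * v 0 j.
Proof. by rewrite mxE big_ord1 mxE. Qed.
End Entries.

Section TaubNutCalculus.
Variables (R : realType) (m : R).
Hypothesis m_gt0 : 0 < m.
Implicit Types (x : 'rV[R]_4) (Q : 'M[R]_4) (a b c : 'I_4).
Notation E := (tnE R).
Notation r := (@tn_r R).
Notation s := (@tn_s R).
Notation g := (tn_metric m).
Notation Y := (tn_Y m).
Notation J Q := (tn_J m Q).
Notation D x := (m + tn_r x).

Lemma tnE_skew a b : E b a = - E a b.
Proof. by have /matrixP/(_ a b) := tnE_T R; rewrite mxE [RHS]mxE. Qed.

Lemma has_partial_mul Q a b x : has_partial a x (fun y => (y *m Q) 0 b) (Q a b).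
Proof.
pose f (y : 'rV[R]_4) := \sum_j y 0 j * Q j b.
apply: (@has_partial_ext R a x f); first by move=> y; rewrite /f mxE.
have H j : has_partial a x (fun y => y 0 j * Q j b) ((a == j)%:R * Q j b + x 0 j * 0).
  exact: (has_partialM (has_partialX a x j) (has_partialC a x (Q j b))).
rewrite /f; apply: (@has_partial_ext R a x (fun y => y 0 o0 * Q o0 b + y 0 o1 * Q o1 b + y 0 o2 * Q o2 b + y 0 o3 * Q o3 b)).
  by move=> y; rewrite sum4.
apply: has_partial_eq (has_partialD (has_partialD (has_partialD (H o0) (H o1)) (H o2)) (H o3)) _.
by rewrite !mulr0 !addr0; move: {H}a; apply: all4; rewrite /= ?mul1r ?mul0r ?addr0 ?add0r.
Qed.

Lemma has_partial_s a b x : has_partial a x (fun y => s y 0 b) (E a b).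
Proof. exact: has_partial_mul. Qed.

Lemma has_partial_r a x : has_partial a x r (2 * x 0 a).
Proof.
have H j : has_partial a x (fun y => y 0 j * y 0 j) ((a == j)%:R * x 0 j + x 0 j * (a == j)%:R).
  exact: (has_partialM (has_partialX a x j) (has_partialX a x j)).
apply: (@has_partial_ext R a x (fun y => y 0 o0 * y 0 o0 + y 0 o1 * y 0 o1 + y 0 o2 * y 0 o2 + y 0 o3 * y 0 o3)).
  by move=> y; rewrite /tn_r mxE sum4 !mxE.
apply: has_partial_eq (has_partialD (has_partialD (has_partialD (H o0) (H o1)) (H o2)) (H o3)) _.
by move: {H}a; apply: all4; rewrite /=; ring.
Qed.

Lemma tn_D_neq0 x : D x != 0.
Proof. by rewrite gt_eqF // tn_D_gt0. Qed.

Lemma tn_metric_ij x b c : g x b c = 4 * D x * (b == c)%:R - 4 * (1 + m * (D x)^-1) * (s x 0 b * s x 0 c).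
Proof.
by rewrite /tn_metric mxDE mxNE mxZE /tn_S outerE [X in X - _]mxE mulr_natr.
Qed.

Lemma has_partial_D a x : has_partial a x (fun y => D y) (0 + 2 * x 0 a).
Proof. exact: (has_partialD (has_partialC a x m) (has_partial_r a x)). Qed.

Lemma has_partial_metric a b c x : has_partial a x (fun y => g y b c)
  (8 * x 0 a * (b == c)%:R + 8 * m / D x ^+ 2 * x 0 a * (s x 0 b * s x 0 c)
   - 4 * (1 + m / D x) * (E a b * s x 0 c + s x 0 b * E a c)).
Proof.
pose f y := 4 * D y * (b == c)%:R - 4 * (1 + m * (D y)^-1) * (s y 0 b * s y 0 c).
apply: (@has_partial_ext R a x f); first by move=> y; rewrite tn_metric_ij.
have HD := has_partial_D a x; have C k := has_partialC a x k.
have H1 := has_partialM (has_partialM (C 4) HD) (C (b == c)%:R).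
have H2 := has_partialM (C 4) (has_partialD (C 1) (has_partialM (C m) (has_partialV HD tn_D_neq0))).
have H3 := has_partialM H2 (has_partialM (has_partial_s a b x) (has_partial_s a c x)).
apply: has_partial_eq (has_partialB H1 H3) _.
by field; rewrite tn_D_neq0.
Qed.

Lemma has_partial_Y a b c x : has_partial a x (fun y => Y y b c)
  (2 * x 0 a * (8 * r x + 6 * m) * E b c - 8 * x 0 a * (x 0 b * s x 0 c - s x 0 b * x 0 c)
   - (4 * r x + 6 * m) * ((a == b)%:R * s x 0 c + x 0 b * E a c - E a b * x 0 c - s x 0 b * (a == c)%:R)).
Proof.
pose f y := (2 * (2 * r y + m) * (m + r y)) * E b c - (4 * r y + 6 * m) * (y 0 b * s y 0 c - s y 0 b * y 0 c).
apply: (@has_partial_ext R a x f).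
  by move=> y; rewrite /f /tn_Y mxDE mxNE !mxZE mxDE mxNE !outerE.
have C k := has_partialC a x k; have Hr := has_partial_r a x.
have Hs j := has_partial_s a j x; have Hx j := has_partialX a x j.
have H1 := has_partialM (has_partialM (has_partialM (C 2) (has_partialD (has_partialM (C 2) Hr) (C m))) (has_partial_D a x)) (C (E b c)).
have H2 := has_partialD (has_partialM (C 4) Hr) (C (6 * m)).
have H3 := has_partialB (has_partialM (Hx b) (Hs c)) (has_partialM (Hs b) (Hx c)).
apply: has_partial_eq (has_partialB H1 (has_partialM H2 H3)) _.
by ring.
Qed.

Lemma tn_metric_smooth : smooth_mat setT g.
Proof. by move=> b c; have [] := has_partial_metric o0 b c 0. Qed.

Lemma tn_Y_smooth : smooth_mat setT Y.
Proof. by move=> b c; have [] := has_partial_Y o0 b c 0. Qed.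

Definition tn_P x := ((2 * r x + m) / 2) *: E + 2^-1 *: ((s x)^T *m x) - ((2 * r x + 3 * m) / (2 * D x)) *: (x^T *m s x).

Lemma tn_metric_P x : g x *m tn_P x = Y x.
Proof.
have -> : tn_P x = - (tn_K m x)^T.
  apply/matrixP => i j; rewrite mxNE [X in _ = - X]mxE /tn_P /tn_K !mxDE !mxNE !mxZE !outerE tnE_skew.
  by ring.
by rewrite mulmxN -{1}(tn_metric_T m x) -trmx_mul (tn_K_metric m_gt0) tn_Y_skew opprK.
Qed.

Lemma tn_row_P (u : 'rV[R]_4) x : u *m tn_P x = ((2 * r x + m) / 2) *: (u *m E) + ((u *m (s x)^T) 0 0 / 2) *: x
  - ((u *m x^T) 0 0 * (2 * r x + 3 * m) / (2 * D x)) *: s x.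
Proof.
rewrite /tn_P mulmxBr mulmxDr -!scalemxAr !row_scalar !scalerA; congr (_ + _ *: _ - _ *: _); first by rewrite mulrC.
by rewrite mulrC mulrA.
Qed.

Definition tn_G a b x : 'rV[R]_4 := (4 * x 0 a) *: delta_mx 0 b + (4 * x 0 b) *: delta_mx 0 a
  - (4 * (a == b)%:R + 4 * m / D x ^+ 2 * s x 0 a * s x 0 b) *: x
  + (4 * m / D x ^+ 2 * (x 0 a * s x 0 b + x 0 b * s x 0 a)) *: s x
  - (4 * (1 + m / D x) * s x 0 b) *: row a E - (4 * (1 + m / D x) * s x 0 a) *: row b E.

Lemma tn_metric_pos x (v : 'rV[R]_4) : v != 0 -> 0 < (v *m g x *m v^T) 0 0.
Proof.
move=> v0; apply: lt_le_trans (tn_metric_ge m_gt0 x v).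
by rewrite mulr_gt0 ?tn_r_gt0 // divr_gt0 ?tn_D_gt0 // mulr_gt0 // exprn_gt0.
Qed.

Lemma tn_metric_unit x : g x \in unitmx.
Proof.
rewrite -row_free_unit -kermx_eq0; apply/rowV0P => v /sub_kermxP vG.
by apply/eqP; apply: contraT => /(tn_metric_pos x); rewrite vG mul0mx mxE ltxx.
Qed.

Lemma rowE1 (A : 'M[R]_4) i j : row i A 0 j = A i j. Proof. by rewrite mxE. Qed.
Lemma deltaE1 i j : (delta_mx 0 i : 'rV[R]_4) 0 j = (i == j)%:R.
Proof. by rewrite mxE eqxx eq_sym. Qed.

Lemma tn_Gam_metric a b x : row b (Gam g a x *m g x) = tn_G a b x.
Proof.
apply/rowP => c; rewrite rowE1 (@Gam_lower R setT g (fun y _ => tn_metric_T m y) (fun y _ => tn_metric_unit y)) //.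
have [_ ->] := has_partial_metric a c b x; have [_ ->] := has_partial_metric b c a x.
have [_ ->] := has_partial_metric c a b x.
rewrite /tn_G !(mxDE, mxNE, mxZE, rowE1, deltaE1) (tnE_skew a b) (tnE_skew a c) (tnE_skew b c).
rewrite (eq_sym c b) (eq_sym c a).
by field; rewrite tn_D_neq0.
Qed.

Lemma tn_dot_delta b (v : 'rV[R]_4)  : ((delta_mx 0 b : 'rV[R]_4) *m v^T) 0 0 = v 0 b.
Proof. by rewrite -rowE !mxE. Qed.

Lemma tn_Gam_Y a b c x : (Gam g a x *m Y x) b c =
  let p := (2 * r x + m) / 2 in let q := (2 * r x + 3 * m) / (2 * D x) in
  4 * x 0 a * (p * E b c + s x 0 b / 2 * x 0 c - q * x 0 b * s x 0 c)
  + 4 * x 0 b * (p * E a c + s x 0 a / 2 * x 0 c - q * x 0 a * s x 0 c)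
  - (4 * (a == b)%:R + 4 * m / D x ^+ 2 * s x 0 a * s x 0 b) * (p * s x 0 c - q * r x * s x 0 c)
  + 4 * m / D x ^+ 2 * (x 0 a * s x 0 b + x 0 b * s x 0 a) * (- p * x 0 c + r x / 2 * x 0 c)
  - 4 * (1 + m / D x) * s x 0 b * (- p * (a == c)%:R + x 0 a / 2 * x 0 c + q * s x 0 a * s x 0 c)
  - 4 * (1 + m / D x) * s x 0 a * (- p * (b == c)%:R + x 0 b / 2 * x 0 c + q * s x 0 b * s x 0 c).
Proof.
rewrite /= -tn_metric_P mulmxA -rowE1 row_mul tn_Gam_metric /tn_G.
have rE i : row i E *m E = - delta_mx 0 i by rewrite -row_mul tnE_sqr linearN /= row1.
have rs i : (row i E *m (s x)^T) 0 0 = x 0 i by rewrite rowE -mulmxA tnE_sT tn_dot_delta.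
have rx i : (row i E *m x^T) 0 0 = - s x 0 i.
  by rewrite rowE -mulmxA -[E *m x^T]opprK -tn_sT mulmxN [LHS]mxE tn_dot_delta.
have dE i : (delta_mx 0 i : 'rV[R]_4) *m E = row i E by rewrite -rowE.
rewrite !(mulmxDl, mulNmx) -!scalemxAl !tn_row_P !rE !dE !rs !rx !tn_dot_delta tn_xs tn_sx tn_ss -/(r x) tn_sE -/(s x).
rewrite !(mxDE, mxNE, mxZE, rowE1, deltaE1).
by field; rewrite tn_D_neq0.
Qed.

Lemma tn_killing_yano a b c x : nabla g Y x a b c + nabla g Y x b a c = 0.
Proof.
have nE i j k : nabla g Y x i j k = partial i (fun y => Y y j k) x - (Gam g i x *m Y x) j k + (Gam g i x *m Y x) k j.
  have T : Y x *m (Gam g i x)^T = - (Gam g i x *m Y x)^T by rewrite trmx_mul tn_Y_skew mulNmx opprK.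
  by rewrite nablaE nabla_formE T opprK mxDE mxDE mxNE mxE_partial [X in _ + X]mxE.
rewrite !nE; have [_ ->] := has_partial_Y a b c x; have [_ ->] := has_partial_Y b a c x.
rewrite !tn_Gam_Y /= (tnE_skew a b) (tnE_skew a c) (tnE_skew b c).
rewrite (eq_sym c b) (eq_sym c a) (eq_sym b a).
by field; rewrite tn_D_neq0.
Qed.

End TaubNutCalculus.

Lemma alternating4 (R : realFieldType) (f : 'I_4 -> 'I_4 -> 'I_4 -> R) :
  (forall a b c, f b a c = - f a b c) -> (forall a b c, f b c a = f a b c) ->
  f o0 o1 o2 = 0 -> f o0 o1 o3 = 0 -> f o0 o2 o3 = 0 -> f o1 o2 o3 = 0 -> forall a b c, f a b c = 0.
Proof.
move=> fs fc h1 h2 h3 h4; have z1 a c : f a a c = 0 by have := fs a a c; lra.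
have z2 a c : f a c a = 0 by rewrite fc.
have z3 a c : f c a a = 0 by rewrite -fc.
have p a b c : f a b c = 0 -> [/\ f b c a = 0, f c a b = 0, f b a c = 0, f a c b = 0 & f c b a = 0].
  by move=> h; split; [rewrite fc|rewrite fc fc|rewrite fs h oppr0|rewrite fc fs h oppr0|rewrite fc fc fs h oppr0].
have [a1 a2 a3 a4 a5] := p _ _ _ h1; have [b1 b2 b3 b4 b5] := p _ _ _ h2.
have [c1 c2 c3 c4 c5] := p _ _ _ h3; have [d1 d2 d3 d4 d5] := p _ _ _ h4.
by apply: all4; apply: all4; apply: all4.
Qed.

Section TaubNutKahler.
Variables (R : realType) (m : R).
Hypothesis m_gt0 : 0 < m.
Implicit Types (x : 'rV[R]_4) (Q : 'M[R]_4) (a b c : 'I_4).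
Notation E := (tnE R).
Notation r := (@tn_r R).
Notation s := (@tn_s R).
Notation g := (tn_metric m).
Notation Y := (tn_Y m).
Notation J Q := (tn_J m Q).
Notation D x := (m + tn_r x).
Notation Q1 := (Q1 R).
Notation Q2 := (Q2 R).
Notation Q3 := (Q3 R).

Lemma std_skew : [/\ Q1^T = - Q1, Q2^T = - Q2 & Q3^T = - Q3].
Proof. by rewrite /Q1 /Q2 /Q3 !M4T !M4N !oppr0 !opprK. Qed.

Lemma std_mul : [/\ Q1 *m Q2 = Q3, Q2 *m Q1 = - Q3, Q1 *m Q1 = - 1%:M, Q2 *m Q2 = - 1%:M & Q3 *m Q3 = - 1%:M].
Proof. by rewrite /Q1 /Q2 /Q3 M4_1 !M4M !M4N !(@simp4 R). Qed.

Lemma tn_fundamental_form Q b c x : Q^T = - Q -> (J Q x *m g x) b c =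
  4 * D x * Q b c - 4 * (s x 0 b * (x *m (E *m Q)) 0 c - (x *m (E *m Q)) 0 b * s x 0 c).
Proof.
move=> QT; rewrite tn_J_metric // mxDE mxNE !mxZE mxDE.
have -> : tn_S x *m Q = (s x)^T *m (x *m (E *m Q)) by rewrite /tn_S -mulmxA /tn_s !mulmxA.
have -> : Q *m tn_S x = - ((x *m (E *m Q))^T *m s x).
  have -> : x *m (E *m Q) = s x *m Q by rewrite /tn_s mulmxA.
  by rewrite trmx_mul QT mulNmx mulNmx opprK /tn_S mulmxA.
by rewrite mxNE !outerE.
Qed.

Lemma has_partial_fundamental_form Q a b c x : Q^T = - Q -> has_partial a x (fun y => (J Q y *m g y) b c)
  (8 * x 0 a * Q b c - 4 * (E a b * (x *m (E *m Q)) 0 c + s x 0 b * (E *m Q) a c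
     - (E *m Q) a b * s x 0 c - (x *m (E *m Q)) 0 b * E a c)).
Proof.
move=> QT; apply: (@has_partial_ext R a x (fun y => 4 * D y * Q b c
  - 4 * (s y 0 b * (y *m (E *m Q)) 0 c - (y *m (E *m Q)) 0 b * s y 0 c))).
  by move=> y; rewrite tn_fundamental_form.
have C k := has_partialC a x k; have Hs j := has_partial_s a j x; have Ht j := has_partial_mul (E *m Q) a j x.
have H1 := has_partialM (has_partialM (C 4) (has_partial_D m a x)) (C (Q b c)).
have H2 := has_partialM (C 4) (has_partialB (has_partialM (Hs b) (Ht c)) (has_partialM (Ht b) (Hs c))).
by apply: has_partial_eq (has_partialB H1 H2) _; ring.
Qed.

Lemma row4_mul x (M : 'M[R]_4) j : (x *m M) 0 j = x 0 o0 * M o0 j + x 0 o1 * M o1 j + x 0 o2 * M o2 j + x 0 o3 * M o3 j.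
Proof. by rewrite mxE sum4. Qed.

Lemma std_cyclic Q x : Q = Q1 \/ Q = Q2 \/ Q = Q3 -> forall a b c, [/\ (E *m Q) a b = (E *m Q) b a &
  x 0 a * Q b c + x 0 b * Q c a + x 0 c * Q a b = E a b * (x *m (E *m Q)) 0 c
   + E b c * (x *m (E *m Q)) 0 a + E c a * (x *m (E *m Q)) 0 b].
Proof.
have H Q' M : E *m Q' = M -> (forall a b, M a b = M b a) ->
  (forall a b c, x 0 a * Q' b c + x 0 b * Q' c a + x 0 c * Q' a b = E a b * (x *m M) 0 c
   + E b c * (x *m M) 0 a + E c a * (x *m M) 0 b) -> forall a b c, [/\ (E *m Q') a b = (E *m Q') b a &
  x 0 a * Q' b c + x 0 b * Q' c a + x 0 c * Q' a b = E a b * (x *m (E *m Q')) 0 c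
   + E b c * (x *m (E *m Q')) 0 a + E c a * (x *m (E *m Q')) 0 b].
  by move=> -> H1 H2 a b c; split.
have K Q' M : Q'^T = - Q' -> (let f a b c := x 0 a * Q' b c + x 0 b * Q' c a + x 0 c * Q' a b
      - (E a b * (x *m M) 0 c + E b c * (x *m M) 0 a + E c a * (x *m M) 0 b) in
    [/\ f o0 o1 o2 = 0, f o0 o1 o3 = 0, f o0 o2 o3 = 0 & f o1 o2 o3 = 0]) ->
  forall a b c, x 0 a * Q' b c + x 0 b * Q' c a + x 0 c * Q' a b = E a b * (x *m M) 0 c
   + E b c * (x *m M) 0 a + E c a * (x *m M) 0 b.
  move=> QT [f1 f2 f3 f4] a b c; apply/eqP; rewrite -subr_eq0; apply/eqP; move: a b c.
  have QE a b : Q' b a = - Q' a b by have /matrixP/(_ a b) := QT; rewrite mxE [RHS]mxE.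
  apply: alternating4 f1 f2 f3 f4 => a b c; last by ring.
  rewrite (QE a b) (QE b c) (QE c a) (tnE_skew R a b) (tnE_skew R b c) (tnE_skew R c a); ring.
have [t1 t2 t3] := std_skew; case=> [->|[->|->]].
- apply: (H _ (M4 (-1) 0 0 0 0 (-1) 0 0 0 0 1 0 0 0 0 1)).
  + by rewrite /tnE /Q1 M4M !(@simp4 R).
  + by apply: all4; apply: all4; rewrite !mxE.
  + by apply: (K _ _ t1); rewrite /tnE /Q1 !row4_mul !mxE /=; split; ring.
- apply: (H _ (M4 0 0 0 1 0 0 (-1) 0 0 (-1) 0 0 1 0 0 0)).
  + by rewrite /tnE /Q2 M4M !(@simp4 R).
  + by apply: all4; apply: all4; rewrite !mxE.
  + by apply: (K _ _ t2); rewrite /tnE /Q2 !row4_mul !mxE /=; split; ring.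
- apply: (H _ (M4 0 0 (-1) 0 0 0 0 (-1) (-1) 0 0 0 0 (-1) 0 0)).
  + by rewrite /tnE /Q3 M4M !(@simp4 R).
  + by apply: all4; apply: all4; rewrite !mxE.
  + by apply: (K _ _ t3); rewrite /tnE /Q3 !row4_mul !mxE /=; split; ring.
Qed.

Lemma std_units Q : Q = Q1 \/ Q = Q2 \/ Q = Q3 -> Q^T = - Q.
Proof. by have [t1 t2 t3] := std_skew; case=> [->|[->|->]]. Qed.

Lemma tn_closed Q x a b c : Q = Q1 \/ Q = Q2 \/ Q = Q3 -> ext_deriv (fun y => J Q y *m g y) x a b c = 0.
Proof.
move=> QQ; have QT := std_units QQ; rewrite /ext_deriv.
have [_ ->] := has_partial_fundamental_form a b c x QT; have [_ ->] := has_partial_fundamental_form b c a x QT.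
have [_ ->] := has_partial_fundamental_form c a b x QT.
have [sbc _] := std_cyclic x QQ b c a; have [sca _] := std_cyclic x QQ c a b; have [sab C] := std_cyclic x QQ a b c.
rewrite sbc sca sab (tnE_skew R a b) (tnE_skew R b c) (tnE_skew R c a).
move: C; set t := x *m _; set M := E *m Q => C.
transitivity (8 * (x 0 a * Q b c + x 0 b * Q c a + x 0 c * Q a b - (E a b * t 0 c + E b c * t 0 a + E c a * t 0 b))).
  by ring.
by rewrite C subrr mulr0.
Qed.

Lemma tn_J_smooth Q : smooth_mat setT (J Q).
Proof.
have oT : open [set: 'rV[R]_4] := openT.
have ss : smooth_mat setT s by move=> i j; rewrite ord1; have [] := has_partial_s o0 j (0 : 'rV[R]_4).
have sS : smooth_mat setT (@tn_S R) := smooth_matM oT (smooth_matT oT ss) ss.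
have C (A : 'M[R]_4) : smooth_mat setT (fun=> A) := smooth_mat_cst oT A.
have sV : smooth_on setT (fun y => (D y)^-1).
  by have [] := has_partialV (has_partial_D m o0 (0 : 'rV[R]_4)) (tn_D_neq0 m_gt0).
apply: smooth_matD => //.
  apply: smooth_matD; [exact: oT|exact: C|apply: smooth_matN; first exact: oT].
  by apply: smooth_matZ => //; apply: smooth_matM => //; exact: C.
by apply: smooth_matZ => //; [exact: smooth_cst|apply: smooth_matM => //; exact: C].
Qed.

Lemma tn_form_skew Q x : Q^T = - Q -> (J Q x *m g x)^T = - (J Q x *m g x).
Proof.
move=> QT; rewrite tn_J_metric //; have T : (tn_S x *m Q)^T = - (Q *m tn_S x) by rewrite trmx_mul QT tn_ST mulNmx.
have T' : (Q *m tn_S x)^T = - (tn_S x *m Q) by rewrite trmx_mul QT tn_ST mulmxN.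
apply/matrixP => i j; rewrite [LHS]mxE mxNE !mxDE !mxNE !mxZE !mxDE.
have /matrixP/(_ i j) := QT; have /matrixP/(_ i j) := T; have /matrixP/(_ i j) := T'.
rewrite [in X in X -> _]mxE mxNE => ->; rewrite [in X in X -> _]mxE mxNE => ->; rewrite [in X in X -> _]mxE mxNE => ->.
ring.
Qed.

Lemma tn_J_sqr Q x : Q^T = - Q -> Q *m Q = - 1%:M -> J Q x *m J Q x = - 1%:M.
Proof.
move=> QT QQ; rewrite tn_J_mul // QQ mulmxN mulNmx mulmx1 mul1mx mulNmx tn_SS.
move: (tn_S x) => A; apply/matrixP => i j; rewrite !mxE.
by field; rewrite tn_D_neq0 // gt_eqF.
Qed.

Lemma tn_J_mul0 Q Q' x : Q^T = - Q -> Q'^T = - Q' -> (Q *m Q')^T = - (Q *m Q') -> J Q x *m J Q' x = J (Q *m Q') x.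
Proof. by move=> QT QT' QQT; rewrite tn_J_mul // tn_SQS // scaler0 subr0. Qed.

Lemma tn_JN Q x : J (- Q) x = - J Q x.
Proof. by rewrite /tn_J mulmxN mulNmx !scalerN !opprD opprK. Qed.

Lemma tn_J_lin (a b c : R) x : a *: J Q1 x + b *: J Q2 x + c *: J Q3 x = J (a *: Q1 + b *: Q2 + c *: Q3) x.
Proof.
rewrite /tn_J !mulmxDl !mulmxDr -!scalemxAl -!scalemxAr.
move: (tn_S x *m Q1) (tn_S x *m Q2) (tn_S x *m Q3) (Q1 *m tn_S x) (Q2 *m tn_S x) (Q3 *m tn_S x) => A B C F G H.
by apply/matrixP => i j; rewrite !mxDE !mxNE !mxZE !mxDE !mxNE !mxZE; ring.
Qed.

Lemma tn_hk_chart : hk_chart setT g (J Q1) (J Q2) (J Q3).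
Proof.
have [t1 t2 t3] := std_skew; have [m12 m21 m11 m22 m33] := std_mul.
split.
- exact: openT.
- exact: tn_metric_smooth.
- exact: tn_J_smooth.
- exact: tn_J_smooth.
- exact: tn_J_smooth.
- move=> x _; split.
  + exact: tn_metric_T.
  + by move=> v; exact: tn_metric_pos.
  + by rewrite tn_J_mul0 ?m12.
  + by rewrite tn_J_mul0 ?m21 ?tn_JN // linearN /= t3.
  + exact: tn_J_sqr.
  + exact: tn_J_sqr.
  + exact: tn_J_sqr.
  + exact: tn_form_skew.
  + exact: tn_form_skew.
  + exact: tn_form_skew.
- by move=> x _ a b c; apply: tn_closed; left.
- by move=> x _ a b c; apply: tn_closed; right; left.
- by move=> x _ a b c; apply: tn_closed; right; right.
Qed.

End TaubNutKahler.

Lemma nijenhuis_torsion_free (R : comNzRingType) (j : 'M[R]_4) (G : 'I_4 -> 'M[R]_4) (dj : 'I_4 -> 'I_4 -> 'I_4 -> R) a b d :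
  (forall c e k, G c e k = G e c k) -> (forall c i k, dj c i k = (G c *m j) i k - (j *m G c) i k) ->
  j *m j = - 1%:M ->
  \sum_c (j a c * dj c b d - j b c * dj c a d + j c d * (dj b a c - dj a b c)) = 0.
Proof.
move=> Gs djE jj; have mE (A B : 'M[R]_4) i k : \sum_c A i c * B c k = (A *m B) i k by rewrite mxE.
have Gj c i k : (G c *m j) i k = (G i *m j) c k by rewrite -!mE; apply: eq_bigr => e _; rewrite Gs.
have T : \sum_c j a c * (j *m G c) b d = \sum_c j b c * (j *m G c) a d.
  under eq_bigr => c _ do rewrite -mE mulr_sumr.
  rewrite exchange_big /=; apply: eq_bigr => e _; rewrite -mE mulr_sumr; apply: eq_bigr => c _.
  by rewrite (Gs c e d) mulrCA.
have S8 (F1 F2 F3 F4 F5 F6 F7 F8 : 'I_4 -> R) :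
    \sum_c (F1 c - F2 c - F3 c + F4 c + F5 c - F6 c - F7 c + F8 c) =
    \sum_c F1 c - \sum_c F2 c - \sum_c F3 c + \sum_c F4 c + \sum_c F5 c - \sum_c F6 c - \sum_c F7 c + \sum_c F8 c.
  by rewrite !(big_split, sumrN).
apply: etrans (etrans (S8 (fun c => j a c * (G b *m j) c d) (fun c => j a c * (j *m G c) b d)
  (fun c => j b c * (G a *m j) c d) (fun c => j b c * (j *m G c) a d) (fun c => (G b *m j) a c * j c d)
  (fun c => (j *m G b) a c * j c d) (fun c => (G a *m j) b c * j c d) (fun c => (j *m G a) b c * j c d)) _).
  apply: eq_bigr => c _; rewrite !djE (Gj c b) (Gj c a).
  move: (G b *m j) (j *m G b) (G a *m j) (j *m G a) (j *m G c) => A1 A2 A3 A4 A5; ring.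
have m1 e i k : (G e *m j *m j) i k = - G e i k by rewrite -mulmxA jj mulmxN mulmx1 mxE.
by rewrite T !mE !m1 -!(mulmxA j) (Gs a b d); ring.
Qed.

Lemma parallel_nijenhuis (R : realType) (U : set 'rV[R]_4) (g J : 'rV[R]_4 -> 'M[R]_4) x a b d : open U ->
  (forall x, U x -> (g x)^T = g x) -> U x -> (forall c, nabla_endo g c J x = 0) -> J x *m J x = - 1%:M ->
  nijenhuis J x a b d = 0.
Proof.
move=> oU gT Ux pJ JJ; rewrite /nijenhuis.
apply: (@nijenhuis_torsion_free R (J x) (fun c => Gam g c x) (fun c i k => partial c (fun y => J y i k) x)).
- by move=> c e k; exact: (Gam_symm oU gT).
- by move=> c i k; rewrite -mxE_partial (partial_nabla_endo g) pJ add0r mxDE mxNE.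
- exact: JJ.
Qed.

Section TaubNutConstants.
Variables (R : realType) (m : R).
Hypothesis m_gt0 : 0 < m.
Implicit Types (x : 'rV[R]_4) (Q : 'M[R]_4) (a b c : 'I_4).
Notation E := (tnE R).
Notation r := (@tn_r R).
Notation s := (@tn_s R).
Notation g := (tn_metric m).
Notation Y := (tn_Y m).
Notation J Q := (tn_J m Q).
Notation D x := (m + tn_r x).
Notation Q1 := (Q1 R).
Notation Q2 := (Q2 R).
Notation Q3 := (Q3 R).

Lemma tn_Kend x : Kend g Y x = tn_K m x.
Proof.
rewrite -[LHS](mulmxK (tn_metric_unit m_gt0 x)) (KendK Y (tn_hk_chart m_gt0)) //.
by rewrite -(tn_K_metric m_gt0) mulmxK // tn_metric_unit.
Qed.

Lemma tr_outer (u v : 'rV[R]_4) : \tr (u^T *m v) = (v *m u^T) 0 0.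
Proof. by rewrite mxtrace_mulC /mxtrace big_ord1. Qed.

Lemma tnE_commute Q : Q = Q1 \/ Q = Q2 \/ Q = Q3 -> E *m Q = Q *m E /\ \tr (E *m Q) = 0.
Proof. by case=> [->|[->|->]]; rewrite /tnE /Q1 /Q2 /Q3 !M4M M4_tr !(@simp4 R); split => //; ring. Qed.

Lemma skew_swap Q (u v : 'rV[R]_4) : Q^T = - Q -> (u *m Q *m v^T) 0 0 = - (v *m Q *m u^T) 0 0.
Proof.
move=> QT; have T : (v *m Q *m u^T)^T = - (u *m Q *m v^T) by rewrite !trmx_mul trmxK QT mulNmx mulmxN mulmxA.
by have /matrixP/(_ 0 0) := T; rewrite mxE [X in _ = X]mxE => ->; rewrite opprK.
Qed.

Lemma tn_sS x : s x *m tn_S x = r x *: s x.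
Proof. by rewrite /tn_S row_scalar tn_ss. Qed.

Lemma tn_xS x : x *m tn_S x = 0.
Proof. by rewrite /tn_S row_scalar tn_xs scale0r. Qed.

Lemma tn_SsT x : tn_S x *m (s x)^T = r x *: (s x)^T.
Proof. by rewrite -{1}(tn_ST x) -trmx_mul tn_sS linearZ. Qed.

Lemma tn_Sx x : tn_S x *m x^T = 0.
Proof. by rewrite -{1}(tn_ST x) -trmx_mul tn_xS linear0. Qed.

Lemma mxtraceN (A : 'M[R]_4) : \tr (- A) = - \tr A.
Proof. exact: raddfN. Qed.

Lemma tn_moment Q x : Q = Q1 \/ Q = Q2 \/ Q = Q3 ->
  moment g Y (J Q) x = (x *m (E *m Q) *m x^T) 0 0 / 2.
Proof.
move=> QQ; have QT := std_units QQ; have [EQ tEQ] := tnE_commute QQ.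
rewrite momentE tn_Kend mulmxA -/(s x); set chi := (s x *m Q *m x^T) 0 0.
have chiN : (x *m Q *m (s x)^T) 0 0 = - chi.
  exact: skew_swap.
have chi' : (tn_s x *m Q *m x^T) 0 0 = chi by [].
have t1 : \tr (E *m J Q x) = (m^-1 - (D x)^-1) * chi.
  rewrite /tn_J mulmxDr mulmxDr mulmxN -!scalemxAr !(mxtraceD, mxtraceN, mxtraceZ) tEQ add0r.
  have -> : E *m (tn_S x *m Q) = x^T *m (s x *m Q) by rewrite /tn_S !mulmxA tnE_sT.
  have -> : E *m (Q *m tn_S x) = Q *m x^T *m s x by rewrite mulmxA EQ -mulmxA /tn_S (mulmxA E) tnE_sT mulmxA.
  rewrite tr_outer (mxtrace_mulC (Q *m x^T)) /mxtrace big_ord1 mulmxA chi'; ring.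
have t2 : \tr (x^T *m s x *m J Q x) = (1 - r x / D x) * chi.
  rewrite -mulmxA tr_outer /tn_J mulmxDr mulmxDr mulmxN -!scalemxAr !mulmxDl mulNmx -!scalemxAl.
  have -> : s x *m (tn_S x *m Q) = r x *: (s x *m Q) by rewrite mulmxA tn_sS -scalemxAl.
  have -> : s x *m (Q *m tn_S x) *m x^T = 0.
    by rewrite -(mulmxA (s x)) -(mulmxA Q) tn_Sx !mulmx0.
  by rewrite scaler0 addr0 -scalemxAl !(mxDE, mxNE, mxZE) chi'; field; rewrite tn_D_neq0.
have t3 : \tr ((s x)^T *m x *m J Q x) = - (1 + r x / m) * chi.
  rewrite -mulmxA tr_outer /tn_J mulmxDr mulmxDr mulmxN -!scalemxAr !mulmxDl mulNmx -!scalemxAl.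
  have -> : x *m (tn_S x *m Q) = 0 by rewrite mulmxA tn_xS mul0mx.
  have -> : x *m (Q *m tn_S x) *m (s x)^T = r x *: (x *m Q *m (s x)^T).
    by rewrite -(mulmxA x) -(mulmxA Q) tn_SsT -!scalemxAr mulmxA.
  by rewrite mul0mx scaler0 subr0 !(mxDE, mxZE) chiN; field; rewrite gt_eqF.
rewrite /tn_K !mulmxDl mulNmx -!scalemxAl !(mxtraceD, mxtraceN, mxtraceZ) t1 t2 t3.
by field; rewrite tn_D_neq0 // gt_eqF.
Qed.

Lemma tn_dmoment Q x : Q = Q1 \/ Q = Q2 \/ Q = Q3 -> dmoment g Y (J Q) x = x *m (E *m Q).
Proof.
move=> QQ; apply/rowP => a; rewrite dmomentE; set M := E *m Q.
have sM b : M a b = M b a by have [] := std_cyclic x QQ a b a.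
have -> : moment g Y (J Q) = fun y => ((y *m M) 0 o0 * y 0 o0 + (y *m M) 0 o1 * y 0 o1 + (y *m M) 0 o2 * y 0 o2
   + (y *m M) 0 o3 * y 0 o3) * 2^-1.
  by apply/funext => y; rewrite tn_moment // mxE sum4 ![y^T _ _]mxE.
have H b : has_partial a x (fun y => (y *m M) 0 b * y 0 b) _ := has_partialM (has_partial_mul M a b x) (has_partialX a x b).
have [_ ->] := has_partialM (has_partialD (has_partialD (has_partialD (H o0) (H o1)) (H o2)) (H o3)) (has_partialC a x 2^-1).
have -> : (x *m M) 0 a = M a o0 * x 0 o0 + M a o1 * x 0 o1 + M a o2 * x 0 o2 + M a o3 * x 0 o3.
  by rewrite row4_mul -!sM; ring.
have S : (x *m M) 0 o0 * (a == o0)%:R + (x *m M) 0 o1 * (a == o1)%:R + (x *m M) 0 o2 * (a == o2)%:R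
    + (x *m M) 0 o3 * (a == o3)%:R = M a o0 * x 0 o0 + M a o1 * x 0 o1 + M a o2 * x 0 o2 + M a o3 * x 0 o3.
  transitivity ((x *m M) 0 a); last by rewrite row4_mul -!sM; ring.
  by clear; move: a; apply: all4; rewrite /= !(mulr0, mulr1, addr0, add0r).
transitivity (2^-1 * ((M a o0 * x 0 o0 + M a o1 * x 0 o1 + M a o2 * x 0 o2 + M a o3 * x 0 o3) +
  (M a o0 * x 0 o0 + M a o1 * x 0 o1 + M a o2 * x 0 o2 + M a o3 * x 0 o3))); last by field.
by rewrite -[X in _ * (_ + X)]S; ring.
Qed.

Lemma tn_kvect x : kvect g (J Q1) Y x = (4 * m)^-1 *: s x.
Proof.
have [t1 _ _] := std_skew R; have [_ _ m11 _ _] := std_mul R.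
rewrite kvectE tn_dmoment; last by left.
have -> : x *m (E *m Q1) = (4 * m)^-1 *: (s x *m J Q1 x *m g x).
  rewrite -mulmxA tn_J_metric // mulmxBr -!scalemxAr mulmxDr.
  have -> : s x *m (tn_S x *m Q1) = r x *: (s x *m Q1) by rewrite mulmxA tn_sS -scalemxAl.
  have -> : s x *m (Q1 *m tn_S x) = 0 by rewrite mulmxA /tn_S row_scalar skew_pair0 // scale0r.
  rewrite addr0 mulmxA -/(s x); move: (s x *m Q1) => A; apply/rowP => i.
  by rewrite !(mxDE, mxNE, mxZE); field; rewrite gt_eqF.
by rewrite -!scalemxAl mulmxK ?tn_metric_unit // -mulmxA tn_J_sqr // mulmxN mulmx1 scalerN opprK.
Qed.

Lemma tn_Aend0 : Aend g (J Q1) Y 0 = (4 * m)^-1 *: E.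
Proof.
apply/row_matrixP => a; rewrite row_Aend /nabla_vect tn_kvect /tn_s mul0mx scaler0 mul0mx addr0.
have -> : kvect g (J Q1) Y = fun y => (4 * m)^-1 *: s y by apply/funext => y; rewrite tn_kvect.
apply/rowP => b; rewrite mxE_partial rowE1 mxZE.
have -> : (fun y => ((4 * m)^-1 *: s y) 0 b) = fun y => (4 * m)^-1 * s y 0 b by apply/funext => y; rewrite mxZE.
have [_ ->] := has_partialM (has_partialC a (0 : 'rV[R]_4) (4 * m)^-1) (has_partial_s a b (0 : 'rV[R]_4)).
by rewrite mul0r add0r.
Qed.

Lemma tn_Kasd0 : Kasd g (J Q1) (J Q2) (J Q3) Y 0 = (m / 2) *: E.
Proof.
rewrite KasdE tn_Kend !tn_moment; [|by right; right|by right; left|by left].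
rewrite !mul0mx mxE mul0r !scale0r !addr0 subr0 /tn_K /tn_s mul0mx !mulmx0 !scaler0 subr0 addr0.
by rewrite /tn_r mul0mx mxE mulr0 add0r.
Qed.

Lemma tn_constants : [/\ knorm g (J Q1) Y 0 + 2 * mu g (J Q1) (J Q2) (J Q3) Y 0 = 1 / 4,
  mu g (J Q1) (J Q2) (J Q3) Y 0 = 1 / 8 & S2 g (J Q1) (J Q2) (J Q3) Y 0 = (m / 2) ^+ 2].
Proof.
have tE : \tr (E *m E) = - 4 by rewrite tnE_sqr linearN /= mxtrace1.
have mE : mu g (J Q1) (J Q2) (J Q3) Y 0 = 1 / 8.
  by rewrite muE tn_Aend0 tn_Kasd0 -scalemxAl -scalemxAr !mxtraceZ tE; field; rewrite gt_eqF.
split => //.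
  by rewrite mE knormE tn_kvect /tn_s mul0mx scaler0 !mul0mx mxE; field.
by rewrite S2E tn_Kasd0 -scalemxAl -scalemxAr !mxtraceZ tE; field.
Qed.

Lemma tn_Y_nonparallel : exists x a b c, nabla g Y x a b c != 0.
Proof.
have [H|nH] := pselect (forall x a b c, nabla g Y x a b c = 0).
  exfalso; pose x : 'rV[R]_4 := delta_mx 0 o0; have hk := tn_hk_chart m_gt0.
  have N a : nabla_form g a Y x = 0 by apply/matrixP => b c; rewrite -nablaE H mxE.
  have : dmoment g Y (J Q1) x = 0.
    apply/rowP => a; rewrite dmomentE.
    have [p _ _] := parallel_J hk a (x := x) I.
    rewrite (partial_moment hk (tn_Y_smooth m) (@tn_J_smooth _ m m_gt0 Q1) I p) N !mul0mx mxtrace0 mul0r oppr0 mxE //.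
  rewrite tn_dmoment; last by left.
  by rewrite mulmxA /x /tnE /Q1 => /rowP/(_ o0); rewrite !(mxE, sum4) /=; lra.
have /existsNP[x /existsNP[a /existsNP[b /existsNP[c /eqP n]]]] := nH.
by exists x, a, b, c.
Qed.

End TaubNutConstants.

Section EuclideanSpace.
Variable R : realType.

Lemma second_countable_rV4 : @second_countable 'rV[R]_4.
Proof.
pose rq (z : 'rV[rat]_4) : 'rV[R]_4 := map_mx ratr z.
pose Bq (p : 'rV[rat]_4 * nat) : set 'rV[R]_4 := ball (rq p.1) p.2.+1%:R^-1.
exists (range Bq); first exact: sub_countable (card_image_le _ _) (countableP _).
split=> [_ [p _ <-]|x P]; first exact: ball_open.
move=> /nbhs_ballP[e e0 He]; have [k Hk] := @ltr_add_invr R 0 (e / 2) (divr_gt0 e0 (ltr0n _ 2)).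
rewrite add0r in Hk; pose d : R := k.+1%:R^-1; have d0 : 0 < d by rewrite invr_gt0.
have H (i : 'I_4) : exists q : rat, `|ratr q - x 0 i| <= d / 2.
  have [q] := @rat_in_itvoo R (x 0 i - d / 2) (x 0 i + d / 2) ltac:(lra).
  by rewrite in_itv /= => /andP[q1 q2]; exists q; rewrite ler_norml; lra.
have [q Hq] := choice H; pose z : 'rV[rat]_4 := \row_i q i.
have zx : `|rq z - x| <= d / 2.
  by apply: normrV_le => [|i]; [rewrite divr_ge0 // ltW|rewrite !mxE].
exists (Bq (z, k)).
  split; first by exists (z, k).
  by rewrite /Bq -ball_normE /= -/d; apply: le_lt_trans zx _; lra.
move=> y; rewrite /Bq -ball_normE /= -/d => By; apply: He; rewrite -ball_normE /=.
have := ler_distD (rq z) x y; rewrite (distrC x (rq z)).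
move: zx By Hk; rewrite -/d; set n1 := `|rq z - x|; set n2 := `|rq z - y|; lra.
Qed.

Lemma connected_rV4 : connected [set: 'rV[R]_4].
Proof.
have -> : [set: 'rV[R]_4] = \bigcup_(x in setT) [set t *: (x : 'rV[R]_4) | t in `[0 : R, 1]].
  apply/seteqP; split=> // x _; exists x => //; exists (1 : R); last by rewrite scale1r.
  by rewrite /= in_itv /= ler01 lexx.
apply: bigcup_connected.
  by exists 0 => x _; exists (0 : R); [rewrite /= in_itv /= ler01 lexx|rewrite scale0r].
move=> x _; apply: connected_continuous_connected; first exact: segment_connected.
apply: continuous_subspaceT => t; apply: cvgZr_tmp; exact: cvg_id.
Qed.

Definition euclidean4 : manifold4 R.
Proof.
refine (@Manifold4 R 'rV[R]_4 unit (fun=> setT) (fun=> id) (fun=> id) _ second_countable_rV4 connected_rV4 _ _ _ _ _ _ _).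
- exact: norm_hausdorff.
- by move=> p; exists tt.
- by move=> _; exact: openT.
- by move=> _; rewrite image_id; exact: openT.
- by [].
- by move=> _ p _; exact: cvg_id.
- by move=> _ p _; exact: cvg_id.
- by move=> _ _ b; rewrite image_id setTI; apply: smooth_coord; exact: openT.
Defined.

End EuclideanSpace.

Lemma ext_deriv_lin (R : realType) (w1 w2 w3 : 'rV[R]_4 -> 'M[R]_4) (a b c : R) x i j k :
  smooth_mat setT w1 -> smooth_mat setT w2 -> smooth_mat setT w3 ->
  ext_deriv (fun y => a *: w1 y + b *: w2 y + c *: w3 y) x i j k =
  a * ext_deriv w1 x i j k + b * ext_deriv w2 x i j k + c * ext_deriv w3 x i j k.
Proof.
move=> s1 s2 s3; have oT : open [set: 'rV[R]_4] := openT.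
have sZ l (w : 'rV[R]_4 -> 'M[R]_4) : smooth_mat setT w -> smooth_mat setT (fun y => l *: w y) := smooth_matZ oT (smooth_cst oT l).
have pZ l (w : 'rV[R]_4 -> 'M[R]_4) n : smooth_mat setT w -> partial_mx n (fun y => l *: w y) x = l *: partial_mx n w x.
  by move=> sw; rewrite (partial_mxZ n (smooth_cst oT l) sw I) partialC scale0r add0r.
have E n p q : partial n (fun y => (a *: w1 y + b *: w2 y + c *: w3 y) p q) x =
    a * partial n (fun y => w1 y p q) x + b * partial n (fun y => w2 y p q) x + c * partial n (fun y => w3 y p q) x.
  have P12 := partial_mxD n (sZ a w1 s1) (sZ b w2 s2) (I : setT x); rewrite !pZ // in P12.
  have P := partial_mxD n (smooth_matD oT (sZ a w1 s1) (sZ b w2 s2)) (sZ c w3 s3) (I : setT x).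
  rewrite P12 pZ // in P.
  by have /matrixP/(_ p q) := P; rewrite !mxE_partial !mxDE !mxZE !mxE_partial.
by rewrite /ext_deriv !E; ring.
Qed.

Section TaubNutManifold.
Variables (R : realType) (m : R).
Hypothesis m_gt0 : 0 < m.
Notation M := (euclidean4 R).
Implicit Types (x : 'rV[R]_4) (Q : 'M[R]_4).
Notation Q1 := (Q1 R).
Notation Q2 := (Q2 R).
Notation Q3 := (Q3 R).

Definition global_field (T : 'rV[R]_4 -> 'M[R]_4) : mxfield M := fun=> T.
Notation g := (global_field (tn_metric m)).
Notation J Q := (global_field (tn_J m Q)).

Lemma cimg_euclidean (i : chart M) : cimg i = setT.
Proof. by rewrite /cimg /= image_id. Qed.

Lemma dmap_id x : dmap id x = 1%:M.
Proof. by apply/matrixP => a b; rewrite mxE partial_coord [RHS]mxE. Qed.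

Lemma global_covariant T : smooth_mat setT T -> covariant2 (global_field T).
Proof.
move=> sT; split=> [i|i j x _]; first by rewrite cimg_euclidean.
by rewrite /pullback -[trans i j]/id dmap_id mul1mx trmx1 mulmx1.
Qed.

Lemma global_endomorphism T : smooth_mat setT T -> endomorphism (global_field T).
Proof.
move=> sT; split=> [i|i j x _]; first by rewrite cimg_euclidean.
by rewrite -[trans i j]/id dmap_id mul1mx mulmx1.
Qed.

Lemma euclidean_orientable : orientable M.
Proof.
exists (fun _ _ => 1); split; [|split].
- by move=> i; rewrite cimg_euclidean; apply: smooth_cst; exact: openT.
- by move=> i x _; rewrite oner_neq0.
- by move=> i j x _; rewrite -[trans i j]/id dmap_id det1 mulr1.
Qed.

Lemma tn_riemannian : riemannian g.
Proof.
split; first by apply: global_covariant; exact: tn_metric_smooth.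
by move=> i x _; split; [exact: tn_metric_T|move=> v; exact: tn_metric_pos].
Qed.

Lemma tn_kahler (a b c : R) : a ^+ 2 + b ^+ 2 + c ^+ 2 = 1 ->
  kahler g (fun i x => a *: J Q1 i x + b *: J Q2 i x + c *: J Q3 i x).
Proof.
move=> abc; pose Q := a *: Q1 + b *: Q2 + c *: Q3.
have -> : (fun i x => a *: J Q1 i x + b *: J Q2 i x + c *: J Q3 i x) = J Q.
  by apply/funext => i; apply/funext => x; rewrite /global_field tn_J_lin.
have [t1 t2 t3] := std_skew R; have [m12 m21 m11 m22 m33] := std_mul R.
have QT : Q^T = - Q by rewrite /Q [LHS]linearD [X in X + _]linearD /= !linearZ /= t1 t2 t3 !scalerN -!opprD.
have m23 : Q2 *m Q3 + Q3 *m Q2 = 0 by rewrite -m12 !mulmxA m21 -(mulmxA Q1) m22 mulNmx -m12 -mulmxA m22 mulmxN mulmx1 opprK subrr.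
have m13 : Q1 *m Q3 + Q3 *m Q1 = 0.
  by rewrite -m12 !mulmxA m11 -(mulmxA Q1) m21 mulNmx mul1mx mulmxN -m12 mulmxA m11 mulNmx mul1mx opprK addrC subrr.
have QQ : Q *m Q = - 1%:M.
  rewrite /Q !(mulmxDl, mulmxDr) -!scalemxAl -!scalemxAr m11 m22 m33 m12 m21.
  have e1 : Q3 *m Q2 = - (Q2 *m Q3) by apply/eqP; rewrite -addr_eq0 addrC m23.
  have e2 : Q3 *m Q1 = - (Q1 *m Q3) by apply/eqP; rewrite -addr_eq0 addrC m13.
  rewrite e1 e2; move: (Q2 *m Q3) (Q1 *m Q3) => A B; rewrite -[in RHS](scale1r 1%:M) -abc.
  by apply/matrixP => i j; rewrite !(mxDE, mxNE, mxZE); ring.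
have hk := tn_hk_chart m_gt0; have oT : open [set: 'rV[R]_4] := openT.
have sJ A : smooth_mat setT (tn_J m A) := tn_J_smooth m_gt0 A.
have pJ e x : nabla_endo (tn_metric m) e (tn_J m Q) x = 0.
  have [p1 p2 p3] := parallel_J hk e (x := x) I.
  have Z k A : nabla_endo (tn_metric m) e (tn_J m A) x = 0 -> nabla_endo (tn_metric m) e (fun y => k *: tn_J m A y) x = 0.
    move=> pA; rewrite (@nabla_endoZ R setT (tn_metric m) e (fun=> k) (tn_J m A) x (smooth_cst oT k) (sJ A) I).
    by rewrite partialC scale0r pA scaler0 addr0.
  have sZ k A : smooth_mat setT (fun y => k *: tn_J m A y) by apply: (smooth_matZ oT (smooth_cst oT k)).
  have -> : tn_J m Q = fun y => a *: tn_J m Q1 y + b *: tn_J m Q2 y + c *: tn_J m Q3 y.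
    by apply/funext => y; rewrite tn_J_lin.
  rewrite (@nabla_endoD R setT _ e _ _ x (smooth_matD oT (sZ a Q1) (sZ b Q2)) (sZ c Q3) I).
  by rewrite (@nabla_endoD R setT _ e _ _ x (sZ a Q1) (sZ b Q2) I) !Z // !addr0.
split; first exact: global_endomorphism.
move=> i x _; rewrite /global_field; have JJ := tn_J_sqr m_gt0 x QT QQ; split.
- exact: JJ.
- have := tn_form_skew m_gt0 x QT; rewrite trmx_mul tn_metric_T -mulmxA => ->.
  by rewrite mulmxN mulmxA JJ mulNmx mul1mx opprK.
- move=> e f h; exact: (@parallel_nijenhuis R setT (tn_metric m) (tn_J m Q) x e f h oT (fun y _ => tn_metric_T m y) I (fun k => pJ k x) JJ).
- move=> e f h.
  have -> : (fun y => tn_J m Q y *m tn_metric m y) = fun y => a *: (tn_J m Q1 y *m tn_metric m y)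
      + b *: (tn_J m Q2 y *m tn_metric m y) + c *: (tn_J m Q3 y *m tn_metric m y).
    by apply/funext => y; rewrite -[tn_J m Q y](tn_J_lin m a b c) [LHS]mulmxDl [X in X + _ = _]mulmxDl -!scalemxAl.
  have sw A : smooth_mat setT (fun y => tn_J m A y *m tn_metric m y) := smooth_matM oT (sJ A) (tn_metric_smooth m_gt0).
  rewrite (ext_deriv_lin a b c x e f h (sw Q1) (sw Q2) (sw Q3)).
  have d1 := tn_closed m_gt0 x e f h (or_introl erefl : Q1 = Q1 \/ Q1 = Q2 \/ Q1 = Q3).
  have d2 := tn_closed m_gt0 x e f h (or_intror (or_introl erefl) : Q2 = Q1 \/ Q2 = Q2 \/ Q2 = Q3).
  have d3 := tn_closed m_gt0 x e f h (or_intror (or_intror erefl) : Q3 = Q1 \/ Q3 = Q2 \/ Q3 = Q3).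
  by rewrite d1 d2 d3 !mulr0 !addr0.
Qed.

Lemma tn_quaternion i x : cimg i x -> J Q1 i x *m J Q2 i x = J Q3 i x /\ J Q2 i x *m J Q1 i x = - J Q3 i x.
Proof.
by move=> _; have q := hk_q (tn_hk_chart m_gt0) (I : setT x); split; [exact: (q_12 q)|exact: (q_21 q)].
Qed.

Lemma tn_hyperkahler : hyperkahler g.
Proof.
exists (J Q1), (J Q2), (J Q3); split; [|split].
- by split; apply: global_endomorphism; exact: tn_J_smooth.
- exact: tn_quaternion.
- exact: tn_kahler.
Qed.

Notation Y := (global_field (tn_Y m)).

Lemma tn_global_killing_yano : killing_yano g Y.
Proof.
split; first by apply: global_covariant; exact: tn_Y_smooth.
by move=> i x _; split; [exact: tn_Y_skew|move=> a b c; exact: tn_killing_yano].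
Qed.

Lemma tn_not_parallel : ~ parallel g Y.
Proof.
move=> P; have [x [a [b [c n]]]] := tn_Y_nonparallel m_gt0.
by move/eqP: n; apply; apply: (P tt); rewrite cimg_euclidean.
Qed.

Lemma tn_is_taub_nut : is_taub_nut g (m / 2).
Proof.
have rg := tn_riemannian; have kyY := tn_global_killing_yano.
have endo : [/\ endomorphism (J Q1), endomorphism (J Q2) & endomorphism (J Q3)].
  by split; apply: global_endomorphism; exact: tn_J_smooth.
have [c1 c2 c3] := tn_constants m_gt0.
have c0 : cimg (tt : chart M) 0 by rewrite cimg_euclidean.
have [N0 N0E] := psi_const rg endo tn_quaternion tn_kahler kyY.
have [P PE] := invP_const rg endo tn_quaternion tn_kahler kyY.
have N0v : N0 = 1 / 4 by rewrite -(N0E tt 0 c0) -c1.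
have Pv : P = (m / 16) ^+ 2 by rewrite -(PE tt 0 c0) /global_field c2 c3; field.
have P0 : 0 < P by rewrite Pv exprn_gt0 // divr_gt0.
have S0 i x : cimg i x -> 0 < S2 (g i) (J Q1 i) (J Q2 i) (J Q3 i) (Y i) x.
  move=> cx; rewrite lt_def (S2_ge0 (ky_of_global rg endo tn_quaternion tn_kahler kyY i)) // andbT.
  by move: P0; rewrite -(PE i x cx); apply: contraTneq => ->; rewrite mulr0 ltxx.
have m0E := charge_const rg endo tn_quaternion tn_kahler kyY S0 c0.
have sm : mu (g tt) (J Q1 tt) (J Q2 tt) (J Q3 tt) (Y tt) 0 * Num.sqrt (S2 (g tt) (J Q1 tt) (J Q2 tt) (J Q3 tt) (Y tt) 0) = m / 16.
  by rewrite /global_field c2 c3 sqrtr_sqr gtr0_norm ?divr_gt0 //; field.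
have m00 : m / 16 != 0 by rewrite mulf_neq0 ?gt_eqF // invr_gt0.
have [fp _ _] := global_form rg endo tn_quaternion tn_kahler kyY N0E S0 (fun i x cx => etrans (m0E i x cx) sm) m00.
have N0p : 0 < N0 by rewrite N0v divr_gt0.
have := fp N0p; rewrite (_ : gh_charge N0 (m / 16) = m / 2) // /gh_charge N0v.
have -> : `|1 / 4 : R| = (1 / 2) ^+ 2 by rewrite ger0_norm ?divr_ge0 //; field.
by rewrite sqrtr_sqr ger0_norm ?divr_ge0 //; field.
Qed.

Lemma tn_curve (gam : R -> 'rV[R]_4) (t : R) : derivable gam t 1 ->
  (derive1 gam t *m tn_metric m (gam t) *m (derive1 gam t)^T) 0 0 <= 1 ->
  [/\ tn_r (derive1 gam t) <= (m + tn_r (gam t)) / (4 * m ^+ 2),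
    is_derive t (1 : R) (fun s => ln (m + tn_r (gam s))) ((m + tn_r (gam t))^-1 * (2 * (derive1 gam t *m (gam t)^T) 0 0)) &
    `|(m + tn_r (gam t))^-1 * (2 * (derive1 gam t *m (gam t)^T) 0 0)| <= m^-1].
Proof.
move=> dg sp; set v := derive1 gam t in sp *; set D := m + tn_r (gam t).
have D0 : 0 < D := tn_D_gt0 m_gt0 (gam t).
have rv : tn_r v <= D / (4 * m ^+ 2).
  have := le_trans (tn_metric_ge m_gt0 (gam t) v) sp; rewrite -/D => H.
  rewrite ler_pdivlMr ?mulr_gt0 ?exprn_gt0 //.
  have := ler_wpM2l (ltW D0) H; rewrite mulr1.
  by congr (_ <= _); field; rewrite gt_eqF.
split; first exact: rv.
- have oT : open [set: 'rV[R]_4] := openT.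
  have sD : smooth_on setT (fun y : 'rV[R]_4 => m + tn_r y) by have [] := has_partial_D m o0 (0 : 'rV[R]_4).
  have H := is_derive_curve (smooth_differentiable oT sD (I : setT (gam t))) dg.
  have K := @is_derive1_comp R (@ln R) (fun s => m + tn_r (gam s)) t _ _ (is_derive1_ln D0) H.
  apply: (is_derive_eq K); congr (_ * _); rewrite mxE mulr_sumr; apply: eq_bigr => b _.
  by have [_ ->] := has_partial_D m b (gam t); rewrite -derive1E -/v mxE; ring.
- have C := cauchy_schwarz v (gam t); set w := (v *m _) 0 0 in C *.
  have rg : tn_r (gam t) <= D by rewrite lerDr ltW.
  rewrite normrM (gtr0_norm (_ : 0 < D^-1)) ?invr_gt0 // mulrC ler_pdivrMr //.
  have Dm : 0 <= m^-1 * D by rewrite mulr_ge0 // ?invr_ge0 ltW.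
  rewrite -(ler_pXn2r (n := 2)) ?nnegrE // -normrX ger0_norm ?sqr_ge0 //.
  have E : (m^-1 * D) ^+ 2 = 4 * (D / (4 * m ^+ 2) * D) by field; rewrite gt_eqF.
  rewrite exprMn (_ : 2 ^+ 2 = 4 :> R); last by ring.
  rewrite E ler_pM2l //; apply: le_trans C _; apply: ler_pM => //; exact: tn_r_ge0.
Qed.

Lemma tn_joined_curve (p q : M) (L : R) : joined g p q L -> 0 <= L /\ exists gam : R -> 'rV[R]_4,
  [/\ gam 0 = p, gam L = q & forall t : R, 0 <= t <= L -> derivable gam t 1 /\
    (derive1 gam t *m tn_metric m (gam t) *m (derive1 gam t)^T) 0 0 <= 1].
Proof.
move=> [L0 [gam [g0 gL H]]]; split => //; exists gam; split => // t t0.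
have [_ /(_ tt I)[dn _ sp]] := H t t0; split; last exact: sp.
exact: (nbhs_singleton dn).
Qed.

Lemma tn_joined_growth (p q : M) (L : R) : joined g p q L -> ln (m + tn_r q) <= ln (m + tn_r p) + L / m.
Proof.
move=> /tn_joined_curve[L0 [gam [g0 gL H]]]; have [L0'|Lp] := leP L 0.
  have LE : L = 0 by apply/le_anti; rewrite L0 L0'.
  by rewrite -g0 -gL LE mul0r addr0.
pose F (t : R) := ln (m + tn_r (gam t)).
pose dF (t : R) := (m + tn_r (gam t))^-1 * (2 * (derive1 gam t *m (gam t)^T) 0 0).
have dFP (t : R) : 0 <= t <= L -> is_derive t (1 : R) F (dF t) /\ `|dF t| <= m^-1.
  by move=> t0; have [d s] := H t t0; have [_ d1 d2] := tn_curve d s.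
have [c c0 E] : exists2 c : R, c \in `]0, L[ & F L - F 0 = dF c * (L - 0).
  apply: (@MVT R F dF 0 L Lp) => [t|].
    by rewrite in_itv /= => /andP[t0 t1]; apply: (dFP t _).1; rewrite !ltW.
  apply: derivable_within_continuous => t; rewrite in_itv /= => /dFP[d _]; exact: (ex_derive (is_derive := d)).
have c0' : 0 <= c <= L by move: c0; rewrite in_itv /= => /andP[c1 c2]; rewrite !ltW.
have [_ B] := dFP c c0'; move: E; rewrite /F gL g0 subr0 => E.
have : dF c * L <= m^-1 * L by rewrite ler_wpM2r //; exact: le_trans (ler_norm _) B.
by rewrite -E mulrC; lra.
Qed.

Lemma tn_joined_prefix (p q : M) (L : R) : joined g p q L -> exists gam : R -> 'rV[R]_4,
  [/\ gam 0 = p, gam L = q & forall t : R, 0 <= t <= L -> [/\ joined g p (gam t) t, derivable gam t 1 &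
    (derive1 gam t *m tn_metric m (gam t) *m (derive1 gam t)^T) 0 0 <= 1]].
Proof.
move=> J'; have [L0 [gam [g0 gL H]]] := J'; exists gam; split => // t t0.
have [_ /(_ tt I)[dn _ sp]] := H t t0; split; [|exact: (nbhs_singleton dn)|exact: sp].
have /andP[t1 t2] := t0; split; first exact: t1.
exists gam; split; [exact: g0|by []|move=> s /andP[s1 s2]].
by apply: H; rewrite s1 (le_trans s2).
Qed.

Lemma tn_joined_near (p q : M) (L K : R) : joined g p q L -> (m + tn_r p) * expR (L / m) <= K ->
  `|(q : 'rV[R]_4) - p| <= Num.sqrt (K / (4 * m ^+ 2)) * L.
Proof.
move=> J' HK; have [L0 _] := J'; have [gam [g0 gL H]] := tn_joined_prefix J'.
apply: normrV_le => [|i]; first by rewrite mulr_ge0 // sqrtr_ge0.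
have [L0'|Lp] := leP L 0.
  have LE : L = 0 by apply/le_anti; rewrite L0 L0'.
  by rewrite -g0 -gL LE mulr0 subrr mxE normr0.
pose F (t : R) := gam t 0 i; pose dF (t : R) := (derive1 gam t) 0 i.
have dFP (t : R) : 0 <= t <= L -> is_derive t (1 : R) F (dF t) /\ `|dF t| <= Num.sqrt (K / (4 * m ^+ 2)).
  move=> t0; have [jt d s] := H t t0; have [rv _ _] := tn_curve d s; have /andP[t1 t2] := t0; split.
    have df : differentiable (fun y : 'rV[R]_4 => y 0 i) (gam t).
      exact: (smooth_differentiable openT (smooth_coord openT i) (I : setT (gam t))).
    have := is_derive_curve df d => /is_derive_eq; apply.
    rewrite (bigD1 i) //= partial_coord eqxx mulr1 big1 ?addr0 ?/dF ?derive1E // => b bi.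
    by rewrite partial_coord (negbTE bi) mulr0.
  rewrite -sqrtr_sqr ler_wsqrtr //; apply: (@le_trans _ _ (tn_r (derive1 gam t))).
    rewrite /tn_r mxE (bigD1 i) //= mxE -expr2 lerDl sumr_ge0 // => b _.
    by rewrite mxE -expr2 sqr_ge0.
  apply: le_trans rv _; rewrite ler_pM2r ?invr_gt0 ?mulr_gt0 ?exprn_gt0 //.
  apply: le_trans HK; have := tn_joined_growth jt.
  rewrite -ler_expR expRD !lnK ?posrE ?tn_D_gt0 // => /le_trans; apply.
  by rewrite ler_pM2l ?tn_D_gt0 // ler_expR ler_pM2r ?invr_gt0.
have [c c0 E] : exists2 c : R, c \in `]0, L[ & F L - F 0 = dF c * (L - 0).
  apply: (@MVT R F dF 0 L Lp) => [t|].
    by rewrite in_itv /= => /andP[t0 t1]; apply: (dFP t _).1; rewrite !ltW.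
  apply: derivable_within_continuous => t; rewrite in_itv /= => /dFP[d _]; exact: (ex_derive (is_derive := d)).
have c0' : 0 <= c <= L by move: c0; rewrite in_itv /= => /andP[c1 c2]; rewrite !ltW.
have [_ B] := dFP c c0'; move: E; rewrite /F gL g0 subr0 => E.
rewrite [X in `|X|]mxE [X in `|_ + X|]mxE E normrM (gtr0_norm Lp).
by rewrite ler_wpM2r.
Qed.

Lemma tn_r_segment (y w : 'rV[R]_4) (t : R) : 0 <= t <= 1 -> tn_r (y + t *: w) <= 2 * tn_r y + 2 * tn_r w.
Proof.
move=> /andP[t0 t1]; rewrite /tn_r !mxE !mulr_sumr -big_split /=; apply: ler_sum => i _; rewrite !mxE.
have t2 : t ^+ 2 <= 1 by rewrite expr_le1.
have := ler_wpM2r (sqr_ge0 (w 0 i)) t2; have := sqr_ge0 (y 0 i - t * w 0 i).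
move: (y 0 i) (w 0 i) => u v; rewrite mul1r => H1 H2.
have -> : (u + t * v) * (u + t * v) = 2 * (u * u) + 2 * (t ^+ 2 * v ^+ 2) - (u - t * v) ^+ 2 by ring.
by rewrite -!expr2; lra.
Qed.

Lemma tn_joined (p q : M) : exists L, joined g p q L.
Proof.
pose y : 'rV[R]_4 := p; pose w : 'rV[R]_4 := (q : 'rV[R]_4) - p.
pose C : R := 1 + 4 * (m + (2 * tn_r y + 2 * tn_r w)) * tn_r w.
have ry := tn_r_ge0 y; have rw := tn_r_ge0 w.
have C0 : 0 <= m + (2 * tn_r y + 2 * tn_r w) by move: m_gt0; lra.
have C1 : 1 <= C by rewrite lerDl !mulr_ge0.
exists (2 * C + 1); apply: jpath_joined; first exact: tn_riemannian.
have -> : q = param (tt : chart M) (y + w) by rewrite /w /y /= addrC subrK.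
apply: (@jpath_segment R M g tt y w C (2 * C + 1)) => //.
- exact: le_trans ler01 C1.
- by rewrite ltr_wpDl // mulr_ge0 // (le_trans ler01).
- by rewrite lerDl.
- by move=> t _; rewrite cimg_euclidean.
- move=> t t0; apply: (le_trans (tn_metric_le m_gt0 (y + t *: w) w)).
  apply: (@le_trans _ _ C); last by rewrite expr2 ler_peMl // (le_trans ler01).
  apply: (@le_trans _ _ (4 * (m + (2 * tn_r y + 2 * tn_r w)) * tn_r w)); last by rewrite lerDr.
  by rewrite ler_wpM2r ?tn_r_ge0 // ler_pM2l // lerD2l tn_r_segment.
Qed.

Lemma tn_dist_lt (p q : M) (e : R) : riemannian_dist g p q < e -> exists2 L, L < e & joined g p q L.
Proof.
move=> d; have [|L JL Le] := inf_lt _ d; first by have [L JL] := tn_joined p q; exists L.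
by exists L.
Qed.

Lemma tn_complete : complete_metric g.
Proof.
move=> u Hu; have [N HN] := Hu 1 ltr01.
pose K0 : R := (m + tn_r (u N)) * expR (1 / m) * expR (1 / m).
have bound k : (N <= k)%N -> (m + tn_r (u k)) * expR (1 / m) <= K0.
  move=> Nk; have [L L1 JL] := tn_dist_lt (HN N k (leqnn N) Nk).
  rewrite ler_pM2r ?expR_gt0 //; have := tn_joined_growth JL.
  rewrite -ler_expR expRD !lnK ?posrE ?tn_D_gt0 // => /le_trans; apply.
  by rewrite ler_pM2l ?tn_D_gt0 // ler_expR ler_pM2r ?invr_gt0 // ltW.
pose c : R := Num.sqrt (K0 / (4 * m ^+ 2)).
have c0 : 0 <= c := sqrtr_ge0 _.
pose v : nat -> 'rV[R]_4 := u.
suff /cvg_ex[p Hp] : cvg (v @ \oo) by exists p.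
apply/cauchy_cvgP/cauchy_ballP => e e0; near_simpl.
pose d : R := Num.min 1 (e / (c + 1)).
have c10 : 0 < c + 1 by rewrite ltr_wpDl.
have d0 : 0 < d by rewrite lt_min ltr01 divr_gt0.
have [N' HN'] := Hu d d0; pose N2 := maxn N N'.
exists ([set k | (N2 <= k)%N], [set k | (N2 <= k)%N]); first by split; exists N2.
move=> [k l] [/= Hk Hl]; rewrite -ball_normE /=.
have [N2k N2l] : (N <= k)%N /\ (N' <= k)%N by move: Hk; rewrite /N2 geq_max => /andP.
have N2l' : (N' <= l)%N by move: Hl; rewrite /N2 geq_max => /andP[].
have [L Ld JL] := tn_dist_lt (HN' k l N2l N2l').
have [L0 _] := JL; have L1 : L <= 1 by apply: ltW; apply: lt_le_trans Ld _; rewrite ge_min lexx.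
have HK : (m + tn_r (u k)) * expR (L / m) <= K0.
  apply: le_trans (bound k N2k); rewrite ler_pM2l ?tn_D_gt0 // ler_expR ler_pM2r ?invr_gt0 //.
have := tn_joined_near JL HK; rewrite -/c distrC => H.
apply: le_lt_trans H _; apply: (@le_lt_trans _ _ (c * d)); first by rewrite ler_wpM2l // ltW.
have : d <= e / (c + 1) by rewrite ge_min lexx orbT.
move=> /(ler_wpM2l c0) /le_lt_trans; apply.
by rewrite mulrA ltr_pdivrMr // mulrC ltr_pM2l // ltrDl.
Unshelve. all: by end_near. Qed.

End TaubNutManifold.

Theorem proposition5 (R : realType) :
  (forall n : R, 0 < n ->
     exists (M : manifold4 R) (g : mxfield M),
       [/\ orientable M, riemannian g & complete_metric g] /\
       [/\ hyperkahler g, has_nonconstant_KY g & is_taub_nut g n]) /\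
  (forall (M : manifold4 R) (g : mxfield M),
     orientable M -> riemannian g -> hyperkahler g -> ~ flat g ->
     has_nonconstant_KY g ->
     (complete_metric g -> exists n : R, 0 < n /\ is_taub_nut g n) /\
     ((exists n : R, n != 0 /\ is_taub_nut g n) \/
      (exists n : R, n != 0 /\
         has_form g (taub_nut_inner_dom n) (fun x => - taub_nut n x)) \/
      has_form g (@linear_gh_dom R) (@linear_gh R))).
Proof.
split=> [n n0|M g _ rg hk nf KY]; last exact: hyperkahler_KY_classification.
have m0 : 0 < 2 * n by rewrite mulr_gt0.
exists (euclidean4 R), (global_field (tn_metric (2 * n))); split; split.
- exact: euclidean_orientable.
- exact: tn_riemannian.
- exact: tn_complete.
- exact: tn_hyperkahler.
- exists (global_field (tn_Y (2 * n))); split; [exact: tn_global_killing_yano|exact: tn_not_parallel].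
- have e : 2 * n / 2 = n by field.
  by have := tn_is_taub_nut m0; rewrite e.
Qed.
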